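(* Let $2-\epsilon\le p<2$ and $1/p+1/p'=1$. Let $\kappa$ be a positive constant and let $\mathbf f\in\mathbf H^1(\Omega)$ satisfy $\|\mathbf f\|_{\mathbf L^2(\Omega)}\le\nu_-\min\{\mathfrak C,\tilde{\mathfrak C}\}$. Let $(\mathbf u,\mathsf p,T)\in\mathbf H_0(\mathrm{div},\Omega)\times L^2_0(\Omega)\times W^{1,p}_0(\Omega)$ be a solution of the continuous coupled problem and let $(\mathbf u_h,\mathsf p_h,T_h)\in\mathbf X_h\times Q_h\times V_h$ be a solution of the discrete coupled problem for $0<h\le h_\star$ (both written in the context). Set $e_T=T-T_h$, $\mathbf e_{\mathbf u}=\mathbf u-\mathbf u_h$. Assume that, for some $0<\rho<1$ and $0<\varrho<1$, $$\mathfrak C^{-1}\|\mathbf e_{\mathbf u}\|_{\mathbf L^2(\Omega)}\le\rho,\qquad C_{\mathcal L}\|\delta_z\|_{W^{-1,p}(\Omega)}\|\mathbf u\|_{\mathbf L^{p'}(\Omega)}\le\varrho(1-\rho)\nu_-\mathfrak C^2,$$ and that, for each $K\in\mathscr T_h$, $\nu(T_h)|_K$ is a polynomial. Then, for every $K\in\mathscr T_h$, $$\mathfrak E_K\le C\Big[\|\mathbf e_{\mathbf u}\|_{\mathbf L^2(\mathcal N_K)}+\sum_{K'\in\mathcal N_K}h_{K'}\|\mathbf{curl}(\mathbf f-\mathscr P_{K'}\mathbf f)\|_{L^2(K')}+\|e_T\|_{L^{\frac{2p}{2-p}}(\mathcal N_K)}+\sum_{\gamma\in\mathscr S_K}h_K^{\frac12}\|[\![(\mathbf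 f-\mathscr P\mathbf f)\cdot\boldsymbol\tau]\!]\|_{L^2(\gamma)}\Big],$$ where $\mathscr P_K$ is the $\mathbf L^2(K)$-orthogonal projection onto $[\mathbb P_0(K)]^2$, $(\mathscr P\mathbf f)|_{K'}=\mathscr P_{K'}\mathbf f$ for each $K'\in\mathscr T_h$, and the constant $C>0$ (which may depend on the maximal degree of the polynomials $\nu(T_h)|_K$) is independent of the continuous and discrete solutions $(\mathbf u,\mathsf p,T)$ and $(\mathbf u_h,\mathsf p_h,T_h)$, the size of the elements of $\mathscr T_h$, and $\#\mathscr T_h$.
   Context: $\Omega\subset\mathbb R^2$ is an open bounded polygonal domain with Lipschitz boundary and unit outward normal $\mathbf n$; $z\in\Omega$; bold letters denote vector-valued functions and spaces. $W^{-1,p}(\Omega)=(W^{1,p'}_0(\Omega))'$ with the dual norm induced by $S\mapsto\|\nabla S\|_{\mathbf L^{p'}(\Omega)}$; $\langle\delta_z,S\rangle=S(z)$. $L^2_0(\Omega)$: zero-average $L^2$ functions; $\mathbf H_0(\mathrm{div},\Omega)=\{\mathbf v\in\mathbf L^2(\Omega):\mathrm{div}\,\mathbf v\in L^2(\Omega),\ \mathbf v\cdot\mathbf n|_{\partial\Omega}=0\}$. The viscosity $\nu:\mathbb R\to\mathbb R$ is Lipschitz with constant $C_{\mathcal L}$ and $0<\nu_-\le\nu(s)\le\nu_+$ for all $s$. Continuous coupled problem: $\int_\Omega(\nu(T)\mathbf u\cdot\mathbf v-\mathsf p\,\mathrm{div}\,\mathbf v)=\int_\Omega\mathbf f\cdot\mathbf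 v$ for all $\mathbf v\in\mathbf H_0(\mathrm{div},\Omega)$; $\int_\Omega\mathsf q\,\mathrm{div}\,\mathbf u=0$ for all $\mathsf q\in L^2_0(\Omega)$; $\int_\Omega(\kappa\nabla T\cdot\nabla S-T\mathbf u\cdot\nabla S)=\langle\delta_z,S\rangle$ for all $S\in W^{1,p'}_0(\Omega)$. Discrete coupled problem: the same three equations with $(\mathbf u,\mathsf p,T)$ replaced by $(\mathbf u_h,\mathsf p_h,T_h)$ and test functions in $\mathbf X_h$, $Q_h$, $V_h$, where $\mathscr T_h$ is a member of a family of conforming shape regular meshes of $\bar\Omega$ into closed triangles $K$, with $h_K=\mathrm{diam}(K)$ (here $h=1/k$ is only an index, $k\in\mathbb N$ numbering a sequence of refinements of an initial mesh), $V_h=\{S_h\in C(\bar\Omega):S_h|_K\in\mathbb P_1(K)\ \forall K,\ S_h|_{\partial\Omega}=0\}$, $\mathbf X_h=\{\mathbf v_h\in\mathbf H_0(\mathrm{div},\Omega):\mathbf v_h|_K=a_K\mathbf x+\mathbf b_K,\ a_K\in\mathbb R,\ \mathbf b_K\in\mathbb R^2\}$, $Q_h=\{\mathsf q_h\in L^2_0(\Omega):\mathsf q_h|_K\in\mathbb P_0(K)\}$. The numbers $\epsilon>0$, $h_\star>0$ are such that the discrete problem admits a solution for $0<h\le h_\star$, $2-\epsilon\le p<2$. Constants: $C_e$ is the best constant in $\|R\|_{L^{2p/(2-p)}(\Omega)}\le C_e\|\nabla R\|_{\mathbf L^p(\Omega)}$ on $W^{1,p}_0(\Omega)$; $C_\kappa$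 is such that $\|\nabla R\|_{\mathbf L^p(\Omega)}\le C_\kappa\sup_{0\ne S\in W^{1,p'}_0(\Omega)}\int_\Omega\kappa\nabla R\cdot\nabla S/\|\nabla S\|_{\mathbf L^{p'}(\Omega)}$ for all $R\in W^{1,p}_0(\Omega)$; $\tilde C_\kappa$, independent of $h$, is such that $\|\nabla R_h\|_{\mathbf L^p(\Omega)}\le\tilde C_\kappa\sup_{0\ne S_h\in V_h}\int_\Omega\kappa\nabla R_h\cdot\nabla S_h/\|\nabla S_h\|_{\mathbf L^{p'}(\Omega)}$ for all $R_h\in V_h$, $0<h\le h_\star$. $\mathfrak C=(2C_eC_\kappa)^{-1}$, $\tilde{\mathfrak C}=(2C_e\tilde C_\kappa)^{-1}$. Indicator: for $\mathbf w=(w_1,w_2)$, $\mathbf{curl}\,\mathbf w=\partial_{x_1}w_2-\partial_{x_2}w_1$. For an internal side $\gamma=\partial K^+\cap\partial K^-$ with unit normals $\mathbf n^\pm$ pointing towards $K^\pm$, $\boldsymbol\tau^\pm$ are unit tangents to $\gamma$, orthogonal to $\mathbf n^\pm$, with $\boldsymbol\tau^-=-\boldsymbol\tau^+$, and $[\![\mathbf w\cdot\boldsymbol\tau]\!]=\boldsymbol\tau^+\cdot\mathbf w|_{K^+}+\boldsymbol\tau^-\cdot\mathbf w|_{K^-}$. $\mathfrak R_K=\mathbf{curl}(\mathbf f-\nu(T_h)\mathbf u_h)|_K$, $\mathfrak J_\gamma=[\![(\mathbf f-\nu(T_h)\mathbf u_h)\cdot\boldsymbol\tau]\!]$, $\mathfrak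 E_K=(h_K^2\|\mathfrak R_K\|^2_{L^2(K)}+h_K\|\mathfrak J_\gamma\|^2_{L^2(\partial K\setminus\partial\Omega)})^{1/2}$. $\mathscr S_K$ is the set of internal sides of $K$ and $\mathcal N_K=\bigcup\{K'\in\mathscr T_h:\mathscr S_K\cap\mathscr S_{K'}\ne\emptyset\}$, also used for the set of those $K'$.
   Formalization: The patch N_K is taken to contain K always; this differs from the stated definition only when the mesh is a single triangle, where N_K and S_K would be empty and the estimate would read h_K‖curl f‖ ≤ 0, which fails e.g. for small f = ε(−x₂, x₁). *)

(* Defs.v *)
From HB Require Import structures.
From mathcomp Require Import all_boot all_order all_algebra.
From mathcomp Require Import all_classical all_reals all_analysis.

Set Implicit Arguments.
Unset Strict Implicit.
Unset Printing Implicit Defensive.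

Import Order.TTheory GRing.Theory Num.Theory.
Import numFieldNormedType.Exports.

Local Open Scope classical_set_scope.
Local Open Scope ring_scope.

Section Plane.
Variable R : realType.

(* The library norm on a product is the max norm; the Euclidean structure of
   the plane is [dot] and [enorm]. *)
Definition dot (x y : R * R) : R := x.1 * y.1 + x.2 * y.2.
Definition enorm (x : R * R) : R := Num.sqrt (dot x x).

Definition area := (@lebesgue_measure R \x @lebesgue_measure R)%E.

Definition seg (a b : R * R) : set (R * R) :=
  [set x | exists t : R, [/\ 0 <= t, t <= 1 & x = a + t *: (b - a)]].

Definition bdry (A : set (R * R)) : set (R * R) := closure A `\` A°.

(* Near each boundary point the set is the strict epigraph of a Lipschitz
   function in an orthonormal frame (e, rot e). *)
Definition lipschitz_boundary (O : set (R * R)) :=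
  forall x, bdry O x ->
  exists (e : R * R) (r h L : R) (g : R -> R),
    [/\ enorm e = 1, 0 < r, 0 < h,
        (forall s t, `|g s - g t| <= L * `|s - t|) &
        forall s t, `|s| < r -> `|t| < h ->
          (O (x + s *: e + t *: (- e.2, e.1)) <-> g s < t)].

Definition polygonal_domain (O : set (R * R)) :=
  [/\ open O, connected O, bounded_set O, lipschitz_boundary O &
      exists s : seq ((R * R) * (R * R)),
        bdry O = \bigcup_(ab in [set` s]) seg ab.1 ab.2].

(* L^q norms and spaces.  Members are honest functions, of which only the
   values on A (up to null sets) matter. *)
Definition Lnm (q : R) (A : set (R * R)) (f : R * R -> R) : \bar R :=
  'N[area]_(q%:E)[(fun x => (\1_A x * f x)%:E)]%E.

Definition Lnmv (q : R) (A : set (R * R)) (v : R * R -> R * R) : \bar R :=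
  Lnm q A (fun x => enorm (v x)).

Definition Lsp (q : R) (A : set (R * R)) : set (R * R -> R) :=
  [set f : R * R -> R | measurable_fun A f /\ (Lnm q A f < +oo)%E].

Definition Lspv (q : R) (A : set (R * R)) : set (R * R -> R * R) :=
  [set v : R * R -> R * R | measurable_fun A v /\ (Lnmv q A v < +oo)%E].

Definition integ (A : set (R * R)) (f : R * R -> R) : R :=
  \int[area]_(x in A) f x.

Definition L20 (A : set (R * R)) : set (R * R -> R) :=
  [set q : R * R -> R | Lsp 2 A q /\ integ A q = 0].

Definition L1loc (A : set (R * R)) : set (R * R -> R) :=
  [set f : R * R -> R | measurable_fun A f /\ forall C, compact C -> C `<=` A ->
     (\int[area]_(x in C) (`|f x|)%:E < +oo)%E].

Definition ei (i : 'I_2) : R * R := if i == ord0 then (1, 0) else (0, 1).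
Definition pd (i : 'I_2) (f : R * R -> R) : R * R -> R := fun x => 'D_(ei i) f x.

Definition smooth (f : R * R -> R) :=
  forall s : seq 'I_2, continuous (foldr pd f s) /\
    forall i x, derivable (foldr pd f s) x (ei i).

Definition test_fun (A : set (R * R)) : set (R * R -> R) :=
  [set f : R * R -> R | smooth f /\
     exists2 C, compact C & C `<=` A /\ forall x, ~ C x -> f x = 0].

(* Weak derivatives on an open set: [wD A i v] is a chosen representative, and
   [is_wD A i v (wD A i v)] holds as soon as v has a weak derivative. *)
Definition is_wD (A : set (R * R)) (i : 'I_2) (v g : R * R -> R) :=
  [/\ L1loc A v, L1loc A g &
   forall phi, test_fun A phi ->
     integ A (fun x => v x * pd i phi x) = - integ A (fun x => g x * phi x)].

Definition wD (A : set (R * R)) (i : 'I_2) (v : R * R -> R) : R * R -> R :=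
  xget (fun=> 0) [set g : R * R -> R | is_wD A i v g].

Definition grad (A : set (R * R)) (v : R * R -> R) : R * R -> R * R :=
  fun x => (wD A ord0 v x, wD A ord_max v x).

Definition curl (A : set (R * R)) (w : R * R -> R * R) : R * R -> R :=
  fun x => wD A ord0 (fun y => (w y).2) x - wD A ord_max (fun y => (w y).1) x.

Definition W1 (q : R) (A : set (R * R)) : set (R * R -> R) :=
  [set v : R * R -> R | Lsp q A v /\
     forall i, is_wD A i v (wD A i v) /\ Lsp q A (wD A i v)].

Definition W1_cvg (q : R) (A : set (R * R)) (phi : nat -> R * R -> R)
    (v : R * R -> R) :=
  (fun n => Lnm q A (fun x => phi n x - v x)) @ \oo --> 0%E /\
  forall i, (fun n => Lnm q A (fun x => pd i (phi n) x - wD A i v x))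
              @ \oo --> 0%E.

Definition W10 (q : R) (A : set (R * R)) : set (R * R -> R) :=
  [set v : R * R -> R | W1 q A v /\
     exists2 phi, (forall n, test_fun A (phi n)) & W1_cvg q A phi v].

Definition H1v (A : set (R * R)) : set (R * R -> R * R) :=
  [set w : R * R -> R * R | W1 2 A (fun x => (w x).1) /\ W1 2 A (fun x => (w x).2)].

Definition is_wdiv (A : set (R * R)) (v : R * R -> R * R) (d : R * R -> R) :=
  forall phi, test_fun A phi ->
    integ A (fun x => dot (v x) (pd ord0 phi x, pd ord_max phi x)) =
    - integ A (fun x => d x * phi x).

Definition wdiv (A : set (R * R)) (v : R * R -> R * R) : R * R -> R :=
  xget (fun=> 0) [set d : R * R -> R | Lsp 2 A d /\ is_wdiv A v d].

(* The normal trace of v is the functional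
   phi |-> \int_A (v . grad phi + phi div v) on H^1(A). *)
Definition H0div (A : set (R * R)) : set (R * R -> R * R) :=
  [set v : R * R -> R * R | [/\ Lspv 2 A v, Lsp 2 A (wdiv A v), is_wdiv A v (wdiv A v) &
     forall phi, W1 2 A phi ->
       integ A (fun x => dot (v x) (grad A phi x) + phi x * wdiv A v x) = 0]].

(* S(z) for the continuous representative of S. *)
Definition delta (A : set (R * R)) (z : R * R) (S : R * R -> R) : R :=
  xget 0 [set s | exists S', [/\ {within A, continuous S'},
    {ae area, forall x, A x -> S' x = S x} & s = S' z]].

(* sup of L S / ||grad S||_q over the nonzero S in V, for a subspace V and a
   linear L; it is 0 when V has no nonzero element. *)
Definition dual_norm (q : R) (A : set (R * R)) (V : set (R * R -> R))
    (L : (R * R -> R) -> R) : \bar R :=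
  ereal_sup ([set 0%E] `|` [set (L S / fine (Lnmv q A (grad A S)))%:E | S in
    [set S : R * R -> R | V S /\ ~ {ae area, forall x, A x -> S x = 0}]]).

Definition kform (A : set (R * R)) (kappa : R) (T S : R * R -> R) : R :=
  integ A (fun x => kappa * dot (grad A T x) (grad A S x)).

Definition embedding_const (A : set (R * R)) (p C : R) :=
  forall S, W10 p A S ->
    (Lnm (2 * p / (2 - p)) A S <= C%:E * Lnmv p A (grad A S))%E.

(* An element or a side is a set of points; a mesh is a set of elements. *)
Definition tri (a b c : R * R) : set (R * R) :=
  [set x | exists s t : R,
     [/\ 0 <= s, 0 <= t, s + t <= 1 & x = a + s *: (b - a) + t *: (c - a)]].

Definition is_tri (a b c : R * R) (K : set (R * R)) :=
  (b.1 - a.1) * (c.2 - a.2) - (b.2 - a.2) * (c.1 - a.1) != 0 /\ K = tri a b c.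

Definition vertex (K : set (R * R)) (a : R * R) := exists b c, is_tri a b c K.

Definition side (K g : set (R * R)) :=
  exists a b c, is_tri a b c K /\ g = seg a b.

Definition diam (K : set (R * R)) : R :=
  sup [set d | exists x y, [/\ K x, K y & d = enorm (x - y)]].

Definition indiam (K : set (R * R)) : R :=
  sup [set d | exists (x : R * R) (r : R),
     [/\ 0 < r, [set y | enorm (y - x) <= r] `<=` K & d = 2 * r]].

Definition mesh : Type := set (set (R * R)).

Definition conforming_mesh (O : set (R * R)) (T : mesh) :=
  [/\ finite_set T, (forall K, T K -> exists a b c, is_tri a b c K),
      closure O = \bigcup_(K in T) K &
      forall K K', T K -> T K' -> K <> K' ->
        [\/ K `&` K' = set0,
            exists a, [/\ vertex K a, vertex K' a & K `&` K' = [set a]] |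
            exists g, [/\ side K g, side K' g & K `&` K' = g]]].

Definition refines (T T0 : mesh) :=
  forall K, T K -> exists2 K0, T0 K0 & K `<=` K0.

(* T 0 is the initial mesh, and T k (k > 0) the mesh of index h = 1/k. *)
Definition mesh_family (O : set (R * R)) (T : nat -> mesh) :=
  [/\ (forall k, conforming_mesh O (T k)), (forall k, refines (T k) (T 0%N)) &
      exists sigma : R, forall k K, T k K -> diam K <= sigma * indiam K].

(* S_K, the internal sides of K. *)
Definition isides (T : mesh) (K : set (R * R)) : set (set (R * R)) :=
  [set g : set (R * R) | side K g /\ exists K', [/\ T K', K' <> K & side K' g]].

(* N_K as a set of elements.  K belongs to it by definition: this adds nothing
   when K has an internal side, that is unless K is the only element. *)
Definition nbrs (T : mesh) (K : set (R * R)) : mesh :=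
  [set K' | T K' /\ (K' = K \/ isides T K `&` isides T K' !=set0)].

(* N_K as a region; sides are left out, as a null set. *)
Definition elem_patch (T : mesh) (K : set (R * R)) : set (R * R) :=
  \bigcup_(K' in nbrs T K) K'°.

Definition Vh (O : set (R * R)) (T : mesh) : set (R * R -> R) :=
  [set S : R * R -> R | [/\ {within closure O, continuous S},
     (forall K, T K -> exists (a : R * R) (b : R),
        forall x, K x -> S x = dot a x + b) &
     forall x, bdry O x -> S x = 0]].

Definition Xh (O : set (R * R)) (T : mesh) : set (R * R -> R * R) :=
  [set v : R * R -> R * R | H0div O v /\ forall K, T K -> exists (a : R) (b : R * R),
     {ae area, forall x, K x -> v x = a *: x + b}].

Definition Qh (O : set (R * R)) (T : mesh) : set (R * R -> R) :=
  [set q : R * R -> R | L20 O q /\ forall K, T K -> exists c : R,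
     {ae area, forall x, K x -> q x = c}].

(* The coupled problem with trial space X * Q * W and test space X * Q * V. *)
Definition coupled (O : set (R * R)) (z : R * R) (nu : R -> R) (kappa : R)
    (f : R * R -> R * R) (X : set (R * R -> R * R)) (Q W V : set (R * R -> R))
    (u : R * R -> R * R) (p T : R * R -> R) :=
  [/\ X u /\ Q p /\ W T,
      (forall v, X v ->
         integ O (fun x => nu (T x) * dot (u x) (v x) - p x * wdiv O v x) =
         integ O (fun x => dot (f x) (v x))),
      (forall q, Q q -> integ O (fun x => q x * wdiv O u x) = 0) &
      (forall S, V S ->
         integ O (fun x => kappa * dot (grad O T x) (grad O S x)
                           - T x * dot (u x) (grad O S x)) =
         delta O z S)].

Definition continuous_sol O z nu kappa f (p p' : R) :=
  coupled O z nu kappa f (H0div O) (L20 O) (W10 p O) (W10 p' O).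

Definition discrete_sol O z nu kappa f (T : mesh) :=
  coupled O z nu kappa f (Xh O T) (Qh O T) (Vh O T) (Vh O T).

(* Total degree at most d; the inner variable of P is the first coordinate. *)
Definition poly_on (d : nat) (K : set (R * R)) (g : R * R -> R) :=
  exists P : {poly {poly R}},
    (forall i j, (d < i + j)%N -> P`_j`_i = 0) /\
    forall x, K x -> g x = P.[x.2%:P].[x.1].

(* Sides are parametrized by [along] on [0, 1], hence the length factor in
   [side_L2], the L^2 norm for arc length. *)
Definition ends (g : set (R * R)) : (R * R) * (R * R) :=
  xget (0, 0) [set ab | ab.1 <> ab.2 /\ g = seg ab.1 ab.2].

Definition along (g : set (R * R)) (t : R) : R * R :=
  (ends g).1 + t *: ((ends g).2 - (ends g).1).

Definition side_length (g : set (R * R)) : R := enorm ((ends g).2 - (ends g).1).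

Definition tangent (g : set (R * R)) : R * R :=
  (side_length g)^-1 *: ((ends g).2 - (ends g).1).

Definition side_L2 (g : set (R * R)) (w : R * R -> R) : \bar R :=
  ((Num.sqrt (side_length g))%:E *
   'N[@lebesgue_measure R]_(2%:E)[(fun t => (\1_(`[0, 1] : set R) t * w (along g t))%:E)])%E.

(* Trace on the side g of a function in H^1(K), as the L^2(g)-limit of the
   restrictions of smooth functions converging to it in H^1(K). *)
Definition is_trace (K g : set (R * R)) (v t : R * R -> R) :=
  [/\ W1 2 K° v, measurable_fun (`[0, 1] : set R) (t \o along g) &
   exists phi : nat -> R * R -> R, [/\ forall n, smooth (phi n),
     W1_cvg 2 K° phi v &
     (fun n => side_L2 g (fun x => phi n x - t x)) @ \oo --> 0%E]].

Definition trace (K g : set (R * R)) (v : R * R -> R) : R * R -> R :=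
  xget (fun=> 0) [set t : R * R -> R | is_trace K g v t].

Definition tan_trace (K g : set (R * R)) (w : R * R -> R * R) : R * R -> R :=
  fun x => dot (tangent g)
    (trace K g (fun y => (w y).1) x, trace K g (fun y => (w y).2) x).

(* The elements K+ and K- sharing the internal side g; their order, and the
   orientation of [tangent g], only affect the sign of the jump. *)
Definition adj (T : mesh) (g : set (R * R)) : set (R * R) * set (R * R) :=
  xget (set0, set0) [set KK | [/\ T KK.1, T KK.2, KK.1 <> KK.2,
                                  side KK.1 g & side KK.2 g]].

(* Tangential jump of a piecewise field, w K being its expression on K. *)
Definition jump (T : mesh) (g : set (R * R))
    (w : set (R * R) -> R * R -> R * R) : R * R -> R :=
  fun x => tan_trace (adj T g).1 g (w (adj T g).1) x
         - tan_trace (adj T g).2 g (w (adj T g).2) x.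

(* L^2(K)-orthogonal projection onto constant fields. *)
Definition P0proj (f : R * R -> R * R) (K : set (R * R)) : R * R :=
  xget (0, 0) [set c | forall d : R * R, integ K° (fun x => dot (f x - c) d) = 0].

Definition error_indicator (T : mesh) (w : R * R -> R * R) (K : set (R * R)) : \bar R :=
  (((diam K ^+ 2)%:E * Lnm 2 K° (curl K° w) ^+ 2 +
    (diam K)%:E *
      (\sum_(g \in isides T K) side_L2 g (jump T g (fun=> w)) ^+ 2)) `^ 2^-1)%E.

End Plane.

(* Main.v *)
From HB Require Import structures.
Require Import Defs.
From mathcomp Require Import all_boot all_order all_algebra.
From mathcomp Require Import all_classical all_reals all_analysis.
From mathcomp Require Import measurable_realfun.
From mathcomp Require Import ring lra.

Set Implicit Arguments.
Unset Strict Implicit.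
Unset Printing Implicit Defensive.

Import Order.TTheory GRing.Theory Num.Theory.
Import numFieldNormedType.Exports.
Local Open Scope classical_set_scope.
Local Open Scope ring_scope.

(* Put w = f - nu(T_h) u_h and e = nu(T) u - nu(T_h) u_h. The first equation,
   tested with the divergence free field (d_2 psi, - d_1 psi) for a test function
   psi, says that w and e have the same circulation against psi. Moreover
   |e| <= nu_+ |u - u_h| + C_L |u| |T - T_h|, where the dual norm of delta_z is
   positive, so that the smallness hypothesis bounds C_L ||u||_{p'}; Hoelder's
   inequality then bounds e on a patch by the errors.

   On an element curl w is curl f minus a polynomial, and on a side the jump of w
   is that of f - P f minus a polynomial of the arc length. Instead of bubble
   functions and inverse estimates, the coefficients of these polynomials are
   extracted one by one: the test functions are products chi_i(s) chi_j(t) on a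
   square inside the element, or chi_i(s) eta(t) on a rectangle around the middle
   part of the side, in adapted coordinates (s, t) and at the scale of the
   element, where the chi_i are smooth, supported in [1/4, 3/4] and dual to the
   monomials s^j.

   Traces and the Green formula on a triangle come from the approximations
   x |-> \int theta(k) v((1 - e) x + e k) dk of v, with a bump theta supported in
   the triangle, which are smooth and only use v inside the triangle. *)

(** * Borel sets of the plane and their generation by rational squares *)

Section PlaneTopology.
Variable R : realType.
Local Notation mu := (@area R).

(** The bound must be uniform in the mesh, while traces and weak derivatives are defined through
    limits without rates. The two are kept apart: the constants of the trace construction depend on
    the triangle and only serve to justify Green's formula, and every constant of the final bound
    comes from the test functions. These are fixed functions of coordinates whose unit is the size
    of the element or the length of the side. In two dimensions the L^2 norm of their gradients is
    scale invariant and that of the functions is proportional to the unit: this is the origin of the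
    powers of the diameter. Shape regularity enters through one inscribed disc, which makes room for
    the square or the rectangle. As the [chi_i] are supported away from 0 and 1, no corner of a
    triangle is approached, and Green's formula is only used near the middle of one side. A constant
    subtracted from [f] on an element does not change its curl and only adds a polynomial to its
    tangential trace, so the estimates are proved with an arbitrary piecewise constant field in the
    place of the projection of [f]. *)

Definition sq (c : R * R) (r : R) : set (R * R) :=
  [set x | `|x.1 - c.1| <= r /\ `|x.2 - c.2| <= r].

(** [ratsq_c] and [ratsq_r] enumerate the squares with rational centre and half-side 1 / (k + 1). A
    number that codes no triple yields the square of half-side 1 at the origin; this is harmless, as
    a square is only used when it is contained in the given open set. *)
Definition ratsq_c (n : nat) : R * R :=
  if (unpickle n : option (rat * rat * nat)) is Some (q1, q2, _) then (ratr q1, ratr q2) else (0, 0) : R * R.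
Definition ratsq_r (n : nat) : R :=
  if (unpickle n : option (rat * rat * nat)) is Some (_, _, k) then (k.+1%:R)^-1 else 1.

Lemma ratsq_r_gt0 n : 0 < ratsq_r n.
Proof. by rewrite /ratsq_r; case: unpickle => [[[q1 q2] k]|//]; rewrite invr_gt0 ltr0Sn. Qed.

Lemma ratsq_enum (q1 q2 : rat) (k : nat) :
  exists n, ratsq_c n = (ratr q1, ratr q2) /\ ratsq_r n = (k.+1%:R)^-1.
Proof.
by exists (pickle (q1, q2, k)); rewrite /ratsq_c /ratsq_r pickleK.
Qed.

Lemma measurable_sq c r : measurable (sq c r).
Proof.
have -> : sq c r = `[c.1 - r, c.1 + r]%classic `*` `[c.2 - r, c.2 + r]%classic.
  apply/seteqP; split => x /=; rewrite /sq /= !in_itv /= !ler_distl//;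
  by move=> [? ?].
by apply: measurableX; exact: measurable_itv.
Qed.

Lemma open_sq (U : set (R * R)) x : open U -> U x ->
  exists2 r, 0 < r & sq x r `<=` U.
Proof.
move=> oU Ux; have /nbhs_ballP[e /= e0 eU] : nbhs x U by exact: open_nbhs_nbhs.
exists (e / 2); first by rewrite divr_gt0.
move=> y [y1 y2]; apply: eU; split; rewrite /ball /=;
 (rewrite distrC; apply: (le_lt_trans (y := e / 2))=> //; rewrite ltr_pdivrMr// ltr_pMr// ltrDr; exact: ltr01).
Qed.

(** The union is countable: this gives the measurability of open sets, and lets an almost everywhere
    statement on an open set be checked on one square at a time. *)
Lemma open_ratsqE (U : set (R * R)) : open U ->
  U = \bigcup_(n in [set n | sq (ratsq_c n) (ratsq_r n) `<=` U])
        sq (ratsq_c n) (ratsq_r n).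
Proof.
move=> oU; apply/seteqP; split=> [x Ux|x [n nU nx]]; last exact: nU.
have [r r0 rU] := open_sq oU Ux.
(* Half of [r], because [x] and any point of the rational square are both within [k'] of its
   centre. *)
have [k kr] : exists k : nat, (k.+1%:R)^-1 < r / 2.
  have r20 : 0 < r / 2 by rewrite divr_gt0.
  by have [k] := ltr_add_invr r20; rewrite add0r; exists k.
set k' := (k.+1%:R)^-1 in kr.
have k0 : 0 < k' by rewrite invr_gt0 ltr0Sn.
have P (y : R) : exists q : rat, `|y - ratr q| <= k'.
  have [|q] := @rat_in_itvoo R (y - k') (y + k'); first by lra.
  by rewrite in_itv /= => /andP[? ?]; exists q; rewrite ler_distlC; lra.
have [q1 h1] := P x.1; have [q2 h2] := P x.2.
have [n [nc nr]] := ratsq_enum q1 q2 k.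
exists n; rewrite /= nc nr; last by [].
move=> y [/= y1 y2]; apply: rU; rewrite /sq /=; rewrite -/k' in y1 y2.
have T (a b c : R) : `|b - c| <= k' -> `|a - c| <= k' -> `|a - b| <= r.
  by rewrite !ler_norml; lra.
by split; [exact: T y1|exact: T y2].
Qed.

Lemma bigcup_measurable_nat (P : set nat) (F : nat -> set (R * R)) :
  (forall n, measurable (F n)) -> measurable (\bigcup_(n in P) F n).
Proof.
by move=> mF; apply: bigcup_measurable => n _.
Qed.

Lemma open_measurable_plane (U : set (R * R)) : open U -> measurable U.
Proof.
move=> /open_ratsqE ->; apply: bigcup_measurable_nat => n; exact: measurable_sq.
Qed.

Lemma closed_measurable_plane (U : set (R * R)) : closed U -> measurable U.
Proof.
move=> cU; rewrite -(setCK U); apply: measurableC; apply: open_measurable_plane; exact: closed_openC.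
Qed.

(** Presents the product sigma-algebra as generated by a family stable under finite intersections,
    the form that the Dynkin induction in [cvL1_set] asks for. *)
Lemma plane_measurableE : @measurable _ (R * R)%type = <<s [set U : set (R * R) | open U] >>.
Proof.
apply/seteqP; split; last first.
  apply: smallest_sub; first exact: sigma_algebra_measurable.
  by move=> U /= /open_measurable_plane.
rewrite measurable_prod_measurableType.
apply: smallest_sub; first exact: smallest_sigma_algebra.
pose S := <<s [set U : set (R * R) | open U] >>.
have SA : sigma_algebra setT S by exact: smallest_sigma_algebra.
have H (g : R * R -> R) : continuous g -> forall A : set R, measurable A -> S (g @^-1` A).
  move=> cg A mA.
  suff : forall A : set R, (measurable : set_system R) A -> S (g @^-1` A) by apply.
  have E : @measurable _ R = _ := @measurable_realfun.RGenOpens.measurableE R.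
  rewrite E.
  have sA : sigma_algebra setT [set A : set R | S (g @^-1` A)].
    split=> /=.
    - by rewrite preimage_set0; case: SA.
    - move=> B SB; rewrite setTD -preimage_setC -setTD; by case: SA => _ + _; apply.
    - move=> F SF; rewrite preimage_bigcup; case: SA => _ _; by apply => n; exact: SF.
  apply: smallest_sub => // _ [a [b ->]] /=.
  by apply: sub_sigma_algebra => /=; apply: open_comp => [x _|]; [exact: cg|exact: interval_open].
move=> _ [A mA] [B mB] <-.
have -> : A `*` B = (fst @^-1` A) `&` (snd @^-1` B) by apply/seteqP; split.
have SI (X Y : set (R * R)) : S X -> S Y -> S (X `&` Y).
  move=> SX SY; exact: (@measurableI _ (g_sigma_algebraType [set U : set (R * R) | open U]) X Y SX SY).
by apply: SI; apply: H => // x; [exact: cvg_fst|exact: cvg_snd].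
Qed.

Lemma continuous_measurable_plane (f : R * R -> R) : continuous f -> measurable_fun setT f.
Proof.
move=> cf; apply: (measurability _ (@measurable_realfun.RGenOpens.measurableE R)) => _ [_ [a [b ->]] <-].
rewrite setTI; apply: open_measurable_plane; apply: open_comp => [x _|]; [exact: cf|exact: interval_open].
Qed.

Lemma open_continuous_measurable (A : set (R * R)) (f : R * R -> R) :
  open A -> {within A, continuous f} -> measurable_fun A f.
Proof.
move=> oA cf; have mA := open_measurable_plane oA.
apply: (measurability _ (@measurable_realfun.RGenOpens.measurableE R)) => _ [_ [a [b ->]] <-].
apply: open_measurable_plane; rewrite openE => x [Ax /= fx].
have : {for x, continuous f}.
  by move: cf; rewrite continuous_open_subspace// => /(_ x); apply; rewrite inE.
move=> cx; apply: filterI; first by apply: open_nbhs_nbhs.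
by apply: cx; apply: open_nbhs_nbhs; split => //; exact: interval_open.
Qed.

End PlaneTopology.

(** * Change of variables under affine maps of the plane *)

Section AffineChange.
Variable R : realType.
Local Notation mu := (@area R).
Local Notation leb := (@lebesgue_measure R).

Lemma measurable_affine1 (a b : R) : measurable_fun [set: _] (fun x : R => a * x + b : measurableTypeR R).
Proof.
apply: measurable_funD => //; exact: measurable_funM.
Qed.

(** By uniqueness of Lebesgue measure: [|a|] times the push-forward gives every half-open interval
    its length. For negative [a] the preimage is half-open on the other side, hence the two
    cases. *)
Lemma lebesgue_measure_affine (a b : R) (A : set R) : a != 0 -> measurable A ->
  pushforward leb (fun x : R => a * x + b : measurableTypeR R) A = ((`|a|^-1)%R%:E * leb A)%E.
Proof.
move=> a0 mA.
have a0' : 0 < `|a| by rewrite normr_gt0.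
pose phi := (fun x : R => a * x + b : measurableTypeR R).
have mphi : measurable_fun [set: R] phi by exact: measurable_affine1.
pose m := mscale (NngNum (normr_ge0 a)) (pushforward leb phi).
suff H : leb A = m mphi A.
  by rewrite H /m /mscale /= muleA -EFinM mulVf ?gt_eqF// mul1e.
apply: (@lebesgue_measure_unique R (m mphi)) => // _ [[u v]] _ <-.
rewrite /m /mscale /= /pushforward /=.
change (leb `]u, v] = `|a|%:E * leb (phi @^-1` `]u, v]%classic))%E.
have [ap|an] := boolP (0 < a).
  have -> : phi @^-1` `]u, v]%classic = `](u - b) / a, (v - b) / a]%classic.
    apply/seteqP; split=> x /=; rewrite !in_itv /= /phi ltr_pdivrMr// ler_pdivlMr//;
    rewrite mulrC => /andP[? ?]; apply/andP; split; lra.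
  rewrite !lebesgue_measure_itv/= !lte_fin ltr_pM2r ?invr_gt0// ltrD2r.
  case: ifPn => // uv; last by rewrite mule0.
  by rewrite -!EFinD -EFinM gtr0_norm//; congr EFin; field.
have {}an : a < 0 by rewrite lt_neqAle a0 leNgt.
have -> : phi @^-1` `]u, v]%classic = `[(v - b) / a, (u - b) / a[%classic.
  apply/seteqP; split=> x /=; rewrite !in_itv /= /phi ler_ndivrMr// ltr_ndivlMr//;
  rewrite mulrC => /andP[? ?]; apply/andP; split; lra.
rewrite !lebesgue_measure_itv/= !lte_fin ltr_nM2r ?invr_lt0// ltrD2r.
case: ifPn => // uv; last by rewrite mule0.
by rewrite -!EFinD -EFinM ltr0_norm//; congr EFin; field.
Qed.

Lemma ge0_integral_affine1 (a b : R) (G : R -> \bar R) : a != 0 ->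
  measurable_fun [set: R] G -> (forall x, 0 <= G x)%E ->
  (\int[leb]_x G (a * x + b)%R = (`|a|^-1)%R%:E * \int[leb]_x G x)%E.
Proof.
move=> a0 mG G0.
have a0' : 0 <= `|a|^-1 by rewrite invr_ge0.
rewrite -(@ge0_integral_mscale _ _ _ leb setT _ (NngNum a0') G)//.
pose phi := (fun x : R => a * x + b : measurableTypeR R).
have mphi : measurable_fun [set: R] phi by exact: measurable_affine1.
have := @ge0_integral_pushforward _ _ (measurableTypeR R) (measurableTypeR R) R phi mphi leb setT G measurableT mG (fun x _ => G0 x).
rewrite preimage_setT /comp => <-.
apply: (@eq_measure_integral _ (measurableTypeR R) R setT (mscale (NngNum a0') leb) (pushforward leb phi)) => A mA _.
by have /= := lebesgue_measure_affine b a0 mA.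
Qed.

Definition aff (c v w : R * R) (x : R * R) : R * R :=
  (c.1 + x.1 * v.1 + x.2 * w.1, c.2 + x.1 * v.2 + x.2 * w.2).

Lemma continuous_aff c v w : continuous (aff c v w).
Proof.
move=> x.
have H (p q r : R) : (fun y : R * R => p + y.1 * q + y.2 * r) y @[y --> x] --> p + x.1 * q + x.2 * r.
  by apply: cvgD; [apply: cvgD; [exact: cvg_cst|]|]; apply: cvgMl; [exact: cvg_fst|exact: cvg_snd].
exact: cvg_pair (H _ _ _) (H _ _ _).
Qed.

Lemma measurable_aff c v w : measurable_fun [set: _] (aff c v w).
Proof.
have H (a b d : R) : measurable_fun [set: _] (fun x : R * R => a + x.1 * b + x.2 * d).
  apply: continuous_measurable_plane => x.
  by apply: cvgD; [apply: cvgD; [exact: cvg_cst|]|]; apply: cvgMl; [exact: cvg_fst|exact: cvg_snd].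
by apply: measurable_fun_pair; exact: H.
Qed.

(** Gaussian elimination with pivot [v.1]. For a fixed second variable, the first coordinate of the
    image becomes the new first variable; for a fixed first variable, what remains is an affine map
    of slope [dt / v.1] in the second. [F'] is the integrand between the two substitutions. *)
Lemma ge0_integral_aff_aux c v w (F : R * R -> \bar R) : v.1 != 0 ->
  v.1 * w.2 - v.2 * w.1 != 0 ->
  measurable_fun [set: R * R] F -> (forall x, 0 <= F x)%E ->
  (\int[mu]_x F (aff c v w x) = (`|v.1 * w.2 - v.2 * w.1|^-1)%R%:E * \int[mu]_x F x)%E.
Proof.
move=> v0 d0 mF F0.
set dt := _ - _ in d0 *.
pose F' x := F (x.1, c.2 + (x.1 - c.1) / v.1 * v.2 + x.2 * (dt / v.1))%R.
have mF' : measurable_fun [set: R * R] F'.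
  apply: (measurableT_comp mF); apply: measurable_fun_pair => //.
  apply: continuous_measurable_plane => x; apply: cvgD; last by apply: cvgMl; exact: cvg_snd.
  apply: cvgD; first exact: cvg_cst.
  by do 2 apply: cvgMl; apply: cvgB; [exact: cvg_fst|exact: cvg_cst].
have E1 x2 : (\int[leb]_x1 F (aff c v w (x1, x2)) = (`|v.1|^-1)%R%:E * \int[leb]_x1 F' (x1, x2))%E.
  rewrite -(@ge0_integral_affine1 v.1 (c.1 + x2 * w.1)%R (fun x1 => F' (x1, x2)))//; last 2 first.
    by apply: (measurableT_comp mF'); exact: measurable_pair2.
    by move=> x; exact: F0.
  apply: eq_integral => x1 _; rewrite /F' /aff /=; congr (F (_, _)); first by ring.
  by rewrite /dt; field.
rewrite /area fubini_tonelli2//; last by apply: measurableT_comp mF _; exact: measurable_aff.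
rewrite /fubini_G; under eq_integral do rewrite E1.
rewrite ge0_integralZl//; last 2 first.
- exact: (@measurable_fun_fubini_tonelli_G _ _ _ _ _ leb F' mF' (fun=> F0 _)).
- by move=> x _; apply: integral_ge0 => y _; exact: F0.
have SW : (\int[leb]_y \int[leb]_x F' (x, y) = \int[leb]_x \int[leb]_y F' (x, y))%E.
  by apply/esym; have := @fubini_tonelli _ _ _ _ R leb leb F' mF' (fun=> F0 _).
rewrite SW {SW}.
have E2 x1 : (\int[leb]_x2 F' (x1, x2) = (`|dt / v.1|^-1)%R%:E * \int[leb]_x2 F (x1, x2))%E.
  rewrite -(@ge0_integral_affine1 (dt / v.1) (c.2 + (x1 - c.1) / v.1 * v.2) (fun x2 => F (x1, x2)))//.
  - by apply: eq_integral => x2 _; rewrite /F' /=; congr (F (_, _)); ring.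
  - by rewrite mulf_neq0 ?invr_eq0.
  - by apply: (measurableT_comp mF); exact: measurable_pair1.
under eq_integral do rewrite E2.
rewrite ge0_integralZl//; last 2 first.
- exact: (@measurable_fun_fubini_tonelli_F _ _ _ _ _ leb F mF F0).
- by move=> x _; apply: integral_ge0 => y _; exact: F0.
rewrite -(@fubini_tonelli1 _ _ _ _ _ leb leb F)// muleA -EFinM; congr (_%:E * _)%E.
by rewrite normf_div invf_div mulrA mulVf ?mul1r// normr_eq0.
Qed.

Lemma ge0_integral_swap (F : R * R -> \bar R) :
  measurable_fun [set: R * R] F -> (forall x, 0 <= F x)%E ->
  (\int[mu]_x F (x.2, x.1) = \int[mu]_x F x)%E.
Proof.
move=> mF F0.
rewrite /area fubini_tonelli2//; last first.
  apply: measurableT_comp mF _; exact: measurable_fun_pair.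
by rewrite fubini_tonelli1.
Qed.

(** If the pivot [v.1] vanishes then [w.1] does not, and exchanging the two variables exchanges [v]
    and [w]. *)
Lemma ge0_integral_aff c v w (F : R * R -> \bar R) :
  v.1 * w.2 - v.2 * w.1 != 0 ->
  measurable_fun [set: R * R] F -> (forall x, 0 <= F x)%E ->
  (\int[mu]_x F (aff c v w x) = (`|v.1 * w.2 - v.2 * w.1|^-1)%R%:E * \int[mu]_x F x)%E.
Proof.
move=> d0 mF F0; have [v0|v0] := eqVneq v.1 0; last exact: ge0_integral_aff_aux.
have w0 : w.1 != 0.
  by apply: contraNneq d0 => w0; rewrite v0 w0 mulr0 mul0r subrr.
have -> : v.1 * w.2 - v.2 * w.1 = - (w.1 * v.2 - w.2 * v.1) by ring.
rewrite normrN -(@ge0_integral_aff_aux c)//; last first.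
  by have -> : w.1 * v.2 - w.2 * v.1 = - (v.1 * w.2 - v.2 * w.1); [ring|rewrite oppr_eq0].
rewrite -ge0_integral_swap//; last by apply: measurableT_comp mF _; exact: measurable_aff.
by apply: eq_integral => x _; rewrite /aff /=; congr (F (_, _)); ring.
Qed.

Lemma integrable_aff c v w (F : R * R -> \bar R) :
  v.1 * w.2 - v.2 * w.1 != 0 -> mu.-integrable setT F ->
  mu.-integrable setT (F \o aff c v w).
Proof.
move=> d0 /integrableP[mF0 iF]; have mF : measurable_fun [set: R * R] F := mF0.
apply/integrableP; split.
  by apply: measurableT_comp mF _; exact: measurable_aff.
have -> : (\int[mu]_x `|(F \o aff c v w) x|)%E = (\int[mu]_x (abse \o F) (aff c v w x))%E by [].
rewrite (@ge0_integral_aff c v w (abse \o F))//; last 2 first.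
- by apply: measurableT_comp => //; exact: measurable_abse.
- by move=> x; exact: abse_ge0.
by rewrite lte_mul_pinfty// lee_fin invr_ge0.
Qed.

Lemma Rintegral_aff c v w (F : R * R -> R) :
  v.1 * w.2 - v.2 * w.1 != 0 -> mu.-integrable setT (EFin \o F) ->
  \int[mu]_x F (aff c v w x) = `|v.1 * w.2 - v.2 * w.1|^-1 * \int[mu]_x F x.
Proof.
move=> d0 iF; rewrite -RintegralZl// /Rintegral; congr fine.
under [in RHS]eq_integral do rewrite EFinM.
have mF : measurable_fun [set: R * R] (EFin \o F) := measurable_int _ iF.
rewrite integralZl//.
rewrite integralE [in RHS]integralE muleBr//; last first.
  by rewrite fin_num_adde_defr//; exact: integrable_pos_fin_num.
have mp := measurable_funepos mF; have mn := measurable_funeneg mF.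
congr (_ - _)%E.
  rewrite -(@ge0_integral_aff c v w _ d0 mp (fun=> funepos_ge0 _ _)).
  by apply: eq_integral => x _; rewrite !funeposE.
rewrite -(@ge0_integral_aff c v w _ d0 mn (fun=> funeneg_ge0 _ _)).
by apply: eq_integral => x _; rewrite !funenegE.
Qed.

End AffineChange.

(** * Integrals and L^2 norms of functions on the whole plane *)

Section SquareIntegrable.
Variable R : realType.
Local Notation mu := (@area R).
Local Notation leb := (@lebesgue_measure R).
Implicit Types (f g : R * R -> R) (A B : set (R * R)).

Global Instance area_ae_filter : Filter (nbhs (almost_everywhere mu)).
Proof.
exact: ae_filter_ringOfSetsType.
Qed.

Lemma aeS (P Q : R * R -> Prop) : (forall x, P x -> Q x) ->
  {ae mu, forall x, P x} -> {ae mu, forall x, Q x}.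
Proof. by move=> PQ; apply: filterS. Qed.

Lemma ae_and (P Q : R * R -> Prop) :
  {ae mu, forall x, P x} -> {ae mu, forall x, Q x} -> {ae mu, forall x, P x /\ Q x}.
Proof. by move=> p q; apply: filterS2 p q. Qed.

Lemma ae_all (P : R * R -> Prop) : (forall x, P x) -> {ae mu, forall x, P x}.
Proof. by move=> p; exact: aeW. Qed.

Definition mble f := measurable_fun [set: R * R] f.
Definition ing f := mu.-integrable setT (EFin \o f).
Definition Int f : R := \int[mu]_x f x.
(** Extension by zero turns integrals and norms over subsets into integrals and norms over the
    plane, so that one integrability predicate and one norm serve everywhere. *)
Definition rs A f : R * R -> R := fun x => \1_A x * f x.

Lemma ing_mble f : ing f -> mble f.
Proof. by move=> /(measurable_int _) /measurable_EFinP. Qed.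

Lemma mbleD f g : mble f -> mble g -> mble (fun x => f x + g x).
Proof. by move=> mf mg; exact: measurable_funD. Qed.
Lemma mbleB f g : mble f -> mble g -> mble (fun x => f x - g x).
Proof. by move=> mf mg; exact: measurable_funB. Qed.
Lemma mbleM f g : mble f -> mble g -> mble (fun x => f x * g x).
Proof. by move=> mf mg; exact: measurable_funM. Qed.
Lemma mbleX f n : mble f -> mble (fun x => f x ^+ n).
Proof. by move=> mf; exact: measurable_funX. Qed.
Lemma mble_cst (c : R) : mble (fun=> c).
Proof. exact: measurable_cst. Qed.
Lemma mbleN f : mble f -> mble (fun x => - f x).
Proof. move=> mf; exact: measurable_funN. Qed.
Lemma mble_abs f : mble f -> mble (fun x => `|f x|).
Proof. by move=> mf; apply: measurableT_comp mf. Qed.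
Lemma mble_indic A : measurable A -> mble (\1_A).
Proof. by move=> mA; exact: measurable_indic. Qed.
Lemma mble_aff c v w f : mble f -> mble (fun x => f (aff c v w x)).
Proof. by move=> mf; apply: (measurableT_comp mf); exact: measurable_aff. Qed.

Lemma rsE A f : rs A f = f \_ A.
Proof.
apply/funext => x; rewrite /rs patchE indicE; case: (x \in A); by rewrite ?mul1r ?mul0r.
Qed.

Lemma rs_in A f x : A x -> rs A f x = f x.
Proof. by move=> Ax; rewrite /rs indicE mem_set// mul1r. Qed.
Lemma rs_out A f x : ~ A x -> rs A f x = 0.
Proof. by move=> Ax; rewrite /rs indicE memNset// mul0r. Qed.

Lemma mble_rs A f : measurable A -> measurable_fun A f -> mble (rs A f).
Proof. by move=> mA mf; rewrite rsE; exact/(measurable_restrictT f mA). Qed.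

Lemma mble_on A f : mble f -> measurable_fun A f.
Proof. by move=> mf; exact: measurable_funTS. Qed.

Lemma integE A f : integ A f = Int (rs A f).
Proof. by rewrite /integ Rintegral_mkcond rsE. Qed.

Lemma ingD f g : ing f -> ing g -> ing (fun x => f x + g x).
Proof. move=> f1 g1; exact: (integrableD measurableT f1 g1). Qed.
Lemma ingB f g : ing f -> ing g -> ing (fun x => f x - g x).
Proof. move=> f1 g1; exact: (integrableB measurableT f1 g1). Qed.
Lemma ingZ (k : R) f : ing f -> ing (fun x => k * f x).
Proof. move=> f1; exact: (integrableZl measurableT k f1). Qed.
Lemma ing0 : ing (fun=> 0).
Proof. exact: integrable0. Qed.

Lemma ing_le f g : mble f -> ing g -> (forall x, `|f x| <= g x) -> ing f.
Proof.
move=> mf ig fg; apply: (le_integrable measurableT _ _ ig).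
  exact/measurable_EFinP.
move=> x _ /=; rewrite lee_fin (le_trans (fg x))// ler_norm//.
Qed.

Lemma ing_abs f : ing f -> ing (fun x => `|f x|).
Proof.
move=> ig; have := integrable_abse ig; by congr (mu.-integrable setT _).
Qed.

Lemma ing_bounded f g (M : R) : mble f -> ing g -> (forall x, `|f x| <= M) ->
  ing (fun x => f x * g x).
Proof.
move=> mf ig fM; have mg := ing_mble ig.
apply: (@ing_le _ (fun x => M * `|g x|)); first exact: mbleM.
  by apply/ingZ/ing_abs.
by move=> x; rewrite normrM ler_wpM2r.
Qed.

Lemma IntD f g : ing f -> ing g -> Int (fun x => f x + g x) = Int f + Int g.
Proof. by move=> f1 g1; exact: RintegralD. Qed.
Lemma IntB f g : ing f -> ing g -> Int (fun x => f x - g x) = Int f - Int g.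
Proof. by move=> f1 g1; exact: RintegralB. Qed.
Lemma IntZ (k : R) f : ing f -> Int (fun x => k * f x) = k * Int f.
Proof. by move=> f1; exact: RintegralZl. Qed.
Lemma IntN f : ing f -> Int (fun x => - f x) = - Int f.
Proof.
move=> f1; rewrite -mulN1r -IntZ//; congr Int; apply/funext => x; by rewrite mulN1r.
Qed.
Lemma Int0 : Int (fun=> 0) = 0.
Proof. by rewrite /Int /Rintegral integral0. Qed.
Lemma Int_ge0 f : (forall x, 0 <= f x) -> 0 <= Int f.
Proof. by move=> f0; apply: Rintegral_ge0. Qed.
Lemma Int_le f g : ing f -> ing g -> (forall x, f x <= g x) -> Int f <= Int g.
Proof. by move=> f1 g1 fg; apply: le_Rintegral. Qed.
Lemma Int_abs_le f : ing f -> `|Int f| <= Int (fun x => `|f x|).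
Proof. by move=> f1; apply: le_normr_Rintegral. Qed.
Lemma eq_Int f g : f =1 g -> Int f = Int g.
Proof. by move=> /funext ->. Qed.
Lemma eq_ing f g : f =1 g -> ing f -> ing g.
Proof. by move=> /funext ->. Qed.

Lemma Int_EFin f : ing f -> (\int[mu]_x (f x)%:E)%E = (Int f)%:E.
Proof.
by move=> f1; rewrite /Int /Rintegral fineK//; exact: integrable_fin_num.
Qed.

Lemma ing_ae f g : mble g -> {ae mu, forall x, f x = g x} -> ing f -> ing g.
Proof.
move=> mg fg f1; have mf := ing_mble f1.
apply/integrableP; split; first exact/measurable_EFinP.
have /integrableP[_ +] := f1.
congr (_ < _)%E; apply: ge0_ae_eq_integral => //=.
- by apply/measurable_EFinP; exact: mble_abs.
- by apply/measurable_EFinP; exact: mble_abs.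
- by apply: aeS fg => x -> _.
Qed.

Lemma Int_ae f g : mble f -> mble g -> {ae mu, forall x, f x = g x} -> Int f = Int g.
Proof.
move=> mf mg fg; congr fine; apply: ae_eq_integral => //; try exact/measurable_EFinP.
by apply: aeS fg => x -> _.
Qed.

Lemma Int0_ae f : ing f -> (forall x, 0 <= f x) -> Int f = 0 -> {ae mu, forall x, f x = 0}.
Proof.
move=> f1 f0 If0; have mf := ing_mble f1.
have : (\int[mu]_(x in setT) `|(f x)%:E| = 0)%E.
  under eq_integral do rewrite gee0_abs ?lee_fin//.
  by rewrite Int_EFin// If0.
move=> /(ae_eq_integral_abs mu measurableT) H.
have {H} : ae_eq mu setT (EFin \o f) (cst 0%E).
  by apply: H; exact/measurable_EFinP.
by apply: filterS => x /(_ I) /= [].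
Qed.

Lemma ing_aff c v w f : v.1 * w.2 - v.2 * w.1 != 0 -> ing f ->
  ing (fun x => f (aff c v w x)).
Proof. by move=> d0 f1; exact: integrable_aff d0 f1. Qed.
Lemma Int_aff c v w f : v.1 * w.2 - v.2 * w.1 != 0 -> ing f ->
  Int (fun x => f (aff c v w x)) = `|v.1 * w.2 - v.2 * w.1|^-1 * Int f.
Proof. by move=> d0 f1; exact: Rintegral_aff. Qed.

Lemma Int_dominated (F : nat -> R * R -> R) f g :
  (forall n, mble (F n)) -> mble f -> ing g ->
  {ae mu, forall x, F n x @[n --> \oo] --> f x} ->
  (forall n x, `|F n x| <= g x) ->
  Int (F n) @[n --> \oo] --> Int f.
Proof.
move=> mF mf ig cF Fg.
have c2 : {ae mu, forall x, setT x -> (F n x)%:E @[n --> \oo] --> (f x)%:E}.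
  by apply: aeS cF => x Px _; apply: cvg_EFin => //; exact: nearW.
have b2 : {ae mu, forall x n, setT x -> (`|(F n x)%:E| <= (g x)%:E)%E}.
  by apply: ae_all => x n _; rewrite lee_fin.
have mF2 n : measurable_fun [set: R * R] (fun x => (F n x)%:E) by apply/measurable_EFinP; exact: mF.
have mf2 : measurable_fun [set: R * R] (fun x => (f x)%:E) by apply/measurable_EFinP.
have [i1 _ H] := @dominated_convergence _ _ R mu setT measurableT _ _ (fun x => (g x)%:E) mF2 mf2 c2 ig b2.
apply: fine_cvg; move: H; congr (_ --> _).
by rewrite Int_EFin.
Qed.

Lemma ing_indic A c r : measurable A -> A `<=` sq c r -> ing (\1_A).
Proof.
move=> mA Asq.
have mle : (mu A < +oo)%E.
  have mle : (mu (sq c r) < +oo)%E.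
    have -> : sq c r = `[c.1 - r, c.1 + r]%classic `*` `[c.2 - r, c.2 + r]%classic.
      apply/seteqP; split => x /=; rewrite /sq /= !in_itv /= !ler_distl//;
      by move=> [? ?].
    rewrite /area product_measure1E; [|exact: measurable_itv|exact: measurable_itv].
    have L (a b : R) : (leb `[a, b]%classic < +oo)%E by rewrite lebesgue_measure_itv /=; case: ifP => _; rewrite ?ltry// -EFinD ltry.
    by apply: lte_mul_pinfty (L _ _) => //; rewrite ge0_fin_numE ?L.
  by apply: le_lt_trans mle; apply: le_measure; rewrite ?inE//; exact: measurable_sq.
apply/integrableP; split; first by apply/measurable_EFinP; exact: measurable_indic.
have -> : (\int[mu]_x `|(EFin \o \1_A) x| = \int[mu]_x (\1_A x)%:E)%E.
  by apply: eq_integral => x _ /=; rewrite ger0_norm// indicE.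
by rewrite integral_indic// setIT.
Qed.

Lemma ing_fubini f : ing f ->
  Int f = \int[leb]_y \int[leb]_x f (x, y).
Proof.
move=> f1; rewrite /Int /Rintegral /area.
rewrite -(@integral21_prod_meas1 _ _ _ _ _ leb leb _ f1); congr fine.
have mG := @measurable_fubini_G _ _ _ _ _ leb leb _ f1.
apply: ae_eq_integral => //=.
- apply/measurable_EFinP; apply: measurableT_comp => //; exact: measurable_fine.
- have := @ae_integrable2 _ _ _ _ _ leb leb _ f1; apply: filterS => y i1 _.
  by rewrite fineK// integrable_fin_num.
Qed.

Lemma ing_fubini_y f : ing f -> {ae leb, forall y, leb.-integrable setT (fun x => (f (x, y))%:E)}.
Proof. by move=> f1; exact: (@ae_integrable2 _ _ _ _ _ leb leb _ f1). Qed.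

Definition sqi f := mble f /\ ing (fun x => f x ^+ 2).
Definition n2 f : R := Num.sqrt (Int (fun x => f x ^+ 2)).

Lemma n2_ge0 f : 0 <= n2 f. Proof. exact: sqrtr_ge0. Qed.
Lemma n2_sq f : n2 f ^+ 2 = Int (fun x => f x ^+ 2).
Proof. by rewrite sqr_sqrtr// Int_ge0// => x; exact: sqr_ge0. Qed.

Lemma sqi_mul f g : sqi f -> sqi g -> ing (fun x => f x * g x).
Proof.
move=> [mf f2] [mg g2]; apply: (@ing_le _ (fun x => f x ^+ 2 + g x ^+ 2)).
- exact: mbleM.
- exact: ingD.
- move=> x; rewrite ler_norml; have := sqr_ge0 (f x + g x); have := sqr_ge0 (f x - g x).
  have := sqr_ge0 (f x); have := sqr_ge0 (g x).
  rewrite sqrrB sqrrD !mulr2n => ? ? ? ?; apply/andP; split; lra.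
Qed.

Lemma sqi_abs f : sqi f -> sqi (fun x => `|f x|).
Proof.
by move=> [mf f2]; split; [exact: mble_abs|apply: eq_ing f2 => x; rewrite real_normK ?num_real].
Qed.

Lemma sqiZ k f : sqi f -> sqi (fun x => k * f x).
Proof.
move=> [mf f2]; split; first by apply: mbleM => //; exact: mble_cst.
by apply: eq_ing (ingZ (k ^+ 2) f2) => x; rewrite exprMn.
Qed.

Lemma sqiD f g : sqi f -> sqi g -> sqi (fun x => f x + g x).
Proof.
move=> sf sg; split; first by apply: mbleD; [case: sf|case: sg].
have [_ f2] := sf; have [_ g2] := sg; have fg := sqi_mul sf sg.
apply: eq_ing (ingD (ingD f2 (ingZ 2 fg)) g2) => x; ring.
Qed.

Lemma sqiB f g : sqi f -> sqi g -> sqi (fun x => f x - g x).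
Proof.
move=> sf /(@sqiZ (-1)) sg; have := sqiD sf sg.
by congr sqi; apply/funext => x; rewrite mulN1r.
Qed.

Lemma sqi_le f g : mble f -> sqi g -> (forall x, `|f x| <= `|g x|) -> sqi f.
Proof.
move=> mf [mg g2] fg; split=> //; apply: ing_le g2 _; first exact: mbleX.
by move=> x; rewrite normrX -[leRHS]real_normK ?num_real// lerXn2r ?nnegrE.
Qed.

Lemma sqi_bounded f g M : mble f -> (forall x, `|f x| <= M) -> sqi g -> sqi (fun x => f x * g x).
Proof.
move=> mf fM sg; have [mg _] := sg.
apply: (@sqi_le _ (fun x => M * g x)); [exact: mbleM|exact: sqiZ|move=> x].
by rewrite !normrM ler_wpM2r// (le_trans (fM x))// ler_norm.
Qed.

Lemma n2Z k f : sqi f -> n2 (fun x => k * f x) = `|k| * n2 f.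
Proof.
move=> [mf f2]; rewrite /n2 -sqrtr_sqr -sqrtrM ?sqr_ge0// -IntZ//.
by congr Num.sqrt; apply: eq_Int => x; rewrite exprMn.
Qed.

(** The quadratic form [H] is nonnegative, and at [(n2 g, n2 f)] it equals [2 * (n2 f * n2 g)] times
    the wanted difference. When one norm vanishes this choice says nothing; the form is then affine
    in one variable, and a suitable value of it excludes [0 < a]. *)
Lemma cauchy_schwarz f g : sqi f -> sqi g ->
  Int (fun x => f x * g x) <= n2 f * n2 g.
Proof.
move=> sf sg; have [mf f2] := sf; have [mg g2] := sg; have fg := sqi_mul sf sg.
set a := Int _.
have H (s t : R) : 0 <= s ^+ 2 * n2 f ^+ 2 - 2 * (s * t) * a + t ^+ 2 * n2 g ^+ 2.
  rewrite !n2_sq -!IntZ// -IntB ?ingZ// -IntD; [|by apply: ingB; exact: ingZ|exact: ingZ].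
  apply: Int_ge0 => x; have := sqr_ge0 (s * f x - t * g x); congr (_ <= _); ring.
have := n2_ge0 f; rewrite le_eqVlt => /orP[/eqP f0|f0].
  have a0 : a <= 0.
    rewrite leNgt; apply/negP => a0.
    have := H ((1 + n2 g ^+ 2) / a) 1; rewrite -f0 !expr0n /= mulr0 mulr1 add0r expr1n mul1r.
    have -> : 2 * ((1 + n2 g ^+ 2) / a) * a = 2 + 2 * n2 g ^+ 2 by field; rewrite gt_eqF.
    by have := sqr_ge0 (n2 g); lra.
  by rewrite -f0 mul0r.
have := n2_ge0 g; rewrite le_eqVlt => /orP[/eqP g0|g0].
  have a0 : a <= 0.
    rewrite leNgt; apply/negP => a0.
    have := H 1 ((1 + n2 f ^+ 2) / a); rewrite -g0 !expr0n /= mulr0 mul1r addr0 expr1n mul1r.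
    have -> : 2 * ((1 + n2 f ^+ 2) / a) * a = 2 + 2 * n2 f ^+ 2 by field; rewrite gt_eqF.
    by have := sqr_ge0 (n2 f); lra.
  by rewrite -g0 mulr0.
have := H (n2 g) (n2 f).
have -> : n2 g ^+ 2 * n2 f ^+ 2 - 2 * (n2 g * n2 f) * a + n2 f ^+ 2 * n2 g ^+ 2 =
  2 * (n2 f * n2 g) * (n2 f * n2 g - a) by ring.
by rewrite pmulr_rge0 ?subr_ge0// !mulr_gt0.
Qed.

Lemma cauchy_schwarz_abs f g : sqi f -> sqi g ->
  Int (fun x => `|f x * g x|) <= n2 f * n2 g.
Proof.
move=> sf sg; have := cauchy_schwarz (sqi_abs sf) (sqi_abs sg).
have E h : n2 (fun x => `|h x|) = n2 h.
  by rewrite /n2; congr Num.sqrt; apply: eq_Int => x; rewrite real_normK ?num_real.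
by rewrite !E; congr (_ <= _); apply: eq_Int => x; rewrite normrM.
Qed.

Lemma n2D f g : sqi f -> sqi g -> n2 (fun x => f x + g x) <= n2 f + n2 g.
Proof.
move=> sf sg; have [mf f2] := sf; have [mg g2] := sg; have fg := sqi_mul sf sg.
rewrite -(@ler_pXn2r _ 2) ?nnegrE ?addr_ge0 ?n2_ge0//.
have := cauchy_schwarz sf sg.
have -> : n2 (fun x => f x + g x) ^+ 2 = n2 f ^+ 2 + 2 * Int (fun x => f x * g x) + n2 g ^+ 2.
  rewrite !n2_sq -IntZ// -IntD//; last exact: ingZ.
  rewrite -IntD//; last by apply: ingD => //; exact: ingZ.
  by apply: eq_Int => x; ring.
by rewrite sqrrD mulr2n; lra.
Qed.

Lemma n2_le f g : sqi f -> sqi g -> (forall x, `|f x| <= `|g x|) -> n2 f <= n2 g.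
Proof.
move=> [mf f2] [mg g2] fg; rewrite /n2 ler_wsqrtr// Int_le// => x.
by rewrite -[leLHS]real_normK ?num_real// -[leRHS]real_normK ?num_real// lerXn2r ?nnegrE.
Qed.

Lemma n2_ae f g : mble f -> mble g -> {ae mu, forall x, f x = g x} -> n2 f = n2 g.
Proof.
move=> mf mg fg; rewrite /n2; congr Num.sqrt; apply: Int_ae; [exact: mbleX|exact: mbleX|].
by apply: aeS fg => x ->.
Qed.

Lemma sqi_ae f g : mble g -> {ae mu, forall x, f x = g x} -> sqi f -> sqi g.
Proof.
move=> mg fg [mf f2]; split => //; apply: ing_ae f2; first exact: mbleX.
by apply: aeS fg => x ->.
Qed.

Lemma LnormE f : sqi f -> 'N[mu]_2%:E[(fun x => (f x)%:E)]%E = (n2 f)%:E.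
Proof.
move=> [mf f2]; rewrite unlock /= /n2.
under eq_integral => x _ do rewrite powR_mulrn// real_normK ?num_real//.
by rewrite Int_EFin// poweR_EFin powR12_sqrt// Int_ge0// => x; exact: sqr_ge0.
Qed.

Lemma Lnorm_sqi f : mble f -> ('N[mu]_2%:E[(fun x => (f x)%:E)] < +oo)%E -> sqi f.
Proof.
move=> mf N2; split => //.
have : (fun x => f x) \in Lfun mu 2%:E.
  by rewrite inE; apply/andP; split; rewrite inE.
move=> /(Lfun2_integrable_sqr) H; exact: H.
Qed.

Lemma Lnm2E A f : sqi (rs A f) -> Lnm 2 A f = (n2 (rs A f))%:E.
Proof. exact: LnormE. Qed.

Lemma Lsp2P A f : measurable A -> Lsp 2 A f <-> measurable_fun A f /\ sqi (rs A f).
Proof.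
move=> mA; split=> [[mf N2]|[mf s]].
  by split => //; apply: Lnorm_sqi => //; exact: mble_rs.
by split => //; rewrite Lnm2E// ltry.
Qed.

End SquareIntegrable.

(** * Smooth functions of one variable and a compactly supported bump *)

Section Smooth1.
Variable R : realType.
Implicit Types (f g : R -> R).

Definition smooth1 f := forall n x, derivable (derive1n n f) x 1.

(** Coinduction principle: smooth functions form the largest class of differentiable functions
    stable under the derivative, so smoothness is proved by exhibiting a stable class. *)
Lemma smooth1_ind (S : set (R -> R)) :
  (forall f, S f -> (forall x, derivable f x 1) /\ S (derive1 f)) ->
  forall f, S f -> smooth1 f.
Proof.
move=> H f Sf n; elim: n f Sf => [|n IH] f Sf x; first by case: (H _ Sf).
rewrite /derive1n iterSr; apply: IH; by case: (H _ Sf).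
Qed.

Lemma smooth1_der f x : smooth1 f -> derivable f x 1.
Proof. by move=> /(_ 0%N x). Qed.

Lemma smooth1_d f : smooth1 f -> smooth1 (derive1 f).
Proof. by move=> sf n x; have := sf n.+1 x; rewrite /derive1n iterSr. Qed.

Lemma smooth1_cont f : smooth1 f -> continuous f.
Proof.
by move=> sf x; apply: differentiable_continuous; apply/derivable1_diffP/smooth1_der.
Qed.

Lemma smooth1_is f (x : R) : smooth1 f -> is_derive x (1 : R) f (derive1 f x).
Proof. by move=> sf; apply: DeriveDef; [exact: smooth1_der|rewrite derive1E]. Qed.

Lemma smooth1_cst c : smooth1 (fun=> c).
Proof.
apply: (@smooth1_ind [set f | exists c, f = (fun=> c)]); last by exists c.
move=> _ [d ->]; split; first by move=> x; exact: derivable_cst.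
by exists 0; apply/funext => x; rewrite derive1E derive_cst.
Qed.

Lemma smooth1D f g : smooth1 f -> smooth1 g -> smooth1 (fun x => f x + g x).
Proof.
move=> sf sg.
apply: (@smooth1_ind [set h | exists f g, [/\ smooth1 f, smooth1 g & h = (fun x => f x + g x)]]); last by exists f, g.
move=> _ [{}f [{}g [{}sf {}sg ->]]]; split.
  by move=> x; apply: derivableD; exact: smooth1_der.
exists (derive1 f), (derive1 g); split; try exact: smooth1_d.
by apply/funext => x; rewrite !derive1E; apply: deriveD; exact: smooth1_der.
Qed.

Lemma smooth1_id : smooth1 id.
Proof.
move=> [|n] x; first exact: derivable_id.
rewrite /derive1n iterSr.
have -> : derive1 (@id R) = cst 1 by apply/funext => y; rewrite derive1E derive_id.
exact: smooth1_cst.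
Qed.

(** The derivative of a product is a sum of products: products alone are not stable under the
    derivative, their finite sums are. *)
Inductive prodcl1 : (R -> R) -> Prop :=
| prodcl1_mul f g : smooth1 f -> smooth1 g -> prodcl1 (fun x => f x * g x)
| prodcl1_add f g : prodcl1 f -> prodcl1 g -> prodcl1 (fun x => f x + g x).

Lemma smooth1M f g : smooth1 f -> smooth1 g -> smooth1 (fun x => f x * g x).
Proof.
move=> sf sg; apply: (@smooth1_ind prodcl1); last exact: prodcl1_mul.
move=> h; elim=> {f g sf sg} [f g sf sg|f g _ [df1 df2] _ [dg1 dg2]].
  split; first by move=> x; apply: derivableM; exact: smooth1_der.
  have -> : derive1 (fun x => f x * g x) = (fun x => f x * derive1 g x + g x * derive1 f x).
    by apply/funext => x; rewrite !derive1E; apply: deriveM; exact: smooth1_der.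
  exact: prodcl1_add (prodcl1_mul sf (smooth1_d sg)) (prodcl1_mul sg (smooth1_d sf)).
split; first by move=> x; exact: derivableD.
have -> : derive1 (fun x => f x + g x) = (fun x => derive1 f x + derive1 g x).
  by apply/funext => x; rewrite !derive1E; apply: deriveD.
exact: prodcl1_add.
Qed.

Lemma smooth1Z c f : smooth1 f -> smooth1 (fun x => c * f x).
Proof. by move=> sf; exact (@smooth1M (fun=> c) f (@smooth1_cst c) sf). Qed.

Lemma smooth1X f n : smooth1 f -> smooth1 (fun x => f x ^+ n).
Proof.
move=> sf; elim: n => [|n IH]; first by under eq_fun do rewrite expr0; exact: smooth1_cst.
by under eq_fun do rewrite exprS; exact: smooth1M.
Qed.

Lemma derivable_comp_aff f (a b x : R) : derivable f (a * x + b) 1 ->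
  derivable (fun y => f (a * y + b)) x 1.
Proof.
move=> /derivable1_diffP df; apply/derivable1_diffP.
apply: (@differentiable_comp _ _ _ _ (fun y : R => a * y + b) f) => //.

Qed.

Lemma derive1_comp_aff f (a b x : R) : derivable f (a * x + b) 1 ->
  derive1 (fun y => f (a * y + b)) x = a * derive1 f (a * x + b).
Proof.
move=> df.
have dm : is_derive x (1 : R) (fun y : R => a * y) a.
  by have := is_deriveZ a (is_derive_id x (1 : R)); rewrite /GRing.scale /= mulr1.
have da : is_derive x (1 : R) (fun y : R => a * y + b) a.
  by have := is_deriveD dm (is_derive_cst b x (1 : R)); rewrite addr0.
have := @derive1_comp R (fun y : R => a * y + b) f x (@ex_derive _ _ _ _ _ _ _ da) df; rewrite /comp => ->.
rewrite mulrC; congr (_ * _).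
by rewrite derive1E; exact: derive_val.
Qed.

Lemma smooth1_aff f a b : smooth1 f -> smooth1 (fun x => f (a * x + b)).
Proof.
move=> sf.
apply: (@smooth1_ind [set h | exists c f, smooth1 f /\ h = (fun x => c * f (a * x + b))]); last first.
  by exists 1, f; split => //; apply/funext => x; rewrite mul1r.
move=> _ [c [{}f [{}sf ->]]]; split.
  by move=> x; apply: derivableM => //; apply: derivable_comp_aff; exact: smooth1_der.
exists (c * a), (derive1 f); split; first exact: smooth1_d.
apply/funext => x; rewrite derive1E deriveM//; last exact/derivable_comp_aff/smooth1_der.
rewrite derive_cst scaler0 addr0 -derive1E derive1_comp_aff; last exact: smooth1_der.
by rewrite /GRing.scale /= mulrA.
Qed.

(** [eker 0] is the classical flat function exp (- 1 / x), extended by 0; the other indices are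
    there because its derivatives are linear combinations of them. *)
Definition eker (n : nat) (x : R) : R := if 0 < x then x^-1 ^+ n * expR (- x^-1) else 0.

(** The inequality [1 + y / n <= expR (y / n)], raised to the power [n]. *)
Lemma pow_le_expR (n : nat) (y : R) : 0 <= y -> y ^+ n <= n%:R ^+ n * expR y.
Proof.
case: n => [|n] y0; first by rewrite !expr0 mul1r; apply: le_trans (expR_ge1Dx y); rewrite lerDl.
have n0 : 0 < n.+1%:R :> R by rewrite ltr0Sn.
have -> : expR y = expR (y / n.+1%:R) ^+ n.+1.
  by rewrite -expRM_natl -mulr_natl mulrCA mulfV ?gt_eqF// mulr1.
rewrite -exprMn lerXn2r ?nnegrE ?mulr_ge0 ?expR_ge0 ?(ltW n0)//.
rewrite -ler_pdivrMl//; apply: le_trans (expR_ge1Dx _).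
by rewrite mulrC lerDr.
Qed.

(** Vanishing to second order gives derivative 0 at the origin, the only point where the two
    formulas meet. *)
Lemma eker_le n : exists2 C : R, 0 <= C & forall x, `|eker n x| <= C * x ^+ 2.
Proof.
exists (n.+2%:R ^+ n.+2); first by rewrite exprn_ge0.
move=> x; rewrite /eker; case: ifPn => [x0|_]; last by rewrite normr0; exact: mulr_ge0 (exprn_ge0 _ (ler0n _ _)) (sqr_ge0 _).
have xi0 : 0 < x^-1 by rewrite invr_gt0.
rewrite ger0_norm; last by apply: mulr_ge0; rewrite ?expR_ge0// exprn_ge0// (ltW xi0).
have := pow_le_expR n.+2 (ltW xi0).
rewrite expRN => H.
rewrite ler_pdivrMr ?expR_gt0//.
have -> : x^-1 ^+ n = x^-1 ^+ n.+2 * x ^+ 2.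
  by rewrite -addn2 exprD -mulrA -exprMn mulVf ?gt_eqF// expr1n mulr1.
by rewrite [leRHS]mulrAC ler_wpM2r ?sqr_ge0.
Qed.

Lemma is_derive_quad0 f C : 0 <= C -> (forall x, `|f x| <= C * x ^+ 2) ->
  is_derive (0 : R) (1 : R) f 0.
Proof.
move=> C0 fC; have f00 : f 0 = 0.
  by apply/eqP; rewrite -normr_le0; have := fC 0; rewrite expr0n /= mulr0.
have H : h^-1 *: (f (h *: 1 + 0) - f 0) @[h --> 0^'] --> (0 : R).
  apply/cvgrPdist_le => /= e e0.
  near=> h.
  have h0 : h != 0 by near: h; exact: nbhs_dnbhs_neq.
  rewrite sub0r normrN f00 subr0 addr0 [h *: 1]mulr1 /GRing.scale /= normrM normfV.
  rewrite ler_pdivrMl ?normr_gt0//; apply: (le_trans (fC h)).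
  rewrite -[h ^+ 2]real_normK ?num_real// expr2 mulrCA ler_wpM2l//.
  have hd : `|h| <= e / (C + 1).
    near: h; apply: nbhs_dnbhs.
    have : \forall h \near (0 : R), `|0 - h| < e / (C + 1).
      by apply: (@nbhsx_ballx _ _ (0 : R)); rewrite divr_gt0// ltr_pwDr.
    by apply: filterS => h; rewrite sub0r normrN => /ltW.
  apply: (@le_trans _ _ (C * (e / (C + 1)))); first by rewrite ler_wpM2l.
  rewrite mulrA ler_pdivrMr ?ltr_pwDr// mulrC ler_wpM2l ?(ltW e0)// lerDl//.
apply: DeriveDef; first by apply/cvg_ex; exists 0.
exact: cvg_lim H.
Unshelve. all: by end_near. Qed.

Lemma is_derive_eker n (x : R) :
  is_derive x (1 : R) (eker n) (eker n.+2 x - n%:R * eker n.+1 x).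
Proof.
have [x0|x0|->] := ltgtP x 0.
- have e0 m : eker m x = 0 by rewrite /eker ltNge (ltW x0).
  rewrite !e0 mulr0 subr0.
  apply: (near_eq_is_derive (f := cst 0)).
  have : nbhs x [set y | y < 0] by apply: open_nbhs_nbhs; split=> //; exact: open_lt.
  by apply: filterS => y y0; rewrite /eker ltNge (ltW y0).
- have nE : \forall y \near x, (fun y : R => y^-1 ^+ n * expR (- y^-1)) y = eker n y.
    have : nbhs x [set y | 0 < y] by apply: open_nbhs_nbhs; split=> //; exact: open_gt.
    by apply: filterS => y y0; rewrite /eker y0.
  suff : is_derive x (1 : R) (fun y : R => y^-1 ^+ n * expR (- y^-1)) (eker n.+2 x - n%:R * eker n.+1 x).
    exact: near_eq_is_derive nE.
  have xn : x != 0 by rewrite gt_eqF.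
  have di : is_derive x (1 : R) (fun y : R => y^-1) (- x^-1 ^+ 2).
    apply: DeriveDef; first exact: derivableV.
    by rewrite deriveV// derive_id /GRing.scale /= mulr1 exprVn.
  have de : is_derive x (1 : R) (fun y : R => expR (- y^-1)) (x^-1 ^+ 2 * expR (- x^-1)).
    have dn : is_derive x (1 : R) (fun y : R => - y^-1) (x^-1 ^+ 2) by rewrite -[X in is_derive _ _ _ X]opprK; apply: is_deriveN.
    apply: DeriveDef.
      apply/derivable1_diffP; apply: (@differentiable_comp _ _ _ _ (fun y : R => - y^-1) expR).
        by apply/derivable1_diffP; case: dn.
      by apply/derivable1_diffP; exact: derivable_expR.
    have d1 : derivable (fun y : R => - y^-1) x 1 by case: dn.
    have := @derive1_comp R (fun y : R => - y^-1) expR x d1 (@derivable_expR R _); rewrite /comp -derive1E => ->.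
    have De : derive1 (@expR R) (- x^-1) = expR (- x^-1) by rewrite derive1E; exact: derive_val.
    by rewrite mulrC De derive1E; congr (_ * _); case: dn.
  have dx := is_deriveX n di.
  have E : (fun y : R => y^-1 ^+ n * expR (- y^-1)) = (([eta GRing.inv] : R -> R) ^+ n * (fun y : R => expR (- y^-1)))%R.
    by apply/funext => y; rewrite !fctE.
  have H := is_deriveM dx de; rewrite -E in H; case: H => H1 H2.
  apply: DeriveDef => //; rewrite H2 !fctE.
  rewrite /eker x0 /GRing.scale /=.
  case: n {dx E H1 H2 nE} => [|n]; first by rewrite !expr0 !mul0r !mulr0 !mul1r addr0 subr0.
  rewrite !exprS /=; ring.
- have [C C0 HC] := eker_le n.
  have -> : eker n.+2 0 - n%:R * eker n.+1 0 = 0 by rewrite /eker ltxx mulr0 subr0.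
  exact: is_derive_quad0 HC.
Qed.

(** By [is_derive_eker], these linear combinations form a class stable under the derivative. *)
Inductive ekcl : (R -> R) -> Prop :=
| ekcl_base c n : ekcl (fun x => c * eker n x)
| ekcl_add f g : ekcl f -> ekcl g -> ekcl (fun x => f x + g x).

Lemma smooth1_eker n : smooth1 (eker n).
Proof.
apply: (@smooth1_ind ekcl); last first.
  by have := ekcl_base 1 n; congr ekcl; apply/funext => x; rewrite mul1r.
move=> f; elim=> [c {}n|{}f g _ [df1 df2] _ [dg1 dg2]].
  have D x := is_derive_eker n x.
  split; first by move=> x; have /(@ex_derive _ _ _ _ _ _ _) := is_deriveZ c (D x).
  have -> : derive1 (fun x => c * eker n x) = (fun x => c * eker n.+2 x + (- (c * n%:R)) * eker n.+1 x).
    apply/funext => x; rewrite derive1E.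
    have := is_deriveZ c (D x) => /(@derive_val _ _ _ _ _ _ _) ->.
    by rewrite /GRing.scale /=; ring.
  by apply: ekcl_add; exact: ekcl_base.
split; first by move=> x; exact: derivableD.
have -> : derive1 (fun x => f x + g x) = (fun x => derive1 f x + derive1 g x).
  by apply/funext => x; rewrite !derive1E; apply: deriveD.
exact: ekcl_add.
Qed.

(** Positive exactly on the open interval (1/4, 3/4). The margin up to 0 and 1 is what later keeps
    the test functions away from the corners of a triangle. *)
Definition bump0 (x : R) : R := eker 0 (1 * x + (- 4^-1)) * eker 0 ((-1) * x + 3 / 4).

Lemma smooth1_bump0 : smooth1 bump0.
Proof. by apply: smooth1M; apply: smooth1_aff; exact: smooth1_eker. Qed.

Lemma eker_ge0 n x : 0 <= eker n x.
Proof.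
rewrite /eker; case: ifPn => // x0.
by rewrite mulr_ge0 ?expR_ge0// exprn_ge0// invr_ge0 ltW.
Qed.

Lemma bump0_ge0 x : 0 <= bump0 x.
Proof. by rewrite mulr_ge0 ?eker_ge0. Qed.

Lemma bump0_gt0 x : 4^-1 < x < 3 / 4 -> 0 < bump0 x.
Proof.
move=> /andP[x1 x2]; rewrite /bump0 /eker !ifT; [|lra|lra].
by rewrite !expr0 !mul1r mulr_gt0 ?expR_gt0.
Qed.

Lemma bump0_out x : ~ (4^-1 < x < 3 / 4) -> bump0 x = 0.
Proof.
move=> H; rewrite /bump0 /eker.
case: ifPn => [a|_]; last by rewrite mul0r.
case: ifPn => [b|_]; last by rewrite mulr0.
by exfalso; apply: H; apply/andP; split; lra.
Qed.

End Smooth1.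

(** * Smooth functions of two variables and polynomials *)

Section Smooth2.
Variable R : realType.
Implicit Types (f g : R * R -> R) (A B : R -> R).

(** Same principle as [smooth1_ind]. Continuity is asked at every stage because derivatives along
    the two axes do not imply it. *)
Lemma smooth_ind (S : set (R * R -> R)) :
  (forall f, S f -> [/\ continuous f, forall i x, derivable f x (ei R i) & forall i, S (pd i f)]) ->
  forall f, S f -> smooth f.
Proof.
move=> H f Sf s.
suff Ss : S (foldr (@pd R) f s) by have [? ? _] := H _ Ss.
by elim: s => [//|i s IH] /=; have [_ _] := H _ IH; apply.
Qed.

Lemma smooth_cont f : smooth f -> continuous f.
Proof. by move=> /(_ [::])[]. Qed.
Lemma smooth_der f i x : smooth f -> derivable f x (ei R i).
Proof. by move=> /(_ [::])[_]; apply. Qed.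
Lemma smooth_pd i f : smooth f -> smooth (pd i f).
Proof. by move=> sf s; have := sf (rcons s i); rewrite foldr_rcons. Qed.
Lemma smooth_mble f : smooth f -> mble f.
Proof. by move=> /smooth_cont; exact: continuous_measurable_plane. Qed.

Lemma pd_cst (c : R) i : pd i (fun=> c) = fun=> 0.
Proof. by apply/funext => x; exact: derive_cst. Qed.

Lemma smooth_cst (c : R) : smooth (fun=> c).
Proof.
apply: (@smooth_ind [set f | exists c, f = (fun=> c)]); last by exists c.
move=> _ [d ->]; split; [by move=> x; exact: cvg_cst|by move=> i x; exact: derivable_cst|].
by move=> i; exists 0; rewrite pd_cst.
Qed.

Lemma pdD f g i : smooth f -> smooth g ->
  pd i (fun x => f x + g x) = fun x => pd i f x + pd i g x.
Proof.
by move=> sf sg; apply/funext => x; apply: deriveD; apply: smooth_der.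
Qed.

Lemma smoothD f g : smooth f -> smooth g -> smooth (fun x => f x + g x).
Proof.
move=> sf sg.
apply: (@smooth_ind [set h | exists f g, [/\ smooth f, smooth g & h = (fun x => f x + g x)]]); last by exists f, g.
move=> _ [{}f [{}g [{}sf {}sg ->]]]; split.
- by move=> x; apply: cvgD; exact: smooth_cont.
- by move=> i x; apply: derivableD; exact: smooth_der.
- by move=> i; exists (pd i f), (pd i g); split; [exact: smooth_pd|exact: smooth_pd|rewrite pdD].
Qed.

Lemma pdM f g i : smooth f -> smooth g ->
  pd i (fun x => f x * g x) = fun x => f x * pd i g x + g x * pd i f x.
Proof.
by move=> sf sg; apply/funext => x; apply: deriveM; apply: smooth_der.
Qed.

Inductive prodcl2 : (R * R -> R) -> Prop :=
| prodcl2_mul f g : smooth f -> smooth g -> prodcl2 (fun x => f x * g x)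
| prodcl2_add f g : prodcl2 f -> prodcl2 g -> prodcl2 (fun x => f x + g x).

Lemma smoothM f g : smooth f -> smooth g -> smooth (fun x => f x * g x).
Proof.
move=> sf sg; apply: (@smooth_ind prodcl2); last exact: prodcl2_mul.
move=> h; elim=> {f g sf sg} [f g sf sg|f g _ [cf df pf] _ [cg dg pg]].
  split.
  - by move=> x; apply: cvgM; exact: smooth_cont.
  - by move=> i x; apply: derivableM; exact: smooth_der.
  - move=> i; rewrite pdM//.
    exact (prodcl2_add (prodcl2_mul sf (@smooth_pd i _ sg)) (prodcl2_mul sg (@smooth_pd i _ sf))).
split.
- by move=> x; apply: cvgD; [exact: cf|exact: cg].
- by move=> i x; exact: derivableD.
- move=> i; have -> : pd i (fun x => f x + g x) = (fun x => pd i f x + pd i g x).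
    by apply/funext => x; exact: deriveD.
  exact: prodcl2_add.
Qed.

Lemma smoothZ c f : smooth f -> smooth (fun x => c * f x).
Proof. by move=> sf; exact (@smoothM (fun=> c) f (@smooth_cst c) sf). Qed.

Lemma pdZ c f i : smooth f -> pd i (fun x => c * f x) = fun x => c * pd i f x.
Proof.
move=> sf; rewrite (@pdM (fun=> c) f i (@smooth_cst c) sf); apply/funext => x.
by rewrite pd_cst mulr0 addr0.
Qed.

Definition lin (v : R * R) (r : R) (x : R * R) : R := dot x v + r.
Definition co (i : 'I_2) (v : R * R) : R := if i == ord0 then v.1 else v.2.

Lemma lin_cont v r : continuous (lin v r).
Proof.
by move=> x; rewrite /lin /dot; apply: cvgD; [apply: cvgD; apply: cvgMl; [exact: cvg_fst|exact: cvg_snd]|exact: cvg_cst].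
Qed.

Lemma lin_ei v r i (h : R) x : lin v r (h *: ei R i + x) = h * co i v + lin v r x.
Proof.
rewrite /lin /dot /ei /co; case: (i == ord0) => /=.
  rewrite /GRing.scale /=; ring.
rewrite /GRing.scale /=; ring.
Qed.

Lemma is_derive_complin A v r i x : smooth1 A ->
  is_derive x (ei R i) (fun y => A (lin v r y)) (co i v * derive1 A (lin v r x)).
Proof.
move=> sA; have dA : differentiable A (lin v r x) by apply/derivable1_diffP/smooth1_der.
have Dd : 'D_(co i v) A (lin v r x) = co i v * derive1 A (lin v r x).
  by rewrite deriveE// diff1E.
have dd := @diff_derivable _ _ _ A (lin v r x) (co i v) dA.
(* Along the axis [i] the affine function [lin v r] moves at constant speed [co i v], so the
   difference quotients are those of [A] itself. *)
have E : (fun h : R => h^-1 *: (((fun y => A (lin v r y)) \o shift x) (h *: ei R i) - A (lin v r x))) =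
  (fun h : R => h^-1 *: ((A \o shift (lin v r x)) (h *: co i v) - A (lin v r x))).
  by apply/funext => h /=; rewrite lin_ei.
apply: DeriveDef; first by rewrite /derivable E.
by rewrite /derive E -Dd.
Qed.

Lemma pd_complin A v r i : smooth1 A ->
  pd i (fun y => A (lin v r y)) = fun x => co i v * derive1 A (lin v r x).
Proof. by move=> sA; apply/funext => x; have [_] := is_derive_complin v r i x sA. Qed.

Lemma smooth_complin A v r : smooth1 A -> smooth (fun y => A (lin v r y)).
Proof.
move=> sA.
apply: (@smooth_ind [set h | exists c A, smooth1 A /\ h = (fun x => c * A (lin v r x))]); last first.
  by exists 1, A; split => //; apply/funext => x; rewrite mul1r.
move=> _ [c [{}A [{}sA ->]]].
have D i x := is_deriveZ c (is_derive_complin v r i x sA).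
split.
- move=> x; apply: cvgMr; apply: (@continuous_comp _ _ _ (lin v r) A); [exact: lin_cont|exact: smooth1_cont].
- by move=> i x; case: (D i x).
- move=> i; exists (c * co i v), (derive1 A); split; first exact: smooth1_d.
  apply/funext => x; transitivity (c *: (co i v * derive1 A (lin v r x))); first by case: (D i x).
  by rewrite /GRing.scale /= mulrA.
Qed.

Lemma smooth_lin v r : smooth (lin v r).
Proof. exact: smooth_complin (@smooth1_id R). Qed.

Lemma smooth_fst : smooth (fun x : R * R => x.1).
Proof.
have := @smooth_lin (1, 0) 0; congr smooth; apply/funext => x.
by rewrite /lin /dot /= mulr1 mulr0 !addr0.
Qed.
Lemma smooth_snd : smooth (fun x : R * R => x.2).
Proof.
have := @smooth_lin (0, 1) 0; congr smooth; apply/funext => x.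
by rewrite /lin /dot /= mulr1 mulr0 !(addr0, add0r).
Qed.

Lemma pd_lin v r i : pd i (lin v r) = fun=> co i v.
Proof.
rewrite (@pd_complin id v r i (@smooth1_id R)); apply/funext => x.
by rewrite derive1E derive_id mulr1.
Qed.

(** A product of two ridge functions. The mollifying bumps and the test functions of the estimates
    have this form, and so have the terms of their derivatives. *)
Definition pb A B v r w s (x : R * R) : R := A (lin v r x) * B (lin w s x).

Lemma smooth_pb A B v r w s : smooth1 A -> smooth1 B -> smooth (pb A B v r w s).
Proof. by move=> sA sB; apply: smoothM; apply: smooth_complin. Qed.

Lemma pd_pb A B v r w s i : smooth1 A -> smooth1 B ->
  pd i (pb A B v r w s) =
  fun x => co i v * pb (derive1 A) B v r w s x + co i w * pb A (derive1 B) v r w s x.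
Proof.
move=> sA sB; rewrite pdM; [|exact: smooth_complin|exact: smooth_complin].
rewrite !pd_complin//; apply/funext => x; rewrite /pb; ring.
Qed.

(** The symmetry of second derivatives makes the rotated gradient of a test function divergence
    free; for this family it is a computation. *)
Lemma pd_pb_comm A B v r w s i j : smooth1 A -> smooth1 B ->
  pd i (pd j (pb A B v r w s)) = pd j (pd i (pb A B v r w s)).
Proof.
move=> sA sB; have sA' := smooth1_d sA; have sB' := smooth1_d sB.
have S C D : smooth1 C -> smooth1 D -> smooth (pb C D v r w s) by exact: smooth_pb.
rewrite !(@pd_pb A B)//.
rewrite !pdD; try (apply: smoothZ; apply: S => //).
rewrite !pdZ; try (apply: S => //).
rewrite !pd_pb//; last first.
apply/funext => x; ring.
Qed.

(** A recursive form of the polynomials of total degree at most [n], chosen so that stability under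
    sums, affine substitutions and derivatives is an induction on [n]. *)
Fixpoint pol (n : nat) f : Prop :=
  if n is m.+1 then exists c g h, [/\ pol m g, pol m h & f = fun x => c + (x.1 * g x + x.2 * h x)]
  else exists c, f = fun=> c.

Lemma pol_cst n (c : R) : pol n (fun=> c).
Proof.
elim: n c => [|n IH] c /=; first by exists c.
by exists c, (fun=> 0), (fun=> 0); split => //; apply/funext => x; rewrite !mulr0 !addr0.
Qed.

Lemma pol_smooth n f : pol n f -> smooth f.
Proof.
elim: n f => [|n IH] f /=; first by move=> [c ->]; exact: smooth_cst.
move=> [c [g [h [/IH sg /IH sh ->]]]].
apply: smoothD; first exact: smooth_cst.
exact: (smoothD (smoothM smooth_fst sg) (smoothM smooth_snd sh)).
Qed.

Lemma polS n f : pol n f -> pol n.+1 f.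
Proof.
elim: n f => [|n IH] f; first by move=> [c ->]; exact: pol_cst.
by move=> [c [g [h [/IH pg /IH ph ->]]]]; exists c, g, h.
Qed.

Lemma pol_le m n f : (m <= n)%N -> pol m f -> pol n f.
Proof.
move=> /subnKC <-; elim: (n - m)%N => [|k IH]; first by rewrite addn0.
by move=> /IH /polS; rewrite addnS.
Qed.

Lemma polD n f g : pol n f -> pol n g -> pol n (fun x => f x + g x).
Proof.
elim: n f g => [|n IH] f g.
  by move=> [c ->] [d ->]; exists (c + d).
move=> [c [g1 [h1 [pg1 ph1 ->]]]] [d [g2 [h2 [pg2 ph2 ->]]]].
exists (c + d), (fun x => g1 x + g2 x), (fun x => h1 x + h2 x); split; [exact: IH|exact: IH|].
by apply/funext => x; ring.
Qed.

Lemma polZ n k f : pol n f -> pol n (fun x => k * f x).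
Proof.
elim: n f => [|n IH] f; first by move=> [c ->]; exists (k * c).
move=> [c [g [h [pg ph ->]]]].
exists (k * c), (fun x => k * g x), (fun x => k * h x); split; [exact: IH|exact: IH|].
by apply/funext => x; ring.
Qed.

Lemma polB n f g : pol n f -> pol n g -> pol n (fun x => f x - g x).
Proof.
move=> pf pg; have := polD pf (@polZ _ (-1) _ pg).
by congr pol; apply/funext => x; rewrite mulN1r.
Qed.

Lemma pol_mulx n f : pol n f -> pol n.+1 (fun x => x.1 * f x).
Proof.
move=> pf; exists 0, f, (fun=> 0); split => //; first exact: pol_cst.
by apply/funext => x; ring.
Qed.
Lemma pol_muly n f : pol n f -> pol n.+1 (fun x => x.2 * f x).
Proof.
move=> pf; exists 0, (fun=> 0), f; split => //; first exact: pol_cst.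
by apply/funext => x; ring.
Qed.

Lemma pol_mullin n f a b c : pol n f -> pol n.+1 (fun x => (c + a * x.1 + b * x.2) * f x).
Proof.
move=> pf.
have := polD (polD (polS (@polZ _ c _ pf)) (@polZ _ a _ (pol_mulx pf))) (@polZ _ b _ (pol_muly pf)).
by congr pol; apply/funext => x; ring.
Qed.

Lemma pol_aff n f c v w : pol n f -> pol n (fun x => f (aff c v w x)).
Proof.
elim: n f => [|n IH] f; first by move=> [d ->]; exists d.
move=> [d [g [h [/IH pg /IH ph ->]]]].
have := polD (pol_cst n.+1 d) (polD (@pol_mullin _ _ v.1 w.1 c.1 pg) (@pol_mullin _ _ v.2 w.2 c.2 ph)).
by congr pol; apply/funext => x; rewrite /aff /=; ring.
Qed.

Lemma pol_pd n f i : pol n f -> pol n (pd i f).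
Proof.
elim: n f => [|n IH] f; first by move=> [d ->]; rewrite pd_cst; exists 0.
move=> [d [g [h [pg ph ->]]]].
have sg := pol_smooth pg; have sh := pol_smooth ph.
have s1 := @smoothM _ _ smooth_fst sg; have s2 := @smoothM _ _ smooth_snd sh.
rewrite (@pdD (fun=> d) _ i (@smooth_cst d) (smoothD s1 s2)).
rewrite (@pdD (fun x => x.1 * g x) (fun x => x.2 * h x) i s1 s2).
rewrite (@pdM (fun x => x.1) g i smooth_fst sg) (@pdM (fun x => x.2) h i smooth_snd sh).
have E1 : pd i (fun x : R * R => x.1) = fun=> co i (1, 0).
  rewrite -(pd_lin (1, 0) 0); congr (pd i _); apply/funext => x.
  by rewrite /lin /dot /= mulr1 mulr0 !addr0.
have E2 : pd i (fun x : R * R => x.2) = fun=> co i (0, 1).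
  rewrite -(pd_lin (0, 1) 0); congr (pd i _); apply/funext => x.
  by rewrite /lin /dot /= mulr1 mulr0 !(add0r, addr0).
rewrite E1 E2 pd_cst.
have := polD (polD (pol_mulx (IH _ pg)) (polS (@polZ _ (co i (1, 0)) _ pg)))
  (polD (pol_muly (IH _ ph)) (polS (@polZ _ (co i (0, 1)) _ ph))).
by congr pol; apply/funext => x; ring.
Qed.

Lemma poly_on_pol d K f : poly_on d K f -> exists2 g, pol d g & forall x, K x -> f x = g x.
Proof.
move=> [P [P0 fP]]; exists (fun x => P.[x.2%:P].[x.1]) => //.
have mono i j n : (i + j <= n)%N -> pol n (fun x : R * R => x.1 ^+ i * x.2 ^+ j).
  move=> ijn; apply: pol_le ijn _; elim: i => [|i IH].
    elim: j => [|j IH]; first by exists 1; apply/funext => x; rewrite !expr0 mulr1.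
    by rewrite add0n in IH *; have := pol_muly IH; congr pol; apply/funext => x; rewrite exprS; ring.
  by rewrite addSn; have := pol_mulx IH; congr pol; apply/funext => x; rewrite exprS; ring.
have sumcl m (F : 'I_m -> R * R -> R) : (forall k, pol d (F k)) -> pol d (fun x => \sum_(k < m) F k x).
  elim: m F => [|m IH] F pF; first by under eq_fun do rewrite big_ord0; exact: pol_cst.
  by under eq_fun do rewrite big_ord_recl; apply: polD => //; exact: IH.
have E x : P.[x.2%:P].[x.1] = \sum_(j < size P) \sum_(i < size P`_j) (P`_j`_i * (x.1 ^+ i * x.2 ^+ j)).
  rewrite (horner_coef P) horner_sum; apply: eq_bigr => j _.
  rewrite hornerM -polyC_exp hornerC horner_coef mulr_suml; apply: eq_bigr => i _.
  by rewrite mulrA.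
under eq_fun do rewrite E.
apply: (sumcl _ (fun j x => \sum_(i < size P`_j) (P`_j`_i * (x.1 ^+ i * x.2 ^+ j)))) => j.
apply: (sumcl _ (fun i x => P`_j`_i * (x.1 ^+ i * x.2 ^+ j))) => i.
have [ij|ij] := leqP (i + j)%N d; first by apply: polZ; exact: mono.
by rewrite P0//; under eq_fun do rewrite mul0r; exact: pol_cst.
Qed.

(** The index set is a full square instead of the triangle [i + j <= n], to match the tensor
    products of dual functions that extract the coefficients. *)
Lemma pol_mono n f : pol n f -> exists c : nat -> nat -> R,
  forall x, f x = \sum_(i < n.+1) \sum_(j < n.+1) c i j * x.1 ^+ i * x.2 ^+ j.
Proof.
elim: n f => [|n IH] f.
  move=> [c ->]; exists (fun _ _ => c) => x.
  by rewrite !big_ord1 !expr0 !mulr1.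
move=> [d [g [h [/IH [cg Eg] /IH [ch Eh] ->]]]].
(* The constant, the coefficients [cg] shifted in the first exponent, and [ch] shifted in the
   second. *)
exists (fun i j => (if (i == 0%N) && (j == 0%N) then d else 0)
   + (if i is i'.+1 then if (j < n.+1)%N then cg i' j else 0 else 0)
   + (if j is j'.+1 then if (i < n.+1)%N then ch i j' else 0 else 0)) => x.
rewrite Eg Eh.
transitivity (\sum_(i < n.+2) \sum_(j < n.+2) ((if (i == 0%N :> nat) && (j == 0%N :> nat) then d else 0) * x.1 ^+ i * x.2 ^+ j)
 + (\sum_(i < n.+2) \sum_(j < n.+2) ((if i : nat is i'.+1 then if (j < n.+1)%N then cg i' j else 0 else 0) * x.1 ^+ i * x.2 ^+ j)
 + \sum_(i < n.+2) \sum_(j < n.+2) ((if j : nat is j'.+1 then if (i < n.+1)%N then ch i j' else 0 else 0) * x.1 ^+ i * x.2 ^+ j))); last first.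
  rewrite -!big_split; apply: eq_bigr => i _ /=; rewrite -!big_split; apply: eq_bigr => j _ /=.
  by rewrite -!mulrDl addrA.
congr (_ + (_ + _)).
- rewrite big_ord_recl /= big_ord_recl /= !expr0 !mulr1.
  by rewrite !big1 ?addr0// => i _; rewrite ?mul0r// big1// => j _; rewrite !mul0r.
- rewrite [in RHS]big_ord_recl /= [X in _ = X + _]big1 ?add0r; last by move=> j _; rewrite !mul0r.
  rewrite mulr_sumr; apply: eq_bigr => i _; rewrite mulr_sumr [in RHS]big_ord_recr /= ltnn !mul0r addr0.
  apply: eq_bigr => j _; rewrite ltn_ord /bump /= add1n exprS; ring.
- rewrite [in RHS]big_ord_recr /= [X in _ = _ + X]big1 ?addr0; last first.
    by move=> [[|j] jn] _ /=; rewrite ?ltnn !mul0r.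
  rewrite mulr_sumr; apply: eq_bigr => i _; rewrite mulr_sumr [in RHS]big_ord_recl /= !mul0r add0r.
  apply: eq_bigr => j _; rewrite ltn_ord /bump /= add1n exprS; ring.
Qed.

End Smooth2.

(** * The fundamental theorem of calculus on parallelograms and integration by parts *)

Section Rectangles.
Variable R : realType.
Local Notation mu := (@area R).
Local Notation leb := (@lebesgue_measure R).
Implicit Types (f g F : R * R -> R).

Lemma MVT_abs (f df : R -> R) : (forall x : R, is_derive x (1 : R) f (df x)) ->
  forall a b, exists c, `|c - a| <= `|b - a| /\ f b - f a = df c * (b - a).
Proof.
move=> Df a b.
have cf : continuous f.
  by move=> x; apply: differentiable_continuous; apply/derivable1_diffP; case: (Df x).
have H a' b' : a' <= b' -> exists2 c, a' <= c <= b' & f b' - f a' = df c * (b' - a').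
  move=> ab; have [|c cab E] := @MVT_segment R f df a' b' ab (fun x _ => Df x).
    exact: continuous_subspaceT.
  by exists c => //; rewrite in_itv in cab.
have [ab|/ltW ba] := leP a b.
  have [c /andP[c1 c2] E] := H _ _ ab; exists c; split => //.
  by rewrite !ger0_norm ?subr_ge0// lerD2r.
have [c /andP[c1 c2] E] := H _ _ ba; exists c; split.
  by rewrite !ler0_norm ?subr_le0// lerN2 lerD2r.
by rewrite -opprB E; ring.
Qed.

Lemma is_derive_comp_aff (f : R -> R) (a b x l : R) : is_derive (a * x + b) (1 : R) f l ->
  is_derive x (1 : R) (fun y : R => f (a * y + b)) (a * l).
Proof.
move=> [d e]; apply: DeriveDef; first exact: derivable_comp_aff.
by rewrite -derive1E derive1_comp_aff// derive1E e.
Qed.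

Lemma is_derive_coord1 f (y x : R) : smooth f ->
  is_derive x (1 : R) (fun t : R => f (t, y)) (pd ord0 f (x, y)).
Proof.
move=> sf; have /= d := @smooth_der _ f ord0 (x, y) sf.
have E : (fun h : R => h^-1 *: ((f \o shift (x, y)) (h *: ei R ord0) - f (x, y))) =
  (fun h : R => h^-1 *: (((fun t : R => f (t, y)) \o shift x) (h *: (1 : R)) - f (x, y))).
  apply/funext => h /=; congr (_ *: (f _ - _)); rewrite /ei eqxx.
  by congr pair => /=; rewrite /GRing.scale /=; ring.
by apply: DeriveDef; [rewrite /derivable -E|rewrite /pd /derive E].
Qed.

Lemma is_derive_coord2 f (x y : R) : smooth f ->
  is_derive y (1 : R) (fun t : R => f (x, t)) (pd ord_max f (x, y)).
Proof.
move=> sf; have /= d := @smooth_der _ f ord_max (x, y) sf.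
have E : (fun h : R => h^-1 *: ((f \o shift (x, y)) (h *: ei R ord_max) - f (x, y))) =
  (fun h : R => h^-1 *: (((fun t : R => f (x, t)) \o shift y) (h *: (1 : R)) - f (x, y))).
  apply/funext => h /=; congr (_ *: (f _ - _)); rewrite /ei /=.
  by congr pair => /=; rewrite /GRing.scale /=; ring.
by apply: DeriveDef; [rewrite /derivable -E|rewrite /pd /derive E].
Qed.

Definition dirpd (v : R * R) f x := v.1 * pd ord0 f x + v.2 * pd ord_max f x.

(** [smooth] only speaks of derivatives along the axes. The increment along [v] is split into a
    vertical step, whose derivative is known, and a horizontal one, treated by the mean value
    theorem and the continuity of the first partial derivative. *)
Lemma is_derive_dir0 f (a v : R * R) : smooth f ->
  is_derive (0 : R) (1 : R) (fun t : R => f (a.1 + t * v.1, a.2 + t * v.2)) (dirpd v f a).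
Proof.
move=> sf.
have := is_derive_coord2 a.1 a.2 sf.
set L2 := pd ord_max f _ => D2.
have D2' : is_derive (0 : R) (1 : R) (fun t : R => f (a.1, a.2 + t * v.2)) (v.2 * L2).
  have d2 : is_derive (v.2 * 0 + a.2) (1 : R) (fun t : R => f (a.1, t)) L2 by rewrite mulr0 add0r.
  have E : (fun t : R => f (a.1, a.2 + t * v.2)) = (fun t : R => (fun y => f (a.1, y)) (v.2 * t + a.2)).
    by apply/funext => t; congr (f (_, _)); ring.
  rewrite E; exact: (is_derive_comp_aff d2).
set L1 := pd ord0 f a.
have -> : dirpd v f a = v.1 * L1 + v.2 * L2 by rewrite /dirpd /L2 /L1 -surjective_pairing.
suff D1 : is_derive (0 : R) (1 : R) (fun t : R => f (a.1 + t * v.1, a.2 + t * v.2) - f (a.1, a.2 + t * v.2)) (v.1 * L1).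
  have := is_deriveD D1 D2'.
  have -> : ((fun t : R => f (a.1 + t * v.1, a.2 + t * v.2) - f (a.1, a.2 + t * v.2)) + (fun t : R => f (a.1, a.2 + t * v.2)))%R =
    (fun t : R => f (a.1 + t * v.1, a.2 + t * v.2)) by apply/funext => t; rewrite !fctE subrK.
  by [].
have c1 := smooth_cont (@smooth_pd _ ord0 f sf).
suff H : h^-1 *: ((f (a.1 + h * v.1, a.2 + h * v.2) - f (a.1, a.2 + h * v.2))) @[h --> (0:R)^'] --> v.1 * L1.
  have E : (fun h : R => h^-1 *: (((fun t : R => f (a.1 + t * v.1, a.2 + t * v.2) - f (a.1, a.2 + t * v.2)) \o shift 0) (h *: (1 : R))
     - (f (a.1 + 0 * v.1, a.2 + 0 * v.2) - f (a.1, a.2 + 0 * v.2)))) =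
     (fun h : R => h^-1 *: ((f (a.1 + h * v.1, a.2 + h * v.2) - f (a.1, a.2 + h * v.2)))).
    apply/funext => h /=; rewrite [h *: (1 : R)]mulr1 addr0 !mul0r !addr0 subrr subr0 //.
  apply: DeriveDef; first by apply/cvg_ex; exists (v.1 * L1); rewrite E.
  by rewrite /derive E; exact: cvg_lim H.
apply/cvgrPdist_le => /= e e0.
have e'0 : 0 < e / (`|v.1| + 1) by rewrite divr_gt0// ltr_wpDl.
have /cvgrPdist_le/(_ _ e'0) := c1 a.
move=> /nbhs_ballP[d /= d0 Hd].
near=> h.
have h0 : h != 0 by near: h; exact: nbhs_dnbhs_neq.
have [c [c2 E]] := MVT_abs (fun x => is_derive_coord1 (a.2 + h * v.2) x sf) a.1 (a.1 + h * v.1).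
rewrite E /GRing.scale /=.
have -> : h^-1 * (pd ord0 f (c, a.2 + h * v.2) * (a.1 + h * v.1 - a.1)) = v.1 * pd ord0 f (c, a.2 + h * v.2) by field.
rewrite -mulrBr normrM.
have hv : `|h| * (`|v.1| + `|v.2| + 1) < d.
  rewrite -ltr_pdivlMr ?ltr_wpDl ?addr_ge0//.
  near: h; apply: nbhs_dnbhs.
  have : \forall h \near (0 : R), `|0 - h| < d / (`|v.1| + `|v.2| + 1).
    by apply: (@nbhsx_ballx _ _ (0 : R)); rewrite divr_gt0// ltr_wpDl ?addr_ge0.
  by apply: filterS => h; rewrite sub0r normrN.
have hv1 : `|h| * `|v.1| < d by apply: le_lt_trans hv; rewrite ler_wpM2l// -addrA lerDl addr_ge0.
have hv2 : `|h| * `|v.2| < d by apply: le_lt_trans hv; rewrite ler_wpM2l// -addrA addrCA lerDl addr_ge0.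
have B : `|L1 - pd ord0 f (c, a.2 + h * v.2)| <= e / (`|v.1| + 1).
  apply: Hd; split; rewrite /ball /=.
    by rewrite distrC (le_lt_trans c2)// addrAC subrr add0r normrM.
  by rewrite opprD addrA subrr sub0r normrN normrM.
apply: (le_trans (ler_wpM2l (normr_ge0 _) B)).
rewrite mulrCA -[leRHS]mulr1 ler_wpM2l ?(ltW e0)// ler_pdivrMr ?ltr_wpDl// mul1r lerDl//.
Unshelve. all: by end_near. Qed.

Lemma is_derive_dir f (a v : R * R) (t : R) : smooth f ->
  is_derive t (1 : R) (fun t : R => f (a.1 + t * v.1, a.2 + t * v.2))
    (dirpd v f (a.1 + t * v.1, a.2 + t * v.2)).
Proof.
move=> sf; have D := is_derive_dir0 (a.1 + t * v.1, a.2 + t * v.2) v sf.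
have E : (fun s : R => f (a.1 + s * v.1, a.2 + s * v.2)) =
  (fun s => (fun r : R => f ((a.1 + t * v.1, a.2 + t * v.2).1 + r * v.1, (a.1 + t * v.1, a.2 + t * v.2).2 + r * v.2)) (1 * s + - t)).
  by apply/funext => s /=; congr (f (_, _)); ring.
rewrite E.
have d0 : is_derive (1 * t + - t) (1 : R) (fun r : R => f ((a.1 + t * v.1, a.2 + t * v.2).1 + r * v.1, (a.1 + t * v.1, a.2 + t * v.2).2 + r * v.2)) (dirpd v f (a.1 + t * v.1, a.2 + t * v.2)).
  by rewrite mul1r subrr.
by have := is_derive_comp_aff d0; rewrite mul1r.
Qed.

Lemma ftc_seg (F f : R -> R) a b : a < b -> (forall x : R, is_derive x (1 : R) F (f x)) -> continuous f ->
  \int[leb]_t (\1_(`[a, b]%classic) t * f t) = F b - F a.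
Proof.
move=> ab DF cf.
have dF x : derivable F x 1 by case: (DF x).
have cF : continuous F.
  by move=> x; apply: differentiable_continuous; exact/derivable1_diffP.
have := @continuous_FTC2 R f F a b ab (continuous_subspaceT cf).
rewrite -EFinB => H; rewrite /Rintegral.
suff -> : (\int[leb]_t (\1_(`[a, b]%classic) t * f t)%:E = \int[leb]_(t in `[a, b]) (f t)%:E)%E.
  rewrite H//.
  - split; first by move=> x _.
    + exact/cvg_at_right_filter/cF.
    + exact/cvg_at_left_filter/cF.
  - by move=> x _; rewrite derive1E; case: (DF x).
rewrite [RHS]integral_mkcond; apply: eq_integral => x _.
by rewrite patchE indicE; case: (x \in _); rewrite ?mul1r ?mul0r.
Qed.

Lemma compact_sq c r : compact (@sq R c r).
Proof.
have -> : sq c r = `[c.1 - r, c.1 + r]%classic `*` `[c.2 - r, c.2 + r]%classic.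
  apply/seteqP; split => x /=; rewrite /sq /= !in_itv /= !ler_distl//;
  by move=> [? ?].
by apply: compact_setX; exact: segment_compact.
Qed.

Lemma continuous_bounded_sq f c r : continuous f ->
  exists2 M, 0 <= M & forall x, sq c r x -> `|f x| <= M.
Proof.
move=> cf.
have /compact_bounded : compact (f @` sq c r).
  by apply: continuous_compact; [exact: continuous_subspaceT|exact: compact_sq].
move=> [M [_ HM]]; exists (`|M| + 1); first by rewrite addr_ge0.
move=> x sx; apply: (HM (`|M| + 1)); last by exists x.
by rewrite (le_lt_trans (ler_norm M))// ltrDl.
Qed.

Lemma compact_in_sq (C : set (R * R)) : compact C -> exists M, 0 < M /\ C `<=` sq (0, 0) M.
Proof.
move=> /compact_bounded[M [_ HM]]; exists (`|M| + 1); split; first by rewrite ltr_wpDl.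
move=> x Cx; have /= := HM (`|M| + 1).
move=> /(_ _ x Cx); rewrite (le_lt_trans (ler_norm M)) ?ltrDl// => /(_ isT).
by rewrite prod_normE /= ge_max /sq /= !subr0 => /andP[].
Qed.

Lemma ing_cont_sq A f c r : measurable A -> A `<=` sq c r -> continuous f ->
  ing (fun x => \1_A x * f x).
Proof.
move=> mA Asq cf; have [M M0 HM] := continuous_bounded_sq c r cf.
have mf := continuous_measurable_plane cf.
apply: (@ing_le _ _ (fun x => M * \1_A x)).
- by apply: mbleM => //; exact: mble_indic.
- by apply: ingZ; exact: ing_indic mA Asq.
- move=> x; rewrite indicE; case: (boolP (x \in A)) => /= [|_].
    by rewrite inE => /Asq /HM; rewrite mul1r mulr1.
  by rewrite mul0r mulr0 normr0.
Qed.

Definition box (a b c d : R) : set (R * R) := `[a, b]%classic `*` `[c, d]%classic.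

Lemma box_indic a b c d (x y : R) : \1_(box a b c d) (x, y) = \1_(`[a, b]%classic) x * \1_(`[c, d]%classic) y :> R.
Proof.
have -> : (\1_(box a b c d) (x, y) : R) = ((x \in `[a, b]%classic) && (y \in `[c, d]%classic))%:R.
  rewrite indicE; congr (nat_of_bool _)%:R; apply/idP/idP.
    by rewrite inE => -[/= h1 h2]; rewrite !mem_set.
  by move=> /andP[]; rewrite !inE => h1 h2.
by rewrite !indicE; case: (x \in _); case: (y \in _); rewrite ?mul1r ?mul0r.
Qed.

Lemma measurable_box a b c d : measurable (box a b c d).
Proof. by apply: measurableX; exact: measurable_itv. Qed.

Lemma box_sq a b c d : exists M, box a b c d `<=` sq (0, 0) M.
Proof.
have /compact_in_sq[M [_ HM]] : compact (box a b c d).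
  by apply: compact_setX; exact: segment_compact.
by exists M.
Qed.

Lemma ing_box_cont f a b c d : continuous f -> ing (fun x => \1_(box a b c d) x * f x).
Proof.
move=> cf; have [M HM] := box_sq a b c d.
by apply: ing_cont_sq HM cf; exact: measurable_box.
Qed.

Lemma dirpd_cont v f : smooth f -> continuous (dirpd v f).
Proof.
move=> sf x; apply: cvgD; apply: cvgMr; exact: (smooth_cont (@smooth_pd _ _ _ sf)).
Qed.

(** Fubini on the parallelogram parametrized by [aff c v w], then the fundamental theorem of
    calculus along [v] on each line. *)
Lemma rect_int F c v w a b s0 s1 : a < b -> smooth F ->
  Int (fun y => \1_(box a b s0 s1) y * dirpd v F (aff c v w y)) =
  \int[leb]_s (\1_(`[s0, s1]%classic) s * (F (aff c v w (b, s)) - F (aff c v w (a, s)))).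
Proof.
move=> ab sF.
have cG : continuous (fun y => dirpd v F (aff c v w y)).
  move=> y; apply: (@continuous_comp _ _ _ (aff c v w) (dirpd v F)); [exact: continuous_aff|exact: dirpd_cont].
rewrite ing_fubini; last exact: ing_box_cont.
apply: eq_Rintegral => s _.
have D (t : R) : is_derive t (1 : R) (fun t : R => F (aff c v w (t, s))) (dirpd v F (aff c v w (t, s))).
  have := is_derive_dir (aff c v w (0, s)) v t sF.
  have E (t' : R) : ((aff c v w (0, s)).1 + t' * v.1, (aff c v w (0, s)).2 + t' * v.2) = aff c v w (t', s).
    by rewrite /aff /=; congr pair; ring.
  rewrite E; congr (is_derive _ _ _ _); apply/funext => t'; by rewrite E.
have cD : continuous (fun t : R => dirpd v F (aff c v w (t, s))).
  move=> t; apply: (@continuous_comp _ _ _ (fun t : R => (t, s)) (fun y => dirpd v F (aff c v w y))).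
    exact: (cvg_pair cvg_id (cvg_cst s)).
  exact: cG.
under eq_Rintegral do rewrite box_indic mulrAC mulrC.
rewrite -(ftc_seg ab D cD).
have [ss|ss] := boolP (s \in `[s0, s1]%classic); rewrite !indicE ?ss ?(negbTE ss).
  by rewrite mul1r; apply: eq_Rintegral => t _; rewrite mul1r.
rewrite mul0r; under eq_Rintegral do rewrite mul0r.
by rewrite /Rintegral integral0.
Qed.

Lemma aff_swap c v w (x : R * R) : aff c w v (x.2, x.1) = aff c v w x.
Proof. by rewrite /aff /=; congr pair; ring. Qed.

Lemma Int_swap f : ing f -> Int (fun x => f (x.2, x.1)) = Int f.
Proof.
move=> f1; have := @Int_aff R (0, 0) (0, 1) (1, 0) f.
rewrite /= mulr0 mulr1 sub0r => /(_ _ f1).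
rewrite oppr_eq0 oner_eq0 normrN normr1 invr1 mul1r => /(_ isT) <-.
by apply: eq_Int => x; rewrite /aff /=; congr (f (_, _)); ring.
Qed.

Lemma rect_int2 F c v w a b s0 s1 : s0 < s1 -> smooth F ->
  Int (fun y => \1_(box a b s0 s1) y * dirpd w F (aff c v w y)) =
  \int[leb]_t (\1_(`[a, b]%classic) t * (F (aff c v w (t, s1)) - F (aff c v w (t, s0)))).
Proof.
move=> ab sF; have := @rect_int F c w v s0 s1 a b ab sF.
have cG : continuous (fun y => dirpd w F (aff c v w y)).
  move=> y; apply: (@continuous_comp _ _ _ (aff c v w) (dirpd w F)); [exact: continuous_aff|exact: dirpd_cont].
rewrite -(Int_swap (ing_box_cont a b s0 s1 cG)) => H.
transitivity (Int (fun y => \1_(box s0 s1 a b) y * dirpd w F (aff c w v y))).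
  apply: eq_Int => -[x y] /=; rewrite !box_indic [\1_(`[a, b]%classic) _ * _]mulrC; congr (_ * dirpd w F _).
  by rewrite -(aff_swap c v w).
rewrite H; apply: eq_Rintegral => t _.
by rewrite -!(aff_swap c w v).
Qed.

Lemma pd_out f (C : set (R * R)) i : closed C -> (forall x, ~ C x -> f x = 0) ->
  forall x, ~ C x -> pd i f x = 0.
Proof.
move=> cC f0 x Cx; rewrite /pd.
have -> : 'D_(ei R i) f x = 'D_(ei R i) (cst 0 : R * R -> R) x.
  apply: near_eq_derive.
  have : nbhs x (~` C) by apply: open_nbhs_nbhs; split => //; exact: closed_openC.
  by apply: filterS => y Cy /=; exact: f0.
exact: derive_cst.
Qed.

Lemma closed_sq c r : closed (@sq R c r).
Proof. by apply: compact_closed; [exact: norm_hausdorff|exact: compact_sq]. Qed.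

Lemma Int_supp f c r : (forall x, ~ sq c r x -> f x = 0) ->
  f = (fun x => \1_(sq c r) x * f x).
Proof.
move=> f0; apply/funext => x; rewrite indicE; case: (boolP (x \in _)); first by rewrite mul1r.
by move=> /negP H; rewrite mul0r f0// => h; apply: H; rewrite inE.
Qed.

Lemma cont_supp_ing f c r : continuous f -> (forall x, ~ sq c r x -> f x = 0) -> ing f.
Proof.
move=> cf f0; rewrite (Int_supp f0); exact: (ing_cont_sq (measurable_sq c r) (@subset_refl _ _) cf).
Qed.

Lemma cont_supp_bounded f c r : continuous f -> (forall x, ~ sq c r x -> f x = 0) ->
  exists2 M, 0 <= M & forall x, `|f x| <= M.
Proof.
move=> cf f0; have [M M0 HM] := continuous_bounded_sq c r cf.
exists M => // x; have [/HM//|/f0 ->] := pselect (sq c r x); by rewrite normr0.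
Qed.

(** On a box strictly larger than the support, the fundamental theorem leaves only boundary values,
    and these vanish. *)
Lemma Int_pd0 f M i : smooth f -> (forall x, ~ sq (0, 0) M x -> f x = 0) -> Int (pd i f) = 0.
Proof.
move=> sf f0; set N := `|M| + 1.
have NM : M < N by rewrite /N (le_lt_trans (ler_norm M))// ltrDl.
have N0 : 0 < N by rewrite ltr_wpDl.
have pf0 : forall x, ~ sq (0, 0) N x -> pd i f x = 0.
  move=> x xN; apply: (@pd_out f (sq (0, 0) M) i (@closed_sq (0, 0) M) f0) => xM; apply: xN.
  by move: xM; rewrite /sq /= !subr0 => -[? ?]; split; apply: le_trans (ltW NM).
have bE : box (- N) N (- N) N = sq (0, 0) N.
  apply/seteqP; split => x /=; rewrite /box /sq /= !in_itv /= !ler_distl;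
  by move=> [/andP[? ?] /andP[? ?]]; split; apply/andP; split; lra.
have fN (x : R * R) : N <= `|x.1| \/ N <= `|x.2| -> f x = 0.
  move=> H; apply: f0; rewrite /sq /= !subr0 => -[h1 h2].
  by case: H => h; [have := lt_le_trans NM (le_trans h h1)|have := lt_le_trans NM (le_trans h h2)]; rewrite ltxx.
rewrite (Int_supp pf0) -bE.
have i01 : i = ord0 \/ i = ord_max.
  by case: i {pf0} => -[|[|//]] ?; [left|right]; apply/val_inj.
have E x : aff (0, 0) (1, 0) (0, 1) x = x.
  by case: x => a b; rewrite /aff /=; congr pair; ring.
have NN : - N < N by rewrite gtrN.
have aN : `|N| = N by rewrite gtr0_norm.
case: i01 => ->.
  have := @rect_int f (0, 0) (1, 0) (0, 1) (- N) N (- N) N NN sf.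
  under eq_Int do rewrite /dirpd /= mul1r mul0r addr0 E.
  move=> ->; transitivity (\int[leb]_s (0 : R)); last by rewrite /Rintegral integral0.
  apply: eq_Rintegral => s _; rewrite !E (fN (N, s)) ?(fN (- N, s)) ?subrr ?mulr0//.
    by left; rewrite /= normrN aN.
  by left; rewrite /= aN.
have := @rect_int2 f (0, 0) (1, 0) (0, 1) (- N) N (- N) N NN sf.
under eq_Int do rewrite /dirpd /= mul1r mul0r add0r E.
move=> ->; transitivity (\int[leb]_s (0 : R)); last by rewrite /Rintegral integral0.
apply: eq_Rintegral => s _; rewrite !E (fN (s, N)) ?(fN (s, - N)) ?subrr ?mulr0//.
  by right; rewrite /= normrN aN.
by right; rewrite /= aN.
Qed.

Lemma test_supp A f : test_fun A f -> exists M, 0 < M /\ forall x, ~ sq (0, 0) M x -> f x = 0.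
Proof.
move=> [sf [C cC [CA f0]]]; have [M [M0 CM]] := compact_in_sq cC.
by exists M; split => // x xM; apply: f0 => Cx; apply: xM; exact: CM.
Qed.

Lemma test_smooth A f : test_fun A f -> smooth f. Proof. by case. Qed.

Lemma test_out A f : test_fun A f -> forall x, ~ A x -> f x = 0.
Proof. by move=> [_ [C _ [CA f0]]] x Ax; apply: f0 => /CA. Qed.

Lemma test_pd A f i : test_fun A f -> test_fun A (pd i f).
Proof.
move=> [sf [C cC [CA f0]]]; split; first exact: smooth_pd.
exists C => //; split => //.
by apply: pd_out => //; apply: compact_closed; [exact: norm_hausdorff|exact: cC].
Qed.

Lemma test_ing A f : test_fun A f -> ing f.
Proof.
by move=> tf; have [M [_ H]] := test_supp tf; apply: cont_supp_ing H; exact/smooth_cont/(test_smooth tf).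
Qed.

Lemma test_bounded A f : test_fun A f -> exists2 M, 0 <= M & forall x, `|f x| <= M.
Proof.
by move=> tf; have [M [_ H]] := test_supp tf; apply: cont_supp_bounded H; exact/smooth_cont/(test_smooth tf).
Qed.

Lemma test_sub A B f : A `<=` B -> test_fun A f -> test_fun B f.
Proof. by move=> AB [sf [C cC [CA f0]]]; split => //; exists C => //; split => // x /CA /AB. Qed.

Lemma test_mull A f g : smooth g -> test_fun A f -> test_fun A (fun x => g x * f x).
Proof.
move=> sg [sf [C cC [CA f0]]]; split; first exact: smoothM.
by exists C => //; split => // x /f0 ->; rewrite mulr0.
Qed.

Lemma Int_test_pd A f i : test_fun A f -> Int (pd i f) = 0.
Proof.
by move=> tf; have [M [_ H]] := test_supp tf; apply: Int_pd0 H; exact: (test_smooth tf).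
Qed.

Lemma Int_parts A f g i : smooth g -> test_fun A f ->
  Int (fun x => g x * pd i f x) = - Int (fun x => pd i g x * f x).
Proof.
move=> sg tf; have sf := test_smooth tf.
have i1 := test_ing (test_mull sg (test_pd i tf)).
have i2 := test_ing (test_mull (@smooth_pd _ i _ sg) tf).
apply/eqP; rewrite -subr_eq0 opprK -IntD//; apply/eqP.
rewrite -[RHS](Int_test_pd i (test_mull sg tf)); apply: eq_Int => x.
by rewrite pdM// (mulrC (pd i g x)).
Qed.

End Rectangles.

(** * Convolution integrals and bumps supported in squares *)

Section Mollifier.
Variable R : realType.
Local Notation mu := (@area R).
Local Notation leb := (@lebesgue_measure R).
Implicit Types (f g eta : R * R -> R).

Lemma area_sq (c : R * R) r : 0 < r -> mu (sq c r) = (4 * r ^+ 2)%:E.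
Proof.
move=> r0.
have -> : sq c r = `[c.1 - r, c.1 + r]%classic `*` `[c.2 - r, c.2 + r]%classic.
  apply/seteqP; split => x /=; rewrite /sq /= !in_itv /= !ler_distl//;
  by move=> [? ?].
rewrite /area product_measure1E; [|exact: measurable_itv|exact: measurable_itv].
have L (a : R) : leb `[a - r, a + r]%classic = (2 * r)%:E.
  rewrite lebesgue_measure_itv /= lte_fin ifT; last by lra.
  by rewrite -EFinD; congr EFin; ring.
by rewrite /= !L -EFinM; congr EFin; ring.
Qed.

(** A nonempty open set contains a square of positive measure, so a null set cannot cover it. *)
Lemma ae_ex (P : R * R -> Prop) (U : set (R * R)) c : open U -> U c ->
  {ae mu, forall x, P x} -> exists2 x, U x & P x.
Proof.
move=> oU Uc [N [mN N0 PN]].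
have [r r0 rU] := open_sq oU Uc.
apply: contrapT => nP.
have : sq c r `<=` N.
  by move=> x xr; apply: PN => Px; apply: nP; exists x => //; exact: rU.
move=> sN; have : (mu (sq c r) <= mu N)%E.
  by apply: le_measure; rewrite ?inE//; exact: measurable_sq.
rewrite area_sq// N0 lee_fin leNgt => /negP; apply.
by rewrite mulr_gt0// exprn_gt0.
Qed.

Definition sct (a : R) (d x : R * R) : R * R := (a * x.1 + d.1, a * x.2 + d.2).

Lemma sct_cont a d : continuous (sct a d).
Proof.
move=> x; apply: (@cvg_pair _ _ _ _ (nbhs _) (nbhs _)) => /=.
  by apply: cvgD; [apply: cvgMr; exact: cvg_fst|exact: cvg_cst].
by apply: cvgD; [apply: cvgMr; exact: cvg_snd|exact: cvg_cst].
Qed.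

Lemma is_derive_sct f a d i x : smooth f ->
  is_derive x (ei R i) (fun y => f (sct a d y)) (a * pd i f (sct a d x)).
Proof.
move=> sf; have D := is_derive_dir0 (sct a d x) (ei R i) sf.
have Ed : dirpd (ei R i) f (sct a d x) = pd i f (sct a d x).
  rewrite /dirpd /ei; case: i {D} => -[|[|//]] hi /=.
    by rewrite mul1r mul0r addr0; congr pd; apply/val_inj.
  by rewrite mul0r add0r mul1r; congr pd; apply/val_inj.
rewrite Ed in D.
have D' : is_derive (0:R) (1:R) (fun t : R => f ((sct a d x).1 + (a * t + 0) * (ei R i).1, (sct a d x).2 + (a * t + 0) * (ei R i).2)) (a * pd i f (sct a d x)).
  have D0 : is_derive (a * 0 + 0) (1:R) (fun t : R => f ((sct a d x).1 + t * (ei R i).1, (sct a d x).2 + t * (ei R i).2)) (pd i f (sct a d x)).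
    by rewrite mulr0 addr0.
  exact: (is_derive_comp_aff D0).
have E : (fun h : R => h^-1 *: (((fun y => f (sct a d y)) \o shift x) (h *: ei R i) - f (sct a d x))) =
  (fun h : R => h^-1 *: (((fun t : R => f ((sct a d x).1 + (a * t + 0) * (ei R i).1, (sct a d x).2 + (a * t + 0) * (ei R i).2)) \o shift 0) (h *: (1 : R))
     - f ((sct a d x).1 + (a * 0 + 0) * (ei R i).1, (sct a d x).2 + (a * 0 + 0) * (ei R i).2))).
  apply/funext => h /=; congr (_ *: (f _ - f _)); rewrite /sct /GRing.scale /= /GRing.scale /=.
    by congr pair; ring.
  by congr pair; ring.
by case: D' => d1 d2; apply: DeriveDef; [rewrite /derivable E|rewrite /derive E -d2].
Qed.

Lemma pd_sct f a d i : smooth f -> pd i (fun y => f (sct a d y)) = fun x => a * pd i f (sct a d x).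
Proof. by move=> sf; apply/funext => x; case: (is_derive_sct a d i x sf). Qed.

Lemma smooth_sct f a d : smooth f -> smooth (fun y => f (sct a d y)).
Proof.
move=> sf.
apply: (@smooth_ind _ [set h | exists c f, smooth f /\ h = (fun x => c * f (sct a d x))]); last first.
  by exists 1, f; split => //; apply/funext => x; rewrite mul1r.
move=> _ [c [{}f [{}sf ->]]].
have D i x := is_deriveZ c (is_derive_sct a d i x sf).
split.
- move=> x; apply: cvgMr; apply: (@continuous_comp _ _ _ (sct a d) f); [exact: sct_cont|exact: smooth_cont].
- by move=> i x; case: (D i x).
- move=> i; exists (c * a), (pd i f); split; first exact: smooth_pd.
  apply/funext => x; transitivity (c *: (a * pd i f (sct a d x))); first by case: (D i x).
  by rewrite /GRing.scale /= mulrA.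
Qed.

Lemma ei_cases i : (ei R i = (1, 0) /\ i = ord0) \/ (ei R i = (0, 1) /\ i = ord_max).
Proof.
by case: i => -[|[|//]] hi; [left|right]; split => //; apply/val_inj.
Qed.

Lemma smooth_mvt_ei f (u : R * R) i h : smooth f -> exists c, `|c| <= `|h| /\
  f (u.1 + h * (ei R i).1, u.2 + h * (ei R i).2) - f u =
  h * pd i f (u.1 + c * (ei R i).1, u.2 + c * (ei R i).2).
Proof.
move=> sf.
have Ed (x : R * R) : dirpd (ei R i) f x = pd i f x.
  rewrite /dirpd; case: (ei_cases i) => -[-> ->] /=; by rewrite ?mul1r ?mul0r ?addr0 ?add0r.
have [c [c1 E]] := MVT_abs (fun t => is_derive_dir u (ei R i) t sf) 0 h.
exists c; rewrite !subr0 in c1 E; split => //.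
by rewrite -Ed [RHS]mulrC -E !mul0r !addr0; congr (_ - f _); case: (u).
Qed.

Lemma test_lip A eta : test_fun A eta -> exists2 L, 0 <= L & forall x y : R * R,
  `|eta x - eta y| <= L * (`|x.1 - y.1| + `|x.2 - y.2|).
Proof.
move=> te; have se := test_smooth te.
have [M0 M00 H0] := test_bounded (test_pd ord0 te).
have [M1 M10 H1] := test_bounded (test_pd ord_max te).
exists (M0 + M1); first by rewrite addr_ge0.
move=> x y.
have [c [_ E1]] := smooth_mvt_ei y ord0 (x.1 - y.1) se.
have [c' [_ E2]] := smooth_mvt_ei (x.1, y.2) ord_max (x.2 - y.2) se.
rewrite /ei /= !mulr1 !mulr0 !addr0 in E1 E2.
rewrite [y.1 + _]addrC subrK in E1; rewrite [y.2 + _]addrC subrK in E2.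
have -> : eta x - eta y = (eta (x.1, x.2) - eta (x.1, y.2)) + (eta (x.1, y.2) - eta y).
  by rewrite addrA subrK; case: (x).
rewrite E1 E2 (le_trans (ler_normD _ _))// !normrM mulrDr addrC lerD//.
  by rewrite mulrC ler_wpM2r// (le_trans (H0 _))// lerDl.
by rewrite mulrC ler_wpM2r// (le_trans (H1 _))// lerDr.
Qed.

(** A convolution with separate scalings of the integration variable and of the parameter: the
    averages [Am e] become such integrals with [a = 1 / e] and [b = (1 - e) / e]. *)
Definition cv (a b : R) eta g (x : R * R) : R :=
  Int (fun y => eta (a * y.1 - b * x.1, a * y.2 - b * x.2) * g y).

Lemma test_mble_sct A (a b : R) eta x : test_fun A eta ->
  mble (fun y : R * R => eta (a * y.1 - b * x.1, a * y.2 - b * x.2)).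
Proof.
by move=> te; apply: smooth_mble; exact: (@smooth_sct eta a (- (b * x.1), - (b * x.2)) (test_smooth te)).
Qed.

Lemma cv_ing A a b eta g x : test_fun A eta -> ing g ->
  ing (fun y => eta (a * y.1 - b * x.1, a * y.2 - b * x.2) * g y).
Proof.
move=> te ig; have [M M0 H] := test_bounded te.
apply: (@ing_bounded _ _ _ M) => //; exact: test_mble_sct te.
Qed.

Lemma cv_lip A a b eta g : test_fun A eta -> ing g ->
  exists2 L, 0 <= L & forall x x', `|cv a b eta g x - cv a b eta g x'| <= L * (`|x.1 - x'.1| + `|x.2 - x'.2|).
Proof.
move=> te ig; have [L L0 HL] := test_lip te.
exists (L * `|b| * Int (fun y => `|g y|)).
  by rewrite !mulr_ge0// Int_ge0.
move=> x x'; rewrite /cv -IntB; [|exact: cv_ing te ig|exact: cv_ing te ig].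
apply: (le_trans (Int_abs_le _)); first by apply: ingB; exact: cv_ing te ig.
rewrite mulrAC -IntZ; last exact: ing_abs.
apply: Int_le.
- by apply: ing_abs; apply: ingB; exact: cv_ing te ig.
- by apply: ingZ; exact: ing_abs.
move=> y; rewrite -mulrBl normrM ler_wpM2r//.
apply: (le_trans (HL _ _)) => /=.
have E (s t : R) (z : R) : a * z - b * s - (a * z - b * t) = (- b) * (s - t) by ring.
by rewrite !E !normrM normrN -mulrDr mulrA.
Qed.

Lemma cv_cont A a b eta g : test_fun A eta -> ing g -> continuous (cv a b eta g).
Proof.
move=> te ig x; have [L L0 HL] := cv_lip a b te ig.
apply/cvgrPdist_le => /= e e0.
have e'0 : 0 < e / (2 * L + 1) by rewrite divr_gt0// ltr_wpDl// mulr_ge0.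
suff : nbhs (x : R * R) [set t | `|cv a b eta g x - cv a b eta g t| <= e] by [].
apply/nbhs_ballP; exists (e / (2 * L + 1)) => //= y [/= y1 y2].
rewrite /ball /= in y1 y2.
apply: (le_trans (HL _ _)).
apply: (@le_trans _ _ (L * (e / (2 * L + 1) + e / (2 * L + 1)))).
  by rewrite ler_wpM2l// lerD// ltW.
rewrite -mulrDl mulrA ler_pdivrMr ?ltr_wpDl ?mulr_ge0//.
rewrite -subr_ge0; have -> : e * (2 * L + 1) - L * (e + e) = e by ring.
exact: ltW.
Qed.

(** Differentiation under the integral sign: [pd i eta] is Lipschitz, so the remainder of the first
    order expansion of [eta] is quadratic in [h], uniformly in the integration variable, and [g] is
    integrable. *)
Lemma cv_derive A a b eta g i x : test_fun A eta -> ing g ->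
  is_derive x (ei R i) (cv a b eta g) (- b * cv a b (pd i eta) g x).
Proof.
move=> te ig; have tp := test_pd i te; have se := test_smooth te.
have [L L0 HL] := test_lip tp.
set G := Int (fun y => `|g y|).
have G0 : 0 <= G by exact: Int_ge0.
have i1 z := cv_ing a b z te ig.
have i2 z := cv_ing a b z tp ig.
have key (h : R) : `|cv a b eta g (h *: ei R i + x) - cv a b eta g x - h * (- b * cv a b (pd i eta) g x)| <= L * (b * h) ^+ 2 * G.
  rewrite mulrA /cv -IntZ// -!IntB//; try (by apply: ingB); try exact: ingZ.
  have ii : ing (fun y => eta (a * y.1 - b * (h *: ei R i + x).1, a * y.2 - b * (h *: ei R i + x).2) * g y
    - eta (a * y.1 - b * x.1, a * y.2 - b * x.2) * g y
    - h * - b * (pd i eta (a * y.1 - b * x.1, a * y.2 - b * x.2) * g y)).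
    by apply: ingB; [exact: ingB|exact: ingZ].
  apply: (le_trans (Int_abs_le ii)); rewrite /G -IntZ; last exact: ing_abs.
  apply: Int_le; [exact: ing_abs|by apply: ingZ; exact: ing_abs|].
  move=> y; rewrite mulrA -!mulrBl normrM ler_wpM2r//.
  set u : R * R := (a * y.1 - b * x.1, a * y.2 - b * x.2).
  have [c [c1 E]] := smooth_mvt_ei u i (- b * h) se.
  have Eu : (a * y.1 - b * (h *: ei R i + x).1, a * y.2 - b * (h *: ei R i + x).2) =
    (u.1 + (- b * h) * (ei R i).1, u.2 + (- b * h) * (ei R i).2).
    by rewrite /u /GRing.scale /=; congr pair; rewrite /GRing.scale /=; ring.
  rewrite Eu E [h * - b]mulrC -mulrBr normrM.
  apply: (@le_trans _ _ (`|- b * h| * (L * `|- b * h|))).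
    rewrite ler_wpM2l//; apply: (le_trans (HL _ _)); rewrite ler_wpM2l//= ![_ + c * _]addrC !addrK.
    case: (ei_cases i) => -[-> _] /=; rewrite ![`|c * _|]normrM normr1 normr0 ?mulr1 ?mulr0 ?addr0 ?add0r; exact: c1.
  by rewrite mulrCA -expr2 real_normK ?num_real// mulNr sqrrN.
have H : h^-1 *: (cv a b eta g (h *: ei R i + x) - cv a b eta g x) @[h --> (0:R)^'] --> - b * cv a b (pd i eta) g x.
  apply/cvgrPdist_le => /= e e0.
  have C0 : 0 <= L * b ^+ 2 * G by apply: mulr_ge0 => //; apply: mulr_ge0 => //; exact: sqr_ge0.
  near=> h.
  have h0 : h != 0 by near: h; exact: nbhs_dnbhs_neq.
  rewrite distrC /GRing.scale /=.
  have -> : h^-1 * (cv a b eta g (h *: ei R i + x) - cv a b eta g x) - - b * cv a b (pd i eta) g x =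
    h^-1 * (cv a b eta g (h *: ei R i + x) - cv a b eta g x - h * (- b * cv a b (pd i eta) g x)).
    by rewrite [RHS]mulrBr mulKf.
  rewrite normrM normfV ler_pdivrMl ?normr_gt0//; apply: (le_trans (key h)).
  have -> : L * (b * h) ^+ 2 * G = `|h| * (`|h| * (L * b ^+ 2 * G)).
    by rewrite mulrA -expr2 real_normK ?num_real//; ring.
  rewrite ler_wpM2l//.
  have hd : `|h| <= e / (L * b ^+ 2 * G + 1).
    near: h; apply: nbhs_dnbhs.
    have : \forall h \near (0 : R), `|0 - h| < e / (L * b ^+ 2 * G + 1).
      by apply: (@nbhsx_ballx _ _ (0 : R)); rewrite divr_gt0// ltr_wpDl.
    by apply: filterS => h; rewrite sub0r normrN => /ltW.
  apply: (le_trans (ler_wpM2r C0 hd)).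
  by rewrite mulrAC ler_pdivrMr ?ltr_wpDl// ler_wpM2l ?(ltW e0)// lerDl.
apply: DeriveDef; first by apply/cvg_ex; exists (- b * cv a b (pd i eta) g x).
exact: cvg_lim H.
Unshelve. all: by end_near. Qed.

Lemma cv_pd A a b eta g i : test_fun A eta -> ing g ->
  pd i (cv a b eta g) = fun x => - b * cv a b (pd i eta) g x.
Proof. by move=> te ig; apply/funext => x; case: (cv_derive a b i x te ig). Qed.

Lemma smooth_cv A a b eta g : test_fun A eta -> ing g -> smooth (cv a b eta g).
Proof.
move=> te ig.
apply: (@smooth_ind _ [set h | exists c eta, test_fun A eta /\ h = (fun x => c * cv a b eta g x)]); last first.
  by exists 1, eta; split => //; apply/funext => x; rewrite mul1r.
move=> _ [c [{}eta [{}te ->]]].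
have D i x := is_deriveZ c (cv_derive a b i x te ig).
split.
- have cc := @cv_cont A a b eta g te ig.
  by move=> x; apply: cvgMr; exact: cc.
- by move=> i x; case: (D i x).
- move=> i; exists (c * - b), (pd i eta); split; first exact: test_pd.
  apply/funext => x; transitivity (c *: (- b * cv a b (pd i eta) g x)); first by case: (D i x).
  by rewrite /GRing.scale /= mulrA.
Qed.

(** The scale [4 * r] sends the interval of half-length [r] around each coordinate of [c] onto
    [1/4, 3/4], the support of [bump0]. *)
Definition bumpat (c : R * R) (r : R) : R * R -> R :=
  let B := pb (@bump0 R) (@bump0 R) ((4 * r)^-1, 0) (2^-1 - c.1 / (4 * r)) (0, (4 * r)^-1) (2^-1 - c.2 / (4 * r)) in B.

Lemma bumpat_smooth c r : smooth (bumpat c r).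
Proof. by apply: smooth_pb; exact: smooth1_bump0. Qed.

Lemma bumpat_ge0 c r x : 0 <= bumpat c r x.
Proof. by rewrite /bumpat /pb mulr_ge0// bump0_ge0. Qed.

Lemma bumpat_gt0 c r : 0 < r -> 0 < bumpat c r c.
Proof.
move=> r0; rewrite /bumpat /pb /lin /dot /= !mulr0 addr0 add0r.
have -> (z : R) : z * (4 * r)^-1 + (2^-1 - z / (4 * r)) = 2^-1 by ring.
by rewrite mulr_gt0// bump0_gt0//; lra.
Qed.

Lemma bumpat_out c r x : 0 < r -> ~ sq c r x -> bumpat c r x = 0.
Proof.
move=> r0 xs; rewrite /bumpat /pb /lin /dot /= !mulr0 addr0 add0r.
have Z (s t : R) : ~ (`|s - t| <= r) -> bump0 (s * (4 * r)^-1 + (2^-1 - t / (4 * r))) = 0.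
  move=> st; apply: bump0_out => /andP[h1 h2]; apply: st.
  have E : s * (4 * r)^-1 + (2^-1 - t / (4 * r)) = (s - t) / (4 * r) + 2^-1 by ring.
  rewrite E in h1 h2.
  have h1' : - 4^-1 < (s - t) / (4 * r) by lra.
  have h2' : (s - t) / (4 * r) < 4^-1 by lra.
  have r40 : 0 < 4 * r by rewrite mulr_gt0.
  rewrite ltr_pdivlMr// in h1'; rewrite ltr_pdivrMr// in h2'.
  by rewrite ler_norml; apply/andP; split; lra.
have [h1|h1] := pselect (`|x.1 - c.1| <= r); last by rewrite Z ?mul0r.
by rewrite mulrC Z ?mul0r// => h2; apply: xs.
Qed.

Lemma bumpat_test c r A : 0 < r -> sq c r `<=` A -> test_fun A (bumpat c r).
Proof.
move=> r0 rA; split; first exact: bumpat_smooth.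
by exists (sq c r); [exact: compact_sq|split => // x; exact: bumpat_out].
Qed.

Lemma Int_bumpat_gt0 c r : 0 < r -> 0 < Int (bumpat c r).
Proof.
move=> r0; have ib := test_ing (bumpat_test r0 (@subset_refl _ (sq c r))).
rewrite lt_neqAle Int_ge0 ?andbT; last exact: bumpat_ge0.
apply/negP => /eqP /esym /(Int0_ae ib (bumpat_ge0 c r)) ae0.
have oU : open [set x | 0 < bumpat c r x].
  have -> : [set x | 0 < bumpat c r x] = bumpat c r @^-1` [set y | 0 < y] by [].
  apply: open_comp; last exact: open_gt.
  by move=> x _; exact: (smooth_cont (bumpat_smooth c r)).
by have [x /= x0 x1] := ae_ex oU (bumpat_gt0 c r0) ae0; rewrite x1 ltxx in x0.
Qed.

Definition moll c r (x : R * R) : R := (Int (bumpat c r))^-1 * bumpat c r x.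

Lemma moll_test c r A : 0 < r -> sq c r `<=` A -> test_fun A (moll c r).
Proof.
move=> r0 rA; have [s [C cC [CA C0]]] := bumpat_test r0 rA.
split; first exact: smoothZ.
by exists C => //; split => // x Cx; rewrite /moll C0 ?mulr0.
Qed.

Lemma moll_ge0 c r x : 0 < r -> 0 <= moll c r x.
Proof. by move=> r0; rewrite /moll mulr_ge0 ?bumpat_ge0// invr_ge0 ltW// Int_bumpat_gt0. Qed.

Lemma Int_moll c r : 0 < r -> Int (moll c r) = 1.
Proof.
move=> r0; rewrite /moll IntZ; last exact: test_ing (bumpat_test r0 (@subset_refl _ (sq c r))).
by rewrite mulVf// gt_eqF// Int_bumpat_gt0.
Qed.

Lemma moll_out c r x : 0 < r -> ~ sq c r x -> moll c r x = 0.
Proof. by move=> r0 xs; rewrite /moll bumpat_out// mulr0. Qed.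

End Mollifier.

(** * Averages over small homothetic copies of a bump: convergence in L^1 *)

Section MollifierConvergence.
Import HBSimple.
Variable R : realType.
Local Notation mu := (@area R).
Local Notation leb := (@lebesgue_measure R).
Implicit Types (f g : R * R -> R).

(** Tonelli's theorem on the product of two planes asks for sigma-finiteness of [area], witnessed by
    the squares of half-side [n + 1]. *)
Lemma tonelli_plane (H : (R * R) * (R * R) -> \bar R) :
  measurable_fun [set: (R * R) * (R * R)] H -> (forall z, 0 <= H z)%E ->
  (\int[mu]_x \int[mu]_k H (x, k) = \int[mu]_k \int[mu]_x H (x, k))%E.
Proof.
move=> mH H0.
have sf : sigma_finite setT mu.
  exists (fun n => @sq R (0, 0) n.+1%:R).
    apply/seteqP; split => // x _; exists (Num.truncn (`|x.1| + `|x.2|)) => //.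
    have h := Num.Theory.truncnS_gt (`|x.1| + `|x.2|).
    by rewrite /sq /= !subr0; split; apply: le_trans (ltW h); rewrite ?lerDl ?lerDr.
  by move=> n; split; [exact: measurable_sq|rewrite area_sq ?ltr0Sn// ltry].
pose L2 : {sigma_finite_measure set _ -> \bar R} := HB.pack (leb \x leb)%E (Measure_isSigmaFinite.Build _ _ _ (leb \x leb)%E sf).
have := @fubini_tonelli _ _ _ _ R L2 L2 H mH H0.
by [].
Qed.

Section Am.
Variables (th : R * R -> R) (c : R * R) (r : R).
Hypotheses (th_test : test_fun setT th) (th_ge0 : forall x, 0 <= th x)
  (Int_th : Int th = 1) (th_out : forall x, ~ sq c r x -> th x = 0).

Definition pt (e : R) (x k : R * R) : R * R :=
  ((1 - e) * x.1 + e * k.1, (1 - e) * x.2 + e * k.2).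

Definition Am (e : R) g (x : R * R) : R := Int (fun k => th k * g (pt e x k)).

Lemma pt_aff e x k : pt e x k = aff ((1 - e) * x.1, (1 - e) * x.2) (e, 0) (0, e) k.
Proof. by rewrite /pt /aff /=; congr pair; ring. Qed.

Lemma pt_aff' e x k : pt e x k = aff (e * k.1, e * k.2) (1 - e, 0) (0, 1 - e) x.
Proof. by rewrite /pt /aff /=; congr pair; ring. Qed.

Lemma th_mble : mble th.
Proof. exact: (smooth_mble (test_smooth th_test)). Qed.

Lemma det_diag (e : R) : (e, 0 : R).1 * (0 : R, e).2 - (e, 0 : R).2 * (0 : R, e).1 = e ^+ 2.
Proof. by rewrite /= mulr0 subr0 expr2. Qed.

Lemma ing_pt e x g : 0 < e -> ing g -> ing (fun k => g (pt e x k)).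
Proof.
move=> e0 ig.
under eq_fun do rewrite pt_aff.
apply: ing_aff => //.
by rewrite det_diag gt_eqF// exprn_gt0.
Qed.

Lemma Am_ing e x g : 0 < e -> ing g -> ing (fun k => th k * g (pt e x k)).
Proof.
move=> e0 ig; have [M M0 HM] := test_bounded th_test.
by apply: (ing_bounded th_mble _ HM); exact: ing_pt.
Qed.

(** The substitution [y = pt e x k], of Jacobian [e ^+ 2], moves the dependence on [x] from the
    rough [g] to the smooth [th]. *)
Lemma Am_cv e g x : 0 < e -> ing g ->
  Am e g x = e ^- 2 * cv (e^-1) ((1 - e) / e) th g x.
Proof.
move=> e0 ig.
have e2 : (e, 0 : R).1 * (0 : R, e).2 - (e, 0 : R).2 * (0 : R, e).1 != 0.
  by rewrite det_diag gt_eqF// exprn_gt0.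
have i1 := cv_ing (e^-1) ((1 - e) / e) x th_test ig.
have := Int_aff ((1 - e) * x.1, (1 - e) * x.2) e2 i1.
rewrite det_diag (ger0_norm (sqr_ge0 e)) => <-.
apply: eq_Int => k; rewrite -pt_aff; congr (th _ * _).
have en : e != 0 by rewrite gt_eqF.
by rewrite /pt /=; case: k => k1 k2 /=; congr pair; field.
Qed.

Lemma smooth_Am e g : 0 < e -> ing g -> smooth (Am e g).
Proof.
move=> e0 ig.
have -> : Am e g = (fun x => e ^- 2 * cv (e^-1) ((1 - e) / e) th g x) by apply/funext => x; rewrite Am_cv.
apply: smoothZ; exact: smooth_cv th_test ig.
Qed.

Lemma AmB e g h x : 0 < e -> ing g -> ing h -> Am e (fun y => g y - h y) x = Am e g x - Am e h x.
Proof.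
move=> e0 ig ih; rewrite /Am -IntB; [|exact: Am_ing|exact: Am_ing].
by apply: eq_Int => k; rewrite mulrBr.
Qed.
Lemma AmD e g h x : 0 < e -> ing g -> ing h -> Am e (fun y => g y + h y) x = Am e g x + Am e h x.
Proof.
move=> e0 ig ih; rewrite /Am -IntD; [|exact: Am_ing|exact: Am_ing].
by apply: eq_Int => k; rewrite mulrDr.
Qed.
Lemma AmZ e (a : R) g x : 0 < e -> ing g -> Am e (fun y => a * g y) x = a * Am e g x.
Proof.
move=> e0 ig; rewrite /Am -IntZ; last exact: Am_ing.
by apply: eq_Int => k; rewrite mulrCA.
Qed.

Lemma Am_ge0 e g x : (forall y, 0 <= g y) -> 0 <= Am e g x.
Proof. by move=> g0; apply: Int_ge0 => k; rewrite mulr_ge0. Qed.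

Lemma Am_abs e g x : 0 < e -> ing g -> `|Am e g x| <= Am e (fun y => `|g y|) x.
Proof.
move=> e0 ig; apply: (le_trans (Int_abs_le (Am_ing x e0 ig))).
rewrite le_eqVlt; apply/orP; left; apply/eqP; apply: eq_Int => k.
by rewrite normrM (ger0_norm (th_ge0 k)).
Qed.

Lemma mble_joint e g : mble g -> measurable_fun [set: (R * R) * (R * R)] (fun z => (th z.2 * g (pt e z.1 z.2))%:E).
Proof.
move=> mg; apply/measurable_EFinP; apply: measurable_funM.
  by apply: (measurableT_comp th_mble).
apply: (measurableT_comp mg).
have H (p : R * R -> R) : mble p -> measurable_fun [set: (R * R) * (R * R)] (fun z => (1 - e) * p z.1 + e * p z.2).
  move=> mp; apply: measurable_funD; apply: measurable_funM => //; exact: (measurableT_comp mp).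
apply: measurable_fun_pair; apply: H.
  exact: measurable_fst.
exact: measurable_snd.
Qed.

(** Exchange of the integrals: for fixed [k] the map [x |-> pt e x k] is a homothety of ratio
    [1 - e], and [th] has integral 1. *)
Lemma Am_total_E e g : 0 < e < 1 -> ing g -> (forall y, 0 <= g y) ->
  (\int[mu]_x (Am e g x)%:E = ((1 - e) ^- 2 * Int g)%:E)%E.
Proof.
move=> /andP[e0 e1] ig g0.
have e10 : 0 < 1 - e by rewrite subr_gt0.
transitivity (\int[mu]_x \int[mu]_k (th k * g (pt e x k))%:E)%E.
  by apply: eq_integral => x _; rewrite Int_EFin//; exact: Am_ing.
have mj := mble_joint e (ing_mble ig).
have j0 : forall z : (R * R) * (R * R), (0 <= (th z.2 * g (pt e z.1 z.2))%:E)%E.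
  by move=> z; rewrite lee_fin mulr_ge0.
have -> : (\int[mu]_x \int[mu]_k (th k * g (pt e x k))%:E = \int[mu]_k \int[mu]_x (th k * g (pt e x k))%:E)%E.
  exact: (tonelli_plane mj j0).
have d0 : (1 - e, 0 : R).1 * (0 : R, 1 - e).2 - (1 - e, 0 : R).2 * (0 : R, 1 - e).1 != 0.
  by rewrite det_diag gt_eqF// exprn_gt0.
transitivity (\int[mu]_k (((1 - e) ^- 2 * Int g) * th k)%:E)%E.
  apply: eq_integral => k _.
  have ik : ing (fun x => g (pt e x k)).
    by under eq_fun do rewrite pt_aff'; exact: ing_aff.
  rewrite Int_EFin; last exact: ingZ.
  rewrite IntZ// mulrC; congr (_ * _)%:E.
  under eq_Int do rewrite pt_aff'.
  by rewrite Int_aff// det_diag (ger0_norm (sqr_ge0 _)).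
rewrite Int_EFin; last by apply: ingZ; exact: test_ing th_test.
by rewrite IntZ ?Int_th ?mulr1//; exact: test_ing th_test.
Qed.

Lemma ing_Am_ge0 e g : 0 < e < 1 -> ing g -> (forall y, 0 <= g y) -> ing (Am e g).
Proof.
move=> e01 ig g0; have /andP[e0 e1] := e01; apply/integrableP; split.
  by apply/measurable_EFinP; exact: (smooth_mble (smooth_Am e0 ig)).
have -> : (\int[mu]_x `|(EFin \o Am e g) x| = \int[mu]_x (Am e g x)%:E)%E.
  by apply: eq_integral => x _ /=; rewrite ger0_norm// Am_ge0.
by rewrite Am_total_E// ltry.
Qed.

Lemma Int_Am e g : 0 < e < 1 -> ing g -> (forall y, 0 <= g y) -> Int (Am e g) = (1 - e) ^- 2 * Int g.
Proof. by move=> e01 ig g0; rewrite /Int /Rintegral Am_total_E. Qed.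

Lemma ing_Am e g : 0 < e < 1 -> ing g -> ing (Am e g).
Proof.
move=> e01 ig; have /andP[e0 e1] := e01.
apply: (ing_le (smooth_mble (smooth_Am e0 ig)) (ing_Am_ge0 e01 (ing_abs ig) (fun=> normr_ge0 _))).
by move=> x; exact: Am_abs.
Qed.

Lemma Int_abs_Am e g : 0 < e < 1 -> ing g -> Int (fun x => `|Am e g x|) <= (1 - e) ^- 2 * Int (fun x => `|g x|).
Proof.
move=> e01 ig; have /andP[e0 e1] := e01.
rewrite -(Int_Am e01 (ing_abs ig) (fun=> normr_ge0 _)).
apply: Int_le; [exact/ing_abs/ing_Am| exact: (ing_Am_ge0 e01 (ing_abs ig) (fun=> normr_ge0 _))|].
by move=> x; exact: Am_abs.
Qed.

(** The shift by 2 puts every term in (0, 1/2], so that the factors [(1 - En n) ^- 2] are at most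
    4. *)
Definition En (n : nat) : R := n.+2%:R^-1.

Lemma En01 n : 0 < En n < 1.
Proof. by rewrite /En invr_gt0 ltr0Sn /= invf_lt1 ?ltr0Sn// ltr1n. Qed.
Lemma En_gt0 n : 0 < En n. Proof. by case/andP: (En01 n). Qed.
Lemma En_le n : En n <= 2^-1.
Proof. by rewrite /En lef_pV2 ?posrE ?ltr0Sn// ler_nat. Qed.
Lemma En_cvg : En n @[n --> \oo] --> (0 : R).
Proof.
have := @cvg_harmonic R; rewrite -cvg_shiftS; exact.
Qed.
Lemma En_sq n : (1 - En n) ^- 2 <= 4.
Proof.
have h := En_le n; have h2 : 2^-1 <= 1 - En n by lra.
have -> : 4 = (2^-1 : R) ^- 2 by field.
by rewrite lef_pV2 ?posrE ?exprn_gt0//; [rewrite lerXn2r ?nnegrE//; lra|lra].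
Qed.
Lemma En_sq_cvg : (1 - En n) ^- 2 @[n --> \oo] --> (1 : R).
Proof.
have H : (1 - En n) @[n --> \oo] --> (1 : R).
  by rewrite -[X in _ --> X]subr0; apply: cvgB; [exact: cvg_cst|exact: En_cvg].
have H2 : (1 - En n) ^+ 2 @[n --> \oo] --> (1 : R).
  have -> : (fun n => (1 - En n) ^+ 2) = (fun n => (1 - En n) * (1 - En n)) by apply/funext => n; rewrite expr2.
  by rewrite -[X in _ --> X](mulr1 1); apply: cvgM.
by have := @cvgV R _ _ _ _ _ (@oner_neq0 R) H2; rewrite invr1 => H3; exact: H3.
Qed.

Definition cvL1 g := Int (fun x => `|Am (En n) g x - g x|) @[n --> \oo] --> (0 : R).

Lemma ing_AmB n g : ing g -> ing (fun x => Am (En n) g x - g x).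
Proof. by move=> ig; apply: ingB => //; apply: ing_Am => //; exact: En01. Qed.

(** The averages are bounded on L^1 by 4 uniformly in [n]. An approximation within [e / 6] thus
    costs four such units under the average and one without it; the sixth is left for the
    convergence of [h]. *)
Lemma cvL1_approx g : ing g ->
  (forall d, 0 < d -> exists h, [/\ ing h, cvL1 h & Int (fun x => `|g x - h x|) <= d]) -> cvL1 g.
Proof.
move=> ig H; apply/cvgrPdist_le => /= e e0.
have e60 : 0 < e / 6 by rewrite divr_gt0.
have [h [ih ch gh]] := H _ e60.
move/cvgrPdist_le : ch => /(_ _ e60); apply: filterS => n.
rewrite !sub0r !normrN (ger0_norm (Int_ge0 _)) // (ger0_norm (Int_ge0 _)) // => hn.
have igh : ing (fun x => g x - h x) by exact: ingB.
have I1 := ing_abs (ing_Am (En01 n) igh).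
have I2 := ing_abs (ing_AmB n ih).
have I3 := ing_abs igh.
apply: (@le_trans _ _ (Int (fun x => `|Am (En n) (fun x => g x - h x) x| + `|Am (En n) h x - h x| + `|g x - h x|))).
  apply: Int_le; [exact/ing_abs/ing_AmB|by apply: ingD => //; exact: ingD|].
  move=> x; rewrite AmB ?En_gt0//.
  have -> : Am (En n) g x - g x = (Am (En n) g x - Am (En n) h x) + (Am (En n) h x - h x) - (g x - h x) by ring.
  by rewrite (le_trans (ler_normB _ _))// lerD2r ler_normD.
rewrite IntD//; last exact: ingD.
rewrite IntD//.
have J := Int_abs_Am (En01 n) igh.
have J2 : (1 - En n) ^- 2 * Int (fun x => `|g x - h x|) <= 4 * Int (fun x => `|g x - h x|).
  by rewrite ler_wpM2r ?En_sq// Int_ge0.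
lra.
Qed.

Lemma cvL1D g h : ing g -> ing h -> cvL1 g -> cvL1 h -> cvL1 (fun x => g x + h x).
Proof.
move=> ig ih cg ch.
have c0 : Int (fun x => `|Am (En n) g x - g x|) + Int (fun x => `|Am (En n) h x - h x|) @[n --> \oo] --> (0 : R).
  by rewrite -[X in _ --> X]addr0; apply: cvgD.
apply: (@squeeze_cvgr _ _ _ _ (fun=> 0) _ _ _ _ _ c0); last exact: cvg_cst.
apply: nearW => n; rewrite Int_ge0 //=.
rewrite -IntD; [|exact/ing_abs/ing_AmB|exact/ing_abs/ing_AmB].
apply: Int_le; [by apply/ing_abs/ing_AmB/ingD|by apply: ingD; exact/ing_abs/ing_AmB|].
move=> x; rewrite AmD ?En_gt0//.
have -> : Am (En n) g x + Am (En n) h x - (g x + h x) = (Am (En n) g x - g x) + (Am (En n) h x - h x) by ring.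
exact: ler_normD.
Qed.

Lemma cvL1Z (a : R) g : ing g -> cvL1 g -> cvL1 (fun x => a * g x).
Proof.
move=> ig cg.
have c0 : `|a| * Int (fun x => `|Am (En n) g x - g x|) @[n --> \oo] --> (0 : R).
  by rewrite -[X in _ --> X](mulr0 `|a|); apply: cvgMr.
move: c0; apply: cvg_trans; apply: near_eq_cvg; apply: nearW => n.
rewrite -IntZ; last exact/ing_abs/ing_AmB.
apply: eq_Int => x; rewrite AmZ ?En_gt0//.
by rewrite -normrM mulrBr.
Qed.

Lemma cvL1_0 : cvL1 (fun=> 0).
Proof.
have -> : cvL1 (fun=> 0) = (Int (fun x => `|Am (En n) (fun=> 0) x - 0|) @[n --> \oo] --> (0 : R)) by [].
apply: cvg_near_cst; apply: nearW => n.
rewrite -[RHS](@Int0 R); apply: eq_Int => x.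
rewrite subr0 /Am; under eq_Int do rewrite mulr0.
by rewrite Int0 normr0.
Qed.

Lemma cvL1_sum (I : Type) (s : seq I) (F : I -> R * R -> R) :
  (forall i, ing (F i)) -> (forall i, cvL1 (F i)) ->
  ing (fun x => \sum_(i <- s) F i x) /\ cvL1 (fun x => \sum_(i <- s) F i x).
Proof.
move=> iF cF; elim: s => [|i s [IH1 IH2]].
  by under eq_fun do rewrite big_nil; split; [exact: ing0|exact: cvL1_0].
under eq_fun do rewrite big_cons; split; [exact: ingD|exact: cvL1D].
Qed.

Lemma Am_cst1 e g x (U : set (R * R)) : (forall k, sq c r k -> g (pt e x k) = 1) -> Am e g x = 1.
Proof.
move=> H; rewrite -Int_th /Am; apply: eq_Int => k.
have [ck|ck] := pselect (sq c r k); first by rewrite H// mulr1.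
by rewrite th_out// mul0r.
Qed.

Lemma pt_near (U : set (R * R)) x : open U -> U x ->
  \forall n \near \oo, forall k, sq c r k -> U (pt (En n) x k).
Proof.
move=> oU Ux; have [d d0 dU] := open_sq oU Ux.
set B := `|x.1| + `|x.2| + `|c.1| + `|c.2| + `|r| + 1.
have B0 : 0 < B by rewrite /B ltr_wpDl ?addr_ge0.
have /cvgrPdist_le/(_ _ (divr_gt0 d0 B0)) := En_cvg.
apply: filterS => n; rewrite sub0r normrN (gtr0_norm (En_gt0 n)) ler_pdivlMr// => EB k [k1 k2].
apply: dU; have e0 := En_gt0 n; split; rewrite /pt /=.
  have -> : (1 - En n) * x.1 + En n * k.1 - x.1 = En n * (k.1 - x.1) by ring.
  rewrite normrM (gtr0_norm e0) (le_trans _ EB)// ler_wpM2l ?(ltW e0)//.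
  have -> : k.1 - x.1 = (k.1 - c.1) + (c.1 - x.1) by ring.
  rewrite (le_trans (ler_normD _ _))//.
  have := ler_normB c.1 x.1; have := ler_norm r.
  rewrite /B; have := normr_ge0 x.2; have := normr_ge0 c.2; lra.
have -> : (1 - En n) * x.2 + En n * k.2 - x.2 = En n * (k.2 - x.2) by ring.
rewrite normrM (gtr0_norm e0) (le_trans _ EB)// ler_wpM2l ?(ltW e0)//.
have -> : k.2 - x.2 = (k.2 - c.2) + (c.2 - x.2) by ring.
rewrite (le_trans (ler_normD _ _))//.
have := ler_normB c.2 x.2; have := ler_norm r.
rewrite /B; have := normr_ge0 x.1; have := normr_ge0 c.1; lra.
Qed.

Lemma ing_indic_sub (A : set (R * R)) M : measurable A -> A `<=` sq (0, 0) M -> ing (\1_A).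
Proof. by move=> mA; exact: ing_indic. Qed.

(* |A - 1_U| = A - 1_U + 2 (1_U - A)^+ *)
Lemma cvL1_open (U : set (R * R)) M : open U -> U `<=` sq (0, 0) M -> cvL1 (\1_U).
Proof.
move=> oU UM; have mU := open_measurable_plane oU.
have iU : ing (\1_U) := ing_indic_sub mU UM.
have U0 (y : R * R) : 0 <= \1_U y :> R by rewrite indicE.
(* Only this positive part calls for dominated convergence: it is below the indicator, and at a
   point of the open set it is eventually 0. The signed difference is integrated exactly by
   [Int_Am]. *)
pose P n x := Num.max 0 (\1_U x - Am (En n) (\1_U) x).
have mP n : mble (P n).
  apply: measurable_maxr; first exact: mble_cst.
  by apply: mbleB; [exact: mble_indic|exact: (smooth_mble (smooth_Am (En_gt0 n) iU))].
have P0 n x : 0 <= P n x by rewrite le_max lexx.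
have PU n x : `|P n x| <= \1_U x.
  rewrite ger0_norm// ge_max U0 /= gerBl Am_ge0//.
have iP n : ing (P n) by exact: ing_le iU (PU n).
have cP : Int (P n) @[n --> \oo] --> (0 : R).
  rewrite -[X in _ --> X](@Int0 R); apply: (Int_dominated mP) iU _ PU; first exact: mble_cst.
  apply: ae_all => x.
  apply: cvg_near_cst.
  have [Ux|Ux] := pselect (U x).
    apply: filterS (pt_near oU Ux) => n Hn.
    rewrite /P (@Am_cst1 _ _ _ setT); last by move=> k /Hn ?; rewrite indicE mem_set.
    by rewrite indicE mem_set// subrr maxxx.
  apply: nearW => n; rewrite /P indicE memNset//= sub0r.
  by apply/max_idPl; rewrite oppr_le0 Am_ge0.
have E n : Int (fun x => `|Am (En n) (\1_U) x - \1_U x|) =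
    ((1 - En n) ^- 2 - 1) * Int (\1_U) + 2 * Int (P n).
  have iA := ing_Am (En01 n) iU.
  rewrite mulrBl mul1r -(Int_Am (En01 n) iU U0) -IntB// -IntZ// -IntD; [|exact: ingB|exact: ingZ].
  apply: eq_Int => x; rewrite /P.
  set a := Am _ _ _; set b := \1_U x.
  have [ab|ba] := lerP a b.
    by rewrite max_r ?subr_ge0//; ring.
  by rewrite max_l ?subr_le0 ?ltW//; ring.
rewrite /cvL1.
have -> : (fun n => Int (fun x => `|Am (En n) (\1_U) x - \1_U x|)) =
  (fun n => ((1 - En n) ^- 2 - 1) * Int (\1_U) + 2 * Int (P n)) by apply/funext => n; rewrite E.
rewrite -[X in _ --> X]addr0; apply: cvgD.
  rewrite -[X in _ --> X](mul0r (Int (\1_U))); apply: cvgMl.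
  by rewrite -[X in _ --> X](subrr (1 : R)); apply: cvgB; [exact: En_sq_cvg|exact: cvg_cst].
by rewrite -[X in _ --> X](mulr0 (2 : R)); apply: cvgMr.
Qed.

Definition Qo (M : R) : set (R * R) := [set x | `|x.1| < M /\ `|x.2| < M].

Lemma open_Qo M : open (Qo M).
Proof.
have -> : Qo M = (fun x : R * R => `|x.1|) @^-1` [set y | y < M] `&` (fun x : R * R => `|x.2|) @^-1` [set y | y < M].
  by apply/seteqP; split.
apply: openI; apply: open_comp; try exact: open_lt.
  by move=> x _; apply: cvg_norm; exact: cvg_fst.
by move=> x _; apply: cvg_norm; exact: cvg_snd.
Qed.

Lemma Qo_sq M : Qo M `<=` sq (0, 0) M.
Proof. by move=> x [h1 h2]; rewrite /sq /= !subr0; split; exact: ltW. Qed.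

(** Dynkin induction on [B], generated by open sets; the fixed window [Qo M] keeps complements and
    countable unions integrable. *)
Lemma cvL1_set M (B : set (R * R)) : measurable B -> cvL1 (\1_(B `&` Qo M)).
Proof.
move=> mB.
have mQ := open_measurable_plane (@open_Qo M).
have iQ (S : set (R * R)) : measurable S -> ing (\1_(S `&` Qo M)).
  move=> mS; apply: (@ing_indic_sub _ M); first exact: measurableI.
  by move=> x [_ /Qo_sq].
apply: (@dynkin_induction _ (R * R)%type [set U : set (R * R) | open U] (fun B => cvL1 (\1_(B `&` Qo M)))) => //.
- exact: plane_measurableE.
- by move=> U V /= oU oV; exact: openI.
- by rewrite setTI; apply: (@cvL1_open _ M); [exact: open_Qo|exact: Qo_sq].
- move=> U /= oU; apply: (@cvL1_open _ M); first by apply: openI => //; exact: open_Qo.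
  by move=> x [_ /Qo_sq].
- move=> S mS cS.
  have cQ : cvL1 (\1_(Qo M)) by apply: (@cvL1_open _ M); [exact: open_Qo|exact: Qo_sq].
  have iQM : ing (\1_(Qo M)) by have := iQ _ measurableT; rewrite setTI.
  have := cvL1D iQM (ingZ (-1) (iQ _ mS)) cQ (@cvL1Z (-1) _ (iQ _ mS) cS).
  congr cvL1; apply/funext => x; rewrite !indicE !in_setI in_setC.
  case: (x \in S); case: (x \in Qo M) => /=; ring.
(* A disjoint union: its finite partial unions are covered by linearity and approach it in L^1 by
   dominated convergence. *)
- move=> F mF tF cF.
  have mUF : measurable (\bigcup_n F n) by exact: bigcup_measurable.
  apply: cvL1_approx; first exact: iQ.
  move=> d d0.
  pose S N x := \sum_(i <- iota 0 N) \1_(F i `&` Qo M) x : R.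
  have SP N := @cvL1_sum nat (iota 0 N) (fun i => \1_(F i `&` Qo M)) (fun i => iQ _ (mF i)) cF.
  have S1 N x : S N x = \1_((\bigcup_(i < N) F i) `&` Qo M) x.
    rewrite /S; have [Qx|Qx] := pselect (Qo M x); last first.
      rewrite indicE memNset; last by move=> [].
      by apply: big1 => i _; rewrite indicE memNset// => -[].
    have [[i /= iN Fx]|nF] := pselect ((\bigcup_(i < N) F i) x).
      rewrite indicE mem_set; last by split => //; exists i.
      rewrite (big_rem i) /=; last by rewrite mem_iota.
      rewrite indicE mem_set//= big1_seq ?addr0// => j /=.
      rewrite mem_rem_uniq ?iota_uniq// inE => /andP[ji _].
      rewrite indicE memNset// => -[Fj _].
      by move: ji; rewrite (tF j i I I) ?eqxx//; exists x.
    rewrite indicE memNset; last by move=> [].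
    apply: big1_seq => i /=; rewrite mem_iota /= add0n => iN.
    by rewrite indicE memNset// => -[Fi _]; apply: nF; exists i.
  have : Int (fun x => `|\1_((\bigcup_n F n) `&` Qo M) x - S n x|) @[n --> \oo] --> (0 : R).
    have iT := iQ _ mUF.
    rewrite -[X in _ --> X](@Int0 R); apply: (Int_dominated _ _ iT).
    - move=> n; apply: mble_abs; apply: mbleB; first exact: (ing_mble iT).
      by apply: ing_mble; case: (SP n).
    - exact: mble_cst.
    - apply: ae_all => x; apply: cvg_near_cst.
      have [[[i _ Fi] Qx]|nF] := pselect (((\bigcup_n F n) `&` Qo M) x).
        exists i.+1 => // n /= iN; rewrite S1 !indicE !mem_set ?subrr ?normr0//.
          by split => //; exists i.
        by split => //; exists i.
      apply: nearW => n; rewrite S1 !indicE !memNset ?subrr ?normr0// => -[[i iN Fi] Qx].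
      by apply: nF; split => //; exists i.
    - move=> n x; rewrite S1 normr_id.
      have sub : ((\bigcup_(i < n) F i) `&` Qo M) x -> ((\bigcup_n F n) `&` Qo M) x.
        by move=> [[i _ Fi] Qx]; split => //; exists i.
      rewrite !indicE; case: (boolP (x \in _ `&` _)) => h1; case: (boolP (x \in _ `&` _)) => h2.
      + by rewrite subrr normr0.
      + by rewrite subr0 normr1.
      + by exfalso; move/negP: h1; apply; rewrite inE; apply: sub; rewrite inE in h2.
      + by rewrite subrr normr0.
  move=> /cvgrPdist_le/(_ _ d0)/(@filter_ex _ _ _)[N].
  rewrite sub0r normrN (ger0_norm (Int_ge0 _))// => HN.
  by exists (S N); case: (SP N).
- by rewrite -plane_measurableE.
Qed.

(** Simple functions approximate [g] in L^1. Multiplying them by the indicator of [Qo M] does not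
    increase the distance to [g] and reduces them to [cvL1_set]. *)
Lemma cvL1_all M g : ing g -> (forall x, ~ Qo M x -> g x = 0) -> cvL1 g.
Proof.
move=> ig g0.
have mQ := open_measurable_plane (@open_Qo M).
apply: cvL1_approx => // d d0.
have [s [is_ _ cs]] := @approximation_sfun_integrable _ _ R mu setT measurableT (EFin \o g) ig.
have sE n x : s n x = \sum_(y \in range (s n)) y * \1_(s n @^-1` [set y]) x by exact: fimfunE.
pose h n x := \1_(Qo M) x * s n x.
pose pre n (y : R) : set (R * R) := s n @^-1` [set y].
have hP n : ing (h n) /\ cvL1 (h n).
  have fr := fimfunP (s n).
  have -> : h n = (fun x : R * R => \sum_(y <- finmap.enum_fset (fset_set (range (s n)))) (y * \1_(pre n y `&` Qo M) x)).
    apply/funext => x; rewrite /h sE fsbig_finite//= mulr_sumr; apply: eq_bigr => y _.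
    rewrite mulrCA; congr (_ * _).
    by rewrite !indicE in_setI; case: (_ \in Qo M); case: (_ \in _) => //=; rewrite ?mulr1 ?mulr0.
  have ms y : measurable (pre n y).
    have m : mble (s n) by apply: ing_mble; exact: (is_ n).
    by rewrite /pre -[X in measurable X]setTI; apply: m => //; exact: measurable_set1.
  have im y : ing (\1_(pre n y `&` Qo M)).
    apply: (@ing_indic_sub _ M); first exact: measurableI.
    by move=> x [_ /Qo_sq].
  apply: cvL1_sum => y; first exact: ingZ.
  by apply: cvL1Z => //; exact: cvL1_set.
move: cs => /fine_cvgP[_ /cvgrPdist_le /(_ _ d0)/(@filter_ex _ _ _)[n]].
rewrite sub0r normrN /= => Hn.
exists (h n); case: (hP n) => ih ch; split => //.
apply: le_trans Hn.
have i2 : ing (fun x => g x - s n x) by apply: ingB => //; exact: (is_ n).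
have -> : fine (\int[mu]_z `|(EFin \o g) z - (s n z)%:E|)%E = Int (fun x => `|g x - s n x|) by [].
rewrite ger0_norm; last exact: Int_ge0.
apply: Int_le; [by apply/ing_abs/ingB|exact: ing_abs|].
move=> x; rewrite /h indicE; have [Qx|Qx] := pselect (Qo M x).
  by rewrite mem_set// mul1r.
by rewrite memNset// mul0r subr0 g0// normr0.
Qed.

End Am.
End MollifierConvergence.

(** * Convergence of the averages in L^2 and the fundamental lemma of the calculus of variations *)

Section WeakDerivatives.
Variable R : realType.
Local Notation mu := (@area R).
Implicit Types (f g v : R * R -> R) (A K : set (R * R)).

Lemma sqi_cst_Q M : sqi (\1_(@Qo R M)).
Proof.
have mQ := open_measurable_plane (@open_Qo R M).
split; first exact: mble_indic.
have iQ : ing (\1_(@Qo R M)) by apply: ing_indic mQ _; exact: Qo_sq.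
apply: eq_ing iQ => x; rewrite indicE.
by case: (x \in _); rewrite ?expr1n ?expr0n.
Qed.

Lemma sqi_ing M g : sqi g -> (forall x, ~ Qo M x -> g x = 0) -> ing g.
Proof.
move=> sg g0; have := sqi_mul (sqi_cst_Q M) sg; apply: eq_ing => x.
rewrite indicE; have [Qx|Qx] := pselect (Qo M x); first by rewrite mem_set// mul1r.
by rewrite g0// mulr0.
Qed.

Section Am2.
Variables (th : R * R -> R) (c : R * R) (r : R).
Hypotheses (th_test : test_fun setT th) (th_ge0 : forall x, 0 <= th x)
  (Int_th : Int th = 1) (th_out : forall x, ~ sq c r x -> th x = 0).
Local Notation Amt := (Am th).

(** Jensen's inequality: the variance of [g] under the probability density [th] is nonnegative. *)
Lemma Am_jensen e g x : 0 < e -> ing g -> sqi g -> Amt e g x ^+ 2 <= Amt e (fun y => g y ^+ 2) x.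
Proof.
move=> e0 ig [_ g2].
set m := Amt e g x.
have i1 := Am_ing th_test x e0 g2; have i2 := Am_ing th_test x e0 ig.
have i3 := test_ing th_test.
have : 0 <= Int (fun k => (th k * g (pt e x k) ^+ 2 - 2 * m * (th k * g (pt e x k))) + m ^+ 2 * th k).
  apply: Int_ge0 => k.
  have -> : th k * g (pt e x k) ^+ 2 - 2 * m * (th k * g (pt e x k)) + m ^+ 2 * th k = th k * (g (pt e x k) - m) ^+ 2 by ring.
  by rewrite mulr_ge0// sqr_ge0.
rewrite IntD; [|by apply: ingB => //; exact: ingZ|exact: ingZ].
rewrite IntB//; last exact: ingZ.
rewrite !IntZ// Int_th.
have -> : Int (fun k => th k * g (pt e x k)) = m by [].
have -> : Int (fun k => th k * g (pt e x k) ^+ 2) = Amt e (fun y => g y ^+ 2) x by [].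
by rewrite expr2 => H; lra.
Qed.

Lemma sqi_Am e g : 0 < e < 1 -> ing g -> sqi g -> sqi (Amt e g).
Proof.
move=> e01 ig sg; have /andP[e0 e1] := e01; have [_ g2] := sg.
have mA := smooth_mble (smooth_Am th_test e0 ig); split => //.
apply: (ing_le (mbleX 2 mA) (ing_Am_ge0 th_test th_ge0 Int_th e01 g2 (fun=> sqr_ge0 _))) => x.
by rewrite ger0_norm ?sqr_ge0//; exact: Am_jensen.
Qed.

Lemma n2_Am e g : 0 < e < 1 -> ing g -> sqi g -> n2 (Amt e g) <= (1 - e)^-1 * n2 g.
Proof.
move=> e01 ig sg; have /andP[e0 e1] := e01; have [_ g2] := sg.
have e10 : 0 <= (1 - e)^-1 by rewrite invr_ge0 subr_ge0 ltW.
rewrite -(@ler_pXn2r _ 2) ?nnegrE ?mulr_ge0 ?n2_ge0//.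
rewrite exprMn !n2_sq exprVn -(Int_Am th_test th_ge0 Int_th e01 g2 (fun=> sqr_ge0 _)).
apply: Int_le; [by have [] := sqi_Am e01 ig sg|exact: (ing_Am_ge0 th_test th_ge0 Int_th e01 g2 (fun=> sqr_ge0 _))|].
by move=> x; exact: Am_jensen.
Qed.

Lemma n2_Am_En n g : ing g -> sqi g -> n2 (Amt (En R n) g) <= 2 * n2 g.
Proof.
move=> ig sg; apply: (le_trans (n2_Am (@En01 R n) ig sg)).
rewrite ler_wpM2r ?n2_ge0//.
have h := @En_le R n; have -> : 2 = (2^-1 : R)^-1 by rewrite invrK.
by rewrite lef_pV2 ?posrE//; lra.
Qed.

Definition trunc (k : nat) g (x : R * R) : R := Num.max (- k%:R) (Num.min k%:R (g x)).

Lemma trunc_le k g x : `|trunc k g x| <= k%:R.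
Proof.
have k0 : 0 <= k%:R :> R by [].
by rewrite /trunc ler_norml le_max lexx /= ge_max ge_min lexx /= andbT; lra.
Qed.

Lemma trunc_le2 k g x : `|trunc k g x| <= `|g x|.
Proof.
have k0 : 0 <= k%:R :> R by [].
rewrite /trunc; have [h|h] := lerP k%:R (g x).
  rewrite max_r; last by lra.
  by rewrite !ger0_norm//; lra.
have [h2|h2] := lerP (- k%:R) (g x); first by [].
by rewrite !ler0_norm; lra.
Qed.

Lemma mble_trunc k g : mble g -> mble (trunc k g).
Proof.
by move=> mg; apply: measurable_maxr; [exact: mble_cst|apply: measurable_minr => //; exact: mble_cst].
Qed.

Lemma trunc_cvg g : sqi g -> n2 (fun x => g x - trunc n g x) @[n --> \oo] --> (0 : R).
Proof.
move=> [mg g2].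
have H : Int (fun x => (g x - trunc n g x) ^+ 2) @[n --> \oo] --> (0 : R).
  rewrite -[X in _ --> X](@Int0 R); apply: (Int_dominated _ _ g2).
  - by move=> n; apply: mbleX; apply: mbleB => //; exact: mble_trunc.
  - exact: mble_cst.
  - apply: ae_all => x; apply: cvg_near_cst.
    exists (Num.truncn `|g x|).+1 => // n /= hn.
    have gn : `|g x| <= n%:R.
      apply: (le_trans (ltW (Num.Theory.truncnS_gt `|g x|))); by rewrite ler_nat.
    move: gn; rewrite ler_norml => /andP[h1 h2].
    by rewrite /trunc min_r// max_r// subrr expr0n.
  - move=> n x; rewrite ger0_norm ?sqr_ge0//.
    have k0 : 0 <= n%:R :> R by [].
    rewrite -[leLHS]real_normK ?num_real// -[leRHS]real_normK ?num_real// lerXn2r ?nnegrE//.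
    rewrite /trunc; have [h|h] := lerP n%:R (g x).
      rewrite max_r; last by lra.
      by rewrite !ger0_norm//; lra.
    have [h2|h2] := lerP (- n%:R) (g x); first by rewrite subrr normr0.
    by rewrite !ler0_norm; lra.
rewrite -sqrtr0; apply: (continuous_cvg _ _ H); exact: sqrt_continuous.
Qed.

(** For a truncation [t] at level [k], the square of [Amt t - t] is at most [2 * k] times its
    modulus, so convergence in L^1 gives convergence in L^2. The remainder [g - t] is controlled by
    the uniform L^2 bound of the averages. *)
Lemma cvL2 M g : sqi g -> (forall x, ~ Qo M x -> g x = 0) ->
  n2 (fun x => Amt (En R n) g x - g x) @[n --> \oo] --> (0 : R).
Proof.
move=> sg g0; have ig := sqi_ing sg g0; have [mg _] := sg.
apply/cvgrPdist_le => /= e e0.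
have e60 : 0 < e / 6 by rewrite divr_gt0.
have /cvgrPdist_le/(_ _ e60)/(@filter_ex _ _ _)[k] := trunc_cvg sg.
rewrite sub0r normrN ger0_norm ?n2_ge0// => hk.
pose t := trunc k g.
have st : sqi t by apply: sqi_le (mble_trunc k mg) sg _ => x; exact: trunc_le2.
have t0 x : ~ Qo M x -> t x = 0.
  by move=> /g0 gx; apply/eqP; rewrite -normr_le0 (le_trans (trunc_le2 _ _ _))// gx normr0.
have it := sqi_ing st t0.
have c1 := cvL1_all th_test th_ge0 Int_th th_out it t0.
have d0 : 0 < (e / 6) ^+ 2 / (2 * k%:R + 1) by rewrite divr_gt0 ?exprn_gt0// ltr_wpDl// mulr_ge0.
move/cvgrPdist_le : c1 => /(_ _ d0); apply: filterS => n.
rewrite !sub0r !normrN (ger0_norm (Int_ge0 _))// ger0_norm ?n2_ge0// => hn.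
have sgt : sqi (fun x => g x - t x) by exact: sqiB.
have igt : ing (fun x => g x - t x) by exact: ingB.
have sA := sqi_Am (@En01 R n) it st.
have sAB : sqi (fun x => Amt (En R n) t x - t x) by exact: sqiB.
have P1 : n2 (fun x => Amt (En R n) t x - t x) <= e / 6.
  rewrite -(@ler_pXn2r _ 2) ?nnegrE ?n2_ge0 ?(ltW e60)// n2_sq.
  have k0 : 0 <= 2 * k%:R :> R by rewrite mulr_ge0.
  apply: (@le_trans _ _ (2 * k%:R * Int (fun x => `|Amt (En R n) t x - t x|))).
    rewrite -IntZ; last exact/ing_abs/ing_AmB.
    apply: Int_le; [by case: sAB|by apply/ingZ/ing_abs/ing_AmB|move=> x].
    rewrite -[leLHS]real_normK ?num_real// expr2 ler_wpM2r//.
    apply: (le_trans (ler_normB _ _)); rewrite mulrDl mul1r lerD ?trunc_le//.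
    have Ac : Amt (En R n) (fun=> k%:R) x = k%:R.
      rewrite /Am; under eq_Int do rewrite mulrC.
      by rewrite IntZ ?Int_th ?mulr1//; exact: test_ing th_test.
    have iA := Am_ing th_test x (@En_gt0 R n) it.
    apply: (le_trans (Int_abs_le iA)); rewrite -[leRHS]Ac.
    apply: Int_le; [exact: ing_abs| |].
      by apply: eq_ing (ingZ k%:R (test_ing th_test)) => y; rewrite mulrC.
    by move=> y; rewrite normrM (ger0_norm (th_ge0 _)) ler_wpM2l// trunc_le.
  apply: (le_trans (ler_wpM2l k0 hn)).
  rewrite mulrC -mulrA ger_pMr ?exprn_gt0// mulrC ler_pdivrMr ?ltr_wpDl// mul1r lerDl//.
have P2 : n2 (Amt (En R n) (fun x => g x - t x)) <= 2 * (e / 6).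
  by apply: (le_trans (n2_Am_En n igt sgt)); rewrite ler_wpM2l.
have sA2 := sqi_Am (@En01 R n) igt sgt.
have -> : (fun x => Amt (En R n) g x - g x) =
  (fun x => (Amt (En R n) (fun x => g x - t x) x + (Amt (En R n) t x - t x)) - (g x - t x)).
  by apply/funext => x; rewrite (AmB th_test _ (@En_gt0 R n) ig it); ring.
have nN f : n2 (fun x => - f x) = n2 f.
  by rewrite /n2; congr Num.sqrt; apply: eq_Int => x; rewrite sqrrN.
have sN : sqi (fun x => - (g x - t x)).
  by have := @sqiZ _ (-1) _ sgt; congr sqi; apply/funext => x; rewrite mulN1r.
apply: (le_trans (n2D (sqiD sA2 sAB) sN)); rewrite nN.
have := n2D sA2 sAB; lra.
Qed.

End Am2.

Lemma ae_forall_nat (P : nat -> R * R -> Prop) : (forall n, {ae mu, forall x, P n x}) ->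
  {ae mu, forall x, forall n, P n x}.
Proof. by move=> H; apply: ae_foralln. Qed.

Lemma L1loc_comp A C d : open A -> L1loc A d -> compact C -> C `<=` A -> measurable C -> ing (rs C d).
Proof.
move=> oA [md H] cC CA mC.
have mdC : measurable_fun C d by apply: measurable_funS md => //; exact: open_measurable_plane.
apply/integrableP; split; first by apply/measurable_EFinP; exact: mble_rs.
apply: le_lt_trans (H C cC CA).
rewrite [leRHS]integral_mkcond; apply: ge0_le_integral => //=.
- by apply/measurable_EFinP; apply: mble_abs; exact: mble_rs.
- apply/(measurable_restrictT _ mC); apply/measurable_EFinP; exact: measurableT_comp.
move=> x _; rewrite patchE /rs indicE; case: (x \in C); first by rewrite mul1r.
by rewrite mul0r normr0.
Qed.

Lemma L1loc_test A g phi : open A -> L1loc A g -> test_fun A phi -> ing (rs A (fun x => g x * phi x)).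
Proof.
move=> oA lg tp; have [sp [C cC [CA p0]]] := tp.
have mC : measurable C by apply: closed_measurable_plane; apply: compact_closed => //; exact: norm_hausdorff.
have [M M0 HM] := test_bounded tp.
have i1 := L1loc_comp oA lg cC CA mC.
apply: eq_ing (ing_bounded (smooth_mble sp) i1 HM) => x.
have [Cx|Cx] := pselect (C x); first by rewrite !rs_in//; [exact: mulrC|exact: CA].
by rewrite p0// mul0r /rs p0 ?mulr0.
Qed.

Lemma sq_in_Qo (c : R * R) r : exists M, sq c r `<=` Qo M.
Proof.
have [M [M0 H]] := compact_in_sq (@compact_sq R c r).
have MM : M < M + 1 by rewrite ltrDl.
exists (M + 1) => x /H; rewrite /sq /= !subr0 => -[h1 h2].
by split; apply: le_lt_trans MM.
Qed.

Lemma pt_in_sq (c : R * R) r s e x k : 0 < e < 1 -> s <= r -> sq c r x -> sq c s k -> sq c r (pt e x k).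
Proof.
move=> /andP[e0 e1] sr [x1 x2] [k1 k2]; split; rewrite /pt /=.
  have -> : (1 - e) * x.1 + e * k.1 - c.1 = (1 - e) * (x.1 - c.1) + e * (k.1 - c.1) by ring.
  rewrite (le_trans (ler_normD _ _))// !normrM [`|1 - e|]gtr0_norm ?subr_gt0// [`|e|]gtr0_norm//.
  have -> : r = (1 - e) * r + e * r by ring.
  by apply: lerD; apply: ler_wpM2l => //; [rewrite subr_ge0 ltW|exact: ltW|exact: le_trans sr].
have -> : (1 - e) * x.2 + e * k.2 - c.2 = (1 - e) * (x.2 - c.2) + e * (k.2 - c.2) by ring.
rewrite (le_trans (ler_normD _ _))// !normrM [`|1 - e|]gtr0_norm ?subr_gt0// [`|e|]gtr0_norm//.
have -> : r = (1 - e) * r + e * r by ring.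
by apply: lerD; apply: ler_wpM2l => //; [rewrite subr_ge0 ltW|exact: ltW|exact: le_trans sr].
Qed.

(* y |-> theta((y - (1 - e) x) / e) *)
Definition kth (th : R * R -> R) (e : R) (x y : R * R) : R :=
  th (e^-1 * y.1 - ((1 - e) / e) * x.1, e^-1 * y.2 - ((1 - e) / e) * x.2).

Lemma kth_sct th e x : kth th e x = (fun y => th (sct e^-1 (- (((1 - e) / e) * x.1), - (((1 - e) / e) * x.2)) y)).
Proof. by []. Qed.

Lemma kth_test A th c r e x : 0 < e -> smooth th -> (forall x, ~ sq c r x -> th x = 0) ->
  (forall k, sq c r k -> A (pt e x k)) -> test_fun A (kth th e x).
Proof.
move=> e0 sth th0 HA; split; first by rewrite kth_sct; exact: smooth_sct.
exists ((fun k => pt e x k) @` sq c r).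
  apply: continuous_compact; last exact: compact_sq.
  apply: continuous_subspaceT => k.
  have -> : (fun k => pt e x k) = aff ((1 - e) * x.1, (1 - e) * x.2) (e, 0) (0, e).
    by apply/funext => k'; rewrite pt_aff.
  exact: continuous_aff.
split; first by move=> _ [k ck <-]; exact: HA.
move=> y Hy; apply: th0 => ck; apply: Hy.
exists (e^-1 * y.1 - ((1 - e) / e) * x.1, e^-1 * y.2 - ((1 - e) / e) * x.2) => //.
have en : e != 0 by rewrite gt_eqF.
by rewrite /pt /=; case: y {ck} => y1 y2 /=; congr pair; field.
Qed.

Lemma kth_pd th e x i : smooth th -> pd i (kth th e x) = fun y => e^-1 * kth (pd i th) e x y.
Proof. by move=> sth; rewrite !kth_sct pd_sct. Qed.

(** On a square contained in [A], the averages of [d] are its integrals against the test functions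
    [kth th e x], hence 0, and they converge to [d] in L^1. Countably many rational squares cover
    [A]. *)
Lemma fund_lemma A d : open A -> L1loc A d ->
  (forall phi, test_fun A phi -> Int (rs A (fun x => d x * phi x)) = 0) ->
  {ae mu, forall x, A x -> d x = 0}.
Proof.
move=> oA ld H.
suff S n : {ae mu, forall x, sq (ratsq_c R n) (ratsq_r R n) `<=` A -> sq (ratsq_c R n) (ratsq_r R n) x -> d x = 0}.
  apply: aeS (ae_forall_nat S) => x Hx Ax.
  move: (Ax); rewrite {1}(open_ratsqE oA) => -[n /= nA nx]; exact: (Hx n nA nx).
set c := ratsq_c R n; set r := ratsq_r R n.
have r0 : 0 < r by exact: ratsq_r_gt0.
have [sA|] := pselect (sq c r `<=` A); last by move=> nA; apply: ae_all => x /nA.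
pose s := r / 2.
have s0 : 0 < s by rewrite divr_gt0.
have sr : s <= r by rewrite /s ler_pdivrMr// ler_pMr// ler1n.
pose th := moll c s.
have tt : test_fun setT th by apply: moll_test.
have t0 x : 0 <= th x by exact: moll_ge0.
have t1 : Int th = 1 by exact: Int_moll.
have tout x : ~ sq c s x -> th x = 0 by exact: moll_out.
pose g := rs (sq c r) d.
have msq := @measurable_sq R c r.
have ig : ing g by apply: L1loc_comp oA ld _ sA msq; exact: compact_sq.
have [M HM] := sq_in_Qo c r.
have g0 x : ~ Qo M x -> g x = 0 by move=> Qx; apply: rs_out => /HM.
have := cvL1_all tt t0 t1 tout ig g0 => CV.
have Az k x : sq c r x -> Am th (En R k) g x = 0.
  move=> xs; rewrite (Am_cv tt)//; last exact: En_gt0.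
  have tk : test_fun (sq c r) (kth th (En R k) x).
    apply: (kth_test (c := c) (r := s)) => //; [exact: En_gt0|exact: (test_smooth tt)|].
    by move=> k' ck; apply: (pt_in_sq (@En01 R k) sr xs ck).
  have tkA := test_sub sA tk.
  suff -> : cv (En R k)^-1 ((1 - En R k) / En R k) th g x = Int (rs A (fun y => d y * kth th (En R k) x y)).
    by rewrite H// mulr0.
  apply: eq_Int => y; rewrite /g /rs -/(kth th (En R k) x y).
  have [ys|ys] := pselect (sq c r y).
    by rewrite !indicE !mem_set ?mul1r 1?mulrC//; exact: sA.
  by rewrite (test_out tk)// mul0r mulr0 mulr0.
have Ig : Int (fun x => `|g x|) = 0.
  apply/eqP; rewrite eq_le Int_ge0// andbT.
  apply/ler_addgt0Pr => e e0; rewrite add0r.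
  move/cvgrPdist_le : CV => /(_ _ e0)/(@filter_ex _ _ _)[k].
  rewrite sub0r normrN (ger0_norm (Int_ge0 _))// => hk; apply: le_trans hk.
  apply: Int_le; [exact: ing_abs|exact/ing_abs/ing_AmB|].
  move=> x; have [xs|xs] := pselect (sq c r x); first by rewrite Az// sub0r normrN.
  by rewrite /g rs_out// normr0.
have := Int0_ae (ing_abs ig) (fun=> normr_ge0 _) Ig.
apply: aeS => x /eqP; rewrite normr_eq0 => /eqP gx _ xs.
by rewrite -gx /g rs_in.
Qed.

End WeakDerivatives.

(** * Uniqueness of weak derivatives and density of smooth functions in H^1 *)

Section SobolevH1.
Variable R : realType.
Local Notation mu := (@area R).
Implicit Types (f g v : R * R -> R) (A K : set (R * R)).

Lemma rsM A f g x : rs A (fun y => f y * g y) x = rs A f x * g x.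
Proof. by rewrite /rs mulrA. Qed.
Lemma rsB A f g x : rs A (fun y => f y - g y) x = rs A f x - rs A g x.
Proof. by rewrite /rs mulrBr. Qed.
Lemma rsD A f g x : rs A (fun y => f y + g y) x = rs A f x + rs A g x.
Proof. by rewrite /rs mulrDr. Qed.

Lemma int_abs_lty C f : ing (rs C f) -> (\int[mu]_(x in C) (`|f x|)%:E < +oo)%E.
Proof.
move=> i1; have H := Int_EFin (ing_abs i1).
suff -> : (\int[mu]_(x in C) (`|f x|)%:E)%E = (\int[mu]_x (`|rs C f x|)%:E)%E by rewrite H ltry.
rewrite integral_mkcond; apply: eq_integral => x _; rewrite patchE /rs indicE.
by case: (x \in C); rewrite ?mul1r// mul0r normr0.
Qed.

Lemma compact_measurable_plane (C : set (R * R)) : compact C -> measurable C.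
Proof. by move=> cC; apply: closed_measurable_plane; apply: compact_closed => //; exact: norm_hausdorff. Qed.

Lemma Lsp_L1loc A f : open A -> Lsp 2 A f -> L1loc A f.
Proof.
move=> oA; have mA := open_measurable_plane oA.
move=> /(Lsp2P _ mA)[mf sf]; split => // C cC CA.
have mC := compact_measurable_plane cC.
have [M [M0 HM]] := compact_in_sq cC.
have sC : sqi (\1_C : R * R -> R).
  split; first exact: mble_indic.
  have iC : ing (\1_C : R * R -> R) by apply: ing_indic HM.
  apply: eq_ing iC => x; rewrite indicE.
  by case: (x \in _); rewrite ?expr1n ?expr0n.
apply: int_abs_lty; apply: eq_ing (sqi_mul sC sf) => x.
rewrite /rs !indicE; case: (boolP (x \in C)) => [|_]; last by rewrite !mul0r.
by rewrite inE => /CA Ax; rewrite (mem_set Ax) !mul1r.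
Qed.

Lemma L1loc_sub A B f : measurable B -> A `<=` B -> L1loc B f -> L1loc A f.
Proof.
move=> mB AB [mf H]; split; first exact: (measurable_funS mB AB mf).
by move=> C cC CA; apply: H => // x /CA /AB.
Qed.

Lemma L1loc_cont A f : measurable A -> continuous f -> L1loc A f.
Proof.
move=> mA cf; have mf := continuous_measurable_plane cf; split; first exact: mble_on.
move=> C cC _; have mC := compact_measurable_plane cC.
have [M [M0 HM]] := compact_in_sq cC.
by apply: int_abs_lty; exact: ing_cont_sq mC HM cf.
Qed.

Lemma L1locB A f g : open A -> L1loc A f -> L1loc A g -> L1loc A (fun x => f x - g x).
Proof.
move=> oA lf lg; have [mf _] := lf; have [mg _] := lg.
split; first exact: measurable_funB.
move=> C cC CA; have mC := compact_measurable_plane cC.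
apply: int_abs_lty; apply: eq_ing (ingB (L1loc_comp oA lf cC CA mC) (L1loc_comp oA lg cC CA mC)) => x.
by rewrite rsB.
Qed.

Lemma is_wD_uniq A i v g h : open A -> is_wD A i v g -> is_wD A i v h ->
  {ae mu, forall x, A x -> g x = h x}.
Proof.
move=> oA [lv lg Hg] [_ lh Hh].
have := fund_lemma oA (L1locB oA lg lh).
suff H : forall phi, test_fun A phi -> Int (rs A (fun x => (g x - h x) * phi x)) = 0.
  by move=> /(_ H); apply: aeS => x Hx /Hx /eqP; rewrite subr_eq0 => /eqP.
move=> phi tp.
have := Hg _ tp; rewrite Hh// !integE => /oppr_inj E.
have ig := L1loc_test oA lg tp; have ih := L1loc_test oA lh tp.
transitivity (Int (fun x => rs A (fun x => g x * phi x) x - rs A (fun x => h x * phi x) x)).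
  by apply: eq_Int => x; rewrite -rsB; congr (_ * _); ring.
by rewrite IntB// E subrr.
Qed.

Lemma wD_is A i v g : is_wD A i v g -> is_wD A i v (wD A i v).
Proof. by move=> H; rewrite /wD; case: xgetP => [y -> //|/(_ g)]; exact. Qed.

Lemma wD_ae A i v g : open A -> is_wD A i v g -> {ae mu, forall x, A x -> wD A i v x = g x}.
Proof. by move=> oA H; exact: is_wD_uniq oA (wD_is H) H. Qed.

Lemma L1loc_ae A f g : open A -> {ae mu, forall x, A x -> f x = g x} -> measurable_fun A g ->
  L1loc A f -> L1loc A g.
Proof.
move=> oA fg mg lf; split => // C cC CA.
have [mf H] := lf; have mA := open_measurable_plane oA.
have mC := compact_measurable_plane cC.
rewrite (_ : (\int[mu]_(x in C) _)%E = (\int[mu]_(x in C) (`|f x|)%:E)%E); first exact: H.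
have mfC := measurable_funS mA CA mf; have mgC := measurable_funS mA CA mg.
apply: ae_eq_integral => //=.
- by apply/measurable_EFinP; exact: measurableT_comp.
- by apply/measurable_EFinP; exact: measurableT_comp.
- by apply: aeS fg => x Hx /CA /Hx ->.
Qed.

Lemma integ_ae A f g : measurable A -> measurable_fun A f -> measurable_fun A g ->
  {ae mu, forall x, A x -> f x = g x} -> integ A f = integ A g.
Proof.
move=> mA mf mg fg; rewrite !integE; apply: Int_ae; [exact: mble_rs|exact: mble_rs|].
apply: aeS fg => x Hx; rewrite /rs indicE; case: (boolP (x \in A)); last by rewrite !mul0r.
by rewrite inE => /Hx ->.
Qed.

Lemma is_wD_ae A i v v' g g' : open A -> measurable_fun A v' -> measurable_fun A g' ->
  {ae mu, forall x, A x -> v x = v' x} -> {ae mu, forall x, A x -> g x = g' x} ->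
  is_wD A i v g -> is_wD A i v' g'.
Proof.
move=> oA mv mg vv gg [lv lg H]; have mA := open_measurable_plane oA.
split; [exact: L1loc_ae vv mv lv|exact: L1loc_ae gg mg lg|move=> phi tp].
have mphi B h : test_fun A h -> measurable_fun B h.
  by move=> th; apply: mble_on; exact: (smooth_mble (test_smooth th)).
have [mv0 _] := lv; have [mg0 _] := lg.
rewrite -(@integ_ae A (fun x => v x * pd i phi x))//; last 3 first.
- by apply: measurable_funM => //; exact: (mphi _ _ (test_pd i tp)).
- by apply: measurable_funM => //; exact: (mphi _ _ (test_pd i tp)).
- by apply: aeS vv => x Hx /Hx ->.
rewrite H//; congr (- _); apply: integ_ae => //.
- by apply: measurable_funM => //; exact: mphi.
- by apply: measurable_funM => //; exact: mphi.
- by apply: aeS gg => x Hx /Hx ->.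
Qed.

Lemma test_rs A f phi : test_fun A phi -> rs A (fun x => f x * phi x) = (fun x => f x * phi x).
Proof.
move=> tp; apply/funext => x; have [Ax|Ax] := pselect (A x); first by rewrite rs_in.
by rewrite rs_out// (test_out tp)// mulr0.
Qed.

Lemma is_wD_sub A B i v g : open A -> open B -> A `<=` B -> is_wD B i v g -> is_wD A i v g.
Proof.
move=> oA oB AB [lv lg H]; have mB := open_measurable_plane oB.
split; [exact: L1loc_sub AB lv|exact: L1loc_sub AB lg|move=> phi tp].
have := H _ (test_sub AB tp); rewrite !integE.
rewrite !(test_rs _ (test_sub AB tp)) !(test_rs _ tp).
by rewrite !(test_rs _ (test_pd i tp)) !(test_rs _ (test_sub AB (test_pd i tp))).
Qed.

Lemma is_wD_smooth A i f : open A -> smooth f -> is_wD A i f (pd i f).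
Proof.
move=> oA sf; have mA := open_measurable_plane oA.
split; [exact: L1loc_cont (smooth_cont sf)|exact: (L1loc_cont mA (smooth_cont (@smooth_pd _ i _ sf)))|].
move=> phi tp; rewrite !integE (test_rs _ tp) (test_rs _ (test_pd i tp)).
exact: Int_parts tp.
Qed.

Lemma is_wDB A i v g v' g' : open A -> is_wD A i v g -> is_wD A i v' g' ->
  is_wD A i (fun x => v x - v' x) (fun x => g x - g' x).
Proof.
move=> oA [lv lg H] [lv' lg' H']; split; [exact: L1locB|exact: L1locB|move=> phi tp].
have := H _ tp; have := H' _ tp; rewrite !integE => E' E.
have tq := test_pd i tp.
transitivity (Int (fun x => rs A (fun x => v x * pd i phi x) x - rs A (fun x => v' x * pd i phi x) x)).
  by apply: eq_Int => x; rewrite -rsB; congr (_ * _); ring.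
rewrite IntB; [|exact: L1loc_test|exact: L1loc_test].
rewrite E E' -opprB opprK addrC -IntB; [|exact: L1loc_test|exact: L1loc_test].
by congr (- _); apply: eq_Int => x; rewrite -rsB; congr (_ * _); ring.
Qed.

(** H^1 with a named gradient: explicit gradients pass to subsets and to differences, whereas [wD]
    chooses a new representative for each set and each function. *)
Definition H1p A v (G : 'I_2 -> R * R -> R) :=
  Lsp 2 A v /\ forall i, is_wD A i v (G i) /\ Lsp 2 A (G i).

Lemma Lsp_ae A f g : open A -> measurable_fun A g -> {ae mu, forall x, A x -> f x = g x} -> Lsp 2 A f -> Lsp 2 A g.
Proof.
move=> oA mg fg; have mA := open_measurable_plane oA.
move=> /(Lsp2P _ mA)[mf sf]; apply/(Lsp2P _ mA); split => //.
apply: sqi_ae sf; first exact: mble_rs.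
apply: aeS fg => x Hx; rewrite /rs indicE; case: (boolP (x \in A)); last by rewrite !mul0r.
by rewrite inE => /Hx ->.
Qed.

Lemma H1p_W1 A v G : open A -> H1p A v G -> W1 2 A v.
Proof.
move=> oA [sv HG]; split => // i; have [w s] := HG i; have W := wD_is w.
split => //; have [_ [mw _] _] := W.
apply: Lsp_ae s => //; apply: aeS (wD_ae oA w) => x Hx Ax; exact/esym/Hx.
Qed.

Lemma W1_H1p A v : W1 2 A v -> H1p A v (fun i => wD A i v).
Proof. by move=> [sv H]; split => // i; have [] := H i. Qed.

Lemma Lsp_sub A B f : measurable A -> measurable B -> A `<=` B -> Lsp 2 B f -> Lsp 2 A f.
Proof.
move=> mA mB AB /(Lsp2P _ mB)[mf sf]; have mfA := measurable_funS mB AB mf.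
apply/(Lsp2P _ mA); split => //.
apply: sqi_le sf _; first exact: mble_rs.
move=> x; rewrite /rs !indicE; case: (boolP (x \in A)) => [|_].
  by rewrite inE => /AB Bx; rewrite mem_set.
by rewrite mul0r normr0.
Qed.

Lemma H1p_sub A B v G : open A -> open B -> A `<=` B -> H1p B v G -> H1p A v G.
Proof.
move=> oA oB AB [sv H]; have mA := open_measurable_plane oA; have mB := open_measurable_plane oB.
split; first exact: Lsp_sub AB sv.
by move=> i; have [w s] := H i; split; [exact: is_wD_sub AB w|exact: Lsp_sub AB s].
Qed.

Lemma Lsp_smooth A M f : measurable A -> A `<=` sq (0, 0) M -> smooth f -> Lsp 2 A f.
Proof.
move=> mA AM sf; apply/(Lsp2P _ mA); split; first (apply: mble_on; exact: smooth_mble).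
split; first by apply: mble_rs => //; (apply: mble_on; exact: smooth_mble).
have c2 : continuous (fun x => f x * f x) by apply: smooth_cont; exact: smoothM.
apply: eq_ing (ing_cont_sq mA AM c2) => x; rewrite /rs indicE.
by case: (x \in A); rewrite ?mul1r ?mul0r ?expr0n.
Qed.

Lemma LspB A f g : measurable A -> Lsp 2 A f -> Lsp 2 A g -> Lsp 2 A (fun x => f x - g x).
Proof.
move=> mA /(Lsp2P _ mA)[mf sf] /(Lsp2P _ mA)[mg sg]; apply/(Lsp2P _ mA); split.
  exact: measurable_funB.
by have := sqiB sf sg; congr sqi; apply/funext => x; rewrite rsB.
Qed.

Lemma H1pB A v G v' G' : open A -> H1p A v G -> H1p A v' G' ->
  H1p A (fun x => v x - v' x) (fun i x => G i x - G' i x).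
Proof.
move=> oA [sv H] [sv' H']; have mA := open_measurable_plane oA.
split; first exact: LspB.
by move=> i; have [w s] := H i; have [w' s'] := H' i; split; [exact: is_wDB|exact: LspB].
Qed.

Lemma H1p_smooth A M f : open A -> A `<=` sq (0, 0) M -> smooth f -> H1p A f (fun i => pd i f).
Proof.
move=> oA AM sf; have mA := open_measurable_plane oA.
split; first exact: Lsp_smooth AM sf.
by move=> i; split; [exact: is_wD_smooth|exact: (Lsp_smooth mA AM (@smooth_pd _ i _ sf))].
Qed.

Lemma H1p_ae A v v' G G' : open A -> measurable_fun A v' -> (forall i, measurable_fun A (G' i)) ->
  {ae mu, forall x, A x -> v x = v' x} -> (forall i, {ae mu, forall x, A x -> G i x = G' i x}) ->
  H1p A v G -> H1p A v' G'.
Proof.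
move=> oA mv mG vv GG [sv H]; split; first exact: Lsp_ae vv sv.
by move=> i; have [w s] := H i; split; [exact: is_wD_ae vv (GG i) w|exact: Lsp_ae (GG i) s].
Qed.

Lemma Lnm2_cvg A (f : nat -> R * R -> R) : (forall n, sqi (rs A (f n))) ->
  (Lnm 2 A (f n) @[n --> \oo] --> 0%E) <-> (n2 (rs A (f n)) @[n --> \oo] --> (0 : R)).
Proof.
move=> sf; have E : (fun n => Lnm 2 A (f n)) = (fun n => (n2 (rs A (f n)))%:E).
  by apply/funext => n; rewrite Lnm2E.
rewrite E; split => [H|H].
  by have /fine_cvgP[_] := H.
by apply: cvg_EFin => //; exact: nearW.
Qed.

Definition H1cvg A (phi : nat -> R * R -> R) v (G : 'I_2 -> R * R -> R) :=
  n2 (rs A (fun x => phi n x - v x)) @[n --> \oo] --> (0 : R) /\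
  forall i, n2 (rs A (fun x => pd i (phi n) x - G i x)) @[n --> \oo] --> (0 : R).

Lemma rs_ae A f g : {ae mu, forall x, A x -> f x = g x} -> {ae mu, forall x, rs A f x = rs A g x}.
Proof.
apply: aeS => x Hx; rewrite /rs indicE; case: (boolP (x \in A)); last by rewrite !mul0r.
by rewrite inE => /Hx ->.
Qed.

(** Replaces extended norms and chosen derivatives by real norms and the named gradient, without
    changing the notion of convergence. *)
Lemma H1cvgP A M phi v G : open A -> A `<=` sq (0, 0) M -> (forall n, smooth (phi n)) -> H1p A v G ->
  W1_cvg 2 A phi v <-> H1cvg A phi v G.
Proof.
move=> oA AM sp HG; have mA := open_measurable_plane oA.
have [sv H] := HG.
have Hw := W1_H1p (H1p_W1 oA HG); have [_ Hw2] := Hw.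
have sA f : smooth f -> Lsp 2 A f by exact: Lsp_smooth AM.
have L f g : smooth f -> Lsp 2 A g -> sqi (rs A (fun x => f x - g x)).
  by move=> sf sg; have /(Lsp2P _ mA)[] := LspB mA (sA _ sf) sg.
have E i n : n2 (rs A (fun x => pd i (phi n) x - wD A i v x)) = n2 (rs A (fun x => pd i (phi n) x - G i x)).
  have [w s] := H i; have [_ s'] := Hw2 i.
  have [m1 _] := L _ _ (@smooth_pd _ i _ (sp n)) s'; have [m2 _] := L _ _ (@smooth_pd _ i _ (sp n)) s.
  apply: n2_ae => //; apply: rs_ae; apply: aeS (wD_ae oA w) => x Hx Ax; by rewrite Hx.
split=> [[c1 c2]|[c1 c2]]; split.
- by apply/Lnm2_cvg => // n; exact: L.
- move=> i; have := c2 i => /Lnm2_cvg; rewrite (_ : (fun n => n2 _) = (fun n => n2 (rs A (fun x => pd i (phi n) x - G i x)))).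
    by apply => n; apply: L; [exact: smooth_pd|have [] := Hw2 i].
  by apply/funext => n; rewrite E.
- by apply/Lnm2_cvg => // n; exact: L.
- move=> i; apply/Lnm2_cvg; first by move=> n; apply: L; [exact: smooth_pd|have [] := Hw2 i].
  rewrite (_ : (fun n => n2 _) = (fun n => n2 (rs A (fun x => pd i (phi n) x - G i x)))) //.
  by apply/funext => n; rewrite E.
Qed.

(** For [x] in [A] the kernel of the average is a test function of [A], by the star-shape
    assumption, so the definition of the weak derivative gives [pd i (phi n) = (1 - e) * Am (G i)]
    on [A]. The averages converge in L^2, and the factor [1 - e] costs [En n] times a bounded
    norm. *)
Lemma H1_density A c r M v G : open A -> A `<=` Qo M -> 0 < r ->
  (forall e x k, 0 < e < 1 -> A x -> sq c r k -> A (pt e x k)) ->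
  H1p A v G -> exists phi, (forall n, smooth (phi n)) /\ H1cvg A phi v G.
Proof.
move=> oA AQ r0 Hc [/(Lsp2P _ (open_measurable_plane oA))[mv sv] HG].
have mA := open_measurable_plane oA.
pose th := moll c r.
have tt : test_fun setT th by apply: moll_test.
have t0 x : 0 <= th x by exact: moll_ge0.
have t1 : Int th = 1 by exact: Int_moll.
have tout x : ~ sq c r x -> th x = 0 by exact: moll_out.
have st := test_smooth tt.
have out f x : ~ Qo M x -> rs A f x = 0 by move=> Qx; apply: rs_out => /AQ.
have iv := sqi_ing sv (out v).
pose phi n := Am th (En R n) (rs A v).
have sphi n : smooth (phi n) by apply: (smooth_Am tt) => //; exact: En_gt0.
have sG i : sqi (rs A (G i)) by have [_ /(Lsp2P _ mA)[]] := HG i.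
have iG i := sqi_ing (sG i) (out (G i)).
have pdphi i n x : A x -> pd i (phi n) x = (1 - En R n) * Am th (En R n) (rs A (G i)) x.
  move=> Ax; have e0 := @En_gt0 R n; set e := En R n in e0 *.
  have en : e != 0 by rewrite gt_eqF.
  have -> : phi n = (fun x => e ^- 2 * cv (e^-1) ((1 - e) / e) th (rs A v) x).
    by apply/funext => y; rewrite /phi (Am_cv tt).
  rewrite pdZ; last exact: smooth_cv tt iv.
  rewrite (cv_pd _ _ i tt iv) (Am_cv tt)//.
  have tk : test_fun A (kth th e x).
    apply: (kth_test (c := c) (r := r)) => // k ck; apply: Hc => //; exact: En01.
  have [w _] := HG i; have [_ _ Hw] := w.
  have := Hw _ tk; rewrite !integE (kth_pd _ _ _ st).
  have -> : Int (rs A (fun y => v y * (e^-1 * kth (pd i th) e x y))) = e^-1 * cv e^-1 ((1 - e) / e) (pd i th) (rs A v) x.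
    rewrite /cv -IntZ; last exact: cv_ing (test_pd i tt) iv.
    by apply: eq_Int => y; rewrite rsM /kth; ring.
  have -> : Int (rs A (fun y => G i y * kth th e x y)) = cv e^-1 ((1 - e) / e) th (rs A (G i)) x.
    by apply: eq_Int => y; rewrite rsM /kth mulrC.
  move=> E.
  have -> : cv e^-1 ((1 - e) / e) (pd i th) (rs A v) x = - e * cv e^-1 ((1 - e) / e) th (rs A (G i)) x.
    by rewrite -[LHS](mulKf (invr_neq0 en)) invrK E; ring.
  by field.
exists phi; split => //; split.
  have H := cvL2 tt t0 t1 tout sv (out v).
  apply: (@squeeze_cvgr _ _ _ _ (fun=> 0) _ _ _ _ _ H); last exact: cvg_cst.
  apply: nearW => n; rewrite n2_ge0 /=.
  have sA := sqi_Am tt t0 t1 (@En01 R n) iv sv.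
  apply: n2_le.
  - have -> : rs A (fun x => phi n x - v x) = (fun x => rs A (phi n) x - rs A v x) by apply/funext => x; rewrite rsB.
    apply: sqiB => //; apply: sqi_le sA _; first by apply: mble_rs => //; (apply: mble_on; exact: smooth_mble).
    by move=> x; rewrite /rs indicE; case: (x \in A); rewrite ?mul1r// mul0r normr0.
  - exact: sqiB.
  - move=> x; have [Ax|Ax] := pselect (A x); first by rewrite !rs_in.
    by rewrite rs_out// normr0.
move=> i.
have H := cvL2 tt t0 t1 tout (sG i) (out (G i)).
have H2 : n2 (fun x => Am th (En R n) (rs A (G i)) x - rs A (G i) x) + En R n * (2 * n2 (rs A (G i))) @[n --> \oo] --> (0 : R).
  rewrite -[X in _ --> X]addr0; apply: cvgD => //.
  by rewrite -[X in _ --> X](mul0r (2 * n2 (rs A (G i)))); apply: cvgMl; exact: En_cvg.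
apply: (@squeeze_cvgr _ _ _ _ (fun=> 0) _ _ _ _ _ H2); last exact: cvg_cst.
apply: nearW => n; rewrite n2_ge0 /=.
have sA := sqi_Am tt t0 t1 (@En01 R n) (iG i) (sG i).
have sB := sqiB sA (sG i).
have sZ := @sqiZ _ (- En R n) _ sA.
have e0 := @En_gt0 R n.
apply: (@le_trans _ _ (n2 (fun x => (Am th (En R n) (rs A (G i)) x - rs A (G i) x) + (- En R n * Am th (En R n) (rs A (G i)) x)))).
  have mr : mble (rs A (fun x => pd i (phi n) x - G i x)).
    have -> : rs A (fun x => pd i (phi n) x - G i x) = (fun x => rs A (pd i (phi n)) x - rs A (G i) x) by apply/funext => x; rewrite rsB.
    apply: mbleB; last by case: (sG i).
    by apply: mble_rs => //; apply: mble_on; exact: (smooth_mble (@smooth_pd _ i _ (sphi n))).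
  have le x : `|rs A (fun x => pd i (phi n) x - G i x) x| <= `|(Am th (En R n) (rs A (G i)) x - rs A (G i) x) + (- En R n * Am th (En R n) (rs A (G i)) x)|.
    have [Ax|Ax] := pselect (A x); last by rewrite rs_out// normr0.
    rewrite !rs_in// pdphi//; suff -> : (1 - En R n) * Am th (En R n) (rs A (G i)) x - G i x = Am th (En R n) (rs A (G i)) x - G i x + - En R n * Am th (En R n) (rs A (G i)) x by []; ring.
  apply: n2_le => //; last exact: sqiD.
  exact: sqi_le mr (sqiD sB sZ) le.
apply: (le_trans (n2D sB sZ)); rewrite lerD2l n2Z// normrN (gtr0_norm e0) ler_wpM2l ?(ltW e0)//.
exact: (n2_Am_En tt t0 t1 n (iG i) (sG i)).
Qed.

End SobolevH1.

(** * Barycentric coordinates, convexity and extreme points of triangles and segments *)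

Section Triangles.
Variable R : realType.
Implicit Types (a b c m v x y : R * R) (A K g : set (R * R)).

(** The cross product of the plane: [tdet] is twice the signed area, and [bs], [bt] are the
    barycentric coordinates at [b] and [c] given by Cramer's rule. *)
Definition dt v w : R := v.1 * w.2 - v.2 * w.1.
Definition tdet a b c : R := dt (b - a) (c - a).
Definition bs a b c x : R := dt (x - a) (c - a) / tdet a b c.
Definition bt a b c x : R := dt (b - a) (x - a) / tdet a b c.

Lemma pair_eqP x y : x.1 = y.1 -> x.2 = y.2 -> x = y.
Proof. by case: x y => [x1 x2] [y1 y2] /= -> ->. Qed.

Lemma bary_ex a b c x : tdet a b c != 0 ->
  x = a + bs a b c x *: (b - a) + bt a b c x *: (c - a).
Proof.
move=> d0; apply: pair_eqP; rewrite /= /bs /bt /tdet /dt /= in d0 *.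
  by rewrite /GRing.scale /=; field.
by rewrite /GRing.scale /=; field.
Qed.

Lemma bs_aff a b c s t : tdet a b c != 0 -> bs a b c (a + s *: (b - a) + t *: (c - a)) = s.
Proof. by move=> d0; rewrite /bs /tdet /dt /= in d0 *; rewrite /GRing.scale /=; field. Qed.
Lemma bt_aff a b c s t : tdet a b c != 0 -> bt a b c (a + s *: (b - a) + t *: (c - a)) = t.
Proof. by move=> d0; rewrite /bt /tdet /dt /= in d0 *; rewrite /GRing.scale /=; field. Qed.

Lemma triP a b c x : tdet a b c != 0 ->
  tri a b c x <-> [/\ 0 <= bs a b c x, 0 <= bt a b c x & bs a b c x + bt a b c x <= 1].
Proof.
move=> d0; split => [[s [t [s0 t0 st ->]]]|[s0 t0 st]]; first by rewrite bs_aff// bt_aff.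
by exists (bs a b c x), (bt a b c x); split => //; exact: bary_ex.
Qed.

Lemma open_lin (v : R * R) (r : R) : open [set x : R * R | 0 < lin v r x].
Proof.
have -> : [set x : R * R | 0 < lin v r x] = lin v r @^-1` [set z : R | 0 < z] by [].
by apply: open_comp; [move=> x _; exact: lin_cont|exact: open_gt].
Qed.

Lemma bs_lin a b c : bs a b c = lin ((c - a).2 / tdet a b c, - (c - a).1 / tdet a b c) (- dt a (c - a) / tdet a b c).
Proof. by apply/funext => x; rewrite /bs /lin /dot /dt /=; ring. Qed.
Lemma bt_lin a b c : bt a b c = lin (- (b - a).2 / tdet a b c, (b - a).1 / tdet a b c) (- dt (b - a) a / tdet a b c).
Proof. by apply/funext => x; rewrite /bt /lin /dot /dt /=; ring. Qed.
Lemma lin_opp v r x : - lin v r x = lin (- v.1, - v.2) (- r) x.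
Proof. by rewrite /lin /dot /=; ring. Qed.
Lemma lin_add v r w s x : lin v r x + lin w s x = lin (v.1 + w.1, v.2 + w.2) (r + s) x.
Proof. by rewrite /lin /dot /=; ring. Qed.

Definition otri a b c : set (R * R) := [set x | [/\ 0 < bs a b c x, 0 < bt a b c x & bs a b c x + bt a b c x < 1]].

Lemma open_otri a b c : open (otri a b c).
Proof.
have -> : otri a b c = [set x | 0 < bs a b c x] `&` [set x | 0 < bt a b c x] `&` [set x | 0 < 1 - (bs a b c x + bt a b c x)].
  by apply/seteqP; split => x /= [] => [h1 h2 h3|[h1 h2] h3]; split => //; lra.
apply: openI; first by apply: openI; rewrite (bs_lin, bt_lin); exact: open_lin.
rewrite bs_lin bt_lin; set p := lin _ _; set q := lin _ _.
have -> : [set x | 0 < 1 - (p x + q x)] = [set x | 0 < lin (0, 0) 1 x + - (p x + q x)].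
  by apply/seteqP; split => x /=; rewrite {1}/lin /dot /=; rewrite !mulr0 !add0r.
rewrite /p /q; under eq_set => x do rewrite lin_add lin_opp lin_add.
exact: open_lin.
Qed.

Lemma otri_sub a b c : tdet a b c != 0 -> otri a b c `<=` tri a b c.
Proof. by move=> d0 x [h1 h2 h3]; apply/triP => //; split; lra. Qed.

Lemma otri_int a b c : tdet a b c != 0 -> otri a b c `<=` (tri a b c)°.
Proof. by move=> d0; rewrite -open_subsetE; [exact: otri_sub|exact: open_otri]. Qed.

Lemma otri_aff a b c (s t : R) : tdet a b c != 0 -> 0 < s -> 0 < t -> s + t < 1 -> otri a b c (a + s *: (b - a) + t *: (c - a)).
Proof. by move=> d0 s0 t0 st; split; rewrite ?bs_aff ?bt_aff. Qed.

Lemma tri_swap12 a b c : tri a b c = tri b a c.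
Proof.
have H a' b' : tri a' b' c `<=` tri b' a' c.
  move=> x [s [t [s0 t0 st ->]]]; exists (1 - s - t), t; split; [lra|lra|lra|].
  by apply: pair_eqP; rewrite /= /GRing.scale /=; ring.
by apply/seteqP; split; exact: H.
Qed.
Lemma tri_swap23 a b c : tri a b c = tri a c b.
Proof.
have H b' c' : tri a b' c' `<=` tri a c' b'.
  move=> x [s [t [s0 t0 st ->]]]; exists t, s; split; [lra|lra|lra|].
  by apply: pair_eqP; rewrite /= /GRing.scale /=; ring.
by apply/seteqP; split; exact: H.
Qed.
Lemma tdet_swap12 a b c : tdet b a c = - tdet a b c.
Proof. by rewrite /tdet /dt /=; ring. Qed.
Lemma tdet_swap23 a b c : tdet a c b = - tdet a b c.
Proof. by rewrite /tdet /dt /=; ring. Qed.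

Lemma is_tri_swap12 a b c K : is_tri a b c K -> is_tri b a c K.
Proof. by move=> [d0 ->]; split; [rewrite -[X in X != 0]/(tdet b a c) tdet_swap12 oppr_eq0|exact: tri_swap12]. Qed.

Lemma tri_convex a b c (e : R) x y : 0 <= e <= 1 -> tri a b c x -> tri a b c y -> tri a b c (pt e x y).
Proof.
move=> /andP[e0 e1] [s [t [s0 t0 st ->]]] [s' [t' [s0' t0' st' ->]]].
exists ((1 - e) * s + e * s'), ((1 - e) * t + e * t'); split.
- by rewrite addr_ge0// mulr_ge0// subr_ge0.
- by rewrite addr_ge0// mulr_ge0// subr_ge0.
- have -> : (1 - e) * s + e * s' + ((1 - e) * t + e * t') = 1 - ((1 - e) * (1 - (s + t)) + e * (1 - (s' + t'))) by ring.
  by rewrite lerBlDr lerDl addr_ge0// mulr_ge0// subr_ge0.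
- by apply: pair_eqP; rewrite /= /GRing.scale /=; ring.
Qed.

Definition cvx A := forall (e : R) x y, 0 <= e <= 1 -> A x -> A y -> A (pt e x y).

(** The image of the interior under the homothety [x |-> pt e x y] is open, as the preimage under
    its inverse [F], and it lies in [A] by convexity. *)
Lemma cvx_int A (e : R) x y : cvx A -> 0 < e < 1 -> A° x -> A y -> A° (pt e x y).
Proof.
move=> cA /andP[e0 e1] Ax Ay.
have e1' : 1 - e != 0 by rewrite subr_eq0 gt_eqF.
pose F := @sct R (1 - e)^-1 (- (e / (1 - e) * y.1), - (e / (1 - e) * y.2)).
have oF : open (F @^-1` A°).
  by apply: open_comp; [move=> z _; exact: sct_cont|exact: open_interior].
have sF : F @^-1` A° `<=` A.
  move=> z /interior_subset Fz; have -> : z = pt e (F z) y.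
    by apply: pair_eqP; rewrite /pt /F /sct /=; field.
  by apply: cA => //; rewrite (ltW e0) (ltW e1).
have : F @^-1` A° `<=` A° by rewrite -open_subsetE.
apply; rewrite /= (_ : F _ = x)//.
by apply: pair_eqP; rewrite /pt /F /sct /=; field.
Qed.

Lemma tri_bounded a b c : exists M, tri a b c `<=` @Qo R M.
Proof.
exists (`|a.1| + `|a.2| + (`|b.1| + `|b.2|) + (`|c.1| + `|c.2|) + 1) => x [s [t [s0 t0 st ->]]].
have E (p q r : R) : `|p + s * (q - p) + t * (r - p)| <= `|p| + `|q| + `|r|.
  have -> : p + s * (q - p) + t * (r - p) = (1 - s - t) * p + s * q + t * r by ring.
  have H (u w : R) : 0 <= u <= 1 -> `|u * w| <= `|w|.
    by move=> /andP[u0 u1]; rewrite normrM (ger0_norm u0) ler_piMl.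
  apply: (le_trans (ler_normD _ _)); apply: lerD; last by apply: H; apply/andP; split; lra.
  apply: (le_trans (ler_normD _ _)); apply: lerD; by apply: H; apply/andP; split; lra.
have := E a.1 b.1 c.1; have := E a.2 b.2 c.2.
have := normr_ge0 a.1; have := normr_ge0 a.2; have := normr_ge0 b.1.
have := normr_ge0 b.2; have := normr_ge0 c.1; have := normr_ge0 c.2.
rewrite /Qo /= /GRing.scale /=; move=> *; split; lra.
Qed.

Lemma tri_int_sq a b c : tdet a b c != 0 -> exists q r, 0 < r /\ @sq R q r `<=` (tri a b c)°.
Proof.
move=> d0; set q := a + 4^-1 *: (b - a) + 4^-1 *: (c - a).
have oq : otri a b c q by apply: otri_aff => //; lra.
have [r r0 H] := open_sq (@open_otri a b c) oq.
by exists q, r; split => // x /H; exact: otri_int.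
Qed.

Lemma tri_star a b c : tdet a b c != 0 -> exists q r M, [/\ 0 < r, (tri a b c)° `<=` @Qo R M &
  forall e x k, 0 < e < 1 -> (tri a b c)° x -> sq q r k -> (tri a b c)° (pt e x k)].
Proof.
move=> d0; have [q [r [r0 H]]] := tri_int_sq d0; have [M HM] := tri_bounded a b c.
exists q, r, M; split => //; first by move=> x /interior_subset; exact: HM.
move=> e x k e01 Kx qk; apply: cvx_int => //; first by move=> *; exact: tri_convex.
by apply: interior_subset; exact: H.
Qed.

(** Extreme points, tested on midpoints. They depend on the set alone, and so recover the vertices
    of a triangle or the ends of a segment that is given merely as a set of points. *)
Definition extr A x := A x /\ forall y z, A y -> A z -> x = 2^-1 *: (y + z) -> y = z.

Lemma extr_vertex a b c : tdet a b c != 0 -> extr (tri a b c) a.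
Proof.
move=> d0; split; first by exists 0, 0; rewrite !scale0r !addr0; split => //; lra.
move=> y z [s [t [s0 t0 st ->]]] [s' [t' [s0' t0' st' ->]]] E.
have := bs_aff 0 0 d0; have := bt_aff 0 0 d0; rewrite !scale0r !addr0 {2 4}E.
have -> : 2^-1 *: (a + s *: (b - a) + t *: (c - a) + (a + s' *: (b - a) + t' *: (c - a))) =
   a + (2^-1 * (s + s')) *: (b - a) + (2^-1 * (t + t')) *: (c - a).
  by apply: pair_eqP; rewrite /= /GRing.scale /=; field.
rewrite bs_aff// bt_aff// => h1 h2.
have -> : s = 0 by lra.
have -> : s' = 0 by lra.
have -> : t = 0 by lra.
by have -> : t' = 0 by lra.
Qed.

(** Any other point is the midpoint of two distinct points of the triangle: vary [t] alone, [s]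
    alone, or both in opposite directions. *)
Lemma extr_tri a b c x : tdet a b c != 0 -> extr (tri a b c) x -> [\/ x = a, x = b | x = c].
Proof.
move=> d0 [[s [t [s0 t0 st ->]]] H].
have P (s1 t1 s2 t2 : R) : 0 <= s1 -> 0 <= t1 -> s1 + t1 <= 1 -> 0 <= s2 -> 0 <= t2 -> s2 + t2 <= 1 ->
    s = 2^-1 * (s1 + s2) -> t = 2^-1 * (t1 + t2) -> s1 = s2 /\ t1 = t2.
  move=> *; have := H (a + s1 *: (b - a) + t1 *: (c - a)) (a + s2 *: (b - a) + t2 *: (c - a)).
  move=> HH; have {HH} : a + s1 *: (b - a) + t1 *: (c - a) = a + s2 *: (b - a) + t2 *: (c - a).
  apply: HH.
  - by exists s1, t1.
  - by exists s2, t2.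
  - by apply: pair_eqP; rewrite /= /GRing.scale /=; subst s t; field.
  move=> E; split; first by rewrite -(bs_aff s1 t1 d0) E bs_aff.
  by rewrite -(bt_aff s1 t1 d0) E bt_aff.
have [s00|s00] := eqVneq s 0.
  have [t00|t00] := eqVneq t 0; first by constructor 1; rewrite s00 t00 !scale0r !addr0.
  have [t11|t11] := eqVneq t 1; first by constructor 3; rewrite s00 t11 scale0r scale1r addr0 addrC subrK.
  have t0' : 0 < t by rewrite lt_neqAle eq_sym t00.
  have t1' : t < 1 by rewrite lt_neqAle t11; lra.
  have [e e0 [e1 e2]] : exists2 e : R, 0 < e & e <= t /\ e <= 1 - t.
    by exists (Num.min t (1 - t)); [rewrite lt_min t0' subr_gt0|rewrite !ge_min !lexx orbT].
  have [_] := P 0 (t - e) 0 (t + e) ltac:(lra) ltac:(lra) ltac:(lra) ltac:(lra) ltac:(lra) ltac:(lra) ltac:(lra) ltac:(lra).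
  lra.
have s0' : 0 < s by rewrite lt_neqAle eq_sym s00.
have [t00|t00] := eqVneq t 0.
  have [s11|s11] := eqVneq s 1; first by constructor 2; rewrite t00 s11 scale0r scale1r addr0 addrC subrK.
  have s1' : s < 1 by rewrite lt_neqAle s11; lra.
  have [e e0 [e1 e2]] : exists2 e : R, 0 < e & e <= s /\ e <= 1 - s.
    by exists (Num.min s (1 - s)); [rewrite lt_min s0' subr_gt0|rewrite !ge_min !lexx orbT].
  have [] := P (s - e) 0 (s + e) 0 ltac:(lra) ltac:(lra) ltac:(lra) ltac:(lra) ltac:(lra) ltac:(lra) ltac:(lra) ltac:(lra).
  lra.
have t0' : 0 < t by rewrite lt_neqAle eq_sym t00.
have [e e0 [e1 e2]] : exists2 e : R, 0 < e & e <= s /\ e <= t.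
  by exists (Num.min s t); [rewrite lt_min s0'|rewrite !ge_min !lexx orbT].
have [] := P (s - e) (t + e) (s + e) (t - e) ltac:(lra) ltac:(lra) ltac:(lra) ltac:(lra) ltac:(lra) ltac:(lra) ltac:(lra) ltac:(lra).
lra.
Qed.

Lemma extr_seg_end a b : a <> b -> extr (seg a b) a.
Proof.
move=> ab; split; first by exists 0; rewrite scale0r addr0; split => //; lra.
move=> y z [s [s0 s1 ->]] [t [t0 t1 ->]] E.
have D : (2^-1 * (s + t)) *: (b - a) = 0.
  have : a - a = 2^-1 *: (a + s *: (b - a) + (a + t *: (b - a))) - a by rewrite -E.
  by rewrite subrr => ->; apply: pair_eqP; rewrite /= /GRing.scale /=; field.
move: D => /eqP; rewrite scaler_eq0 => /orP[/eqP h|]; last by rewrite subr_eq0 => /eqP /esym.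
have -> : s = 0 by lra.
by have -> : t = 0 by lra.
Qed.

Lemma extr_seg a b x : extr (seg a b) x -> x = a \/ x = b.
Proof.
move=> [[t [t0 t1 ->]] H].
have [t00|t00] := eqVneq t 0; first by left; rewrite t00 scale0r addr0.
have [t11|t11] := eqVneq t 1; first by right; rewrite t11 scale1r addrC subrK.
have t0' : 0 < t by rewrite lt_neqAle eq_sym t00.
have t1' : t < 1 by rewrite lt_neqAle t11.
have [e e0 [e1 e2]] : exists2 e : R, 0 < e & e <= t /\ e <= 1 - t.
  by exists (Num.min t (1 - t)); [rewrite lt_min t0' subr_gt0|rewrite !ge_min !lexx orbT].
have E : a + (t - e) *: (b - a) = a + (t + e) *: (b - a).
  apply: H.
  - by exists (t - e); split => //; lra.
  - by exists (t + e); split => //; lra.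
  - by apply: pair_eqP; rewrite /= /GRing.scale /=; field.
have : (2 * e) *: (b - a) = 0.
  have : (a + (t + e) *: (b - a)) - (a + (t - e) *: (b - a)) = 0 by rewrite E subrr.
  by move=> <-; apply: pair_eqP; rewrite /= /GRing.scale /=; ring.
move=> /eqP; rewrite scaler_eq0 => /orP[/eqP h|/eqP ba]; first by exfalso; lra.
by left; rewrite ba scaler0 addr0.
Qed.

Lemma segC a b : seg a b = seg b a.
Proof.
have H a' b' : seg a' b' `<=` seg b' a'.
  move=> x [t [t0 t1 ->]]; exists (1 - t); split; [lra|lra|].
  by apply: pair_eqP; rewrite /= /GRing.scale /=; ring.
by apply/seteqP; split; exact: H.
Qed.

Lemma tri_neq12 a b c : tdet a b c != 0 -> a <> b.
Proof. by move=> d0 ab; move: d0; rewrite /tdet /dt ab subrr /= !mul0r subrr eqxx. Qed.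

(** [ends g] is an arbitrary choice, but both its points are extreme in the segment; hence they are
    the two vertices that witness [side], possibly in the other order. *)
Lemma side_ends K g : side K g -> exists c, [/\ is_tri (ends g).1 (ends g).2 c K,
  (ends g).1 <> (ends g).2 & g = seg (ends g).1 (ends g).2].
Proof.
move=> [a [b [c [tK gE]]]]; have [d0 _] := tK.
have ab : a <> b by exact: (tri_neq12 (c := c)).
have [n gE'] : (ends g).1 <> (ends g).2 /\ g = seg (ends g).1 (ends g).2.
  by rewrite /ends; case: xgetP => [y -> //|/(_ (a, b))]; case.
have x1 : extr (seg a b) (ends g).1 by rewrite -gE {1}gE'; exact: extr_seg_end.
have x2 : extr (seg a b) (ends g).2 by rewrite -gE {1}gE' segC; apply: extr_seg_end => /esym.
exists c; split => //.
case/extr_seg: x1 => E1; case/extr_seg: x2 => E2; move: n; rewrite E1 E2 // => _.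
exact: is_tri_swap12.
Qed.

(** Nine segments, both orders and degenerate ones included: this crude count is the factor 9 in
    [indicator_bound]. *)
Definition tsides a b c : seq (set (R * R)) := [seq seg x y | x <- [:: a; b; c], y <- [:: a; b; c]].

Lemma side_tsides a b c K g : is_tri a b c K -> side K g -> [set` tsides a b c] g.
Proof.
move=> [d0 KE] [a' [b' [c' [tK gE]]]]; have [d0' KE'] := tK.
have [d0'' KE''] := is_tri_swap12 tK.
have x1 : extr (tri a b c) a' by rewrite -KE KE'; exact: extr_vertex.
have x2 : extr (tri a b c) b' by rewrite -KE KE''; exact: extr_vertex.
rewrite gE /=; apply/allpairsP; exists (a', b') => /=; split => //; rewrite !inE.
  by case/extr_tri: x1 => // ->; rewrite eqxx ?orbT.
by case/extr_tri: x2 => // ->; rewrite eqxx ?orbT.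
Qed.

End Triangles.

(** * Functions on the unit interval, and partial integration of functions on the unit square *)

Section SideFunctions.
Variable R : realType.
Local Notation mu := (@area R).
Local Notation leb := (@lebesgue_measure R).
Implicit Types (f g h v : R * R -> R) (A K : set (R * R)) (w : R -> R).

Lemma mble_comp1 (u : R -> R) : measurable_fun [set: R] u -> mble (fun x : R * R => u x.2).
Proof. by move=> mu'; apply: (measurableT_comp mu'). Qed.
Lemma mble_comp0 (u : R -> R) : measurable_fun [set: R] u -> mble (fun x : R * R => u x.1).
Proof. by move=> mu'; apply: (measurableT_comp mu'). Qed.

Definition U01 : set (R * R) := box 0 1 0 1.
(* A function on [0, 1] seen as a function of the second coordinate on the unit square: its
   L^2 norm and integrals are then those of the plane. *)
Definition up w : R * R -> R := fun x => \1_U01 x * w x.2.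

Lemma upE w x : up w x = \1_(`[0, 1]%classic) x.1 * (\1_(`[0, 1]%classic) x.2 * w x.2).
Proof. by case: x => x y; rewrite /up /U01 box_indic mulrA. Qed.

Lemma mble_up w : measurable_fun (`[0, 1] : set R) w -> mble (up w).
Proof.
move=> mw; have mi : measurable_fun [set: R] (\1_(`[0, 1]%classic) : R -> R) by exact: measurable_indic.
have E : (fun s => \1_(`[0, 1]%classic) s * w s) = w \_ `[0, 1]%classic.
  by apply/funext => s; rewrite patchE indicE; case: (_ \in _); rewrite ?mul1r ?mul0r.
have m2 : measurable_fun [set: R] (fun s => \1_(`[0, 1]%classic) s * w s).
  by rewrite E; apply/(measurable_restrictT _ _).1.
have -> : up w = (fun x => \1_(`[0, 1]%classic) x.1 * (\1_(`[0, 1]%classic) x.2 * w x.2)).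
  by apply/funext => x; rewrite upE.
by apply: mbleM; [exact: (mble_comp0 mi)|exact: (mble_comp1 m2)].
Qed.

Lemma leb01 : leb `[0, 1]%classic = 1%E.
Proof. by rewrite lebesgue_measure_itv /= lte01 oppr0 adde0. Qed.

#[export] Instance leb_ae_filter : Filter (nbhs (almost_everywhere leb)).
Proof. exact: ae_filter_ringOfSetsType. Qed.

Lemma int_indic01 (k : \bar R) : (0 <= k)%E -> (\int[leb]_x ((\1_(`[0, 1]%classic) x)%:E * k) = k)%E.
Proof.
move=> k0; transitivity ((\int[leb]_x (\1_(`[0, 1]%classic) x)%:E) * k)%E.
  apply: ge0_integralZr => //; first by apply/measurable_EFinP; exact: measurable_indic.
by rewrite integral_indic// setIT [X in (X * _)%E]leb01 mul1e.
Qed.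

Lemma sq_up (H : R -> \bar R) : measurable_fun [set: R] H -> (forall s, 0 <= H s)%E ->
  (\int[mu]_x ((\1_(`[0, 1]%classic) x.1)%:E * H x.2) = \int[leb]_s H s)%E.
Proof.
move=> mH H0; rewrite /area fubini_tonelli2.
- by rewrite /fubini_G; apply: eq_integral => s _; exact: (int_indic01 (H0 s)).
- apply: emeasurable_funM; last exact: (measurableT_comp mH).
  by apply/measurable_EFinP; apply: (@mble_comp0 (\1_(`[0, 1]%classic))); exact: measurable_indic.
- by move=> x; rewrite mule_ge0// lee_fin indicE.
Qed.

Lemma Lnorm_up w : measurable_fun (`[0, 1] : set R) w ->
  ('N[leb]_2%:E[(fun t => (\1_(`[0, 1]%classic) t * w t)%:E)] = 'N[mu]_2%:E[(fun x => (up w x)%:E)])%E.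
Proof.
move=> mw; have E : (fun s => \1_(`[0, 1]%classic) s * w s) = w \_ `[0, 1]%classic.
  by apply/funext => s; rewrite patchE indicE; case: (_ \in _); rewrite ?mul1r ?mul0r.
have m2 : measurable_fun [set: R] (fun s => \1_(`[0, 1]%classic) s * w s).
  by rewrite E; apply/(measurable_restrictT _ _).1.
rewrite unlock /=; congr poweR.
rewrite -(sq_up (H := fun s => (`|\1_(`[0, 1]%classic) s * w s| `^ 2)%:E)).
- apply: eq_integral => x _; rewrite upE -EFinM; congr EFin.
  rewrite [in RHS]normrM indicE; case: (_ \in _); rewrite /= ?normr1 ?mul1r// normr0 !mul0r powR0//.
- by apply/measurable_EFinP; apply: (measurableT_comp (@measurable_powR R 2)); exact: measurableT_comp.
- by move=> s; rewrite lee_fin powR_ge0.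
Qed.

Definition slice h (s : R) : R := \int[leb]_t h (t, s).

Lemma slice_mble h : ing h -> measurable_fun [set: R] (slice h).
Proof.
move=> h1; have := @measurable_fubini_G _ _ _ _ _ leb leb _ h1 => m.
by apply: (measurableT_comp _ m) => //; exact: measurable_fine.
Qed.

(** The variance of [u] on [0, 1], an interval of length 1, is nonnegative. *)
Lemma sq_slice_le (u : R -> R) : leb.-integrable setT (fun t => (u t)%:E) ->
  leb.-integrable setT (fun t => (u t ^+ 2)%:E) -> (forall t, ~ `[0, 1]%classic t -> u t = 0) ->
  (\int[leb]_t u t) ^+ 2 <= \int[leb]_t (u t ^+ 2).
Proof.
move=> i1 i2 out; set m := \int[leb]_t u t.
pose I : R -> R := \1_(`[0, 1]%classic).
have iI : leb.-integrable setT (fun t => (I t)%:E).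
  exact: (@integrable_indic_itv R 0 1 true false).
have iIE : \int[leb]_t I t = 1.
  by rewrite /Rintegral integral_indic// setIT [X in fine X]leb01.
have H : 0 <= \int[leb]_t (u t ^+ 2 - (2 * m) * u t + m ^+ 2 * I t).
  apply: Rintegral_ge0 => t _; rewrite /I indicE; case: (boolP (t \in _)) => [_|].
    have -> : u t ^+ 2 - 2 * m * u t + m ^+ 2 * 1%:R = (u t - m) ^+ 2 by ring.
    exact: sqr_ge0.
  by move/negP => nt; rewrite out ?mulr0 ?expr0n/= ?subr0 ?addr0// => /mem_set.
have iu2 : leb.-integrable setT (fun t => ((2 * m) * u t)%:E) by apply: (integrableZl measurableT (2 * m) i1).
have iI2 : leb.-integrable setT (fun t => (m ^+ 2 * I t)%:E) by apply: (integrableZl measurableT (m ^+ 2) iI).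
have i3 : leb.-integrable setT (fun t => (u t ^+ 2 - (2 * m) * u t)%:E) by exact: (integrableB measurableT i2 iu2).
move: H; rewrite RintegralD// RintegralB// RintegralZl// RintegralZl// iIE -/m.
rewrite mulr1 -mulrA -expr2; lra.
Qed.

(** [sq_slice_le] on almost every line, integrated over [s] by Tonelli's theorem. *)
Lemma slice_n2 h : ing h -> sqi h -> (forall x, ~ U01 x -> h x = 0) ->
  sqi (up (slice h)) /\ n2 (up (slice h)) <= n2 h.
Proof.
move=> h1 [mh h2] out.
have ms := slice_mble h1; have mup : mble (up (slice h)) by apply: mble_up; exact: measurable_funTS.
have a1 := ing_fubini_y h1; have a2 := ing_fubini_y h2.
have le : (\int[mu]_x ((up (slice h) x) ^+ 2)%:E <= \int[mu]_x ((h x) ^+ 2)%:E)%E.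
  have -> : (\int[mu]_x ((up (slice h) x) ^+ 2)%:E = \int[leb]_s ((\1_(`[0, 1]%classic) s * slice h s) ^+ 2)%:E)%E.
    rewrite -(sq_up (H := fun s => ((\1_(`[0, 1]%classic) s * slice h s) ^+ 2)%:E)).
    - apply: eq_integral => x _; rewrite upE -EFinM; congr EFin.
      by rewrite [in LHS]exprMn indicE; case: (_ \in _); rewrite /= ?expr1n ?expr0n.
    - by apply/measurable_EFinP; apply: measurable_funX; apply: measurable_funM => //; exact: measurable_indic.
    - by move=> s; rewrite lee_fin sqr_ge0.
  have -> : (\int[mu]_x ((h x) ^+ 2)%:E = \int[leb]_s \int[leb]_t ((h (t, s)) ^+ 2)%:E)%E.
    rewrite /area fubini_tonelli2//; last by move=> x; rewrite lee_fin sqr_ge0.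
    by apply/measurable_EFinP; exact: measurable_funX.
  apply: ae_ge0_le_integral => //.
  - by move=> s _; rewrite lee_fin sqr_ge0.
  - by apply/measurable_EFinP; apply: measurable_funX; apply: measurable_funM => //; exact: measurable_indic.
  - by move=> s _; apply: integral_ge0 => t _; rewrite lee_fin sqr_ge0.
  - apply: (@measurable_fun_fubini_tonelli_G _ _ _ _ _ leb (fun x => ((h x) ^+ 2)%:E)).
      by apply/measurable_EFinP; exact: measurable_funX.
    by move=> x; rewrite lee_fin sqr_ge0.
  apply: (@filterS2 _ _ leb_ae_filter _ _ _ _ a1 a2) => s i1 i2 _.
  have fin : (\int[leb]_t ((h (t, s)) ^+ 2)%:E = (\int[leb]_t ((h (t, s)) ^+ 2))%:E)%E.
    by rewrite /Rintegral fineK// integrable_fin_num.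
  rewrite fin lee_fin; apply: (@le_trans _ _ (slice h s ^+ 2)).
    by rewrite exprMn indicE; case: (_ \in _); rewrite ?expr1n ?mul1r// expr0n mul0r sqr_ge0.
  apply: (sq_slice_le i1 i2) => t nt; apply: out => -[/= ? _]; exact: nt.
have i : ing (fun x => up (slice h) x ^+ 2).
  apply/integrableP; split; first by apply/measurable_EFinP; exact: mbleX.
  under eq_integral => x _ do rewrite /= ger0_norm ?sqr_ge0//.
  by apply: (le_lt_trans le); rewrite Int_EFin// ltry.
split => //; rewrite /n2 ler_wsqrtr//.
by rewrite -lee_fin -!Int_EFin.
Qed.
End SideFunctions.

(** * An explicit trace operator on a side of a triangle *)

Section TraceOperator.
Variable R : realType.
Local Notation mu := (@area R).
Local Notation leb := (@lebesgue_measure R).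
Implicit Types (f h F : R * R -> R) (A K g : set (R * R)) (w : R -> R) (G : 'I_2 -> R * R -> R).

Lemma ae_snd (P : R -> Prop) : {ae leb, forall s, P s} -> {ae mu, forall x : R * R, P x.2}.
Proof.
move=> [N [mN N0 HN]]; exists (setT `*` N); split.
- exact: measurableX.
- transitivity (leb setT * leb N)%E; last by rewrite N0 mule0.
  exact: product_measure1E.
- by move=> x /= Hx; split => //; apply: HN.
Qed.

Lemma ae_neq (r : R) : {ae leb, forall s : R, s != r}.
Proof.
exists [set r]; split; first exact: measurable_set1.
  exact: lebesgue_measure_set1.
by move=> s /= /negP; rewrite negbK => /eqP.
Qed.

Lemma n2_refl w : sqi (up w) -> sqi (up (fun s => w (1 - s))) /\ n2 (up (fun s => w (1 - s))) = n2 (up w).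
Proof.
move=> sw; have E : up (fun s => w (1 - s)) = (fun x => up w (aff (0, 1) (1, 0) (0, -1) x)).
  apply/funext => -[t s]; rewrite !upE /aff /=.
  have -> : 0 + t * 1 + s * 0 = t by ring.
  have -> : 1 + t * 0 + s * (-1) = 1 - s by ring.
  congr (_ * (_ * _)); rewrite !indicE; congr ((_ : bool)%:R).
  by apply/idP/idP; rewrite !inE /= !in_itv /= => /andP[? ?]; apply/andP; split; lra.
have d0 : (1 : R, 0 : R).1 * (0 : R, -1 : R).2 - (1 : R, 0 : R).2 * (0 : R, -1 : R).1 != 0 by rewrite /= mulr0 subr0 mul1r oppr_eq0 oner_eq0.
have d1 : `|(1 : R, 0 : R).1 * (0 : R, -1 : R).2 - (1 : R, 0 : R).2 * (0 : R, -1 : R).1| = 1 by rewrite /= mulr0 subr0 mul1r normrN normr1.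
have [mw iw] := sw; split.
  by split; rewrite E; [exact: mble_aff|exact: (ing_aff (0, 1) d0 iw)].
by rewrite /n2 E (Int_aff (0, 1) d0 iw) d1 invr1 mul1r.
Qed.

(** With both coordinates restricted to (0, 1/2), the parallelogram at a vertex stays inside the
    triangle, see [half_in_tri]. *)
Definition oi (s : R) : R := \1_(`]0, 2^-1[%classic) s.
Lemma oi_in s : 0 < s < 2^-1 -> oi s = 1.
Proof. by move=> H; rewrite /oi indicE mem_set. Qed.
Lemma oi_out s : ~ (0 < s < 2^-1) -> oi s = 0.
Proof. by move=> H; rewrite /oi indicE memNset//= in_itv. Qed.
Lemma oi_mble : measurable_fun [set: R] oi.
Proof. exact: measurable_indic. Qed.
Lemma oi_le1 s : `|oi s| <= 1.
Proof. by rewrite /oi indicE; case: (_ \in _); rewrite ?normr1 ?normr0. Qed.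

(* The integrand of f (p + s v) = int_0^{1/2} (2 f - (1 - 2 t) D_m f) (p + t m + s v) dt. *)
Definition hh (p m v : R * R) F G (x : R * R) : R :=
  (2 * (oi x.1 * oi x.2)) * F (aff p m v x) +
  ((oi x.1 * oi x.2 * - (1 - 2 * x.1) * m.1) * G ord0 (aff p m v x) +
   (oi x.1 * oi x.2 * - (1 - 2 * x.1) * m.2) * G ord_max (aff p m v x)).

Lemma hh_out p m v F G x : ~ U01 x -> hh p m v F G x = 0.
Proof.
move=> nx; have E : oi x.1 * oi x.2 = 0.
  have [h1|h1] := pselect (0 < x.1 < 2^-1); last by rewrite (oi_out h1) mul0r.
  have [h2|h2] := pselect (0 < x.2 < 2^-1); last by rewrite (oi_out h2) mulr0.
  exfalso; apply: nx; move: h1 h2 => /andP[? ?] /andP[? ?]; split => /=; rewrite in_itv /=; apply/andP; split; lra.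
by rewrite /hh E !(mulr0, mul0r, addr0).
Qed.

Lemma hh_coef1 x : `|2 * (oi x.1 * oi x.2)| <= 2.
Proof. by rewrite normrM normrM ger0_norm// ler_piMr// mulr_ile1// oi_le1. Qed.
Lemma hh_coef2 (k : R) x : `|oi x.1 * oi x.2 * - (1 - 2 * x.1) * k| <= `|k|.
Proof.
rewrite normrM ler_piMl//.
have [h1|h1] := pselect (0 < x.1 < 2^-1); last by rewrite (oi_out h1) !mul0r normr0.
rewrite !normrM; apply: mulr_ile1 => //.
  by apply: mulr_ile1 => //; exact: oi_le1.
by move: h1 => /andP[? ?]; rewrite normrN ler_norml; apply/andP; split; lra.
Qed.

Lemma mble_oi2 : mble (fun x : R * R => oi x.1 * oi x.2).
Proof. by apply: mbleM; [exact: (mble_comp0 oi_mble)|exact: (mble_comp1 oi_mble)]. Qed.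

Lemma mble_co2 (k : R) : mble (fun x : R * R => oi x.1 * oi x.2 * - (1 - 2 * x.1) * k).
Proof.
apply: mbleM; last exact: mble_cst.
apply: mbleM; first exact: mble_oi2.
apply: mbleN; apply: mbleB; first exact: mble_cst.
by apply: mbleM; [exact: mble_cst|exact: (smooth_mble (@smooth_fst R))].
Qed.

Lemma n2_aff p m v F : dt m v != 0 -> sqi F ->
  sqi (fun x => F (aff p m v x)) /\ n2 (fun x => F (aff p m v x)) = Num.sqrt (`|dt m v|^-1) * n2 F.
Proof.
move=> d0 [mF iF]; split; first by split; [exact: mble_aff|exact: (ing_aff p d0 iF)].
by rewrite /n2 (Int_aff p d0 iF) sqrtrM// invr_ge0.
Qed.

Lemma hh_sqi p m v F G : dt m v != 0 -> sqi F -> (forall i, sqi (G i)) ->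
  [/\ sqi (hh p m v F G), ing (hh p m v F G) &
   n2 (hh p m v F G) <= Num.sqrt (`|dt m v|^-1) * (2 + `|m.1| + `|m.2|) * (n2 F + n2 (G ord0) + n2 (G ord_max))].
Proof.
move=> d0 sF sG.
have [F1 F2] := n2_aff p d0 sF.
have [G1 G2] := n2_aff p d0 (sG ord0); have [H1 H2] := n2_aff p d0 (sG ord_max).
have B (k : R * R -> R) (M : R) (f : R * R -> R) : mble k -> (forall x, `|k x| <= M) -> sqi f ->
    sqi (fun x => k x * f x) /\ n2 (fun x => k x * f x) <= M * n2 f.
  move=> mk kM sf; have s1 := sqi_bounded mk kM sf; split => //.
  have M0 : 0 <= M by exact: (le_trans (normr_ge0 (k (0, 0)))).
  rewrite -[M in M * n2 f]ger0_norm// -n2Z//; apply: n2_le => //; first exact: sqiZ.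
  by move=> x; rewrite !normrM (ger0_norm M0) ler_wpM2r.
have m1 : mble (fun x : R * R => 2 * (oi x.1 * oi x.2)) by apply: mbleM; [exact: mble_cst|exact: mble_oi2].
have [s1 e1] := B _ _ _ m1 hh_coef1 F1.
have [s2 e2] := B _ _ _ (mble_co2 m.1) (hh_coef2 m.1) G1.
have [s3 e3] := B _ _ _ (mble_co2 m.2) (hh_coef2 m.2) H1.
have sh : sqi (hh p m v F G) by apply: sqiD => //; exact: sqiD.
split => //.
  apply: (@sqi_ing _ 2 _ sh) => x nx; apply: hh_out => -[/= h1 h2]; apply: nx.
  by move: h1 h2; clear; rewrite /= !in_itv /= => /andP[? ?] /andP[? ?]; split; rewrite ltr_norml; apply/andP; split; lra.
apply: (le_trans (n2D s1 (sqiD s2 s3))).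
apply: (@le_trans _ _ (2 * n2 (fun x => F (aff p m v x)) + (`|m.1| * n2 (fun x => G ord0 (aff p m v x)) + `|m.2| * n2 (fun x => G ord_max (aff p m v x))))).
  by apply: lerD => //; apply: (le_trans (n2D s2 s3)); exact: lerD.
rewrite F2 G2 H2; set S := Num.sqrt _; have S0 : 0 <= S by exact: sqrtr_ge0.
have := n2_ge0 F; have := n2_ge0 (G ord0); have := n2_ge0 (G ord_max).
move: (n2 F) (n2 _) (n2 _) => x y z z0 y0 x0.
have := normr_ge0 m.1; have := normr_ge0 m.2; move: `|m.1| `|m.2| => u u' u0 u0'.
rewrite -subr_ge0.
have -> : S * (2 + u + u') * (x + y + z) - (2 * (S * x) + (u * (S * y) + u' * (S * z))) =
  S * (2 * (y + z) + u * (x + z) + u' * (x + y)) by ring.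
by rewrite mulr_ge0// !addr_ge0// mulr_ge0// addr_ge0.
Qed.

(** The weight [2 * t - 1] in [FF] vanishes at 1/2 and equals -1 at 0, so the integral of its
    derivative returns the value on the side alone. *)
Lemma slice_hh_smooth p m v K f s : smooth f -> 0 < s < 2^-1 ->
  (forall t, 0 < t < 2^-1 -> K (aff p m v (t, s))) ->
  slice (hh p m v (rs K f) (fun i => rs K (pd i f))) s = f (aff p m v (0, s)).
Proof.
move=> sf s01 HK.
pose q : R * R := (p.1 + s * v.1, p.2 + s * v.2).
have qE t : aff p m v (t, s) = (q.1 + t * m.1, q.2 + t * m.2) by rewrite /aff /q /=; congr pair; ring.
pose FF (t : R) := (2 * t - 1) * f (q.1 + t * m.1, q.2 + t * m.2).
pose ff (t : R) := 2 * f (q.1 + t * m.1, q.2 + t * m.2) + (2 * t - 1) * dirpd m f (q.1 + t * m.1, q.2 + t * m.2).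
have dF (t : R) : is_derive t (1 : R) FF (ff t).
  have d1 : is_derive t (1 : R) (fun t : R => 2 * t - 1) 2.
    have -> : (fun t : R => 2 * t - 1) = (fun t : R => 2 *: (id t) - cst 1 t) by [].
    by apply: is_derive_eq; rewrite subr0 /GRing.scale /= mulr1.
  have d2 := is_derive_dir q m t sf.
  apply: (@is_derive_eq _ _ _ _ _ _ _ _ (is_deriveM d1 d2)).
  by rewrite /ff /GRing.scale /= addrC mulrC; congr (_ + _).
have cf : continuous ff.
  have ca : continuous (fun t : R => ((q.1 + t * m.1, q.2 + t * m.2) : R * R)).
    have H (a b : R) : continuous (fun t : R => a + t * b).
      by move=> t; apply: cvgD; [exact: cvg_cst|apply: cvgM; [exact: cvg_id|exact: cvg_cst]].
    by move=> t; exact: (cvg_pair (H _ _ t) (H _ _ t)).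
  move=> t; apply: cvgD; apply: cvgM.
  - exact: cvg_cst.
  - by apply: (@continuous_comp _ _ _ (fun t : R => ((q.1 + t * m.1, q.2 + t * m.2) : R * R)) f); [exact: ca|exact: smooth_cont].
  - by apply: cvgB; [apply: cvgM; [exact: cvg_cst|exact: cvg_id]|exact: cvg_cst].
  - by apply: (@continuous_comp _ _ _ (fun t : R => ((q.1 + t * m.1, q.2 + t * m.2) : R * R)) (dirpd m f)); [exact: ca|exact: dirpd_cont].
have h0 : (0 : R) < 2^-1 by lra.
have := ftc_seg h0 dF cf.
have -> : FF 2^-1 - FF 0 = f (aff p m v (0, s)) by rewrite /FF qE; field.
move=> <-; rewrite /slice /Rintegral; congr fine.
transitivity (\int[leb]_(t in `]0%R, 2^-1%R[%classic) (ff t)%:E)%E.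
  rewrite [RHS]integral_mkcond; apply: eq_integral => t _; rewrite patchE.
  case: (boolP (t \in _)) => [|/negP nt].
    rewrite inE /= in_itv /= => t01; have Kt := HK _ t01; rewrite /hh !(rs_in _ Kt) /= !oi_in// qE /ff /dirpd.
    by congr EFin; ring.
  have o0 : oi t = 0 by apply: oi_out => H; apply: nt; rewrite inE /= in_itv.
  by rewrite /hh [X in oi X]/= o0 !(mul0r, mulr0, addr0).
rewrite -(@integral_itv_bndoo R 0 2^-1 _ true false).
  rewrite [LHS]integral_mkcond; apply: eq_integral => t _; rewrite patchE indicE.
  by case: (t \in _); rewrite ?mul1r ?mul0r.
by apply/measurable_EFinP; apply: measurable_funTS; exact: continuous_measurable_fun.
Qed.

(** [hh] is linear in the function and its gradient, and it reproduces smooth functions on the side;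
    so the error is the slice of [hh] applied to [f - F] and [pd i f - G i]. *)
Lemma oi_le p m v K f F G : dt m v != 0 -> smooth f -> sqi (rs K f) -> (forall i, sqi (rs K (pd i f))) ->
  (forall s t, 0 < s < 2^-1 -> 0 < t < 2^-1 -> K (aff p m v (t, s))) ->
  sqi (rs K F) -> (forall i, sqi (rs K (G i))) ->
  let w := fun s => oi s * (f (aff p m v (0, s)) - slice (hh p m v (rs K F) (fun i => rs K (G i))) s) in
  sqi (up w) /\ n2 (up w) <= Num.sqrt (`|dt m v|^-1) * (2 + `|m.1| + `|m.2|) *
    (n2 (rs K (fun x => f x - F x)) + n2 (rs K (fun x => pd ord0 f x - G ord0 x)) +
     n2 (rs K (fun x => pd ord_max f x - G ord_max x))).
Proof.
move=> d0 sf s1 s2 HK sF sG w.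
have sFd : sqi (rs K (fun x => f x - F x)).
  by have := sqiB s1 sF; congr sqi; apply/funext => x; rewrite rsB.
have sGd i : sqi (rs K (fun x => pd i f x - G i x)).
  by have := sqiB (s2 i) (sG i); congr sqi; apply/funext => x; rewrite rsB.
pose h1 := hh p m v (rs K f) (fun i => rs K (pd i f)).
pose h2 := hh p m v (rs K F) (fun i => rs K (G i)).
pose h3 := hh p m v (rs K (fun x => f x - F x)) (fun i => rs K (fun x => pd i f x - G i x)).
have [_ i1 _] := hh_sqi p d0 s1 s2.
have [_ i2 _] := hh_sqi p d0 sF sG.
have [s3 i3 e3] := hh_sqi p d0 sFd sGd.
have h3E x : h3 x = h1 x - h2 x by rewrite /h1 /h2 /h3 /hh !rsB; move: (oi _) (oi _) (rs _ _ _) (rs _ _ _) (rs _ _ _) (rs _ _ _) (rs _ _ _) (rs _ _ _); clear=> *; ring.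
have out3 x : ~ U01 x -> h3 x = 0 by exact: hh_out.
have [su3 nu3] := slice_n2 i3 s3 out3.
pose w3 s := oi s * slice h3 s.
have mw : measurable_fun [set: R] w3 by apply: measurable_funM; [exact: oi_mble|exact: slice_mble].
have a0 := ae_snd (ing_fubini_y i1); have b0 := ae_snd (ing_fubini_y i2).
have E3 s : leb.-integrable setT (fun t => (h1 (t, s))%:E) -> leb.-integrable setT (fun t => (h2 (t, s))%:E) ->
   w3 s = w s.
  move=> j1 j2; rewrite /w3 /w; have [s01|s01] := pselect (0 < s < 2^-1); last by rewrite oi_out// !mul0r.
  congr (_ * _); rewrite -(slice_hh_smooth sf s01 (HK s ^~ s01)) -/h1 -/h2 /slice.
  rewrite -RintegralB//; apply: eq_Rintegral => t _; exact: h3E.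
have ae3 : {ae mu, forall x, up w3 x = up w x}.
  apply: aeS (ae_and a0 b0) => x [j1 j2]; rewrite /up (E3 _ j1 j2) //.
have mww : mble (up w).
  apply: mble_up; apply: measurable_funTS; apply: measurable_funM; first exact: oi_mble.
  apply: measurable_funB; last exact: slice_mble.
  apply: continuous_measurable_fun.
  have H (a b : R) : continuous (fun t : R => a + t * b).
    by move=> t; apply: cvgD; [exact: cvg_cst|apply: cvgM; [exact: cvg_id|exact: cvg_cst]].
  have E : (fun s => f (aff p m v (0, s))) = (fun s : R => f (p.1 + s * v.1, p.2 + s * v.2)).
    by apply/funext => s; rewrite /aff /= !mul0r !addr0.
  rewrite E => s; apply: (@continuous_comp _ _ _ (fun t : R => ((p.1 + t * v.1, p.2 + t * v.2) : R * R)) f).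
    exact: (cvg_pair (H _ _ s) (H _ _ s)).
  exact: smooth_cont.
have mw3 : mble (up w3) by apply: mble_up; exact: measurable_funTS.
have le3 x : `|up w3 x| <= `|up (slice h3) x|.
  by rewrite /up /w3 !normrM ler_wpM2l// ler_piMl// oi_le1.
have sw3 := sqi_le mw3 su3 le3.
split; first exact: sqi_ae mww ae3 sw3.
rewrite -(n2_ae mw3 mww ae3); apply: (le_trans (n2_le sw3 su3 le3)).
exact: (le_trans nu3).
Qed.

Lemma aff_seg (a b c : R * R) (s : R) : aff a (c - a) (b - a) (0, s) = a + s *: (b - a).
Proof. by apply: pair_eqP; rewrite /aff /= /GRing.scale /=; ring. Qed.

Lemma half_in_tri (a b c : R * R) (s t : R) : tdet a b c != 0 -> 0 < s < 2^-1 -> 0 < t < 2^-1 ->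
  (tri a b c)° (aff a (c - a) (b - a) (t, s)).
Proof.
move=> d0 /andP[s0 s1] /andP[t0 t1]; apply: otri_int => //.
have -> : aff a (c - a) (b - a) (t, s) = a + s *: (b - a) + t *: (c - a).
  by apply: pair_eqP; rewrite /aff /= /GRing.scale /=; ring.
by apply: otri_aff => //; lra.
Qed.

Lemma up_split w w1 w2 : sqi (up w1) -> sqi (up w2) -> mble (up w) ->
  {ae mu, forall x, up w x = up w1 x + up w2 x} -> sqi (up w) /\ n2 (up w) <= n2 (up w1) + n2 (up w2).
Proof.
move=> s1 s2 mw E; have s12 := sqiD s1 s2; have [m12 _] := s12.
have E' : {ae mu, forall x, up w1 x + up w2 x = up w x} by apply: aeS E => x ->.
split; first exact: sqi_ae mw E' s12.
by rewrite -(n2_ae m12 mw E'); exact: n2D.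
Qed.

Lemma oi_split (s A T1 T2 : R) : 0 < s -> s < 1 -> s != 2^-1 ->
  A - (oi s * T1 + oi (1 - s) * T2) = oi s * (A - T1) + oi (1 - s) * (A - T2).
Proof.
move=> s0 s1 n2'; suff E : oi s + oi (1 - s) = 1.
  transitivity ((oi s + oi (1 - s)) * A - (oi s * T1 + oi (1 - s) * T2)); first by rewrite E mul1r.
  by ring.
have [lt|ge] := ltP s 2^-1.
  by rewrite (oi_in (s := s)) ?s0// (oi_out (s := 1 - s)) ?addr0// => /andP[]; lra.
have gt : 2^-1 < s by rewrite lt_neqAle eq_sym n2' ge.
rewrite (oi_in (s := 1 - s)); last by apply/andP; split; lra.
by rewrite (oi_out (s := s)) ?add0r// => /andP[]; lra.
Qed.

(** The trace is written down from [F] and its gradient: on the half of the side near [a] with the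
    parallelogram at [a], on the other half with the one at [b], reflected. The constant depends on
    the triangle; it serves to identify traces and does not enter the final estimate. *)
Lemma trace_op (a b c : R * R) F G : tdet a b c != 0 -> H1p (tri a b c)° F G ->
  exists tau : R -> R, [/\ measurable_fun [set: R] tau, sqi (up tau) &
   exists2 C : R, 0 <= C & forall f, smooth f ->
     sqi (up (fun s => f (a + s *: (b - a)) - tau s)) /\
     n2 (up (fun s => f (a + s *: (b - a)) - tau s)) <=
      C * (n2 (rs (tri a b c)° (fun x => f x - F x)) +
           n2 (rs (tri a b c)° (fun x => pd ord0 f x - G ord0 x)) +
           n2 (rs (tri a b c)° (fun x => pd ord_max f x - G ord_max x)))].
Proof.
move=> d0 HF; have oK : open (tri a b c)° by exact: open_interior.
have mK := open_measurable_plane oK; have [M KM] := tri_bounded a b c.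
have KM' : (tri a b c)° `<=` sq (0, 0) M by move=> x /interior_subset /KM /(@Qo_sq R M).
have [/(Lsp2P _ mK)[_ sF] HG] := HF.
have sG i : sqi (rs (tri a b c)° (G i)) by have [_ /(Lsp2P _ mK)[]] := HG i.
have sS f : smooth f -> sqi (rs (tri a b c)° f).
  by move=> sf; have /(Lsp2P _ mK)[] := Lsp_smooth mK KM' sf.
have d0' : tdet b a c != 0 by rewrite tdet_swap12 oppr_eq0.
have d1 : dt (c - a) (b - a) != 0.
  have -> : dt (c - a) (b - a) = - tdet a b c by rewrite /tdet /dt; ring.
  by rewrite oppr_eq0.
have d2 : dt (c - b) (a - b) != 0.
  have -> : dt (c - b) (a - b) = tdet a b c by rewrite /tdet /dt /=; ring.
  by [].
have HK1 s t : 0 < s < 2^-1 -> 0 < t < 2^-1 -> (tri a b c)° (aff a (c - a) (b - a) (t, s)).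
  exact: half_in_tri.
have HK2 s t : 0 < s < 2^-1 -> 0 < t < 2^-1 -> (tri a b c)° (aff b (c - b) (a - b) (t, s)).
  by rewrite tri_swap12; exact: half_in_tri.
set K := (tri a b c)° in HK1 HK2 HF oK mK KM' sF sG sS HG *.
pose t1 := slice (hh a (c - a) (b - a) (rs K F) (fun i => rs K (G i))).
pose t2 := slice (hh b (c - b) (a - b) (rs K F) (fun i => rs K (G i))).
pose tau s := oi s * t1 s + oi (1 - s) * t2 (1 - s).
have [_ i1 _] := hh_sqi a d1 sF sG.
have [_ i2 _] := hh_sqi b d2 sF sG.
have m1s : measurable_fun [set: R] (fun s : R => 1 - s) by exact: measurable_funB.
have mtau : measurable_fun [set: R] tau.
  apply: measurable_funD; apply: measurable_funM; [exact: oi_mble|exact: slice_mble i1| |].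
    exact: (measurableT_comp oi_mble m1s).
  exact: (measurableT_comp (slice_mble i2) m1s).
have mseg f : smooth f -> mble (up (fun s => f (a + s *: (b - a)) - tau s)).
  move=> sf; apply: mble_up; apply: measurable_funTS; apply: measurable_funB => //.
  apply: continuous_measurable_fun.
  have H (x y : R) : continuous (fun t : R => x + t * y).
    by move=> t; apply: cvgD; [exact: cvg_cst|apply: cvgM; [exact: cvg_id|exact: cvg_cst]].
  move=> s; apply: (@continuous_comp _ _ _ (fun s : R => a + s *: (b - a)) f); last exact: smooth_cont.
  exact: (cvg_pair (H _ _ s) (H _ _ s)).
pose C1 := Num.sqrt (`|dt (c - a) (b - a)|^-1) * (2 + `|(c - a).1| + `|(c - a).2|).
pose C2 := Num.sqrt (`|dt (c - b) (a - b)|^-1) * (2 + `|(c - b).1| + `|(c - b).2|).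
have main f : smooth f -> sqi (up (fun s => f (a + s *: (b - a)) - tau s)) /\
     n2 (up (fun s => f (a + s *: (b - a)) - tau s)) <=
      (C1 + C2) * (n2 (rs K (fun x => f x - F x)) + n2 (rs K (fun x => pd ord0 f x - G ord0 x)) +
           n2 (rs K (fun x => pd ord_max f x - G ord_max x))).
  move=> sf; have sp i : sqi (rs K (pd i f)) by apply: sS; exact: smooth_pd.
  have [u1 e1] := oi_le d1 sf (sS _ sf) sp HK1 sF sG.
  have [u2 e2] := oi_le d2 sf (sS _ sf) sp HK2 sF sG.
  have [u2' e2'] := n2_refl u2.
  have E : {ae mu, forall x, up (fun s => f (a + s *: (b - a)) - tau s) x =
     up (fun s => oi s * (f (aff a (c - a) (b - a) (0, s)) - t1 s)) x +
     up (fun s => oi (1 - s) * (f (aff b (c - b) (a - b) (0, 1 - s)) - t2 (1 - s))) x}.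
    (* The two open halves leave out the end points and the midpoint of the side. *)
    have [h1 h2 h3] := And3 (ae_snd (ae_neq 0)) (ae_snd (ae_neq 1)) (ae_snd (ae_neq 2^-1)).
    apply: aeS (ae_and h1 (ae_and h2 h3)) => x [n0 [n1 n2']].
    rewrite !upE -!mulrDr; congr (_ * _); rewrite indicE; case: (boolP (x.2 \in _)) => [|_]; last by rewrite !mul0r ?addr0.
    rewrite inE /= in_itv /= !mul1r /tau => /andP[x0 x1].
    have x0' : 0 < x.2 by rewrite lt_neqAle eq_sym n0.
    have x1' : x.2 < 1 by rewrite lt_neqAle n1.
    rewrite !aff_seg; have -> : b + (1 - x.2) *: (a - b) = a + x.2 *: (b - a).
      by apply: pair_eqP; rewrite /= /GRing.scale /=; ring.
    exact: oi_split.
  have [sA nA] := up_split u1 u2' (mseg _ sf) E.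
  split; first exact: sA.
  apply: (le_trans nA); rewrite e2'; apply: (le_trans (lerD e1 e2)); rewrite -mulrDl; exact: lexx.
exists tau; split => //.
  have s0 := @smooth_cst R 0; have [s1 _] := main _ s0.
  have := sqiZ (-1) s1; congr sqi; apply/funext => x; rewrite /up; ring.
exists (C1 + C2) => //; rewrite addr_ge0// mulr_ge0 ?sqrtr_ge0// !addr_ge0//.
Qed.

End TraceOperator.

(** * Existence and uniqueness of traces *)

Section Traces.
Variable R : realType.
Local Notation mu := (@area R).
Local Notation leb := (@lebesgue_measure R).
Implicit Types (f h F : R * R -> R) (A K g : set (R * R)) (w tau : R -> R) (G : 'I_2 -> R * R -> R) (a b c m v : R * R).

Definition n3 K f F G := n2 (rs K (fun x => f x - F x)) + n2 (rs K (fun x => pd ord0 f x - G ord0 x)) +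
  n2 (rs K (fun x => pd ord_max f x - G ord_max x)).

Lemma cvg0Z (k : R) (e : nat -> R) : e n @[n --> \oo] --> (0 : R) -> k * e n @[n --> \oo] --> (0 : R).
Proof. by move=> e0; rewrite -[X in _ --> X](mulr0 k); apply: cvgM; [exact: cvg_cst|]. Qed.

Lemma n3_cvg K (phi : nat -> R * R -> R) F G : H1cvg K phi F G -> n3 K (phi n) F G @[n --> \oo] --> (0 : R).
Proof.
move=> [c1 c2]; have -> : (0 : R) = 0 + 0 + 0 by rewrite !addr0.
by apply: cvgD; [apply: cvgD; [exact: c1|exact: c2]|exact: c2].
Qed.

(* tau is the trace on [a, b] of a function F on K with gradient G. *)
Definition is_op K a b F G tau := [/\ measurable_fun [set: R] tau, sqi (up tau) &
   exists2 C : R, 0 <= C & forall f, smooth f ->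
     sqi (up (fun s => f (a + s *: (b - a)) - tau s)) /\
     n2 (up (fun s => f (a + s *: (b - a)) - tau s)) <= C * n3 K f F G].

Lemma is_op_sub K a b F G tau q : is_op K a b F G tau -> smooth q -> 
  is_op K a b (fun x => F x - q x) (fun i x => G i x - pd i q x) (fun s => tau s - q (a + s *: (b - a))).
Proof.
move=> [mt st [C C0 H]] sq.
have E f s : f (a + s *: (b - a)) - (tau s - q (a + s *: (b - a))) = (f (a + s *: (b - a)) + q (a + s *: (b - a))) - tau s by ring.
have mq : measurable_fun [set: R] (fun s => q (a + s *: (b - a))).
  apply: continuous_measurable_fun.
  have Hc (x y : R) : continuous (fun t : R => x + t * y).
    by move=> t; apply: cvgD; [exact: cvg_cst|apply: cvgM; [exact: cvg_id|exact: cvg_cst]].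
  move=> s; apply: (@continuous_comp _ _ _ (fun s : R => a + s *: (b - a)) q); last exact: smooth_cont.
  exact: (cvg_pair (Hc _ _ s) (Hc _ _ s)).
split; first exact: measurable_funB.
  have [s1 _] := H _ sq; have := sqiZ (-1) s1; congr sqi; apply/funext => x; rewrite /up; ring.
exists C => // f sf; have [s1 e1] := H _ (smoothD sf sq).
have E1 : up (fun s => f (a + s *: (b - a)) - (tau s - q (a + s *: (b - a)))) = up (fun s => (f (a + s *: (b - a)) + q (a + s *: (b - a))) - tau s).
  by apply/funext => x; rewrite /up E.
rewrite E1; split => //; apply: (le_trans e1); rewrite ler_wpM2l//.
rewrite /n3 !(pdD _ sf sq).
have D k1 k2 k3 : rs K (fun x => k1 x + k2 x - k3 x) = rs K (fun x : R * R => k1 x - (k3 x - k2 x)) :> (R * R -> R).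
  by apply/funext => x; congr (_ * _); ring.
by rewrite !D lexx.
Qed.

Lemma side_length_gt0 g : (ends g).1 <> (ends g).2 -> 0 < side_length g :> R.
Proof.
move=> n; rewrite /side_length /enorm sqrtr_gt0 /dot.
set x := _ - _; have x0 : x <> 0 by move=> /eqP; rewrite subr_eq0 => /eqP /esym.
rewrite lt_neqAle addr_ge0 ?andbT -?expr2 ?sqr_ge0//.
rewrite eq_sym paddr_eq0 ?sqr_ge0// !sqrf_eq0; apply/negP => /andP[/eqP h1 /eqP h2].
by apply: x0; apply: pair_eqP.
Qed.

Lemma side_L2E g (w : R * R -> R) : measurable_fun (`[0, 1] : set R) (w \o along g) ->
  sqi (up (w \o along g)) -> side_L2 g w = (Num.sqrt (side_length g) * n2 (up (w \o along g)))%:E.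
Proof.
move=> mw sw; rewrite /side_L2 (@Lnorm_up _ (w \o along g))// LnormE//.
Qed.

Lemma side_L2_sqi g (w : R * R -> R) : (ends g).1 <> (ends g).2 -> measurable_fun (`[0, 1] : set R) (w \o along g) ->
  (side_L2 g w < +oo)%E -> sqi (up (w \o along g)).
Proof.
move=> n mw; rewrite /side_L2 (@Lnorm_up _ (w \o along g))// => H; apply: Lnorm_sqi; first exact: mble_up.
have l0 : 0 < Num.sqrt (side_length g) by rewrite sqrtr_gt0 side_length_gt0.
rewrite ltNge; apply/negP; rewrite leye_eq => /eqP E.
by move: H; rewrite E gt0_muley ?lte_fin// ltxx.
Qed.

Lemma along_cont g (f : R * R -> R) : smooth f -> measurable_fun (`[0, 1] : set R) (f \o along g).
Proof.
move=> sf; apply: measurable_funTS; apply: continuous_measurable_fun.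
have Hc (x y : R) : continuous (fun t : R => x + t * y).
  by move=> t; apply: cvgD; [exact: cvg_cst|apply: cvgM; [exact: cvg_id|exact: cvg_cst]].
move=> s; apply: (@continuous_comp _ _ _ (along g) f); last exact: smooth_cont.
exact: (cvg_pair (Hc _ _ s) (Hc _ _ s)).
Qed.

Lemma squeeze0 (k : R) (e : nat -> R) : 0 <= k -> e n @[n --> \oo] --> (0 : R) -> (\forall n \near \oo, k <= e n) -> k = 0.
Proof.
move=> k0 e0 H; apply: le_anti; rewrite k0 andbT.
have := @ler_cvg_to _ _ _ _ (fun=> k) e k 0 (cvg_cst _) e0 H; exact.
Qed.

Lemma n2_eq0 f h : sqi f -> sqi h -> n2 (fun x => f x - h x) = 0 -> {ae mu, forall x, f x = h x}.
Proof.
move=> sf sh /eqP; rewrite -sqrf_eq0 n2_sq => /eqP H.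
have [_ i] := sqiB sf sh.
have := Int0_ae i (fun x => sqr_ge0 _) H; apply: aeS => x /eqP.
by rewrite sqrf_eq0 subr_eq0 => /eqP.
Qed.

Lemma tri_mble_sq a b c : exists M, (tri a b c)° `<=` @sq R (0, 0) M.
Proof. by have [M H] := tri_bounded a b c; exists M => x /interior_subset /H /(@Qo_sq R M). Qed.

Lemma trace_uniq K g c F G tau t : is_tri (ends g).1 (ends g).2 c K -> (ends g).1 <> (ends g).2 ->
  H1p K° F G -> is_op K° (ends g).1 (ends g).2 F G tau -> is_trace K g F t ->
  {ae mu, forall x, up (t \o along g) x = up tau x}.
Proof.
move=> [d0 KE] n HF [mt st [C C0 H]] [_ mtt [phi [sp cp cs]]].
have oK : open K° by exact: open_interior.
have [M KM] : exists M, K° `<=` sq (0, 0) M by rewrite KE; exact: tri_mble_sq.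
have /(H1cvgP oK KM sp HF) /n3_cvg c3 := cp.
have l0 : 0 < Num.sqrt (side_length g) by rewrite sqrtr_gt0 side_length_gt0.
have mB k : measurable_fun (`[0, 1] : set R) ((fun x => phi k x - t x) \o along g).
  by apply: measurable_funB => //; exact: along_cont.
(* A trace is only required to be measurable, and the side norms are extended reals. They are
   eventually finite, and a single finite one makes [t] square integrable. *)
have nf : \forall k \near \oo, sqi (up ((fun x => phi k x - t x) \o along g)).
  have /fine_cvgP[fn _] := cs; apply: filterS fn => k fk; apply: side_L2_sqi => //.
  by rewrite ltey_eq fk.
have c4 : n2 (up ((fun x => phi k x - t x) \o along g)) @[k --> \oo] --> (0 : R).
  have /fine_cvgP[_ fc] := cs.
  have H1 := cvg0Z (Num.sqrt (side_length g))^-1 fc.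
  apply: cvg_trans H1; apply: near_eq_cvg; apply: filterS nf => k sk /=.
  by rewrite side_L2E//= mulKf// gt_eqF.
have sU k : sqi (up (fun s => phi k ((ends g).1 + s *: ((ends g).2 - (ends g).1)) - tau s)) by have [] := H _ (sp k).
have st' : sqi (up (t \o along g)).
  have [k _ sk] := nf.
  have sk' := sk k (leqnn k); rewrite /= in sk'.
  have := sqiB (sqiD (sU k) st) sk'; congr sqi; apply/funext => x; rewrite /up /along /=; ring.
apply: n2_eq0 => //; apply: (squeeze0 (n2_ge0 _) (e := fun k => n2 (up ((fun x => phi k x - t x) \o along g)) + C * n3 K° (phi k) F G)).
  by rewrite -[X in _ --> X]addr0; apply: cvgD => //; exact: cvg0Z.
apply: filterS nf => k sk; have [s1 e1] := H _ (sp k).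
have skN := sqiZ (-1) sk.
rewrite (_ : (fun x => _) = (fun x => (-1) * up ((fun x => phi k x - t x) \o along g) x + up (fun s => phi k ((ends g).1 + s *: ((ends g).2 - (ends g).1)) - tau s) x)); last first.
  by apply/funext => x; rewrite /up /along /=; ring.
by apply: (le_trans (n2D skN s1)); rewrite n2Z// normrN1 mul1r lerD2l.
Qed.

Lemma trace_ex K g c F G : is_tri (ends g).1 (ends g).2 c K -> (ends g).1 <> (ends g).2 ->
  H1p K° F G -> exists tau, is_op K° (ends g).1 (ends g).2 F G tau /\ exists t, is_trace K g F t.
Proof.
move=> [d0 KE] n HF; set a := (ends g).1 in n d0 KE *; set b := (ends g).2 in n d0 KE *.
have HF' : H1p (tri a b c)° F G by rewrite -KE.
have [tau [mt st [C C0 H]]] := trace_op d0 HF'.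
have op : is_op K° a b F G tau by rewrite KE; split => //; exists C.
exists tau; split => //.
have oK : open K° by exact: open_interior.
have [M KM] : exists M, K° `<=` sq (0, 0) M by rewrite KE; exact: tri_mble_sq.
have [q [r [M' [r0 KM' Hs]]]] := tri_star d0.
have [phi [sp cp]] := H1_density (@open_interior _ (tri a b c)) KM' r0 Hs HF'.
pose L2 := dot (b - a) (b - a).
have L20 : L2 != 0.
  have := side_length_gt0 n; rewrite /side_length /enorm sqrtr_gt0 -/a -/b => /gt_eqF /negbT; exact.
(* A trace is a function on the plane: [tau] is extended to be constant along the perpendiculars to
   the side. *)
exists (fun x => tau (dot (x - a) (b - a) / L2)).
have E s : dot (along g s - a) (b - a) / L2 = s.
  by rewrite /along -/a -/b /dot /= /L2 /dot /= in L20 *; rewrite /GRing.scale /=; field.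
split; first exact: H1p_W1 HF.
  rewrite (_ : _ \o _ = tau); first exact: measurable_funTS.
  by apply/funext => s; rewrite /= E.
exists phi; split => //; first by apply/(H1cvgP oK KM sp HF); rewrite KE.
have mB k : measurable_fun (`[0, 1] : set R) (phi k \o along g) by exact: along_cont.
have Ek k : (fun x => phi k x - tau (dot (x - a) (b - a) / L2)) \o along g = (fun s => phi k (a + s *: (b - a)) - tau s).
  by apply/funext => s; rewrite /= E.
have Es k : side_L2 g (fun x => phi k x - tau (dot (x - a) (b - a) / L2)) = (Num.sqrt (side_length g) * n2 (up (fun s => phi k (a + s *: (b - a)) - tau s)))%:E.
  rewrite side_L2E Ek//; last by have [] := H _ (sp k).
  by apply: measurable_funB; [exact: mB|exact: measurable_funTS].
rewrite (_ : (fun k => side_L2 _ _) = (fun k => (Num.sqrt (side_length g) * n2 (up (fun s => phi k (a + s *: (b - a)) - tau s)))%:E)); last by apply/funext => k; rewrite Es.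
apply: cvg_EFin; first exact: nearW.
apply: cvg0Z.
have c3 := cvg0Z C (n3_cvg cp).
apply: (@squeeze_cvgr _ _ _ _ (fun=> 0) _ _ _ _ _ c3); last exact: cvg_cst.
by apply: nearW => k; rewrite n2_ge0 /=; have [] := H _ (sp k).
Qed.

Lemma trace_is K g c F G : is_tri (ends g).1 (ends g).2 c K -> (ends g).1 <> (ends g).2 ->
  H1p K° F G -> is_trace K g F (trace K g F).
Proof.
move=> tK n HF; have [tau [_ [t tt]]] := trace_ex tK n HF.
by rewrite /trace; case: xgetP => [y -> //|/(_ t)].
Qed.

End Traces.

(** * Integration by parts near the middle of a side *)

Section GreenTrace.
Variable R : realType.
Local Notation mu := (@area R).
Local Notation leb := (@lebesgue_measure R).
Implicit Types (f h F psi : R * R -> R) (A K g : set (R * R)) (w tau : R -> R) (G : 'I_2 -> R * R -> R) (a b c m v : R * R).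

Lemma Int_up w : ing (up w) -> Int (up w) = \int[leb]_s (\1_(`[0, 1]%classic) s * w s).
Proof.
move=> iu; rewrite ing_fubini//; apply: eq_Rintegral => s _.
have iI : leb.-integrable setT (fun t => (\1_(`[0, 1]%classic : set R) t)%:E).
  exact: (@integrable_indic_itv R 0 1 true false).
transitivity (\int[leb]_t ((\1_(`[0, 1]%classic) s * w s) * \1_(`[0, 1]%classic) t)).
  by apply: eq_Rintegral => t _; rewrite upE /= mulrC.
rewrite RintegralZl// (_ : \int[leb]_t _ = 1) ?mulr1//.
by rewrite /Rintegral integral_indic// setIT [X in fine X]leb01.
Qed.

Lemma seg_cont a v (f : R * R -> R) : continuous f -> continuous (fun s : R => f (a + s *: v)).
Proof.
move=> cf; have Hc (x y : R) : continuous (fun t : R => x + t * y).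
  by move=> t; apply: cvgD; [exact: cvg_cst|apply: cvgM; [exact: cvg_id|exact: cvg_cst]].
move=> s; apply: (@continuous_comp _ _ _ (fun s : R => a + s *: v) f); last exact: cf.
exact: (cvg_pair (Hc _ _ s) (Hc _ _ s)).
Qed.

Lemma sqi_up_cont w : continuous w -> sqi (up w) /\ ing (up w).
Proof.
move=> cw.
have c2 : continuous (fun x : R * R => w x.2).
  by move=> x; apply: (@continuous_comp _ _ _ (fun x : R * R => x.2) w); [exact: cvg_snd|exact: cw].
have c3 : continuous (fun x : R * R => w x.2 * w x.2) by move=> x; apply: cvgM; exact: c2.
have i1 := ing_box_cont 0 1 0 1 c2; have i2 := ing_box_cont 0 1 0 1 c3.
split; last exact: i1.
split; first exact: (ing_mble i1).
apply: eq_ing i2 => x; rewrite /up /U01 indicE; case: (_ \in _); rewrite ?mul1r// !mul0r expr0n//.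
Qed.

(** A quarter turn of [v], to the left for [sg = 1] and to the right for [sg = -1]; the sign encodes
    on which side of the segment the triangle lies. *)
Definition perp (sg : R) v : R * R := (- (sg * v.2), sg * v.1).

Lemma green_rng (d t s : R) : 0 < d -> t <= d -> 4^-1 <= s -> s <= 3 / 4 -> [/\ t < 2 * d, 8^-1 < s & s < 7 / 8].
Proof. by move=> *; split; lra. Qed.
Lemma green_rng2 (s : R) : 4^-1 <= s <= 3 / 4 -> [/\ 0 <= s <= 1 & 8^-1 <= s <= 7 / 8].
Proof. by move=> /andP[? ?]; split; apply/andP; split; lra. Qed.

Lemma green_num : [/\ (8^-1 : R) < 7 / 8, ~~ ((7 / 8 : R) <= 3 / 4) & ~~ ((4^-1 : R) <= 8^-1)].
Proof. by split; rewrite -?ltNge; lra. Qed.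

(** In the frame [(m, v)] the support of [F] meets [K] in half a rectangle. The derivative along [v]
    integrates to 0, and the one along [m] leaves the values on the side. The box of integration, of
    depth [2 * d] and between 1/8 and 7/8, is strictly larger than the support, so that no other
    boundary value survives. *)
Lemma green_smooth K a v sg d F i : open K -> (exists M, K `<=` sq (0, 0) M) -> smooth F -> 0 < d ->
  sg ^+ 2 = 1 -> 0 < dot v v ->
  (forall t s, 0 < t < 2 * d -> 8^-1 < s < 7 / 8 -> K (aff a (perp sg v) v (t, s))) ->
  (forall t s, t < 0 -> ~ K (aff a (perp sg v) v (t, s))) ->
  (forall t s, ~ (`|t| <= d /\ 4^-1 <= s <= 3 / 4) -> F (aff a (perp sg v) v (t, s)) = 0 /\ pd i F (aff a (perp sg v) v (t, s)) = 0) ->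
  Int (rs K (pd i F)) = - co i (perp sg v) * Int (up (fun s => F (a + s *: v))).
Proof.
move=> oK [M KM] sF d0 sg1 v0 HK HN HF; set m := perp sg v in HK HN HF *.
have mK := open_measurable_plane oK; set L := dot v v in v0 *.
have detE : m.1 * v.2 - m.2 * v.1 = - (sg * L) by rewrite /m /perp /L /dot /=; ring.
have L0 : L != 0 by rewrite gt_eqF.
have sg0 : sg != 0 by rewrite -sqrf_eq0 sg1 oner_eq0.
have nsg : `|sg| = 1.
  by move/eqP: sg1; rewrite sqrf_eq1 => /orP[]/eqP ->; rewrite ?normrN1 ?normr1.
have det0 : m.1 * v.2 - m.2 * v.1 != 0 by rewrite detE oppr_eq0 mulf_neq0.
have detL : `|m.1 * v.2 - m.2 * v.1| = L by rewrite detE normrN normrM nsg mul1r gtr0_norm.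
have iF : ing (rs K (pd i F)) := ing_cont_sq mK KM (smooth_cont (@smooth_pd _ i _ sF)).
have := Int_aff a det0 iF; rewrite detL => E1.
have -> : Int (rs K (pd i F)) = L * Int (fun x => rs K (pd i F) (aff a m v x)) by rewrite E1 mulrA mulfV// mul1r.
pose I : R * R -> R := \1_(box 0 (2 * d) 8^-1 (7 / 8)).
have cdir u : continuous (fun y => dirpd u F (aff a m v y)).
  move=> y; apply: (@continuous_comp _ _ _ (aff a m v) (dirpd u F)); [exact: continuous_aff|exact: dirpd_cont].
have iD u : ing (fun y => I y * dirpd u F (aff a m v y)) by exact: (ing_box_cont _ _ _ _ (cdir u)).
(* The frame is orthogonal and both its vectors have squared length [L]. *)
have pdE x : pd i F x = L^-1 * (co i m * dirpd m F x + co i v * dirpd v F x).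
  apply: (mulfI L0); rewrite mulrA mulfV// mul1r /L /dot /dirpd /m /perp /=.
  by case: (ei_cases R i) => -[_ ->]; rewrite /co /=; move: (pd _ _ x) (pd _ _ x) sg1; clear=> p q sg1; ring: sg1.
have ae0 : {ae mu, forall x : R * R, x.1 != 0}.
  exists ([set (0 : R)] `*` setT); split; first exact: measurableX.
    transitivity (leb [set (0 : R)%R] * leb setT)%E; first exact: product_measure1E.
    by rewrite [X in (X * _)%E]lebesgue_measure_set1 mul0e.
  by move=> x /= /negP; rewrite negbK => /eqP.
have E2 : Int (fun x => rs K (pd i F) (aff a m v x)) =
    Int (fun x => L^-1 * (co i m * (I x * dirpd m F (aff a m v x)) + co i v * (I x * dirpd v F (aff a m v x)))).
  apply: Int_ae.
  - by apply: mble_aff; exact: (ing_mble iF).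
  - by apply: (ing_mble); apply: ingZ; apply: ingD; apply: ingZ; exact: iD.
  apply: aeS ae0 => -[t s] /= t0.
  have -> : L^-1 * (co i m * (I (t, s) * dirpd m F (aff a m v (t, s))) + co i v * (I (t, s) * dirpd v F (aff a m v (t, s)))) =
     I (t, s) * pd i F (aff a m v (t, s)) by rewrite pdE; ring.
  have [B|B] := pselect (`|t| <= d /\ 4^-1 <= s <= 3 / 4); last first.
    by have [_ z] := HF _ _ B; rewrite /rs z !mulr0.
  move: B => [td /andP[s1 s2]].
  have [tp|tn] := ltP 0 t.
    have td' : t <= d by move: td; rewrite gtr0_norm.
    have [r1 r2 r3] := green_rng d0 td' s1 s2.
    have Ki : K (aff a m v (t, s)) by apply: HK; rewrite ?tp ?r1 ?r2 ?r3.
    rewrite (rs_in _ Ki) /I indicE mem_set ?mul1r//.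
    by split; rewrite /= in_itv /= !ltW.
  have tn' : t < 0 by rewrite lt_neqAle t0.
  rewrite (rs_out _ (HN _ _ tn')) /I indicE memNset ?mul0r// => -[/=].
  by rewrite in_itv /= leNgt tn'.
rewrite E2 IntZ; last by apply: ingD; apply: ingZ; exact: iD.
rewrite IntD; [|by apply: ingZ; exact: iD|by apply: ingZ; exact: iD].
rewrite !IntZ; [|exact: iD|exact: iD].
have h1 : (0 : R) < 2 * d by rewrite mulr_gt0.
have [h2 h3 h4] := green_num.
have R1 : Int (fun y => I y * dirpd m F (aff a m v y)) = - Int (up (fun s => F (a + s *: v))).
  have sF' := smoothZ (-1) sF.
  have -> : Int (fun y => I y * dirpd m F (aff a m v y)) = - Int (fun y => I y * dirpd m (fun x => (-1) * F x) (aff a m v y)).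
    rewrite -IntN; last exact: (ing_box_cont _ _ _ _ (fun y => @continuous_comp _ _ _ (aff a m v) (dirpd m (fun x => (-1) * F x)) y (@continuous_aff _ _ _ _ y) (@dirpd_cont _ m _ sF' _))).
    by apply: eq_Int => y; rewrite /dirpd !(pdZ _ _ sF); ring.
  rewrite (rect_int a m v _ _ h1 sF') Int_up; last by have [] := sqi_up_cont (seg_cont (a := a) (v := v) (smooth_cont sF)).
  congr (- _); apply: eq_Rintegral => s _.
  have [z1 _] : F (aff a m v (2 * d, s)) = 0 /\ pd i F (aff a m v (2 * d, s)) = 0.
    by apply: HF => -[+ _]; rewrite (ger0_norm (ltW h1)) leNgt (_ : d < 2 * d)// ltr_pMl// ltr1n.
  have aE : aff a m v (0, s) = a + s *: v by apply: pair_eqP; rewrite /aff /= /GRing.scale /=; ring.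
  rewrite z1 mulr0 sub0r aE mulN1r opprK.
  have [B|B] := pselect (4^-1 <= s <= 3 / 4).
    by have [q1 q2] := green_rng2 B; rewrite !indicE !mem_set//= in_itv.
  have [z2 _] : F (aff a m v (0, s)) = 0 /\ pd i F (aff a m v (0, s)) = 0 by apply: HF => -[_ /B].
  by rewrite -aE z2 !mulr0.
have R2 : Int (fun y => I y * dirpd v F (aff a m v y)) = 0.
  rewrite (rect_int2 a m v _ _ h2 sF); transitivity (\int[leb]_t (0 : R)); last by rewrite /Rintegral integral0.
  apply: eq_Rintegral => t _.
  have [z1 _] : F (aff a m v (t, 7 / 8)) = 0 /\ pd i F (aff a m v (t, 7 / 8)) = 0.
    by apply: HF => -[_ /andP[_]]; rewrite (negbTE h3).
  have [z2 _] : F (aff a m v (t, 8^-1)) = 0 /\ pd i F (aff a m v (t, 8^-1)) = 0.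
    by apply: HF => -[_ /andP[]]; rewrite (negbTE h4).
  by rewrite z1 z2 subr0 mulr0.
rewrite R1 R2 mulr0 addr0 mulrA mulfV// mul1r mulrN mulNr//.
Qed.

Lemma Int_abs_cs f h : sqi f -> sqi h -> `|Int (fun x => f x * h x)| <= n2 f * n2 h.
Proof. by move=> sf sh; apply: (le_trans (Int_abs_le (sqi_mul sf sh))); exact: cauchy_schwarz_abs. Qed.

Lemma add3_le (x y z : R) : 0 <= x -> 0 <= y -> 0 <= z -> [/\ x <= x + y + z, y <= x + y + z & z <= x + y + z].
Proof. by move=> *; split; lra. Qed.

(** Both sides are continuous in [F] for the H^1 norm, the boundary term by the estimate in [is_op].
    So the defect [X], which is 0 for smooth functions, is bounded by a multiple of the distance
    [n3] to any smooth [f], and density makes it 0. *)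
Lemma green_trace K a b sg d F G tau psi i : open K -> (exists M, K `<=` sq (0, 0) M) -> smooth psi -> 0 < d ->
  sg ^+ 2 = 1 -> 0 < dot (b - a) (b - a) ->
  (forall t s, 0 < t < 2 * d -> 8^-1 < s < 7 / 8 -> K (aff a (perp sg (b - a)) (b - a) (t, s))) ->
  (forall t s, t < 0 -> ~ K (aff a (perp sg (b - a)) (b - a) (t, s))) ->
  (forall t s, ~ (`|t| <= d /\ 4^-1 <= s <= 3 / 4) -> psi (aff a (perp sg (b - a)) (b - a) (t, s)) = 0 /\
     pd i psi (aff a (perp sg (b - a)) (b - a) (t, s)) = 0) ->
  H1p K F G -> is_op K a b F G tau -> (exists phi, (forall n, smooth (phi n)) /\ H1cvg K phi F G) ->
  Int (rs K (fun x => F x * pd i psi x + G i x * psi x)) =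
  - co i (perp sg (b - a)) * Int (up (fun s => tau s * psi (a + s *: (b - a)))).
Proof.
move=> oK [M KM] sp d0 sg1 v0 HK HN Hp HF [mt st [C C0 Ho]] [phi [sphi cphi]].
have mK := open_measurable_plane oK.
have [/(Lsp2P _ mK)[_ sF] HG] := HF.
have sG j : sqi (rs K (G j)) by have [_ /(Lsp2P _ mK)[]] := HG j.
have sS f : smooth f -> sqi (rs K f) by move=> sf; have /(Lsp2P _ mK)[] := Lsp_smooth mK KM sf.
have sps : sqi (rs K psi) by exact: sS.
have spd : sqi (rs K (pd i psi)) by apply: sS; exact: smooth_pd.
set k := co i _.
pose up_psi := up (fun s => psi (a + s *: (b - a))).
have [sup iup] := sqi_up_cont (seg_cont (a := a) (v := b - a) (smooth_cont sp)).
pose X := Int (rs K (fun x => F x * pd i psi x + G i x * psi x)) + k * Int (up (fun s => tau s * psi (a + s *: (b - a)))).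
pose C1 := n2 (rs K (pd i psi)) + n2 (rs K psi) + `|k| * (C * n2 up_psi).
have rsMM (f h : R * R -> R) x : rs K (fun y => f y * h y) x = rs K f x * rs K h x.
  by rewrite /rs indicE; case: (x \in K); rewrite ?mul1r ?mul0r.
have upMM (f h : R -> R) x : up (fun y => f y * h y) x = up f x * up h x.
  by rewrite /up indicE; case: (_ \in _); rewrite ?mul1r ?mul0r.
have bd f : smooth f -> `|X| <= C1 * n3 K f F G.
  move=> sf; have [so eo] := Ho _ sf.
  have sfp := smoothM sf sp.
  have g0 : Int (rs K (pd i (fun x => f x * psi x))) + k * Int (up (fun s => f (a + s *: (b - a)) * psi (a + s *: (b - a)))) = 0.
    rewrite (green_smooth oK (ex_intro _ M KM) sfp d0 sg1 v0 HK HN) ?mulNr ?addNr//.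
    by move=> t s /Hp[z1 z2]; rewrite (pdM _ sf sp) z1 z2 !mulr0 mul0r addr0.
  have sFd : sqi (rs K (fun x => f x - F x)).
    by have := sqiB (sS _ sf) sF; congr sqi; apply/funext => x; rewrite rsB.
  have sGd j : sqi (rs K (fun x => pd j f x - G j x)).
    by have := sqiB (sS _ (@smooth_pd _ j _ sf)) (sG j); congr sqi; apply/funext => x; rewrite rsB.
  have [suf _] := sqi_up_cont (seg_cont (a := a) (v := b - a) (smooth_cont sf)).
  have E : X = - (Int (fun x => rs K (fun x => f x - F x) x * rs K (pd i psi) x) +
      Int (fun x => rs K (fun x => pd i f x - G i x) x * rs K psi x) +
      k * Int (fun x => up (fun s => f (a + s *: (b - a)) - tau s) x * up_psi x)).
    have J1 : Int (fun x => rs K (fun x => f x - F x) x * rs K (pd i psi) x) =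
       Int (fun x => rs K f x * rs K (pd i psi) x) - Int (fun x => rs K F x * rs K (pd i psi) x).
      rewrite -IntB; [|exact: sqi_mul (sS _ sf) spd|exact: sqi_mul sF spd].
      by apply: eq_Int => x; rewrite rsB mulrBl.
    have J2 : Int (fun x => rs K (fun x => pd i f x - G i x) x * rs K psi x) =
       Int (fun x => rs K (pd i f) x * rs K psi x) - Int (fun x => rs K (G i) x * rs K psi x).
      rewrite -IntB; [|exact: sqi_mul (sS _ (@smooth_pd _ i _ sf)) sps|exact: sqi_mul (sG i) sps].
      by apply: eq_Int => x; rewrite rsB mulrBl.
    have J3 : Int (fun x => up (fun s => f (a + s *: (b - a)) - tau s) x * up_psi x) =
       Int (up (fun s => f (a + s *: (b - a)) * psi (a + s *: (b - a)))) - Int (up (fun s => tau s * psi (a + s *: (b - a)))).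
      rewrite -IntB.
      - by apply: eq_Int => x; rewrite !upMM /up_psi /up; ring.
      - by apply: eq_ing (sqi_mul suf sup) => x; rewrite upMM.
      - by apply: eq_ing (sqi_mul st sup) => x; rewrite upMM.
    have J4 : Int (rs K (pd i (fun x => f x * psi x))) = Int (fun x => rs K f x * rs K (pd i psi) x) + Int (fun x => rs K (pd i f) x * rs K psi x).
      rewrite -IntD; [|exact: sqi_mul (sS _ sf) spd|exact: sqi_mul (sS _ (@smooth_pd _ i _ sf)) sps].
      by apply: eq_Int => x; rewrite (pdM _ sf sp) rsD !rsMM; ring.
    have J5 : Int (rs K (fun x => F x * pd i psi x + G i x * psi x)) = Int (fun x => rs K F x * rs K (pd i psi) x) + Int (fun x => rs K (G i) x * rs K psi x).
      rewrite -IntD; [|exact: sqi_mul sF spd|exact: sqi_mul (sG i) sps].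
      by apply: eq_Int => x; rewrite rsD !rsMM.
    by rewrite J1 J2 J3 /X J5; move: g0; rewrite J4; move: (Int _) (Int _) (Int _) (Int _) (Int _) (Int _); clear=> *; lra.
  rewrite E normrN /C1.
  have b1 := Int_abs_cs sFd spd; have b2 := Int_abs_cs (sGd i) sps; have b3 := Int_abs_cs so sup.
  have Gle : n2 (rs K (fun x => pd i f x - G i x)) <= n3 K f F G.
    have [_ h1 h2] := add3_le (n2_ge0 (rs K (fun x => f x - F x))) (n2_ge0 (rs K (fun x => pd ord0 f x - G ord0 x)))
      (n2_ge0 (rs K (fun x => pd ord_max f x - G ord_max x))).
    by case: (ei_cases R i) => -[_ ->]; [exact: h1|exact: h2].
  have Fle : n2 (rs K (fun x => f x - F x)) <= n3 K f F G.
    by have [h _ _] := add3_le (n2_ge0 (rs K (fun x => f x - F x))) (n2_ge0 (rs K (fun x => pd ord0 f x - G ord0 x)))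
      (n2_ge0 (rs K (fun x => pd ord_max f x - G ord_max x))); exact: h.
  apply: (le_trans (ler_normD _ _)); rewrite mulrDl normrM; apply: lerD; last first.
    rewrite -mulrA ler_wpM2l//; apply: (le_trans b3); rewrite mulrAC ler_wpM2r ?n2_ge0//.
  apply: (le_trans (ler_normD _ _)); rewrite mulrDl; apply: lerD.
    by apply: (le_trans b1); rewrite mulrC ler_wpM2l ?n2_ge0.
  by apply: (le_trans b2); rewrite mulrC ler_wpM2l ?n2_ge0.
have X0 : `|X| = 0.
  apply: (squeeze0 (normr_ge0 _) (e := fun n => C1 * n3 K (phi n) F G)); first by apply: cvg0Z; exact: n3_cvg.
  apply: nearW => n; exact: (bd _ (sphi n)).
by move/eqP: X0; rewrite normr_eq0 /X addr_eq0 => /eqP ->; rewrite mulNr.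
Qed.
End GreenTrace.

(** * Smooth functions dual to the monomials on the unit interval *)

Section DualFunctions.
Variable R : realType.
Local Notation mu := (@area R).
Local Notation leb := (@lebesgue_measure R).
Implicit Types (w p q : R -> R).

Definition I1 w : R := Int (up w).

Lemma I1_ing w : continuous w -> ing (up w).
Proof. by move=> cw; have [] := sqi_up_cont cw. Qed.

Lemma eq_I1 p q : (forall s, 0 <= s <= 1 -> p s = q s) -> I1 p = I1 q.
Proof.
move=> H; apply: eq_Int => x; rewrite /up indicE; case: (boolP (x \in _)); last by rewrite !mul0r.
by rewrite inE => -[_ /=]; rewrite in_itv /= => /H ->.
Qed.

Lemma I1D p q : continuous p -> continuous q -> I1 (fun s => p s + q s) = I1 p + I1 q.
Proof.
move=> cp cq; rewrite -IntD; [|exact: I1_ing|exact: I1_ing].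
by apply: eq_Int => x; rewrite /up mulrDr.
Qed.

Lemma I1Z (k : R) p : continuous p -> I1 (fun s => k * p s) = k * I1 p.
Proof.
by move=> cp; rewrite -IntZ; [apply: eq_Int => x; rewrite /up mulrCA|exact: I1_ing].
Qed.

Lemma I1_0 : I1 (fun=> 0) = 0.
Proof. by rewrite -[RHS](@Int0 R); apply: eq_Int => x; rewrite /up mulr0. Qed.

Lemma cont_sum n (F : 'I_n -> R -> R) : (forall k, continuous (F k)) -> continuous (fun s => \sum_(k < n) F k s).
Proof.
elim: n F => [|n IH] F cF.
  by rewrite (_ : (fun s => _) = fun=> 0); [move=> s; exact: cvg_cst|apply/funext => s; rewrite big_ord0].
rewrite (_ : (fun s => _) = (fun s => (\sum_(k < n) F (widen_ord (leqnSn n) k) s) + F ord_max s)).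
  by move=> s; apply: cvgD; [exact: IH|exact: cF].
by apply/funext => s; rewrite big_ord_recr.
Qed.

Lemma I1_sum n (F : 'I_n -> R -> R) : (forall k, continuous (F k)) ->
  I1 (fun s => \sum_(k < n) F k s) = \sum_(k < n) I1 (F k).
Proof.
elim: n F => [|n IH] F cF.
  rewrite big_ord0; transitivity (I1 (fun=> 0)); last exact: I1_0.
  by apply: eq_I1 => s _; rewrite big_ord0.
rewrite big_ord_recr /= -IH// -I1D//; last by apply: cont_sum.
by apply: eq_I1 => s _; rewrite big_ord_recr.
Qed.

Lemma I1_eq0 p : continuous p -> (forall s, 0 <= p s) -> I1 p = 0 -> forall s, 0 < s < 1 -> p s = 0.
Proof.
move=> cp p0 I0 s s01; have i := I1_ing cp.
have up0 (x : R * R) : 0 <= up p x by rewrite /up mulr_ge0// indicE.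
have ae0 := Int0_ae i up0 I0.
apply/eqP/negPn/negP => ps.
have ps0 : 0 < p s by rewrite lt_neqAle eq_sym ps p0.
pose U : set (R * R) := [set x | 0 < x.1 /\ x.1 < 1] `&` [set x | 0 < p x.2] `&` [set x | 0 < x.2 /\ x.2 < 1].
have c2 : continuous (fun x : R * R => p x.2).
  by move=> x; apply: (@continuous_comp _ _ _ (fun x : R * R => x.2) p); [exact: cvg_snd|exact: cp].
have o1 (f : R * R -> R) : continuous f -> open [set x | 0 < f x].
  move=> cf; have -> : [set x | 0 < f x] = f @^-1` [set z : R | 0 < z] by [].
  by apply: open_comp; [move=> x _; exact: cf|exact: open_gt].
have o2 (f : R * R -> R) : continuous f -> open [set x | f x < 1].
  move=> cf; have -> : [set x | f x < 1] = f @^-1` [set z : R | z < 1] by [].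
  by apply: open_comp; [move=> x _; exact: cf|exact: open_lt].
have oU : open U.
  apply: openI; first apply: openI.
  - by apply: openI; [apply: o1|apply: o2]; move=> x; exact: cvg_fst.
  - exact: o1.
  - by apply: openI; [apply: o1|apply: o2]; move=> x; exact: cvg_snd.
have Us : U (2^-1, s).
  by split; [split => //=; split; lra|move: s01 => /andP[]].
have [x [[[x1 x2] x3] [x4 x5]]] := ae_ex oU Us ae0.
rewrite /up indicE mem_set ?mul1r; first by move=> /eqP; rewrite gt_eqF.
by split; rewrite /= in_itv /= !ltW.
Qed.

(** A polynomial of size at most [n] with the [n + 1] roots [rs], equally spaced inside (1/4, 3/4),
    is zero. *)
Lemma poly_itv0 n (c : 'I_n -> R) : (forall s, 4^-1 < s < 3 / 4 -> \sum_(k < n) c k * s ^+ k = 0) -> forall k, c k = 0.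
Proof.
move=> H; pose p : {poly R} := \poly_(k < n) (if insub k is Some i then c i else 0).
have pE s : p.[s] = \sum_(k < n) c k * s ^+ k.
  by rewrite horner_poly; apply: eq_bigr => k _; rewrite valK.
pose rs := [seq 4^-1 + (2 * n.+2%:R)^-1 * i.+1%:R : R | i <- iota 0 n.+1].
have n0 : 0 < n.+2%:R :> R by rewrite ltr0n.
have p0 : p = 0.
  apply: (@roots_geq_poly_eq0 _ p rs).
  - apply/allP => x /mapP[i]; rewrite mem_iota add0n /= => /= ilt ->; apply/rootP; rewrite pE H//.
    have i0 : 0 < i.+1%:R :> R by rewrite ltr0n.
    have i1 : i.+1%:R < n.+2%:R :> R by rewrite ltr_nat.
    rewrite invfM; have -> : 2^-1 / n.+2%:R * i.+1%:R = 2^-1 * (i.+1%:R / n.+2%:R) :> R by ring.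
    have q0 : 0 < i.+1%:R / n.+2%:R :> R by rewrite divr_gt0.
    have q1 : i.+1%:R / n.+2%:R < 1 :> R by rewrite ltr_pdivrMr// mul1r.
    by move: (_ / _) q0 q1 => q *; apply/andP; split; lra.
  - rewrite map_inj_uniq ?iota_uniq// => i j /addrI /mulfI E.
    have : i.+1%:R = j.+1%:R :> R by apply: E; rewrite invr_eq0 mulf_neq0 ?pnatr_eq0.
    by move=> /eqP; rewrite eqr_nat eqSS => /eqP.
  - by rewrite size_map size_iota; apply: (leq_trans (size_poly _ _)).
move=> k; have := congr1 (fun q : {poly R} => q`_k) p0.
by rewrite coef_poly ltn_ord coef0 valK.
Qed.

Definition mb (k : nat) (s : R) : R := s ^+ k * bump0 s.
Lemma smooth1_mb k : smooth1 (mb k).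
Proof. by apply: smooth1M; [exact: (@smooth1X _ (fun s => s) k (@smooth1_id R))|exact: smooth1_bump0]. Qed.

(** The Gram matrix of the monomials for the scalar product with weight [bump0]. *)
Definition gram n : 'M[R]_n := \matrix_(i, j) I1 (mb (i + j)).

(** A vector of the kernel gives a polynomial whose square has integral 0 against [bump0]; it then
    vanishes on (1/4, 3/4), and so do its coefficients. *)
Lemma gram_unit n : gram n \in unitmx.
Proof.
rewrite -row_free_unit; apply: inj_row_free => c c0.
have E : I1 (fun s => (\sum_(k < n) c 0 k * s ^+ k) ^+ 2 * bump0 s) = 0.
  have cm i j : continuous (fun s : R => c 0 i * c 0 j * mb (i + j) s).
    by apply: smooth1_cont; apply: smooth1Z; exact: smooth1_mb.
  transitivity (I1 (fun s => \sum_(i < n) \sum_(j < n) c 0 i * c 0 j * mb (i + j) s)).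
    apply: eq_I1 => s _; rewrite expr2 mulr_suml mulr_suml; apply: eq_bigr => i _.
    rewrite mulr_sumr mulr_suml; apply: eq_bigr => j _; rewrite /mb exprD; ring.
  rewrite I1_sum; last by move=> i; apply: cont_sum => j; exact: cm.
  transitivity (\sum_(i < n) \sum_(j < n) c 0 i * c 0 j * gram n i j).
    apply: eq_bigr => i _; rewrite I1_sum; last by move=> j; exact: cm.
    by apply: eq_bigr => j _; rewrite I1Z ?mxE//; apply: smooth1_cont; exact: smooth1_mb.
  rewrite exchange_big big1//= => j _.
  have := congr1 (fun M : 'rV[R]_n => M 0 j) c0; rewrite !mxE => cj.
  transitivity (c 0 j * \sum_(i < n) c 0 i * gram n i j); last by rewrite cj mulr0.
  by rewrite mulr_sumr; apply: eq_bigr => i _; ring.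
have cE : continuous (fun s : R => (\sum_(k < n) c 0 k * s ^+ k) ^+ 2 * bump0 s).
  have cp : continuous (fun s : R => \sum_(k < n) c 0 k * s ^+ k).
    by apply: cont_sum => k; apply: smooth1_cont; apply: smooth1Z; exact: (@smooth1X _ (fun s => s) k (@smooth1_id R)).
  move=> s; apply: cvgM; last by apply: smooth1_cont; exact: smooth1_bump0.
  by apply: cvgM; exact: cp.
apply/rowP => k; rewrite mxE; move: k; apply: poly_itv0 => s sI.
have s01 : 0 < s < 1 by move: sI => /andP[? ?]; apply/andP; split; lra.
have := I1_eq0 cE _ E s01.
move=> /(_ (fun s => mulr_ge0 (sqr_ge0 _) (bump0_ge0 s))) /eqP.
by rewrite mulf_eq0 sqrf_eq0 (gt_eqF (bump0_gt0 sI)) orbF => /eqP.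
Qed.


Lemma smooth1_sum n (F : 'I_n -> R -> R) : (forall k, smooth1 (F k)) -> smooth1 (fun s => \sum_(k < n) F k s).
Proof.
elim: n F => [|n IH] F sF.
  by rewrite (_ : (fun s => _) = fun=> 0); [exact: smooth1_cst|apply/funext => s; rewrite big_ord0].
rewrite (_ : (fun s => _) = (fun s => (\sum_(k < n) F (widen_ord (leqnSn n) k) s) + F ord_max s)).
  by apply: smooth1D; [exact: IH|exact: sF].
by apply/funext => s; rewrite big_ord_recr.
Qed.

Definition supp1 w := forall s, ~ (4^-1 <= s <= 3 / 4) -> w s = 0.

Lemma derive1_out w : smooth1 w -> supp1 w -> supp1 (derive1 w).
Proof.
move=> sw zw s ns; have D := smooth1_is s sw.
have oN : \forall y \near s, w y = 0.
  have [h|h] := leP 4^-1 s.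
    have h2 : 3 / 4 < s by rewrite ltNge; apply/negP => h2; apply: ns; rewrite h.
    near=> y; apply: zw; apply/negP; rewrite negb_and -!ltNge; apply/orP; right.
    by near: y; exact: lt_nbhsr.
  near=> y; apply: zw; apply/negP; rewrite negb_and -!ltNge; apply/orP; left.
  by near: y; exact: lt_nbhsl.
rewrite derive1E.
have -> : 'D_1 w s = 'D_1 (cst 0 : R -> R) s by apply: near_eq_derive; exact: oN.
exact: derive_cst.
Unshelve. all: by end_near.
Qed.

Lemma bounded1 w : smooth1 w -> supp1 w -> exists2 M, 0 <= M & forall s, `|w s| <= M.
Proof.
move=> sw zw; have c2 : continuous (fun x : R * R => w x.2).
  by move=> x; apply: (@continuous_comp _ _ _ (fun x : R * R => x.2) w); [exact: cvg_snd|exact: smooth1_cont].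
have [M M0 HM] := continuous_bounded_sq (0, 0) 1 c2; exists M => // s.
have [h|h] := pselect (4^-1 <= s <= 3 / 4); last by rewrite zw// normr0.
apply: (HM (0, s)); split => /=; rewrite ?subrr ?normr0// subr0 ler_norml.
by move: h => /andP[? ?]; apply/andP; split; lra.
Qed.

(** The rows of the inverse Gram matrix are the coefficients of the [chi i] in the functions
    [s ^+ k * bump0 s], which are smooth and have the support of the bump. *)
Lemma dual_ex (n : nat) : exists chi : 'I_n -> R -> R, [/\ forall i, smooth1 (chi i), forall i, supp1 (chi i) &
  forall i j : 'I_n, I1 (fun s => chi i s * s ^+ j) = (i == j)%:R].
Proof.
pose C := invmx (gram n).
exists (fun i s => \sum_(k < n) C i k * mb k s); split.
- by move=> i; apply: smooth1_sum => k; apply: smooth1Z; exact: smooth1_mb.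
- move=> i s ns; rewrite big1// => k _; rewrite /mb bump0_out ?mulr0// => /andP[h1 h2].
  by apply: ns; rewrite !ltW.
- move=> i j; have := congr1 (fun M : 'M[R]_n => M i j) (mulVmx (gram_unit n)).
  rewrite !mxE => <-.
  transitivity (I1 (fun s => \sum_(k < n) C i k * mb (k + j) s)).
    apply: eq_I1 => s _; rewrite mulr_suml; apply: eq_bigr => k _.
    by rewrite /mb exprD; ring.
  rewrite I1_sum; last by move=> k; apply: smooth1_cont; apply: smooth1Z; exact: smooth1_mb.
  by apply: eq_bigr => k _; rewrite I1Z ?mxE//; apply: smooth1_cont; exact: smooth1_mb.
Qed.

Lemma Int_prod p q : continuous p -> continuous q -> supp1 p -> supp1 q ->
  Int (fun x : R * R => p x.1 * q x.2) = I1 p * I1 q.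
Proof.
move=> cp cq zp zq.
have c2 (f : R -> R) : continuous f -> continuous (fun x : R * R => f x.2).
  by move=> cf x; apply: (@continuous_comp _ _ _ (fun x : R * R => x.2) f); [exact: cvg_snd|exact: cf].
have c1 (f : R -> R) : continuous f -> continuous (fun x : R * R => f x.1).
  by move=> cf x; apply: (@continuous_comp _ _ _ (fun x : R * R => x.1) f); [exact: cvg_fst|exact: cf].
have cpq : continuous (fun x : R * R => p x.1 * q x.2) by move=> x; apply: cvgM; [exact: c1|exact: c2].
have z01 f s : supp1 f -> \1_(`[0, 1]%classic : set R) s * f s = f s.
  move=> zf; have [h|h] := pselect (4^-1 <= s <= 3 / 4); last by rewrite zf// mulr0.
  by rewrite indicE mem_set ?mul1r//= in_itv /=; move: h => /andP[? ?]; apply/andP; split; lra.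
have ip : leb.-integrable setT (fun t => (p t)%:E).
  have : leb.-integrable `[0, 1]%classic (EFin \o p).
    apply: continuous_compact_integrable; first exact: segment_compact.
    exact: continuous_subspaceT.
  rewrite integrable_mkcond//; congr integrable; apply/funext => t.
  by rewrite patchE -(z01 p t zp) indicE; case: (t \in _); rewrite ?mul1r ?mul0r.
have ipq : ing (fun x : R * R => p x.1 * q x.2).
  apply: (@cont_supp_ing _ _ (0, 0) 1) => // x nx.
  have [h1|h1] := pselect (4^-1 <= x.1 <= 3 / 4); last by rewrite zp// mul0r.
  have [h2|h2] := pselect (4^-1 <= x.2 <= 3 / 4); last by rewrite zq// mulr0.
  exfalso; apply: nx; move: h1 h2 => /andP[? ?] /andP[? ?].
  by split; rewrite /= subr0 ler_norml; apply/andP; split; lra.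
rewrite ing_fubini// /I1 !Int_up; [|exact: I1_ing|exact: I1_ing].
have eq_q : (\int[leb]_s (\1_(`[0, 1]%classic) s * q s) = \int[leb]_s q s) by apply: eq_Rintegral => s _; exact: z01.
have eq_p : (\int[leb]_s (\1_(`[0, 1]%classic) s * p s) = \int[leb]_s p s) by apply: eq_Rintegral => s _; exact: z01.
have iq : leb.-integrable setT (fun t => (q t)%:E).
  have : leb.-integrable `[0, 1]%classic (EFin \o q).
    apply: continuous_compact_integrable; first exact: segment_compact.
    exact: continuous_subspaceT.
  rewrite integrable_mkcond//; congr integrable; apply/funext => t.
  by rewrite patchE -(z01 q t zq) indicE; case: (t \in _); rewrite ?mul1r ?mul0r.
rewrite eq_q eq_p -RintegralZl//; apply: eq_Rintegral => y _ /=.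
by rewrite -RintegralZr// ; apply: eq_Rintegral => s _.
Qed.

End DualFunctions.

(** * Shape regularity, neighbouring elements, and open sets in the closure of a Lipschitz domain *)

Section FatTriangles.
Variable R : realType.
Implicit Types (A K g : set (R * R)) (a b c m v x y : R * R).

Lemma enorm_ge0 x : 0 <= enorm x. Proof. exact: sqrtr_ge0. Qed.
Lemma dot_ge0 x : 0 <= dot x x.
Proof. by rewrite /dot -!expr2 addr_ge0// sqr_ge0. Qed.
Lemma enorm_sq x : enorm x ^+ 2 = dot x x.
Proof. by rewrite sqr_sqrtr// dot_ge0. Qed.

Lemma le_of_sq (u w : R) : 0 <= w -> u ^+ 2 <= w ^+ 2 -> `|u| <= w.
Proof. by move=> w0 H; rewrite -(ger0_norm w0) -!sqrtr_sqr ler_wsqrtr. Qed.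

Lemma lagrange2 x y : dot x y ^+ 2 + dt x y ^+ 2 = dot x x * dot y y.
Proof. by rewrite /dot /dt; ring. Qed.

Lemma dot_cs x y : `|dot x y| <= enorm x * enorm y.
Proof.
apply: le_of_sq; first by rewrite mulr_ge0// enorm_ge0.
by rewrite exprMn !enorm_sq -lagrange2 lerDl sqr_ge0.
Qed.
Lemma dt_cs x y : `|dt x y| <= enorm x * enorm y.
Proof.
apply: le_of_sq; first by rewrite mulr_ge0// enorm_ge0.
by rewrite exprMn !enorm_sq -lagrange2 lerDr sqr_ge0.
Qed.

Lemma enorm_gt0 x : x <> 0 -> 0 < enorm x.
Proof.
move=> x0; rewrite sqrtr_gt0 lt_neqAle dot_ge0 andbT eq_sym /dot -!expr2 paddr_eq0 ?sqr_ge0// !sqrf_eq0.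
by apply/negP => /andP[/eqP h1 /eqP h2]; apply: x0; exact: pair_eqP.
Qed.

Lemma enorm_le1 x : enorm x <= `|x.1| + `|x.2|.
Proof.
have s0 : 0 <= `|x.1| + `|x.2| by rewrite addr_ge0.
have := @le_of_sq (enorm x) _ s0; rewrite (ger0_norm (enorm_ge0 x)); apply.
rewrite enorm_sq /dot -!expr2 sqrrD !real_normK ?num_real//.
have : 0 <= `|x.1| * `|x.2| by rewrite mulr_ge0.
by rewrite mulr2n; lra.
Qed.

Lemma enorm_coord x : `|x.1| <= enorm x /\ `|x.2| <= enorm x.
Proof.
split; apply: le_of_sq; rewrite ?enorm_ge0// enorm_sq /dot -!expr2; have := sqr_ge0 x.1; have := sqr_ge0 x.2; lra.
Qed.

Lemma diam_ge a b c K x y : is_tri a b c K -> K x -> K y -> enorm (x - y) <= diam K.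
Proof.
move=> [_ KE] Kx Ky; have [M HM] := tri_bounded a b c.
apply: ub_le_sup; last by exists x, y.
exists (4 * M) => _ [x' [y' [+ + ->]]]; rewrite KE => /HM[x1 x2] /HM[y1 y2].
apply: (le_trans (enorm_le1 _)).
have h1 : `|(x' - y').1| <= `|x'.1| + `|y'.1| := ler_normB _ _.
have h2 : `|(x' - y').2| <= `|x'.2| + `|y'.2| := ler_normB _ _.
lra.
Qed.

(** Shape regularity with an explicit disc in place of the supremum [indiam]. *)
Definition fat K (s : R) := exists q r, [/\ 0 < r, (forall y, enorm (y - q) <= r -> K y) & diam K <= s * r].

Lemma tri_disc a b c : tdet a b c != 0 -> exists q r, 0 < r /\ forall y, enorm (y - q) <= r -> tri a b c y.
Proof.
move=> d0; have [q [r [r0 H]]] := tri_int_sq d0; exists q, r; split => // y yq.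
apply: interior_subset; apply: H; have [h1 h2] := enorm_coord (y - q).
by split; [exact: (le_trans h1)|exact: (le_trans h2)].
Qed.

Lemma tri_vertices a b c : [/\ tri a b c a, tri a b c b & tri a b c c].
Proof.
split; [exists 0, 0|exists 1, 0|exists 0, 1]; (split; [lra|lra|lra|]).
all: by apply: pair_eqP; rewrite /= /GRing.scale /=; ring.
Qed.

Lemma diam_gt0 a b c K : is_tri a b c K -> 0 < diam K.
Proof.
move=> tK; have [d0 KE] := tK; have [Ka Kb _] := tri_vertices a b c.
have := diam_ge tK (x := b) (y := a); rewrite KE => /(_ Kb Ka); apply: lt_le_trans.
by apply: enorm_gt0 => /eqP; rewrite subr_eq0 => /eqP /esym; exact: (tri_neq12 d0).
Qed.

(** The inscribed diameters are bounded by [diam K], so some diameter [2 * r] exceeds half of their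
    supremum, whence [indiam K < 4 * r]. *)
Lemma fat_indiam a b c K (s : R) : is_tri a b c K -> diam K <= s * indiam K -> fat K (4 * s).
Proof.
move=> tK H; have [d0 KE] := tK; have h0 := diam_gt0 tK.
have [q0 [r0 [r00 Hr0]]] := tri_disc d0.
pose S := [set d : R | exists (x : R * R) (r : R), [/\ 0 < r, [set y | enorm (y - x) <= r] `<=` K & d = 2 * r]].
have S0 : S (2 * r0) by exists q0, r0; split => // y /= /Hr0; rewrite KE.
have r2 (q : R * R) (r : R) : 0 < r -> (forall y, enorm (y - q) <= r -> K y) -> 2 * r <= diam K.
  move=> rp Hq.
  have K1 : K (q.1 + r, q.2).
    apply: Hq; rewrite /enorm /dot /=; have -> : q.1 + r - q.1 = r by ring.
    by rewrite subrr mulr0 addr0 -expr2 sqrtr_sqr gtr0_norm.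
  have K2 : K (q.1 - r, q.2).
    apply: Hq; rewrite /enorm /dot /=; have -> : q.1 - r - q.1 = - r by ring.
    by rewrite subrr mulr0 addr0 -expr2 sqrtr_sqr normrN gtr0_norm.
  have := diam_ge tK K1 K2; rewrite /enorm /dot /= subrr mulr0 addr0 -expr2 sqrtr_sqr.
  have -> : q.1 + r - (q.1 - r) = 2 * r by ring.
  by rewrite gtr0_norm// mulr_gt0.
have hS : has_sup S.
  split; first by exists (2 * r0).
  by exists (diam K) => _ [q [r [rp Hq ->]]]; exact: (r2 q r rp Hq).
have i0 : 0 < indiam K.
  by apply: (@lt_le_trans _ _ (2 * r0)); [rewrite mulr_gt0|apply: ub_le_sup S0; have [] := hS].
have s0 : 0 < s.
  by rewrite -(pmulr_lgt0 s i0); exact: (lt_le_trans h0).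
have e0 : 0 < indiam K / 2 by rewrite divr_gt0.
have [_ [q [r [rp Hq ->]]] lt] := sup_adherent e0 hS.
exists q, r; split => //.
have lt' : indiam K < 4 * r by move: lt; rewrite -/(indiam K); lra.
apply: (le_trans H); have -> : 4 * s * r = s * (4 * r) by ring.
by apply: ler_wpM2l; exact: ltW.
Qed.

Lemma enormZ (k : R) x : enorm (k *: x) = `|k| * enorm x.
Proof.
rewrite /enorm /dot /= /GRing.scale /= -sqrtr_sqr -sqrtrM ?sqr_ge0//; congr Num.sqrt; ring.
Qed.

(* The disc of radius r fits in the strip between the side [a, b] and the parallel through c. *)
Lemma disc_side a b c q (r : R) : tdet a b c != 0 -> 0 < r -> (forall y, enorm (y - q) <= r -> tri a b c y) ->
  2 * r * enorm (b - a) <= `|tdet a b c|.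
Proof.
move=> d0 r0 H; set v := b - a; set D := tdet a b c in d0 *.
have v0 : 0 < enorm v.
  by apply: enorm_gt0 => /eqP; rewrite subr_eq0 => /eqP /esym; exact: (tri_neq12 d0).
pose n : R * R := (- v.2, v.1).
have nE : enorm n = enorm v by rewrite /enorm /n /dot /=; congr Num.sqrt; ring.
have Hk (k : R) : `|k| <= r / enorm v -> 0 <= bt a b c (q + k *: n) <= 1.
  move=> kr; have : tri a b c (q + k *: n).
    by apply: H; rewrite addrC addKr enormZ nE -ler_pdivlMr.
  by move=> /(triP _ d0)[h1 h2 h3]; apply/andP; split => //; lra.
have k0 : 0 <= r / enorm v by rewrite divr_ge0// ltW.
have := Hk (r / enorm v); rewrite ger0_norm// lexx => /(_ isT).
have := Hk (- (r / enorm v)); rewrite normrN ger0_norm// lexx => /(_ isT).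
have E k : bt a b c (q + k *: n) = bt a b c q + k * enorm v ^+ 2 / D.
  by rewrite enorm_sq /bt /n -/v -/D /dt /dot /= /GRing.scale /=; ring.
rewrite !E => /andP[h1 h2] /andP[h3 h4].
have K : `|2 * (r / enorm v * enorm v ^+ 2 / D)| <= 1.
  rewrite ler_norml; move: h1 h2 h3 h4; rewrite !mulNr; move: (_ / D) (bt _ _ _ _) => *; apply/andP; split; lra.
have E2 : 2 * (r / enorm v * enorm v ^+ 2 / D) = (2 * r * enorm v) / D.
  by field; rewrite d0 gt_eqF.
move: K; rewrite E2 normrM normfV ler_pdivrMr ?normr_gt0// mul1r; apply: le_trans.
by rewrite ger0_norm// !mulr_ge0// ltW.
Qed.

(** The orientation of the vertices: [perp (sgd a b c) (b - a)] points from the side to the half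
    plane that contains [c]. *)
Definition sgd a b c : R := Num.sg (tdet a b c).

Lemma sgd_sq a b c : tdet a b c != 0 -> sgd a b c ^+ 2 = 1.
Proof. by move=> d0; rewrite /sgd sqr_sg d0. Qed.

(** The facts on the shape of an element that the side estimate uses, with constants that depend on
    [s] alone; [t] and [u] are measured in units of the length of the side. *)
Record tri_geom (K : set (R * R)) a b c (s : R) : Prop := TriGeom {
  tg_len : diam K <= s * enorm (b - a);
  tg_len2 : enorm (b - a) <= diam K;
  tg_rect : forall t u, 0 < t < 2 * (16 * s)^-1 -> 8^-1 < u < 7 / 8 ->
    K° (aff a (perp (sgd a b c) (b - a)) (b - a) (t, u));
  tg_neg : forall t u, t < 0 -> ~ K° (aff a (perp (sgd a b c) (b - a)) (b - a) (t, u)) }.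

(** In the coordinates [(t, u)] the barycentric coordinates are [u] plus a multiple of [t], and a
    multiple of [t]; by [disc_side] both factors have modulus at most [s / 2]. For [t] below
    [1 / (8 * s)] the multiples stay below 1/16, and 1/8 - 1/16 is positive while 7/8 + 1/16 + 1/16
    = 1: this fixes the constant 16. *)
Lemma fat_geom a b c K (s : R) : is_tri a b c K -> fat K s -> 0 < s /\ tri_geom K a b c s.
Proof.
move=> tK [q [r [r0 Hq hs]]]; have [d0 KE] := tK; have h0 := diam_gt0 tK.
have s0 : 0 < s by rewrite -(pmulr_lgt0 s r0); exact: (lt_le_trans h0).
split => //.
have Hq1 : forall y, enorm (y - q) <= r -> tri a b c y by move=> y /Hq; rewrite KE.
have d1 := disc_side d0 r0 Hq1.
have d0' : tdet a c b != 0 by rewrite tdet_swap23 oppr_eq0.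
have Hq2 : forall y, enorm (y - q) <= r -> tri a c b y by move=> y /Hq; rewrite KE tri_swap23.
have d2 := disc_side d0' r0 Hq2; rewrite tdet_swap23 normrN in d2.
have [Ka Kb Kc] := tri_vertices a b c; rewrite -KE in Ka Kb Kc.
have Lh := diam_ge tK Kb Ka; have Ch := diam_ge tK Kc Ka.
have L0 : 0 < enorm (b - a).
  by apply: enorm_gt0 => /eqP; rewrite subr_eq0 => /eqP /esym; exact: (tri_neq12 d0).
have C0 : 0 < enorm (c - a).
  by apply: enorm_gt0 => /eqP; rewrite subr_eq0 => /eqP /esym; exact: (tri_neq12 d0').
have Dle : `|tdet a b c| <= enorm (b - a) * enorm (c - a) := dt_cs _ _.
have Lr : 2 * r <= enorm (b - a) by rewrite -(ler_pM2r C0); exact: (le_trans d2).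
set v := b - a in d1 Lh L0 Dle Lr *; set L := enorm v in d1 Lh L0 Dle Lr *.
set D := tdet a b c in d0 d1 Dle *.
have nD : 0 < `|D| by rewrite normr_gt0.
have sgD : sgd a b c * D = `|D| by rewrite /sgd -/D -normrEsg.
have sgn : sgd a b c ^+ 2 = 1 by exact: sgd_sq.
set sg := sgd a b c in sgD sgn *.
have DE : D^-1 = sg / `|D| by rewrite -sgD; field; rewrite d0 -sqrf_eq0 sgn oner_eq0.
have ebt t u : bt a b c (aff a (perp sg v) v (t, u)) = t * (L ^+ 2 / `|D|).
  rewrite /bt -/D DE enorm_sq -/v /perp /aff /dt /dot /=.
  rewrite -[RHS]mul1r -sgn; rewrite -/v; field.
  by rewrite gt_eqF.
have ebs t u : bs a b c (aff a (perp sg v) v (t, u)) = u - t * (dot v (c - a) / `|D|).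
  rewrite /bs -/D.
  have -> : dt (aff a (perp sg v) v (t, u) - a) (c - a) = u * D - t * (sg * dot v (c - a)).
    by rewrite /D /tdet /perp /aff /dt /dot -/v /=; ring.
  rewrite mulrBl mulfK//; congr (_ - _); rewrite DE.
  rewrite -[RHS]mul1r -sgn; ring.
have B1 : 0 < L ^+ 2 / `|D| <= s / 2.
  rewrite divr_gt0 ?exprn_gt0//= ler_pdivrMr//.
  apply: (@le_trans _ _ (s / 2 * (2 * r * L))); last by rewrite ler_wpM2l// divr_ge0// ltW.
  have -> : s / 2 * (2 * r * L) = s * r * L by field.
  by rewrite expr2; apply: ler_wpM2r; [exact: ltW|exact: (le_trans Lh)].
have B2 : `|dot v (c - a) / `|D| | <= s / 2.
  rewrite normrM normfV normr_id ler_pdivrMr//.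
  apply: (@le_trans _ _ (s / 2 * (2 * r * L))); last by rewrite ler_wpM2l// divr_ge0// ltW.
  have -> : s / 2 * (2 * r * L) = L * (s * r) by field.
  apply: (le_trans (dot_cs _ _)); apply: ler_wpM2l; [exact: ltW|exact: (le_trans Ch)].
split.
- apply: (le_trans hs); apply: ler_wpM2l; first exact: ltW.
  by move: r0 Lr; rewrite -/v -/L; clear; lra.
- exact: Lh.
- move=> t u /andP[t0 t1] /andP[u0 u1]; rewrite KE; apply: otri_int => //.
  have ts : t * (s / 2) < 16^-1.
    have -> : (16 : R)^-1 = 2 * (16 * s)^-1 * (s / 2) by field; rewrite gt_eqF.
    by rewrite ltr_pM2r// divr_gt0.
  have T1 : t * (L ^+ 2 / `|D|) < 16^-1.
    by apply: le_lt_trans ts; rewrite ler_wpM2l ?(ltW t0)//; move: B1 => /andP[].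
  have T10 : 0 < t * (L ^+ 2 / `|D|) by rewrite mulr_gt0//; move: B1 => /andP[].
  have T2 : `|t * (dot v (c - a) / `|D|)| < 16^-1.
    by apply: le_lt_trans ts; rewrite normrM (gtr0_norm t0); apply: ler_wpM2l; [exact: ltW|].
  move: T2; rewrite ltr_norml => /andP[T2 T3].
  split; rewrite -/v ?ebt ?ebs; [move: T3 u0; clear|exact: T10|move: T1 T2 u1; clear].
    move: (t * _) => z; lra.
  move: (t * _) (t * _) => z z'; lra.
- move=> t u t0 /interior_subset; rewrite KE => /(triP _ d0)[_]; rewrite -/v ebt => h _.
  move: h; rewrite leNgt nmulr_rlt0//; by move: B1 => /andP[->].
Qed.

Lemma seg_collinear a b p q x : seg p q a -> seg p q b -> seg p q x -> dt (b - a) (x - a) = 0.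
Proof.
by move=> [s [_ _ ->]] [t [_ _ ->]] [u [_ _ ->]]; rewrite /dt /= /GRing.scale /=; ring.
Qed.

(** On the same side of the segment, the rectangles of [tri_geom] would give the triangles a common
    point off its line. But conformity reduces their intersection to one segment, which contains
    both ends of [g]. *)
Lemma opposite_sides (O : set (R * R)) (T : mesh R) K K' g c c' s s' : conforming_mesh O T -> T K -> T K' -> K <> K' ->
  is_tri (ends g).1 (ends g).2 c K -> is_tri (ends g).1 (ends g).2 c' K' ->
  fat K s -> fat K' s' ->
  sgd (ends g).1 (ends g).2 c' = - sgd (ends g).1 (ends g).2 c.
Proof.
move=> [_ _ _ Hc] TK TK' KK' tK tK' fK fK'.
have [s0 G] := fat_geom tK fK; have [s0' G'] := fat_geom tK' fK'.
have [d0 KE] := tK; have [d0' KE'] := tK'.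
set a := (ends g).1 in tK tK' G G' d0 d0' KE KE' *; set b := (ends g).2 in tK tK' G G' d0 d0' KE KE' *.
have [Ka Kb _] := tri_vertices a b c; have [Ka' Kb' _] := tri_vertices a b c'.
rewrite -KE in Ka Kb; rewrite -KE' in Ka' Kb'.
have [E|E] := eqVneq (sgd a b c') (sgd a b c); last first.
  move: E; rewrite /sgd; case: sgrP d0' => //; case: sgrP d0 => //= _ _ _ _; rewrite ?eqxx// ?opprK//.
exfalso.
pose t := Num.min (16 * s)^-1 (16 * s')^-1.
have i0 : 0 < (16 * s)^-1 by rewrite invr_gt0 mulr_gt0.
have i0' : 0 < (16 * s')^-1 by rewrite invr_gt0 mulr_gt0.
have t0 : 0 < t by rewrite lt_min i0.
have t1 : t < 2 * (16 * s)^-1.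
  by apply: (@le_lt_trans _ _ (16 * s)^-1); [rewrite ge_min lexx|rewrite ltr_pMl// ltr1n].
have t2 : t < 2 * (16 * s')^-1.
  by apply: (@le_lt_trans _ _ (16 * s')^-1); [rewrite ge_min lexx orbT|rewrite ltr_pMl// ltr1n].
have u1 : ((8^-1 : R) < 2^-1) && ((2^-1 : R) < 7 / 8) by apply/andP; split; lra.
set x := aff a (perp (sgd a b c) (b - a)) (b - a) (t, 2^-1).
have Kx : K x by apply: interior_subset; apply: (tg_rect G) => //; rewrite t0 t1.
have Kx' : K' x.
  by apply: interior_subset; rewrite /x -E; apply: (tg_rect G') => //; rewrite t0 t2.
have ab := tri_neq12 d0.
case: (Hc _ _ TK TK' KK').
- by move=> E0; have : (K `&` K') a by []; rewrite E0.
- move=> [y [_ _ Ey]]; apply: ab.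
  have : (K `&` K') a by []. have : (K `&` K') b by []. by rewrite Ey => -> ->.
- move=> [g' [[p [q [_ [_ gE]]]] _ Eg]].
  have H z : K z -> K' z -> seg p q z by move=> k k'; rewrite -gE -Eg.
  have := seg_collinear (H _ Ka Ka') (H _ Kb Kb') (H _ Kx Kx').
  have -> : dt (b - a) (x - a) = t * (sgd a b c * dot (b - a) (b - a)) by rewrite /x /dt /perp /aff /dot /=; ring.
  move=> /eqP; rewrite !mulf_eq0 (gt_eqF t0) /= -sqrf_eq0 sgd_sq// oner_eq0 /= -enorm_sq sqrf_eq0.
  by rewrite gt_eqF// enorm_gt0// => /eqP; rewrite subr_eq0 => /eqP /esym.
Qed.

(** The pair chosen by [adj] must contain [K]: a third element on the side would be opposite to both
    of its members, which are opposite to each other, and three signs cannot be pairwise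
    opposite. *)
Lemma adj_cases (O : set (R * R)) (T : mesh R) K g (s : R) : conforming_mesh O T -> (forall K, T K -> fat K s) ->
  T K -> isides T K g ->
  exists c1 c2, [/\ is_tri (ends g).1 (ends g).2 c1 (adj T g).1, is_tri (ends g).1 (ends g).2 c2 (adj T g).2,
    nbrs T K (adj T g).1, nbrs T K (adj T g).2 & 
    [/\ sgd (ends g).1 (ends g).2 c2 = - sgd (ends g).1 (ends g).2 c1, (ends g).1 <> (ends g).2 &
     K = (adj T g).1 \/ K = (adj T g).2]].
Proof.
move=> cm fT TK [sK [K' [TK' K'K sK']]].
have [T1 T2 n12 s1 s2] : [/\ T (adj T g).1, T (adj T g).2, (adj T g).1 <> (adj T g).2, side (adj T g).1 g & side (adj T g).2 g].
  by rewrite /adj; case: xgetP => [y -> //|/(_ (K, K'))]; case; split => // /esym.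
set K1 := (adj T g).1 in T1 n12 s1 *; set K2 := (adj T g).2 in T2 n12 s2 *.
have [c1 [t1 ab _]] := side_ends s1; have [c2 [t2 _ _]] := side_ends s2; have [c [tK _ _]] := side_ends sK.
have o12 := opposite_sides cm T1 T2 n12 t1 t2 (fT _ T1) (fT _ T2).
have Kor : K = K1 \/ K = K2.
  have [e1|n1] := pselect (K = K1); first by left.
  have [e2|n2] := pselect (K = K2); first by right.
  exfalso; have o1 := opposite_sides cm TK T1 n1 tK t1 (fT _ TK) (fT _ T1).
  have o2 := opposite_sides cm TK T2 n2 tK t2 (fT _ TK) (fT _ T2).
  have [d0 _] := t1; have := sgd_sq d0; move: o12; rewrite o2 -o1 => E.
  have -> : sgd (ends g).1 (ends g).2 c1 = 0 by lra.
  by rewrite expr0n /= => /eqP; rewrite eq_sym oner_eq0.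
have isd L : T L -> side L g -> isides T L g.
  move=> TL sL; split => //; have [LK|LK] := pselect (L = K); last by exists K; split => // /esym.
  by exists K'; split => //; rewrite LK.
exists c1, c2; split => //.
- by split => //; right; exists g; split; [split => //; exists K'|exact: isd].
- by split => //; right; exists g; split; [split => //; exists K'|exact: isd].
Qed.

(** A Lipschitz domain has no slits: near each boundary point there are points with a whole
    neighbourhood outside the closure. As the elements cover the closure of the domain, this puts
    their interiors, and the rectangles across internal sides, inside the domain itself. *)
Lemma lipschitz_open (O U : set (R * R)) : lipschitz_boundary O -> open U -> U `<=` closure O -> U `<=` O.
Proof.
move=> lO oU UO x Ux; apply: contrapT => nOx.
have bx : bdry O x.
  by split; [exact: UO|move=> /interior_subset].
have [e [r [h [L [gg [e1 r0 h0 HL HO]]]]]] := lO _ bx.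
have [d d0 Hd] := open_sq oU Ux.
have ee : dot e e = 1 by rewrite -enorm_sq e1 expr1n.
(* x itself is not in O, so g 0 >= 0; points just below the graph have a neighbourhood outside O *)
have g0 : 0 <= gg 0.
  rewrite leNgt; apply/negP => g0; apply: nOx.
  have := HO 0 0; rewrite !normr0 => /(_ r0 h0)[_] /(_ g0).
  by rewrite !scale0r !addr0.
pose n : R * R := (- e.2, e.1).
have [c1 c2] := enorm_coord e; rewrite e1 in c1 c2.
pose t0 := Num.min (h / 2) (d / 2).
have t00 : 0 < t0 by rewrite lt_min !divr_gt0.
have t0h : t0 < h by apply: (@le_lt_trans _ _ (h / 2)); [rewrite ge_min lexx|lra].
have t0d : t0 < d by apply: (@le_lt_trans _ _ (d / 2)); [rewrite ge_min lexx orbT|lra].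
pose y := x + (- t0) *: n.
have sqy : sq x d y.
  split; rewrite /y /n /= /GRing.scale /= addrC addKr normrM normrN (gtr0_norm t00) ?normrN.
    by rewrite -[d]mulr1 ler_pM// ltW.
  by rewrite -[d]mulr1 ler_pM// ltW.
have Cy : closure O y by apply: UO; exact: Hd.
(* the open neighbourhood of y below the graph misses O *)
pose L' := Num.max L 1.
have L'0 : 0 < L' by rewrite lt_max ltr01 orbT.
(* Within [rr] of [y] the graph description is valid, and a graph of slope at most [L'] cannot come
   down to the point, since [(L' + 1) * rr <= t0 / 2]. *)
pose rr := Num.min (Num.min r (h - t0)) (t0 / (2 * (L' + 1))).
have rr0 : 0 < rr by rewrite !lt_min r0 subr_gt0 t0h divr_gt0// mulr_gt0// addr_gt0.
pose V : set (R * R) := [set z | `|dot (z - y) e| < rr /\ `|dot (z - y) n| < rr].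
have Vy : nbhs y V.
  have cl (w : R * R) : continuous (fun z : R * R => `|lin w (- dot y w) z|).
    by move=> z; apply: (@continuous_comp _ _ _ (lin w (- dot y w)) (fun r : R => `|r|)); [exact: lin_cont|exact: norm_continuous].
  have VE : V = (fun z => `|lin e (- dot y e) z|) @^-1` [set z | z < rr] `&` (fun z => `|lin n (- dot y n) z|) @^-1` [set z | z < rr].
    have E w z : dot (z - y) w = lin w (- dot y w) z by rewrite /lin /dot /=; ring.
    by apply/seteqP; split => z; rewrite /V /= !E.
  apply: open_nbhs_nbhs; split; last by rewrite /V /= subrr /dot /= !mul0r addr0 normr0.
  by rewrite VE; apply: openI; apply: open_comp; (try exact: open_lt); move=> z _; exact: cl.
have [z [Oz [z1 z2]]] := Cy _ Vy.
have zE : z = x + dot (z - y) e *: e + (- t0 + dot (z - y) n) *: n.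
  have ee' : e.1 * e.1 = 1 - e.2 * e.2 by move: ee; rewrite /dot; lra.
  apply: pair_eqP; rewrite /y /n /dot /= /GRing.scale /=.
    have -> : x.1 + ((z.1 - (x.1 + - t0 * - e.2)) * e.1 + (z.2 - (x.2 + - t0 * e.1)) * e.2) * e.1 + (- t0 + ((z.1 - (x.1 + - t0 * - e.2)) * - e.2 + (z.2 - (x.2 + - t0 * e.1)) * e.1)) * - e.2 =
      x.1 + (z.1 - (x.1 + - t0 * - e.2)) * (e.1 * e.1 + e.2 * e.2) + t0 * e.2 by ring.
    by rewrite ee'; ring.
  have -> : x.2 + ((z.1 - (x.1 + - t0 * - e.2)) * e.1 + (z.2 - (x.2 + - t0 * e.1)) * e.2) * e.2 + (- t0 + ((z.1 - (x.1 + - t0 * - e.2)) * - e.2 + (z.2 - (x.2 + - t0 * e.1)) * e.1)) * e.1 =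
      x.2 + (z.2 - (x.2 + - t0 * e.1)) * (e.1 * e.1 + e.2 * e.2) - t0 * e.1 by ring.
  by rewrite ee'; ring.
set s := dot (z - y) e in z1 zE; set t := dot (z - y) n in z2 zE.
have rr1 : rr <= r by rewrite !ge_min lexx.
have rr2 : rr <= h - t0 by rewrite !ge_min lexx orbT.
have rr3 : rr <= t0 / (2 * (L' + 1)) by rewrite !ge_min lexx !orbT.
have sr : `|s| < r by exact: (lt_le_trans z1).
have th : `|- t0 + t| < h.
  apply: (le_lt_trans (ler_normD _ _)); rewrite normrN (gtr0_norm t00); move: z2 rr2; clear; lra.
have := HO s (- t0 + t) sr th; rewrite -/n -zE => -[/(_ Oz) gs _].
have := HL s 0; rewrite subr0 => HLs.
have LL : L * `|s| <= L' * rr.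
  apply: (@le_trans _ _ (L' * `|s|)); first by rewrite ler_wpM2r// le_max lexx.
  by rewrite ler_wpM2l ?(ltW L'0)// ltW.
have K1 : gg 0 - gg s <= L' * rr.
  by apply: (le_trans _ (le_trans HLs LL)); rewrite distrC ler_norm.
have K2 : (L' + 1) * rr <= t0 / 2.
  have p0 : 0 < L' + 1 by rewrite addr_gt0.
  apply: (@le_trans _ _ ((L' + 1) * (t0 / (2 * (L' + 1))))); first by rewrite ler_wpM2l// ltW.
  by rewrite le_eqVlt; apply/orP; left; apply/eqP; field; rewrite gt_eqF.
have K3 : t <= rr by apply: ltW; apply: le_lt_trans z2; exact: ler_norm.
move: g0 gs K1 K2 K3 t00; rewrite mulrDl mul1r; move: (L' * rr) (gg 0) (gg s); clear => *; lra.
Qed.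

End FatTriangles.

(** * Rotated gradients as test fields for the first equation *)

Section RotatedGradients.
Variable R : realType.
Local Notation mu := (@area R).
Implicit Types (f g phi psi : R * R -> R) (A O K : set (R * R)) (u v w : R * R -> R * R).

Definition rot psi (x : R * R) : R * R := (pd ord_max psi x, - pd ord0 psi x).

Definition sqv A v := sqi (rs A (fun x => (v x).1)) /\ sqi (rs A (fun x => (v x).2)).
Definition n2v A v := n2 (rs A (fun x => enorm (v x))).

Lemma measurable_pair A (f g : R * R -> R) : measurable A -> measurable_fun A f -> measurable_fun A g ->
  measurable_fun A (fun x => (f x, g x)).
Proof.
move=> mA mf mg.
have m1 : measurable_fun [set: R * R] (rs A f) by exact: mble_rs.
have m2 : measurable_fun [set: R * R] (rs A g) by exact: mble_rs.
apply: (@eq_measurable_fun _ _ _ _ A (fun x => (rs A f x, rs A g x))).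
  by move=> x; rewrite inE => Ax; rewrite !rs_in.
by apply: measurable_funTS; exact: measurable_fun_pair m1 m2.
Qed.

Lemma measurable_enorm A v : measurable A -> measurable_fun A v -> measurable_fun A (fun x => enorm (v x)).
Proof.
move=> mA mv.
have m1 : measurable_fun A (fun x => (v x).1) by apply: (measurableT_comp _ mv).
have m2 : measurable_fun A (fun x => (v x).2) by apply: (measurableT_comp _ mv).
have m3 : measurable_fun A (fun x => dot (v x) (v x)).
  by apply: measurable_funD; apply: measurable_funM.
apply: (@measurableT_comp _ _ _ _ _ _ (fun r : R => Num.sqrt r)) => //.
by apply: continuous_measurable_fun => r; exact: sqrt_continuous.
Qed.

Lemma sqi_enorm A v : measurable A -> measurable_fun A v -> sqv A v -> sqi (rs A (fun x => enorm (v x))).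
Proof.
move=> mA mv [[_ i1] [_ i2]]; split; first by apply: mble_rs => //; exact: measurable_enorm.
apply: eq_ing (ingD i1 i2) => x; rewrite /rs !exprMn enorm_sq /dot; ring.
Qed.

Lemma Lspv2P A v : measurable A -> Lspv 2 A v <-> measurable_fun A v /\ sqv A v.
Proof.
move=> mA; split => [[mv lv]|[mv sv]].
  split => //; have : Lsp 2 A (fun x => enorm (v x)) by split => //; exact: measurable_enorm.
  move=> /(Lsp2P _ mA)[_ se].
  split; apply: (sqi_le _ se).
  - by apply: mble_rs => //; apply: (measurableT_comp _ mv).
  - by move=> x; rewrite /rs !normrM ler_wpM2l// [leRHS]ger0_norm ?enorm_ge0//; have [] := enorm_coord (v x).
  - by apply: mble_rs => //; apply: (measurableT_comp _ mv).
  - by move=> x; rewrite /rs !normrM ler_wpM2l// [leRHS]ger0_norm ?enorm_ge0//; have [] := enorm_coord (v x).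
have : Lsp 2 A (fun x => enorm (v x)) by apply/(Lsp2P _ mA); split; [exact: measurable_enorm|exact: sqi_enorm].
by move=> [].
Qed.

Lemma Lnmv2E A v : measurable A -> measurable_fun A v -> sqv A v -> Lnmv 2 A v = (n2v A v)%:E.
Proof. by move=> mA mv sv; rewrite /Lnmv Lnm2E//; exact: sqi_enorm. Qed.

Lemma sqi_rs_sub A B f : measurable A -> A `<=` B -> sqi (rs B f) -> sqi (rs A f).
Proof.
move=> mA AB sf.
have E : rs A f = (fun x => \1_A x * rs B f x).
  apply/funext => x; rewrite /rs !indicE; case: (boolP (x \in A)) => [|_]; last by rewrite !mul0r.
  by rewrite inE => /AB /mem_set ->; rewrite !mul1r.
rewrite E; apply: (sqi_bounded (M := 1)) => //; first exact: mble_indic.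
by move=> x; rewrite indicE; case: (_ \in _); rewrite ?normr1 ?normr0.
Qed.

Lemma n2_rs_sub A B f : measurable A -> A `<=` B -> sqi (rs B f) -> n2 (rs A f) <= n2 (rs B f).
Proof.
move=> mA AB sf; apply: n2_le => //; first exact: sqi_rs_sub sf.
move=> x; rewrite /rs !indicE; case: (boolP (x \in A)) => [|_]; last by rewrite !mul0r normr0.
by rewrite inE => /AB /mem_set ->.
Qed.

Lemma sqv_sub A B v : measurable A -> A `<=` B -> sqv B v -> sqv A v.
Proof. by move=> mA AB [s1 s2]; split; exact: sqi_rs_sub AB _. Qed.

Lemma test_sqi A f B : measurable B -> test_fun A f -> sqi (rs B f).
Proof.
move=> mB tf; have sf := test_smooth tf; have [M [M0 HM]] := test_supp tf.
have mf := smooth_mble sf.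
split; first by apply: mble_rs => //; exact: mble_on.
have i2 : ing (fun x => f x * f x) by apply: (test_ing (A := A)); apply: test_mull.
apply: (@ing_le _ (fun x => rs B f x ^+ 2) _ _ i2).
  by apply: mbleX; apply: mble_rs => //; exact: mble_on.
by move=> x; rewrite /rs indicE; case: (_ \in _); rewrite ?mul1r ?mul0r ?expr0n/= ?normr0 -expr2 ?sqr_ge0// ger0_norm ?sqr_ge0.
Qed.

Lemma rsMM A f g x : rs A (fun y => f y * g y) x = rs A f x * rs A g x.
Proof. by rewrite /rs indicE; case: (x \in A); rewrite ?mul1r ?mul0r. Qed.

Lemma ing_rsM A f g : sqi (rs A f) -> sqi (rs A g) -> ing (rs A (fun x => f x * g x)).
Proof. by move=> sf sg; apply: eq_ing (sqi_mul sf sg) => x; rewrite rsMM. Qed.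

Lemma rot_wdiv0 O psi phi : test_fun O psi -> pd ord0 (pd ord_max psi) = pd ord_max (pd ord0 psi) -> smooth phi ->
  test_fun O phi -> Int (rs O (fun x => dot (rot psi x) (pd ord0 phi x, pd ord_max phi x))) = 0.
Proof.
move=> tp pc sphi tphi; have t0 := test_pd ord0 tp; have t1 := test_pd ord_max tp.
have s0 := test_smooth t0; have s1 := test_smooth t1.
have i0 : ing (fun x => pd ord_max psi x * pd ord0 phi x) by exact: test_ing (@test_mull R O (pd ord0 phi) (pd ord_max psi) s1 (test_pd ord0 tphi)).
have i1 : ing (fun x => pd ord0 psi x * pd ord_max phi x) by exact: test_ing (@test_mull R O (pd ord_max phi) (pd ord0 psi) s0 (test_pd ord_max tphi)).
transitivity (Int (fun x => pd ord_max psi x * pd ord0 phi x - pd ord0 psi x * pd ord_max phi x)).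
  apply: eq_Int => x; have [Ox|Ox] := pselect (O x); first by rewrite (rs_in _ Ox) /dot /rot /= mulNr; reflexivity.
  rewrite (rs_out _ Ox) (test_out t0 Ox) (test_out t1 Ox) !mul0r; exact: (esym (subr0 0)).
have e0 := Int_parts ord0 s1 tphi; have e1 := Int_parts ord_max s0 tphi.
rewrite IntB; [rewrite e0 e1 pc; exact: subrr|exact: i0|exact: i1].
Qed.

Lemma rs_dotE A (f1 f2 g1 g2 h k : R * R -> R) x :
  rs A (fun x => dot (f1 x, - f2 x) (g1 x, g2 x) + h x * k x) x =
  rs A (fun x => g1 x * f1 x) x - rs A (fun x => g2 x * f2 x) x + rs A (fun x => h x * k x) x.
Proof. by rewrite /rs /dot /=; ring. Qed.

Lemma rs_dotM A (f1 f2 g1 g2 h k : R * R -> R) :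
  rs A (fun x => dot (f1 x, - f2 x) (g1 x, g2 x) + h x * k x) =
  fun x => rs A g1 x * rs A f1 x - rs A g2 x * rs A f2 x + rs A h x * rs A k x.
Proof. by apply/funext => x; rewrite rs_dotE !rsMM. Qed.

(** The divergence vanishes by the symmetry of second derivatives. So does the normal trace: against
    [phi] in H^1, the weak derivatives of [phi] may be tested with the derivatives of [psi], which
    are themselves test functions. *)
Lemma rot_H0div O psi : open O -> test_fun O psi -> pd ord0 (pd ord_max psi) = pd ord_max (pd ord0 psi) ->
  H0div O (rot psi) /\ {ae mu, forall x, O x -> wdiv O (rot psi) x = 0}.
Proof.
move=> oO tp pc; have mO := open_measurable_plane oO.
have t0 := test_pd ord0 tp; have t1 := test_pd ord_max tp.
have s0 := test_smooth t0; have s1 := test_smooth t1.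
have H0 phi : test_fun O phi -> integ O (fun x => dot (rot psi x) (pd ord0 phi x, pd ord_max phi x)) = 0.
  by move=> tphi; rewrite integE; exact: rot_wdiv0 tp pc (test_smooth tphi) tphi.
have L0 : Lsp 2 O (fun=> 0 : R).
  apply/(Lsp2P _ mO); split; first exact: measurable_cst.
  have -> : rs O (fun=> 0 : R) = (fun=> 0) by apply/funext => x; rewrite /rs mulr0.
  by split; [exact: mble_cst|apply: eq_ing (@ing0 R) => x; rewrite expr0n].
have W0 : is_wdiv O (rot psi) (fun=> 0).
  move=> phi tphi; rewrite (H0 _ tphi) integE.
  have -> : rs O (fun x => 0 * phi x) = (fun=> 0) by apply/funext => x; rewrite /rs mul0r mulr0.
  by rewrite Int0 oppr0.
have [LW W] : Lsp 2 O (wdiv O (rot psi)) /\ is_wdiv O (rot psi) (wdiv O (rot psi)).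
  rewrite /wdiv; case: xgetP => [y _ H|/(_ (fun=> 0)) H]; first exact: H.
  by exfalso; apply: H; split; [exact: L0|exact: W0].
have ae0 : {ae mu, forall x, O x -> wdiv O (rot psi) x = 0}.
  apply: (fund_lemma oO); first exact: Lsp_L1loc.
  by move=> phi tphi; have := W _ tphi; rewrite (H0 _ tphi) integE => /eqP; rewrite eq_sym oppr_eq0 => /eqP.
split; last exact: ae0.
split; [|exact: LW|exact: W|].
  apply/(Lspv2P _ mO); split.
    apply: (measurable_pair mO); first by apply: mble_on; exact: (smooth_mble s1).
    by apply: mble_on; apply: mbleN; exact: (smooth_mble s0).
  split; first exact: (test_sqi mO t1).
  have := sqiZ (-1) (test_sqi mO t0); congr sqi; apply/funext => x; by rewrite /rs /rot /= mulN1r mulrN.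
move=> phi Wphi; have [Lphi Hphi] := Wphi.
have [[_ _ w0] _] := Hphi ord0; have [[_ _ w1] _] := Hphi ord_max.
have sG i : sqi (rs O (wD O i phi)) by have [_ /(Lsp2P _ mO)[]] := Hphi i.
have [mphi sphi] : measurable_fun O phi /\ sqi (rs O phi) by apply/(Lsp2P _ mO).
have [mw sw] : measurable_fun O (wdiv O (rot psi)) /\ sqi (rs O (wdiv O (rot psi))) by apply/(Lsp2P _ mO).
rewrite integE.
have z : {ae mu, forall x, rs O (fun x => phi x * wdiv O (rot psi) x) x = 0}.
  apply: aeS ae0 => x Hx; have [Ox|Ox] := pselect (O x); last by rewrite (rs_out _ Ox).
  by rewrite (rs_in _ Ox) (Hx Ox) mulr0.
have sp0 := test_sqi mO t0; have sp1 := test_sqi mO t1.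
transitivity (Int (fun x => rs O (fun x => wD O ord0 phi x * pd ord_max psi x) x - rs O (fun x => wD O ord_max phi x * pd ord0 psi x) x)).
  apply: Int_ae.
  - have -> : rs O (fun x => dot (rot psi x) (grad O phi x) + phi x * wdiv O (rot psi) x) =
      (fun x => (rs O (wD O ord0 phi) x * rs O (pd ord_max psi) x - rs O (wD O ord_max phi) x * rs O (pd ord0 psi) x) + rs O phi x * rs O (wdiv O (rot psi)) x).
      exact: (rs_dotM O (pd ord_max psi) (pd ord0 psi) (wD O ord0 phi) (wD O ord_max phi) phi (wdiv O (rot psi))).
    apply: mbleD; last by apply: mbleM; [case: sphi|case: sw].
    have [a0 _] := sG ord0; have [a1 _] := sG ord_max; have [b0 _] := sp0; have [b1 _] := sp1.
    by apply: mbleB; [exact: (mbleM a0 b1)|exact: (mbleM a1 b0)].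
  - by apply: ing_mble; apply: ingB; [exact: (ing_rsM (sG ord0) sp1)|exact: (ing_rsM (sG ord_max) sp0)].
  apply: aeS z => x zx; have := rs_dotE O (pd ord_max psi) (pd ord0 psi) (wD O ord0 phi) (wD O ord_max phi) phi (wdiv O (rot psi)) x.
  by rewrite zx addr0; exact.
rewrite IntB; [|exact: (ing_rsM (sG ord0) sp1)|exact: (ing_rsM (sG ord_max) sp0)].
have e2 := w0 (pd ord_max psi) t1; rewrite integE integE in e2.
have e1 := w1 (pd ord0 psi) t0; rewrite integE integE -pc e2 in e1.
rewrite (oppr_inj e1); exact: subrr.
Qed.

End RotatedGradients.

(** * Test functions in an orthogonal frame and their scaling *)

Section FrameFunctions.
Variable R : realType.
Local Notation mu := (@area R).
Implicit Types (f g phi psi : R * R -> R) (A B : R -> R) (O K : set (R * R)) (a v m : R * R) (sg : R).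

(** [tc] and [sc] invert [aff a (perp sg v) v]; for [sg ^+ 2 = 1] both frame vectors have squared
    length [dot v v]. *)
Definition tc a sg v (x : R * R) : R := lin ((dot v v)^-1 *: perp sg v) (- dot a (perp sg v) / dot v v) x.
Definition sc a v (x : R * R) : R := lin ((dot v v)^-1 *: v) (- dot a v / dot v v) x.
(* A(t) B(s) in the coordinates x = a + t m + s v, m = perp sg v. *)
Definition fr A B a sg v : R * R -> R :=
  pb A B ((dot v v)^-1 *: perp sg v) (- dot a (perp sg v) / dot v v)
         ((dot v v)^-1 *: v) (- dot a v / dot v v).

Lemma frE A B a sg v x : fr A B a sg v x = A (tc a sg v x) * B (sc a v x).
Proof. by []. Qed.

Lemma tc_aff a sg v t s : sg ^+ 2 = 1 -> dot v v != 0 -> tc a sg v (aff a (perp sg v) v (t, s)) = t.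
Proof.
move=> s1 v0; apply: (mulIf v0).
have -> : tc a sg v (aff a (perp sg v) v (t, s)) * dot v v = t * dot (perp sg v) (perp sg v).
  by rewrite /tc /lin /perp /aff /dot /= /GRing.scale /= in v0 *; field.
have -> : dot (perp sg v) (perp sg v) = sg ^+ 2 * dot v v by rewrite /perp /dot /=; ring.
by rewrite s1 mul1r.
Qed.

Lemma sc_aff a sg v t s : dot v v != 0 -> sc a v (aff a (perp sg v) v (t, s)) = s.
Proof. by move=> v0; rewrite /sc /lin /perp /aff /dot /= /GRing.scale /= in v0 *; field. Qed.

Lemma aff_coord a sg v x : sg ^+ 2 = 1 -> dot v v != 0 -> aff a (perp sg v) v (tc a sg v x, sc a v x) = x.
Proof.
move=> s1 v0.
have D : dt (perp sg v) v != 0.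
  have -> : dt (perp sg v) v = - (sg * dot v v) by rewrite /dt /perp /dot /=; ring.
  by rewrite oppr_eq0 mulf_neq0// -sqrf_eq0 s1 oner_eq0.
have E1 : tc a sg v x * dot v v = dot (x - a) (perp sg v).
  by rewrite /tc /lin /perp /dot /= /GRing.scale /= in v0 *; field.
have E2 : sc a v x * dot v v = dot (x - a) v.
  by rewrite /sc /lin /perp /dot /= /GRing.scale /= in v0 *; field.
apply: pair_eqP; apply: (mulIf v0); rewrite /aff /=.
  have -> : (a.1 + tc a sg v x * (perp sg v).1 + sc a v x * v.1) * dot v v =
     a.1 * dot v v + (tc a sg v x * dot v v) * (perp sg v).1 + (sc a v x * dot v v) * v.1 by ring.
  rewrite E1 E2 /perp /dot /=.
  have -> : a.1 * (v.1 * v.1 + v.2 * v.2) + ((x.1 - a.1) * - (sg * v.2) + (x.2 - a.2) * (sg * v.1)) * - (sg * v.2) + ((x.1 - a.1) * v.1 + (x.2 - a.2) * v.2) * v.1 =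
     a.1 * (v.1 * v.1 + v.2 * v.2) + sg ^+ 2 * ((x.1 - a.1) * v.2 - (x.2 - a.2) * v.1) * v.2 + ((x.1 - a.1) * v.1 + (x.2 - a.2) * v.2) * v.1 by ring.
  by rewrite s1; ring.
have -> : (a.2 + tc a sg v x * (perp sg v).2 + sc a v x * v.2) * dot v v =
   a.2 * dot v v + (tc a sg v x * dot v v) * (perp sg v).2 + (sc a v x * dot v v) * v.2 by ring.
rewrite E1 E2 /perp /dot /=.
have -> : a.2 * (v.1 * v.1 + v.2 * v.2) + ((x.1 - a.1) * - (sg * v.2) + (x.2 - a.2) * (sg * v.1)) * (sg * v.1) + ((x.1 - a.1) * v.1 + (x.2 - a.2) * v.2) * v.2 =
   a.2 * (v.1 * v.1 + v.2 * v.2) + sg ^+ 2 * ((x.2 - a.2) * v.1 - (x.1 - a.1) * v.2) * v.1 + ((x.1 - a.1) * v.1 + (x.2 - a.2) * v.2) * v.2 by ring.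
by rewrite s1; ring.
Qed.

Lemma fr_aff A B a sg v t s : sg ^+ 2 = 1 -> dot v v != 0 -> fr A B a sg v (aff a (perp sg v) v (t, s)) = A t * B s.
Proof. by move=> s1 v0; rewrite frE tc_aff// sc_aff. Qed.

Lemma fr_pd A B a sg v i x : smooth1 A -> smooth1 B ->
  pd i (fr A B a sg v) x = (dot v v)^-1 * (co i (perp sg v) * fr (derive1 A) B a sg v x + co i v * fr A (derive1 B) a sg v x).
Proof.
move=> sA sB; rewrite /fr (pd_pb _ _ _ _ i sA sB).
have E (w : R * R) (k : R) : co i (k *: w) = k * co i w by rewrite /co; case: (i == ord0).
by rewrite !E; ring.
Qed.

Lemma fr_smooth A B a sg v : smooth1 A -> smooth1 B -> smooth (fr A B a sg v).
Proof. exact: smooth_pb. Qed.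

Lemma fr_comm A B a sg v i j : smooth1 A -> smooth1 B -> pd i (pd j (fr A B a sg v)) = pd j (pd i (fr A B a sg v)).
Proof. exact: pd_pb_comm. Qed.

(** The Jacobian is [dot v v] and the square of half-side 1 has area 4, so the square of the norm is
    at most [4 * M ^+ 2 * dot v v]. *)
Lemma n2_cov g a sg v (M : R) : mble g -> sg ^+ 2 = 1 -> dot v v != 0 -> 0 <= M ->
  (forall t s, ~ @sq R (0, 0) 1 (t, s) -> g (aff a (perp sg v) v (t, s)) = 0) ->
  (forall t s, `|g (aff a (perp sg v) v (t, s))| <= M) ->
  sqi g /\ n2 g <= 2 * M * enorm v.
Proof.
move=> mg s1 v0 M0 out bd.
have detE : (perp sg v).1 * v.2 - (perp sg v).2 * v.1 = - (sg * dot v v) by rewrite /perp /dot /=; ring.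
have nsg : `|sg| = 1 by move/eqP: s1; rewrite sqrf_eq1 => /orP[]/eqP ->; rewrite ?normrN1 ?normr1.
have det0 : (perp sg v).1 * v.2 - (perp sg v).2 * v.1 != 0.
  by rewrite detE oppr_eq0 mulf_neq0// -sqrf_eq0 s1 oner_eq0.
have vp : 0 < dot v v by rewrite lt_neqAle eq_sym v0 dot_ge0.
have detL : `|(perp sg v).1 * v.2 - (perp sg v).2 * v.1| = dot v v by rewrite detE normrN normrM nsg mul1r gtr0_norm.
pose I : R * R -> R := \1_(@sq R (0, 0) 1).
have iI : ing I by exact: (@ing_indic _ _ (0, 0) 1 (measurable_sq _ _) (fun x h => h)).
have iIE : Int I = 4.
  have E0 := area_sq (0, 0) (@ltr01 R).
  apply: EFin_inj; rewrite -(Int_EFin iI) /I integral_indic; [|exact: measurableT|exact: measurable_sq].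
  rewrite setIT; transitivity (4 * 1 ^+ 2 : R)%:E; [exact: E0|by rewrite expr1n mulr1].
pose gX := fun x => g (aff a (perp sg v) v x).
have mgX : mble gX by exact: mble_aff.
have le2 x : gX x ^+ 2 <= M ^+ 2 * I x.
  rewrite /I indicE; case: (boolP (x \in _)) => [_|/negP nx].
    rewrite mulr1 -real_normK ?num_real// lerXn2r ?nnegrE//.
    by case: x => t s; exact: bd.
  have -> : gX x = 0 by case: x nx => t s nx; apply: out => H; apply: nx; rewrite inE.
  by rewrite expr0n/= mulr0.
have iX2 : ing (fun x => gX x ^+ 2).
  apply: (@ing_le _ _ (fun x => M ^+ 2 * I x)); [exact: mbleX|exact: ingZ|].
  by move=> x; rewrite ger0_norm ?sqr_ge0.
(* transport back by the inverse affine map *)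
have i2 : ing (fun x => g x ^+ 2).
  pose L := dot v v.
  have EX : (fun x => g x ^+ 2) = (fun x => gX (aff (- dot a (perp sg v) / L, - dot a v / L) ((perp sg v).1 / L, v.1 / L) ((perp sg v).2 / L, v.2 / L) x) ^+ 2).
    apply/funext => x; rewrite /gX.
    have -> : aff (- dot a (perp sg v) / L, - dot a v / L) ((perp sg v).1 / L, v.1 / L) ((perp sg v).2 / L, v.2 / L) x = (tc a sg v x, sc a v x).
      by apply: pair_eqP; rewrite /aff /tc /sc /lin /L /perp; set D := (dot v v)^-1; rewrite /dot /= /GRing.scale /=; ring.
    by rewrite aff_coord.
  rewrite EX; apply: (ing_aff _ _ iX2).
  have -> : ((perp sg v).1 / L, v.1 / L).1 * ((perp sg v).2 / L, v.2 / L).2 - ((perp sg v).1 / L, v.1 / L).2 * ((perp sg v).2 / L, v.2 / L).1 =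
    ((perp sg v).1 * v.2 - (perp sg v).2 * v.1) / (L ^+ 2) by rewrite /= /L; field.
  by rewrite mulf_neq0// invr_eq0 expf_neq0.
split; first by split.
have := Int_aff a det0 i2; rewrite detL => E.
have E2 : Int (fun x => g x ^+ 2) = dot v v * Int (fun x => gX x ^+ 2) by rewrite /gX E mulrA mulfV// mul1r.
have le : Int (fun x => g x ^+ 2) <= (2 * M * enorm v) ^+ 2.
  rewrite E2 exprMn enorm_sq mulrC ler_wpM2r ?dot_ge0//.
  have -> : (2 * M) ^+ 2 = M ^+ 2 * 4 by ring.
  by rewrite -iIE -IntZ//; apply: Int_le => //; exact: ingZ.
rewrite /n2; apply: (le_trans (ler_wsqrtr le)).
by rewrite sqrtr_sqr ger0_norm// !mulr_ge0// enorm_ge0.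
Qed.

Lemma perp_norm sg v : sg ^+ 2 = 1 -> enorm (perp sg v) = enorm v.
Proof.
move=> s1; rewrite /enorm; congr Num.sqrt.
have -> : dot (perp sg v) (perp sg v) = sg ^+ 2 * dot v v by rewrite /perp /dot /=; ring.
by rewrite s1 mul1r.
Qed.

Lemma co_le i v : `|co i v| <= enorm v.
Proof. by have [h1 h2] := enorm_coord v; rewrite /co; case: (i == ord0). Qed.

(** The interval [-1, 1] accommodates both the dual functions, supported in [1/4, 3/4], and the
    cutoff across a side, supported in [-d, d]. *)
Definition bd1 A (M : R) := [/\ smooth1 A, forall s, `|A s| <= M, forall s, `|derive1 A s| <= M &
  forall s, ~ (-1 <= s <= 1) -> A s = 0 /\ derive1 A s = 0].

(** Scaling in two dimensions: the norm of the function gains the length of [v], that of its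
    gradient is invariant. *)
Lemma fr_bounds A B a sg v (M : R) : sg ^+ 2 = 1 -> dot v v != 0 -> bd1 A M -> bd1 B M ->
  (sqi (fr A B a sg v) /\ n2 (fr A B a sg v) <= 2 * M ^+ 2 * enorm v) /\
  (forall i, sqi (pd i (fr A B a sg v)) /\ n2 (pd i (fr A B a sg v)) <= 4 * M ^+ 2).
Proof.
move=> s1 v0 [sA bA dA oA] [sB bB dB oB].
have M0 : 0 <= M by exact: (le_trans (normr_ge0 (A 0))).
have sf := fr_smooth a sg v sA sB.
have nsq t s : ~ @sq R (0, 0) 1 (t, s) -> ~ (-1 <= t <= 1) \/ ~ (-1 <= s <= 1).
  move=> H; have [h1|h1] := pselect (-1 <= t <= 1); last by left.
  right => h2; apply: H; split; rewrite /= subr0 ler_norml//.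
split.
  apply: (n2_cov (a := a) (smooth_mble sf) s1 v0).
  - by rewrite exprn_ge0.
  - move=> t s /nsq H; rewrite fr_aff//; case: H => H; first by have [-> _] := oA _ H; rewrite mul0r.
    by have [-> _] := oB _ H; rewrite mulr0.
  - by move=> t s; rewrite fr_aff// normrM expr2 ler_pM.
move=> i; have spd := @smooth_pd _ i _ sf.
have vp : 0 < enorm v by rewrite sqrtr_gt0 lt_neqAle eq_sym v0 dot_ge0.
have -> : 4 * M ^+ 2 = 2 * (2 * M ^+ 2 / enorm v) * enorm v by field; rewrite gt_eqF.
apply: (n2_cov (a := a) (smooth_mble spd) s1 v0).
- by rewrite divr_ge0 ?(ltW vp)// mulr_ge0// exprn_ge0.
- move=> t s /nsq H; rewrite fr_pd// !fr_aff//; case: H => H; first by have [-> ->] := oA _ H; rewrite !mul0r !mulr0 addr0 mulr0.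
  by have [-> ->] := oB _ H; rewrite !mulr0 addr0 mulr0.
- move=> t s; rewrite fr_pd// !fr_aff// normrM -enorm_sq normfV [`|enorm v ^+ 2|]ger0_norm ?sqr_ge0//.
  have -> : 2 * M ^+ 2 / enorm v = (enorm v ^+ 2)^-1 * (2 * M ^+ 2 * enorm v) by field; rewrite gt_eqF.
  rewrite ler_wpM2l ?invr_ge0 ?sqr_ge0//.
  apply: (le_trans (ler_normD _ _)).
  have -> : 2 * M ^+ 2 * enorm v = enorm v * (M * M) + enorm v * (M * M) by ring.
  apply: lerD; rewrite normrM; apply: ler_pM => //; rewrite ?co_le//.
  + by rewrite -(perp_norm v s1); exact: co_le.
  + by rewrite normrM ler_pM.
  + by rewrite normrM ler_pM.
Qed.

Lemma fr_test A B a sg v O (t0 t1 s0 s1 : R) : sg ^+ 2 = 1 -> dot v v != 0 -> smooth1 A -> smooth1 B ->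
  (forall t, ~ (t0 <= t <= t1) -> A t = 0) -> (forall s, ~ (s0 <= s <= s1) -> B s = 0) ->
  (forall t s, t0 <= t <= t1 -> s0 <= s <= s1 -> O (aff a (perp sg v) v (t, s))) ->
  test_fun O (fr A B a sg v).
Proof.
move=> sg1 v0 sA sB zA zB HO; split; first exact: fr_smooth.
pose C : set (R * R) := [set x | t0 <= tc a sg v x <= t1 /\ s0 <= sc a v x <= s1].
exists C; last first.
  split.
    by move=> x [h1 h2]; rewrite -(aff_coord a x sg1 v0); exact: HO.
  move=> x nC; rewrite frE; have [h1|h1] := pselect (t0 <= tc a sg v x <= t1); last by rewrite zA// mul0r.
  have [h2|h2] := pselect (s0 <= sc a v x <= s1); last by rewrite zB// mulr0.
  by exfalso; apply: nC.
have cl (w : R * R) (r x0 x1 : R) : closed [set x | x0 <= lin w r x <= x1].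
  have -> : [set x | x0 <= lin w r x <= x1] = lin w r @^-1` [set z : R | z \in `[x0, x1]].
    by apply/seteqP; split => x; rewrite /= in_itv.
  by apply: closed_comp; [move=> x _; exact: lin_cont|exact: interval_closed].
have clC : closed C.
  have -> : C = [set x | t0 <= tc a sg v x <= t1] `&` [set x | s0 <= sc a v x <= s1] by [].
  by apply: closedI; exact: cl.
have [M HM] : exists M, C `<=` @sq R (0, 0) M.
  exists (`|a.1| + `|a.2| + (`|t0| + `|t1|) * (`|(perp sg v).1| + `|(perp sg v).2|) + (`|s0| + `|s1|) * (`|v.1| + `|v.2|)) => x [h1 h2].
  rewrite -(aff_coord a x sg1 v0).
  have b (z z0 z1 : R) : z0 <= z <= z1 -> `|z| <= `|z0| + `|z1|.
    move=> /andP[? ?]; rewrite ler_norml; have := ler_norm z1; have := ler_norm (- z0); rewrite normrN.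
    have := normr_ge0 z0; have := normr_ge0 z1; move=> *; apply/andP; split; lra.
  have bt := b _ _ _ h1; have bs := b _ _ _ h2.
  have E (p q r : R) (t s : R) : `|p + t * q + s * r| <= `|p| + `|t| * `|q| + `|s| * `|r|.
    by apply: (le_trans (ler_normD _ _)); rewrite -(normrM s) lerD2r; apply: (le_trans (ler_normD _ _)); rewrite -(normrM t).
  have F (x1 x2 y1 y2 : R) : 0 <= x1 -> x1 <= x2 -> 0 <= y1 -> 0 <= y2 -> x1 * y1 <= x2 * (y1 + y2).
    by move=> *; rewrite ler_pM// lerDl.
  have F' (x1 x2 y1 y2 : R) : 0 <= x1 -> x1 <= x2 -> 0 <= y1 -> 0 <= y2 -> x1 * y2 <= x2 * (y1 + y2).
    by move=> *; rewrite ler_pM// lerDr.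
  split; rewrite /aff /= subr0; apply: (le_trans (E _ _ _ _ _)); apply: lerD.
  - by apply: lerD; [rewrite lerDl|apply: F].
  - exact: F.
  - by apply: lerD; [rewrite lerDr|apply: F'].
  - exact: F'.
by apply: (subclosed_compact clC _ HM); exact: compact_sq.
Qed.
End FrameFunctions.

(** * The estimate of the curl inside an element *)

Section InteriorEstimate.
Variable R : realType.
Local Notation mu := (@area R).
Local Notation leb := (@lebesgue_measure R).
Implicit Types (f g F phi psi : R * R -> R) (w : R -> R) (A B O K : set (R * R)) (a b c v m : R * R) (sg : R) (G : 'I_2 -> R * R -> R).

Lemma Int_sum n (F : 'I_n -> R * R -> R) : (forall k, ing (F k)) ->
  ing (fun x => \sum_(k < n) F k x) /\ Int (fun x => \sum_(k < n) F k x) = \sum_(k < n) Int (F k).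
Proof.
elim: n F => [|n IH] F iF.
  have E : (fun x : R * R => \sum_(k < 0) F k x) = fun=> 0 by apply/funext => x; rewrite big_ord0.
  by rewrite E Int0 big_ord0; split => //; exact: ing0.
have [i1 e1] := IH (fun k => F (widen_ord (leqnSn n) k)) (fun k => iF _).
have E : (fun x => \sum_(k < n.+1) F k x) = (fun x => \sum_(k < n) F (widen_ord (leqnSn n) k) x + F ord_max x).
  by apply/funext => x; rewrite big_ord_recr.
rewrite E big_ord_recr /= -e1; split; first exact: (ingD i1 (iF _)).
exact: (IntD i1 (iF _)).
Qed.

Lemma bd1_family n (chi : 'I_n -> R -> R) : (forall i, smooth1 (chi i)) -> (forall i, supp1 (chi i)) ->
  exists2 M, 0 < M & forall i, bd1 (chi i) M.
Proof.
move=> sc zc.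
have H i : exists M, 0 <= M /\ ((forall s, `|chi i s| <= M) /\ (forall s, `|derive1 (chi i) s| <= M)).
  have [M1 M10 H1] := bounded1 (sc i) (zc i).
  have [M2 M20 H2] := bounded1 (smooth1_d (sc i)) (derive1_out (sc i) (zc i)).
  exists (M1 + M2); split; first exact: addr_ge0.
  by split => s; [apply: (le_trans (H1 s)); rewrite lerDl|apply: (le_trans (H2 s)); rewrite lerDr].
have [M HM] := boolp.choice H.
exists (1 + \sum_i M i); first by rewrite ltr_pwDl// sumr_ge0// => i _; have [] := HM i.
have le i : M i <= 1 + \sum_i M i.
  by rewrite (bigD1 i)//= addrCA lerDl addr_ge0// sumr_ge0// => j _; have [] := HM j.
move=> i; have [_ [h1 h2]] := HM i; split => //.
- by move=> s; exact: (le_trans (h1 s)).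
- by move=> s; exact: (le_trans (h2 s)).
- move=> s ns; have ns' : ~ (4^-1 <= s <= 3 / 4) by move=> /andP[? ?]; apply: ns; apply/andP; split; lra.
  by split; [exact: zc|exact: (derive1_out (sc i) (zc i))].
Qed.

(** In frame coordinates the integral of a monomial against a product of two dual functions is a
    product of two moments, which is 1 for the matching exponents and 0 otherwise; [dot v v] is the
    Jacobian. *)
Lemma pol_dual n (chi : 'I_n.+1 -> R -> R) (Cq : R * R -> R) a sg v :
  (forall i, smooth1 (chi i)) -> (forall i, supp1 (chi i)) ->
  (forall i j : 'I_n.+1, I1 (fun s => chi i s * s ^+ j) = (i == j)%:R) ->
  sg ^+ 2 = 1 -> dot v v != 0 -> pol n Cq ->
  exists c : nat -> nat -> R,
   (forall x, Cq x = \sum_(k < n.+1) \sum_(l < n.+1) c k l * tc a sg v x ^+ k * sc a v x ^+ l) /\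
   forall i j : 'I_n.+1, Int (fun x => Cq x * fr (chi i) (chi j) a sg v x) = dot v v * c i j.
Proof.
move=> sc' zc dual s1 v0 pq.
have [c Hc] := pol_mono (pol_aff a (perp sg v) v pq); exists c.
split; first by move=> x; rewrite -{1}(aff_coord a x s1 v0) Hc.
move=> i j.
have detE : (perp sg v).1 * v.2 - (perp sg v).2 * v.1 = - (sg * dot v v) by rewrite /perp /dot /=; ring.
have nsg : `|sg| = 1 by move/eqP: s1; rewrite sqrf_eq1 => /orP[]/eqP ->; rewrite ?normrN1 ?normr1.
have det0 : (perp sg v).1 * v.2 - (perp sg v).2 * v.1 != 0.
  by rewrite detE oppr_eq0 mulf_neq0// -sqrf_eq0 s1 oner_eq0.
have vp : 0 < dot v v by rewrite lt_neqAle eq_sym v0 dot_ge0.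
have detL : `|(perp sg v).1 * v.2 - (perp sg v).2 * v.1| = dot v v by rewrite detE normrN normrM nsg mul1r gtr0_norm.
have tf : test_fun setT (fr (chi i) (chi j) a sg v).
  exact: (@fr_test R _ _ a sg v setT 4^-1 (3 / 4) 4^-1 (3 / 4) s1 v0 (sc' i) (sc' j) (zc i) (zc j)).
have ig : ing (fun x => Cq x * fr (chi i) (chi j) a sg v x) := test_ing (test_mull (pol_smooth pq) tf).
have := Int_aff a det0 ig; rewrite detL => E.
have -> : Int (fun x => Cq x * fr (chi i) (chi j) a sg v x) =
   dot v v * Int (fun x => Cq (aff a (perp sg v) v x) * fr (chi i) (chi j) a sg v (aff a (perp sg v) v x)).
  by rewrite E mulrA mulfV// mul1r.
congr (_ * _).
pose p (i k : nat) (s : R) := (if insub i is Some i' then chi i' s else 0) * s ^+ k.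
have pE (i' : 'I_n.+1) k s : p i' k s = chi i' s * s ^+ k by rewrite /p valK.
have cp (i' : 'I_n.+1) k : continuous (p i' k).
  have -> : p i' k = (fun s => chi i' s * s ^+ k) by apply/funext => s; rewrite pE.
  by apply: smooth1_cont; apply: smooth1M; [exact: sc'|exact: (@smooth1X _ (fun s => s) k (@smooth1_id R))].
have zp (i' : 'I_n.+1) k : supp1 (p i' k) by move=> s ns; rewrite pE (zc i' _ ns) mul0r.
have ipp (k l : 'I_n.+1) : ing (fun x : R * R => p i k x.1 * p j l x.2).
  have c2 (f : R -> R) : continuous f -> continuous (fun x : R * R => f x.2).
    by move=> cf x; apply: (@continuous_comp _ _ _ (fun x : R * R => x.2) f); [exact: cvg_snd|exact: cf].
  have c1 (f : R -> R) : continuous f -> continuous (fun x : R * R => f x.1).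
    by move=> cf x; apply: (@continuous_comp _ _ _ (fun x : R * R => x.1) f); [exact: cvg_fst|exact: cf].
  apply: (@cont_supp_ing _ _ (0, 0) 1).
    by move=> x; apply: cvgM; [exact: (c1 _ (cp i k))|exact: (c2 _ (cp j l))].
  move=> x nx.
  have [h1|h1] := pselect (4^-1 <= x.1 <= 3 / 4); last by rewrite (zp i k _ h1) mul0r.
  have [h2|h2] := pselect (4^-1 <= x.2 <= 3 / 4); last by rewrite (zp j l _ h2) mulr0.
  exfalso; apply: nx; move: h1 h2 => /andP[? ?] /andP[? ?].
  by split; rewrite /= subr0 ler_norml; apply/andP; split; lra.
transitivity (Int (fun x => \sum_(k < n.+1) \sum_(l < n.+1) c k l * (p i k x.1 * p j l x.2))).
  apply: eq_Int => -[t s]; rewrite fr_aff// Hc mulr_suml; apply: eq_bigr => k _.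
  by rewrite mulr_suml; apply: eq_bigr => l _; rewrite !pE /=; ring.
have [_ ->] := @Int_sum _ (fun (k : 'I_n.+1) x => \sum_(l < n.+1) c k l * (p i k x.1 * p j l x.2)) (fun k => (@Int_sum _ (fun (l : 'I_n.+1) x => c k l * (p i k x.1 * p j l x.2)) (fun l => ingZ _ (ipp k l))).1).
rewrite (bigD1 i)//= [X in _ + X]big1 ?addr0; last first.
  move=> k ki; have [_ ->] := @Int_sum _ (fun (l : 'I_n.+1) x => c k l * (p i k x.1 * p j l x.2)) (fun l => ingZ _ (ipp k l)).
  rewrite big1// => l _; rewrite IntZ; last exact: ipp.
  rewrite Int_prod; [|exact: cp|exact: cp|exact: zp|exact: zp].
  have -> : I1 (p i k) = 0.
    by transitivity (I1 (fun s => chi i s * s ^+ k)); [apply: eq_I1 => s _; rewrite pE|rewrite dual eq_sym (negbTE ki)].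
  by rewrite mul0r mulr0.
have [_ ->] := @Int_sum _ (fun (l : 'I_n.+1) x => c i l * (p i i x.1 * p j l x.2)) (fun l => ingZ _ (ipp i l)).
have Ip (i' k : 'I_n.+1) : I1 (p i' k) = (i' == k)%:R.
  by transitivity (I1 (fun s => chi i' s * s ^+ k)); [apply: eq_I1 => s _; rewrite pE|rewrite dual].
rewrite (bigD1 j)//= [X in _ + X]big1 ?addr0; last first.
  move=> l lj; rewrite IntZ; last exact: ipp.
  rewrite Int_prod; [|exact: cp|exact: cp|exact: zp|exact: zp].
  by rewrite (Ip j l) eq_sym (negbTE lj) !mulr0.
rewrite IntZ; last exact: ipp.
rewrite Int_prod; [|exact: cp|exact: cp|exact: zp|exact: zp].
by rewrite !Ip !eqxx !mulr1.
Qed.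

(** The integral of the field [(f, g)] against [rot psi], that is, the weak form of its curl. *)
Definition cir A f g psi := Int (rs A (fun x => f x * pd ord_max psi x - g x * pd ord0 psi x)).
Definition nE A f g := n2 (rs A f) + n2 (rs A g).

Lemma rsMl A f g x : rs A (fun y => f y * g y) x = rs A f x * g x.
Proof. by rewrite /rs mulrA. Qed.

Lemma cir_le A f g psi (M : R) : sqi (rs A f) -> sqi (rs A g) -> (forall i, sqi (pd i psi)) ->
  (forall i, n2 (pd i psi) <= M) ->
  ing (rs A (fun x => f x * pd ord_max psi x - g x * pd ord0 psi x)) /\ `|cir A f g psi| <= nE A f g * M.
Proof.
move=> sf sgg sp bp.
have i1 := sqi_mul sf (sp ord_max); have i2 := sqi_mul sgg (sp ord0).
have E : rs A (fun x => f x * pd ord_max psi x - g x * pd ord0 psi x) = (fun x => rs A f x * pd ord_max psi x - rs A g x * pd ord0 psi x).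
  by apply/funext => x; rewrite -!(rsMl _ _ (pd _ psi)) -rsB.
rewrite /cir E; split; first exact: ingB.
rewrite IntB//; apply: (le_trans (ler_normB _ _)); rewrite /nE mulrDl; apply: lerD.
  by apply: (le_trans (Int_abs_cs sf (sp ord_max))); rewrite ler_wpM2l// n2_ge0.
by apply: (le_trans (Int_abs_cs sgg (sp ord0))); rewrite ler_wpM2l// n2_ge0.
Qed.

(* The variational identity that replaces the pressure equation: tested with rotated gradients,
   (f, g) and (f', g') agree. *)
Definition rot_eq O f g f' g' := forall psi, test_fun O psi ->
  pd ord0 (pd ord_max psi) = pd ord_max (pd ord0 psi) -> cir O f g psi = cir O f' g' psi.

Lemma cir_test A B f g psi : A `<=` B -> test_fun A psi -> cir B f g psi = cir A f g psi.
Proof.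
move=> AB tp; have t0 := test_pd ord0 tp; have t1 := test_pd ord_max tp.
apply: eq_Int => x; have [Ax|Ax] := pselect (A x).
  by rewrite (rs_in _ Ax) (rs_in _ (AB _ Ax)).
by rewrite (rs_out _ Ax) /rs (test_out t0 Ax) (test_out t1 Ax) !mulr0 subr0 mulr0.
Qed.

Lemma cir_curl A f g G1 G2 psi : open A -> H1p A f G1 -> H1p A g G2 -> test_fun A psi ->
  cir A f g psi = Int (rs A (fun x => (G2 ord0 x - G1 ord_max x) * psi x)).
Proof.
move=> oA [sf H1] [sg H2] tp; have mA := open_measurable_plane oA.
have t0 := test_pd ord0 tp; have t1 := test_pd ord_max tp.
have [[lf lG1 e1] _] := H1 ord_max; have [[lg lG2 e2] _] := H2 ord0.
have j1 := e1 _ tp; rewrite integE integE in j1.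
have j2 := e2 _ tp; rewrite integE integE in j2.
have i1 := L1loc_test oA lf t1; have i2 := L1loc_test oA lg t0.
have i3 := L1loc_test oA lG1 tp; have i4 := L1loc_test oA lG2 tp.
transitivity (Int (fun x => rs A (fun x => f x * pd ord_max psi x) x - rs A (fun x => g x * pd ord0 psi x) x)).
  by apply: eq_Int => x; rewrite -rsB.
rewrite IntB; [|exact: i1|exact: i2].
rewrite j1 j2 opprK addrC -IntB; [|exact: i4|exact: i3].
by apply: eq_Int => x; rewrite -rsB; congr (_ * _); ring.
Qed.

Lemma coef_bound (c X Y n0 e M h l L : R) : 0 < l -> l <= h -> 0 <= n0 -> 0 <= e -> L = 4 * l ^+ 2 ->
  L * c = X - Y -> `|X| <= n0 * (2 * M ^+ 2 * (2 * l)) -> `|Y| <= e * (4 * M ^+ 2) ->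
  `|c| <= l ^- 2 * (8 * M ^+ 2 * (h * n0 + e)).
Proof.
move=> l0 h0 n00 e0 vv e3 b2 b1; have l2 : 0 < l ^+ 2 by rewrite exprn_gt0.
have -> : c = l ^- 2 * (4^-1 * (L * c)) by rewrite vv; field; rewrite gt_eqF.
rewrite normrM ger0_norm ?invr_ge0 ?(ltW l2)//; apply: ler_wpM2l; first by rewrite invr_ge0 ltW.
rewrite normrM ger0_norm ?invr_ge0// e3.
have b3 := le_trans (ler_normB _ _) (lerD b2 b1).
apply: (@le_trans _ _ (4^-1 * (n0 * (2 * M ^+ 2 * (2 * l)) + e * (4 * M ^+ 2)))).
  by rewrite ler_wpM2l ?invr_ge0.
rewrite -subr_ge0.
have -> : 8 * M ^+ 2 * (h * n0 + e) - 4^-1 * (n0 * (2 * M ^+ 2 * (2 * l)) + e * (4 * M ^+ 2)) =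
   M ^+ 2 * (n0 * (8 * h - l) + 7 * e) by field.
by apply: mulr_ge0; rewrite ?sqr_ge0// addr_ge0// mulr_ge0//; move: h0 l0; clear; lra.
Qed.

(** Only the polynomial part [Cq] of the curl has to be bounded. Testing with dual functions on the
    inner square bounds its coefficients by [cf] and by the field [(f', g')], and the comparison
    [h <= S * l] carries the bound from the inner square to all of [K]. *)
Lemma interior_est (n : nat) (S : R) : 0 < S -> exists2 C, 0 < C &
  forall O K f g f' g' G1 G2 cf Cq (q : R * R) (l h : R),
  open O -> open K -> K `<=` O -> sqi (rs O f) -> sqi (rs O g) -> sqi (rs O f') -> sqi (rs O g') ->
  rot_eq O f g f' g' -> K `<=` sq q h -> sq q l `<=` K -> 0 < l -> h <= S * l ->
  H1p K f G1 -> H1p K g G2 -> pol n Cq -> measurable_fun K cf -> sqi (rs K cf) ->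
  {ae mu, forall x, K x -> G2 ord0 x - G1 ord_max x = cf x - Cq x} ->
  h * n2 (rs K (fun x => G2 ord0 x - G1 ord_max x)) <= C * (h * n2 (rs K cf) + nE K f' g').
Proof.
move=> S0; have [chi [sch zch dual]] := dual_ex R n.+1.
have [M M0 bdM] := bd1_family sch zch.
(* Points of [K] have frame coordinates of modulus at most [Y], so [P] dominates the sum of all the
   monomials on [K]. *)
pose Y := 1 + S.
pose P := \sum_(i < n.+1) \sum_(j < n.+1) Y ^+ i * Y ^+ j.
have Y0 : 0 < Y by rewrite addr_gt0.
have P0 : 0 <= P by apply: sumr_ge0 => i _; apply: sumr_ge0 => j _; rewrite mulr_ge0// exprn_ge0// ltW.
pose C := 1 + 2 * S ^+ 2 * P * (8 * M ^+ 2).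
have Cp : 0 <= 2 * S ^+ 2 * P * (8 * M ^+ 2) by rewrite !mulr_ge0// ltW.
exists (C + C * S); first by rewrite addr_gt0// ?mulr_gt0// ltr_pwDl.
move=> O K f g f' g' G1 G2 cf Cq q l h oO oK KO sf sgg sf' sg' HW Kh lK l0 hS HG1 HG2 pq mcf scf ae0.
have mK := open_measurable_plane oK.
have Kq : K q by apply: lK; split; rewrite subrr normr0 ltW.
have h0 : l <= h.
  have K2 : K (q.1 + l, q.2) by apply: lK; split => /=; [rewrite addrC addKr gtr0_norm|rewrite subrr normr0 ltW].
  have [/= + _] := Kh _ K2; rewrite addrC addKr gtr0_norm//.
have hp : 0 < h by exact: (lt_le_trans l0).
(* With the sign -1, [perp] turns [v] into the first axis and the frame maps the unit square onto
   [sq q l]. *)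
pose a : R * R := (q.1 - l, q.2 - l); pose v : R * R := (0, 2 * l).
have vv : dot v v = 4 * l ^+ 2 by rewrite /dot /v /=; ring.
have v0 : dot v v != 0 by rewrite vv mulf_neq0// ?expf_neq0 ?gt_eqF.
have sg1 : (-1 : R) ^+ 2 = 1 by rewrite sqrrN expr1n.
have ev : enorm v = 2 * l.
  by rewrite /enorm vv (_ : 4 * l ^+ 2 = (2 * l) ^+ 2) ?sqrtr_sqr ?gtr0_norm ?mulr_gt0//; ring.
have affE t s : aff a (perp (-1) v) v (t, s) = (q.1 + l * (2 * t - 1), q.2 + l * (2 * s - 1)).
  by apply: pair_eqP; rewrite /aff /perp /a /v /=; ring.
have [c [Hc Ic]] := pol_dual a sch zch dual sg1 v0 pq.
have bc (i j : 'I_n.+1) : `|c i j| <= l ^- 2 * (8 * M ^+ 2 * (h * n2 (rs K cf) + nE K f' g')).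
  pose psi := fr (chi i) (chi j) a (-1) v.
  have tp : test_fun K psi.
    apply: (@fr_test R _ _ a (-1) v K 4^-1 (3 / 4) 4^-1 (3 / 4) sg1 v0 (sch i) (sch j) (zch i) (zch j)).
    move=> t s /andP[t1 t2] /andP[s1 s2]; apply: lK; rewrite affE; split; rewrite /= addrC addKr normrM gtr0_norm// ger_pMr// ler_norml.
      by apply/andP; split; move: t1 t2; clear; lra.
    by apply/andP; split; move: s1 s2; clear; lra.
  have [[sp np] Hpd] := fr_bounds a sg1 v0 (bdM i) (bdM j).
  have comm : pd ord0 (pd ord_max psi) = pd ord_max (pd ord0 psi) := fr_comm a (-1) v ord0 ord_max (sch i) (sch j).
  have e1 := HW _ (test_sub KO tp) comm.
  rewrite (cir_test _ _ KO tp) (cir_test _ _ KO tp) (cir_curl oK HG1 HG2 tp) in e1.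
  have [_ b1] := cir_le (sqi_rs_sub mK KO sf') (sqi_rs_sub mK KO sg') (fun k => (Hpd k).1) (fun k => (Hpd k).2).
  have smp := test_smooth tp.
  have i1 : ing (rs K (fun x => cf x * psi x)) by apply: eq_ing (sqi_mul scf sp) => x; rewrite rsMl.
  have i2 : ing (fun x => Cq x * psi x) := test_ing (test_mull (pol_smooth pq) tp).
  have mG1 : measurable_fun K (G1 ord_max) by have [_ HG] := HG1; have [[_ [mm _] _] _] := HG ord_max.
  have mG2 : measurable_fun K (G2 ord0) by have [_ HG] := HG2; have [[_ [mm _] _] _] := HG ord0.
  have e2 : Int (rs K (fun x => (G2 ord0 x - G1 ord_max x) * psi x)) = Int (rs K (fun x => cf x * psi x)) - Int (fun x => Cq x * psi x).
    rewrite -(IntB i1 i2); apply: Int_ae.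
    - apply: (mble_rs mK); apply: measurable_funM; first exact: measurable_funB.
      by apply: mble_on; exact: (smooth_mble smp).
    - by apply: ing_mble; exact: ingB.
    - apply: aeS ae0 => x Hx; have [Kx|Kx] := pselect (K x).
        by rewrite !(rs_in _ Kx) (Hx Kx) mulrBl.
      by rewrite !(rs_out _ Kx) (test_out tp Kx) mulr0 subr0.
  rewrite e2 in e1; rewrite (Ic i j) in e1.
  have e3 : dot v v * c i j = Int (rs K (fun x => cf x * psi x)) - cir K f' g' psi by rewrite -e1; ring.
  have b2 : `|Int (rs K (fun x => cf x * psi x))| <= n2 (rs K cf) * (2 * M ^+ 2 * (2 * l)).
    have -> : Int (rs K (fun x => cf x * psi x)) = Int (fun x => rs K cf x * psi x) by apply: eq_Int => x; rewrite rsMl.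
    by apply: (le_trans (Int_abs_cs scf sp)); rewrite -ev; apply: ler_wpM2l; [exact: n2_ge0|exact: np].
  exact: (coef_bound l0 h0 (n2_ge0 _) (addr_ge0 (n2_ge0 _) (n2_ge0 _)) vv e3 b2 b1).
set Q := h * n2 (rs K cf) + nE K f' g' in bc *.
have nE0 : 0 <= nE K f' g' := addr_ge0 (n2_ge0 _) (n2_ge0 _).
have Q0 : 0 <= Q := addr_ge0 (mulr_ge0 (ltW hp) (n2_ge0 _)) nE0.
have l2 : 0 < l ^+ 2 by rewrite exprn_gt0.
have bCq x : K x -> `|Cq x| <= P * (l ^- 2 * (8 * M ^+ 2 * Q)).
  move=> Kx; rewrite Hc; have [x1 x2] := Kh _ Kx.
  have bcoord (z z' : R) : `|z - z'| <= h -> `|(z - z') / (2 * l) + 2^-1| <= Y.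
    have l20 : 0 < 2 * l by rewrite mulr_gt0.
    move=> zz; apply: (le_trans (ler_normD _ _)); rewrite normrM normfV (gtr0_norm l20) [X in _ + X]ger0_norm ?invr_ge0//.
    have : `|z - z'| / (2 * l) <= S / 2.
      rewrite ler_pdivrMr ?mulr_gt0//; apply: (le_trans zz); apply: (le_trans hS).
      by have -> : S / 2 * (2 * l) = S * l by field.
    by rewrite /Y; move: S0; clear; move: (_ / (2 * l)) => z0 *; lra.
  have bt : `|tc a (-1) v x| <= Y.
    have -> : tc a (-1) v x = (x.1 - q.1) / (2 * l) + 2^-1.
      by rewrite /tc /lin vv /perp /a /v /dot /= /GRing.scale /=; field; rewrite gt_eqF.
    exact: bcoord.
  have bs : `|sc a v x| <= Y.
    have -> : sc a v x = (x.2 - q.2) / (2 * l) + 2^-1.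
      by rewrite /sc /lin vv /perp /a /v /dot /= /GRing.scale /=; field; rewrite gt_eqF.
    exact: bcoord.
  apply: (le_trans (ler_norm_sum _ _ _)); rewrite /P mulr_suml; apply: ler_sum => i _.
  apply: (le_trans (ler_norm_sum _ _ _)); rewrite mulr_suml; apply: ler_sum => j _.
  rewrite normrM normrM mulrAC -mulrA mulrC; apply: ler_pM => //.
  by rewrite mulrC !normrX; apply: ler_pM; rewrite ?exprn_ge0//; apply: lerXn2r; rewrite // nnegrE ltW.
have sCq : sqi (rs K Cq).
  have [M' HM'] : exists M', K `<=` sq (0, 0) M'.
    exists (`|q.1| + `|q.2| + h) => x /Kh[x1 x2]; split; rewrite /= subr0.
      have -> : x.1 = q.1 + (x.1 - q.1) by ring.
      by apply: (le_trans (ler_normD _ _)); apply: lerD => //; rewrite lerDl.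
    have -> : x.2 = q.2 + (x.2 - q.2) by ring.
    by apply: (le_trans (ler_normD _ _)); apply: lerD => //; rewrite lerDr.
  by have /(Lsp2P _ mK)[] := Lsp_smooth mK HM' (pol_smooth pq).
have nI : exists2 I : R * R -> R, sqi I & n2 I = 2 * h /\ forall x, K x -> I x = 1.
  exists (\1_(sq q h) : R * R -> R); last first.
    split; last by move=> x /Kh Hx; rewrite indicE mem_set.
    have iI : ing (\1_(sq q h) : R * R -> R) := @ing_indic _ _ q h (measurable_sq _ _) (fun x H => H).
    have E : Int (fun x => (\1_(sq q h) x : R) ^+ 2) = (2 * h) ^+ 2.
      transitivity (Int (\1_(sq q h) : R * R -> R)).
        by apply: eq_Int => x; rewrite indicE; case: (_ \in _); rewrite ?expr1n ?expr0n.
      apply: EFin_inj; rewrite -(Int_EFin iI) integral_indic; [|exact: measurableT|exact: measurable_sq].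
      rewrite setIT; transitivity (4 * h ^+ 2 : R)%:E; [exact: (area_sq q hp)|].
      by congr EFin; ring.
    by rewrite /n2 E sqrtr_sqr gtr0_norm// mulr_gt0.
  have iI : ing (\1_(sq q h) : R * R -> R) := @ing_indic _ _ q h (measurable_sq _ _) (fun x H => H).
  split; first exact: (mble_indic (measurable_sq _ _)).
  by apply: eq_ing iI => x; rewrite indicE; case: (_ \in _); rewrite ?expr1n ?expr0n.
have [I sI [nI1 I1']] := nI.
have nCq : n2 (rs K Cq) <= 2 * h * (P * (l ^- 2 * (8 * M ^+ 2 * Q))).
  set T := P * _ in bCq *.
  have T0 : 0 <= T by exact: (le_trans (normr_ge0 _) (bCq _ Kq)).
  rewrite -nI1 mulrC -[X in X * _](ger0_norm T0) -n2Z//; apply: n2_le => //; first exact: sqiZ.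
  move=> x; have [Kx|Kx] := pselect (K x); last by rewrite (rs_out _ Kx) normr0.
  by rewrite (rs_in _ Kx) (I1' _ Kx) mulr1 (ger0_norm T0); exact: bCq.
have nle : n2 (rs K (fun x => G2 ord0 x - G1 ord_max x)) <= n2 (rs K cf) + n2 (rs K Cq).
  have sNq := sqiZ (-1) sCq; have s3 := sqiD scf sNq; have [m3 _] := s3.
  have mG1 : measurable_fun K (G1 ord_max) by have [_ HG] := HG1; have [[_ [mm _] _] _] := HG ord_max.
  have mG2 : measurable_fun K (G2 ord0) by have [_ HG] := HG2; have [[_ [mm _] _] _] := HG ord0.
  rewrite (@n2_ae _ _ (fun x => rs K cf x + (-1) * rs K Cq x)) //.
  - by apply: (le_trans (n2D scf sNq)); rewrite n2Z// normrN1 mul1r.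
  - by apply: (mble_rs mK); exact: measurable_funB.
  - apply: aeS ae0 => x Hx; have [Kx|Kx] := pselect (K x).
      by rewrite !(rs_in _ Kx) (Hx Kx) mulN1r.
    by rewrite !(rs_out _ Kx) mulr0 addr0.
apply: (@le_trans _ _ (h * n2 (rs K cf) + h * (2 * h * (P * (l ^- 2 * (8 * M ^+ 2 * Q)))))).
  by rewrite -mulrDr; apply: ler_wpM2l; [exact: ltW|]; apply: (le_trans nle); rewrite lerD2l.
have hl : (h / l) ^+ 2 <= S ^+ 2.
  apply: lerXn2r; rewrite ?nnegrE ?divr_ge0 ?(ltW hp) ?(ltW l0) ?(ltW S0)//.
  by rewrite (ler_pdivrMr _ _ l0).
have -> : h * (2 * h * (P * (l ^- 2 * (8 * M ^+ 2 * Q)))) = (h / l) ^+ 2 * (2 * P * (8 * M ^+ 2) * Q) by field; rewrite gt_eqF.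
have PQ : 0 <= 2 * P * (8 * M ^+ 2) * Q by rewrite !mulr_ge0// ltW.
apply: (@le_trans _ _ (Q + S ^+ 2 * (2 * P * (8 * M ^+ 2) * Q))).
  by apply: lerD; [rewrite /Q lerDl|apply: ler_wpM2r].
have -> : Q + S ^+ 2 * (2 * P * (8 * M ^+ 2) * Q) = C * Q by rewrite /C; ring.
by rewrite ler_wpM2r// lerDl mulr_ge0 ?(ltW S0)// addr_ge0.
Qed.

End InteriorEstimate.

(** * Green's formula for rotated gradients on the two sides of an edge *)

Section RotatedGreen.
Variable R : realType.
Local Notation mu := (@area R).
Local Notation leb := (@lebesgue_measure R).
Implicit Types (f g F phi psi : R * R -> R) (w tau : R -> R) (A B O K : set (R * R)) (a b c v m : R * R) (sg : R) (G : 'I_2 -> R * R -> R).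

Lemma n2_up_le w (M : R) : continuous w -> 0 <= M -> (forall s, 0 <= s <= 1 -> `|w s| <= M) -> n2 (up w) <= M.
Proof.
move=> cw M0 H; have [sw _] := sqi_up_cont cw.
have [s1 i1] := @sqi_up_cont R (fun=> 1) (fun=> cvg_cst _).
have n1 : n2 (up (fun=> 1 : R)) = 1.
  rewrite /n2 (_ : Int _ = 1) ?sqrtr1//.
  transitivity (Int (up (fun=> 1 : R))).
    by apply: eq_Int => x; rewrite /up mulr1 indicE; case: (_ \in _); rewrite ?expr1n ?expr0n.
  rewrite Int_up//; transitivity (\int[leb]_s (\1_(`[0, 1]%classic) s : R)).
    by apply: eq_Rintegral => s _; rewrite mulr1.
  by rewrite /Rintegral integral_indic// setIT [X in fine X]leb01.
rewrite -[M]mulr1 -n1 -[M in M * _]ger0_norm// -n2Z//; apply: n2_le => //; first exact: sqiZ.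
move=> x; rewrite /up indicE; case: (boolP (x \in _)) => [|_]; last by rewrite !mul0r mulr0.
rewrite inE => -[_ /=]; rewrite in_itv /= => xx.
by rewrite !mul1r mulr1 (ger0_norm M0); exact: H.
Qed.

(** Normalized to be 1 at [t = 0], so that the test function restricts to the dual function on the
    side; the scale [4 * d] confines it to [-d, d]. *)
Definition cut (d : R) (t : R) : R := (bump0 (2^-1 : R))^-1 * bump0 ((4 * d)^-1 * t + 2^-1).

Lemma bump_half : 0 < bump0 (2^-1 : R).
Proof. by apply: bump0_gt0; apply/andP; split; lra. Qed.

Lemma cut0 d : cut d 0 = 1.
Proof. by rewrite /cut mulr0 add0r mulVf// gt_eqF// bump_half. Qed.

Lemma smooth1_cut d : smooth1 (cut d).
Proof. by apply: smooth1Z; apply: (smooth1_aff (f := @bump0 R)); exact: smooth1_bump0. Qed.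

Lemma cut_arg (d t : R) : 0 < d -> ~ (`|t| <= d) -> ~ (4^-1 <= (4 * d)^-1 * t + 2^-1 <= 3 / 4).
Proof.
move=> d0 nt /andP[h1 h2]; apply: nt; rewrite ler_norml.
have d4 : 0 < 4 * d by rewrite mulr_gt0.
have E : t = (4 * d) * ((4 * d)^-1 * t) by rewrite mulrA mulfV ?gt_eqF// mul1r.
have h3 : - 4^-1 <= (4 * d)^-1 * t by move: h1; clear; lra.
have h4 : (4 * d)^-1 * t <= 4^-1 by move: h2; clear; lra.
have F1 : 4 * d * (- 4^-1) <= 4 * d * ((4 * d)^-1 * t) by rewrite ler_wpM2l// ltW.
have F2 : 4 * d * ((4 * d)^-1 * t) <= 4 * d * 4^-1 by rewrite ler_wpM2l// ltW.
rewrite -E in F1 F2.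
have G1 : 4 * d * (- 4^-1) = - d by field.
have G2 : 4 * d * 4^-1 = d by field.
by rewrite G1 in F1; rewrite G2 in F2; rewrite F1 F2.
Qed.

Lemma supp1_bump0 : supp1 (@bump0 R).
Proof. by move=> s ns; rewrite bump0_out// => /andP[h1 h2]; apply: ns; rewrite !ltW. Qed.

Lemma derive1_cut d t : derive1 (cut d) t = (bump0 (2^-1 : R))^-1 * ((4 * d)^-1 * derive1 (@bump0 R) ((4 * d)^-1 * t + 2^-1)).
Proof.
have D : derivable (@bump0 R) ((4 * d)^-1 * t + 2^-1) 1 by apply: smooth1_der; exact: smooth1_bump0.
rewrite -(derive1_comp_aff D) /cut.
have sA : smooth1 (fun t => bump0 ((4 * d)^-1 * t + 2^-1) : R) by apply: (smooth1_aff (f := @bump0 R)); exact: smooth1_bump0.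
have d1 := smooth1_is t sA.
have d2 := is_deriveZ (bump0 (2^-1 : R))^-1 d1.
by have [_ E] := d2; rewrite derive1E; exact: E.
Qed.

Lemma cut_out (d t : R) : 0 < d -> ~ (`|t| <= d) -> cut d t = 0 /\ derive1 (cut d) t = 0.
Proof.
move=> d0 nt; have n := cut_arg d0 nt; split; first by rewrite /cut (supp1_bump0 n) mulr0.
by rewrite derive1_cut (derive1_out (@smooth1_bump0 R) supp1_bump0 n) !mulr0.
Qed.

Lemma bd1_cut (d : R) : 0 < d -> d <= 1 -> exists2 M, 0 < M & bd1 (cut d) M.
Proof.
move=> d0 d1.
have [M1 M10 H1] := bounded1 (@smooth1_bump0 R) supp1_bump0.
have [M2 M20 H2] := bounded1 (smooth1_d (@smooth1_bump0 R)) (derive1_out (@smooth1_bump0 R) supp1_bump0).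
have k0 : 0 < (bump0 (2^-1 : R))^-1 by rewrite invr_gt0 bump_half.
have e0 : 0 < (4 * d)^-1 by rewrite invr_gt0 mulr_gt0.
set k := (bump0 _)^-1 in k0.
exists (k * M1 + k * ((4 * d)^-1 * M2) + 1).
  by rewrite ltr_pwDr// addr_ge0// !mulr_ge0// ltW.
have p1 : 0 <= k * M1 by rewrite mulr_ge0// ltW.
have p2 : 0 <= k * ((4 * d)^-1 * M2) by rewrite !mulr_ge0// ltW.
split; first exact: smooth1_cut.
- move=> s; apply: (@le_trans _ _ (k * M1)); last by move: p2; clear; lra.
  by rewrite /cut -/k normrM (gtr0_norm k0) ler_wpM2l// ltW.
- move=> s; apply: (@le_trans _ _ (k * ((4 * d)^-1 * M2))); last by move: p1; clear; lra.
  rewrite derive1_cut -/k normrM (gtr0_norm k0) ler_wpM2l ?(ltW k0)//.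
  by rewrite normrM (gtr0_norm e0) ler_wpM2l// ltW.
- move=> s ns; apply: cut_out => // sd; apply: ns; rewrite -ler_norml; exact: (le_trans sd).
Qed.

Lemma bd1_le w (M M' : R) : M <= M' -> bd1 w M -> bd1 w M'.
Proof. by move=> MM [h1 h2 h3 h4]; split => // s; [exact: (le_trans (h2 s))|exact: (le_trans (h3 s))]. Qed.

Lemma ae_fst_neq0 : {ae mu, forall x : R * R, x.1 != 0}.
Proof.
exists ([set (0 : R)] `*` setT); split; first exact: measurableX.
  transitivity (leb [set (0 : R)%R] * leb setT)%E; first exact: product_measure1E.
  by rewrite [X in (X * _)%E]lebesgue_measure_set1 mul0e.
by move=> x /= /negP; rewrite negbK => /eqP.
Qed.

Lemma aff_perpN a sg v (t s : R) : aff a (perp (- sg) v) v (t, s) = aff a (perp sg v) v (- t, s).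
Proof. by apply: pair_eqP; rewrite /aff /perp /=; ring. Qed.

(** Up to the null line [t = 0], the rectangle that carries the derivatives of [psi] consists of a
    half inside [K1] and outside [K2], and a half inside [K2] and outside [K1]. *)
Lemma cir_split O K1 K2 a sg v (d : R) f g psi : sg ^+ 2 = 1 -> dot v v != 0 -> 0 < d ->
  (forall t u, 0 < t < 2 * d -> 8^-1 < u < 7 / 8 -> K1 (aff a (perp sg v) v (t, u))) ->
  (forall t u, t < 0 -> ~ K1 (aff a (perp sg v) v (t, u))) ->
  (forall t u, 0 < t < 2 * d -> 8^-1 < u < 7 / 8 -> K2 (aff a (perp (- sg) v) v (t, u))) ->
  (forall t u, t < 0 -> ~ K2 (aff a (perp (- sg) v) v (t, u))) ->
  K1 `<=` O -> K2 `<=` O ->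
  (forall i t s, ~ (`|t| <= d /\ 4^-1 <= s <= 3 / 4) -> pd i psi (aff a (perp sg v) v (t, s)) = 0) ->
  ing (rs O (fun x => f x * pd ord_max psi x - g x * pd ord0 psi x)) ->
  ing (rs K1 (fun x => f x * pd ord_max psi x - g x * pd ord0 psi x)) ->
  ing (rs K2 (fun x => f x * pd ord_max psi x - g x * pd ord0 psi x)) ->
  cir O f g psi = cir K1 f g psi + cir K2 f g psi.
Proof.
move=> s1 v0 d0 r1 n1 r2 n2' KO1 KO2 zp; rewrite /cir.
set h := fun x => _; move=> iO i1 i2.
have detE : (perp sg v).1 * v.2 - (perp sg v).2 * v.1 = - (sg * dot v v) by rewrite /perp /dot /=; ring.
have det0 : (perp sg v).1 * v.2 - (perp sg v).2 * v.1 != 0.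
  by rewrite detE oppr_eq0 mulf_neq0// -sqrf_eq0 s1 oner_eq0.
have i12 := ingD i1 i2; rewrite -IntD//.
have e1 := Int_aff a det0 iO; have e2 := Int_aff a det0 i12.
have k0 : `|(perp sg v).1 * v.2 - (perp sg v).2 * v.1|^-1 != 0 by rewrite invr_eq0 normr_eq0.
apply: (mulfI k0); rewrite -e1 -e2.
apply: Int_ae; [by apply: mble_aff; exact: ing_mble iO|by apply: (@mble_aff _ _ _ _ (fun x => rs K1 h x + rs K2 h x)); exact: ing_mble i12|].
apply: aeS ae_fst_neq0 => -[t s] /= t0.
have zh : ~ (`|t| <= d /\ 4^-1 <= s <= 3 / 4) -> h (aff a (perp sg v) v (t, s)) = 0.
  by move=> H; rewrite /h !zp// !mulr0 subr0.
have [B|B] := pselect (`|t| <= d /\ 4^-1 <= s <= 3 / 4); last by rewrite /rs zh// !mulr0 addr0.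
move: B => [td /andP[b1 b2]].
have [tp|tn] := ltP 0 t.
  have td' : t <= d by move: td; rewrite gtr0_norm.
  have [q1 q2 q3] := green_rng d0 td' b1 b2.
  have K1x : K1 (aff a (perp sg v) v (t, s)) by apply: r1; rewrite ?tp ?q1 ?q2 ?q3.
  have K2x : ~ K2 (aff a (perp sg v) v (t, s)).
    by rewrite -[t]opprK -aff_perpN; apply: n2'; rewrite oppr_lt0.
  by rewrite (rs_in _ K1x) (rs_out _ K2x) (rs_in _ (KO1 _ K1x)) addr0.
have tn' : t < 0 by rewrite lt_neqAle t0.
have nt : 0 < - t by rewrite oppr_gt0.
have td' : - t <= d by move: td; rewrite ltr0_norm.
have [q1 q2 q3] := green_rng d0 td' b1 b2.
have K1x : ~ K1 (aff a (perp sg v) v (t, s)) by exact: n1.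
have K2x : K2 (aff a (perp sg v) v (t, s)).
  by rewrite -[t]opprK -aff_perpN; apply: r2; rewrite ?nt ?q1 ?q2 ?q3.
by rewrite (rs_out _ K1x) (rs_in _ K2x) (rs_in _ (KO2 _ K2x)) add0r.
Qed.

Lemma up_ing_mul (t w : R -> R) : sqi (up t) -> continuous w -> ing (up (fun s => t s * w s)).
Proof.
move=> st cw; have [sw _] := sqi_up_cont cw.
by apply: eq_ing (sqi_mul st sw) => x; rewrite /up indicE; case: (_ \in _); rewrite ?mul1r ?mul0r.
Qed.

(* One half of the Green formula for the rotated gradient of psi = cut(t) chi(s). *)
Lemma green_half K a b sg (d : R) f g G1 G2 t1 t2 psi (chi : R -> R) : open K -> (exists M, K `<=` sq (0, 0) M) ->
  smooth psi -> 0 < d -> sg ^+ 2 = 1 -> 0 < dot (b - a) (b - a) ->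
  (forall t s, 0 < t < 2 * d -> 8^-1 < s < 7 / 8 -> K (aff a (perp sg (b - a)) (b - a) (t, s))) ->
  (forall t s, t < 0 -> ~ K (aff a (perp sg (b - a)) (b - a) (t, s))) ->
  (forall i t s, ~ (`|t| <= d /\ 4^-1 <= s <= 3 / 4) -> psi (aff a (perp sg (b - a)) (b - a) (t, s)) = 0 /\
     pd i psi (aff a (perp sg (b - a)) (b - a) (t, s)) = 0) ->
  H1p K f G1 -> H1p K g G2 -> is_op K a b f G1 t1 -> is_op K a b g G2 t2 ->
  (exists phi : nat -> R * R -> R, (forall n, smooth (phi n)) /\ H1cvg K phi f G1) ->
  (exists phi : nat -> R * R -> R, (forall n, smooth (phi n)) /\ H1cvg K phi g G2) ->
  (forall s, psi (a + s *: (b - a)) = chi s) -> continuous chi ->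
  cir K f g psi = Int (rs K (fun x => (G2 ord0 x - G1 ord_max x) * psi x))
     - sg * Int (up (fun s => ((b - a).1 * t1 s + (b - a).2 * t2 s) * chi s)).
Proof.
move=> oK bK sp d0 sg1 v0 HK HN Hp H1 H2 o1 o2 c1 c2 psiE cchi.
have mK := open_measurable_plane oK; have [M KM] := bK.
have e1 := green_trace oK bK sp d0 sg1 v0 HK HN (Hp ord_max) H1 o1 c1.
have e2 := green_trace oK bK sp d0 sg1 v0 HK HN (Hp ord0) H2 o2 c2.
have sS f0 : smooth f0 -> sqi (rs K f0) by move=> sf; have /(Lsp2P _ mK)[] := Lsp_smooth mK KM sf.
have sps := sS _ sp; have sp0 := sS _ (@smooth_pd _ ord0 _ sp); have sp1 := sS _ (@smooth_pd _ ord_max _ sp).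
have [/(Lsp2P _ mK)[_ sf] HG1] := H1; have [/(Lsp2P _ mK)[_ sgg] HG2] := H2.
have sG1 : sqi (rs K (G1 ord_max)) by have [_ /(Lsp2P _ mK)[]] := HG1 ord_max.
have sG2 : sqi (rs K (G2 ord0)) by have [_ /(Lsp2P _ mK)[]] := HG2 ord0.
have i1 := ing_rsM sf sp1; have i2 := ing_rsM sgg sp0.
have i3 := ing_rsM sG1 sps; have i4 := ing_rsM sG2 sps.
have [_ st1 _] := o1; have [_ st2 _] := o2.
have j1 := up_ing_mul st1 cchi; have j2 := up_ing_mul st2 cchi.
have E1 : Int (rs K (fun x => f x * pd ord_max psi x + G1 ord_max x * psi x)) =
  Int (rs K (fun x => f x * pd ord_max psi x)) + Int (rs K (fun x => G1 ord_max x * psi x)).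
  by rewrite -(IntD i1 i3); apply: eq_Int => x; rewrite rsD.
have E2 : Int (rs K (fun x => g x * pd ord0 psi x + G2 ord0 x * psi x)) =
  Int (rs K (fun x => g x * pd ord0 psi x)) + Int (rs K (fun x => G2 ord0 x * psi x)).
  by rewrite -(IntD i2 i4); apply: eq_Int => x; rewrite rsD.
have E3 : cir K f g psi = Int (rs K (fun x => f x * pd ord_max psi x)) - Int (rs K (fun x => g x * pd ord0 psi x)).
  by rewrite -(IntB i1 i2); apply: eq_Int => x; rewrite rsB.
have E4 : Int (rs K (fun x => (G2 ord0 x - G1 ord_max x) * psi x)) = Int (rs K (fun x => G2 ord0 x * psi x)) - Int (rs K (fun x => G1 ord_max x * psi x)).
  by rewrite -(IntB i4 i3); apply: eq_Int => x; rewrite -rsB; congr (_ * _); ring.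
have E5 : Int (up (fun s => ((b - a).1 * t1 s + (b - a).2 * t2 s) * chi s)) =
  (b - a).1 * Int (up (fun s => t1 s * chi s)) + (b - a).2 * Int (up (fun s => t2 s * chi s)).
  rewrite -(IntZ _ j1) -(IntZ _ j2) -IntD; [|exact: ingZ|exact: ingZ].
  by apply: eq_Int => x; rewrite /up; ring.
have F1 : Int (up (fun s => t1 s * psi (a + s *: (b - a)))) = Int (up (fun s => t1 s * chi s)).
  by apply: eq_Int => x; rewrite /up psiE.
have F2 : Int (up (fun s => t2 s * psi (a + s *: (b - a)))) = Int (up (fun s => t2 s * chi s)).
  by apply: eq_Int => x; rewrite /up psiE.
rewrite E1 F1 in e1; rewrite E2 F2 in e2; rewrite E3 E4 E5.
rewrite (canRL (addrK _) e1).
rewrite (canRL (addrK _) e2).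
by rewrite /co /perp /=; move: (Int _) (Int _) (Int _) (Int _) => *; ring.
Qed.

End RotatedGreen.

(** * The estimate of the tangential jump on a side *)

Section SideEstimate.
Variable R : realType.
Local Notation mu := (@area R).
Local Notation leb := (@lebesgue_measure R).
Implicit Types (f g F phi psi : R * R -> R) (w tau : R -> R) (A B O K : set (R * R)) (a b c v m : R * R) (sg : R) (G : 'I_2 -> R * R -> R).

(** What Green's formula needs on one side of an edge; it is used twice, with opposite signs
    [sg]. *)
Record half_data O K a b sg (d : R) f g G1 G2 (t1 t2 : R -> R) : Prop := HalfData {
  hd_open : open K;
  hd_bd : exists M, K `<=` @sq R (0, 0) M;
  hd_sub : K `<=` O;
  hd_rect : forall t s, 0 < t < 2 * d -> 8^-1 < s < 7 / 8 -> K (aff a (perp sg (b - a)) (b - a) (t, s));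
  hd_neg : forall t s, t < 0 -> ~ K (aff a (perp sg (b - a)) (b - a) (t, s));
  hd_H1 : H1p K f G1;
  hd_H2 : H1p K g G2;
  hd_o1 : is_op K a b f G1 t1;
  hd_o2 : is_op K a b g G2 t2;
  hd_c1 : exists phi : nat -> R * R -> R, (forall n, smooth (phi n)) /\ H1cvg K phi f G1;
  hd_c2 : exists phi : nat -> R * R -> R, (forall n, smooth (phi n)) /\ H1cvg K phi g G2 }.

Lemma Int_rs_le K f psi (T : R) : sqi (rs K f) -> sqi psi -> n2 psi <= T ->
  `|Int (rs K (fun x => f x * psi x))| <= n2 (rs K f) * T.
Proof.
move=> sf sp H; have -> : Int (rs K (fun x => f x * psi x)) = Int (fun x => rs K f x * psi x).
  by apply: eq_Int => x; rewrite rsMl.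
by apply: (le_trans (Int_abs_cs sf sp)); apply: ler_wpM2l => //; exact: n2_ge0.
Qed.

Lemma zero_alg1 (x y z w p q r : R) : x = 0 /\ y = 0 -> x * z = 0 /\ p * (q * (y * z) + r * (x * w)) = 0.
Proof. by move=> [-> ->]; rewrite !mul0r !mulr0 addr0 mulr0. Qed.
Lemma zero_alg2 (x y z w p q r : R) : z = 0 /\ w = 0 -> x * z = 0 /\ p * (q * (y * z) + r * (x * w)) = 0.
Proof. by move=> [-> ->]; rewrite !mulr0 addr0 mulr0. Qed.

Lemma norm4_le (y1 y2 z1 z2 : R) : `|y1 + y2 - z1 - z2| <= `|y1| + `|y2| + `|z1| + `|z2|.
Proof.
apply: (le_trans (ler_normB _ _)); rewrite lerD2r; apply: (le_trans (ler_normB _ _)).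
by rewrite lerD2r ler_normD.
Qed.

(** The boundary terms of the two Green formulas carry opposite signs, so their sum contains the
    moments of the tangential jump; the rest consists of element curls and of the field [(f', g')].
    The constant is uniform because the profiles of the test function in the frame do not depend on
    the side. *)
Lemma side_coef (n : nat) (S : R) : 1 <= S -> exists2 C, 0 < C &
  exists chi : 'I_n.+1 -> R -> R, [/\ forall i, smooth1 (chi i), forall i s, `|chi i s| <= C,
   forall i j : 'I_n.+1, I1 (fun s => chi i s * s ^+ j) = (i == j)%:R &
  forall O K1 K2 a b sg f g f' g' G11 G12 G21 G22 t11 t12 t21 t22,
  let d := (16 * S)^-1 in
  open O -> sqi (rs O f) -> sqi (rs O g) -> sqi (rs O f') -> sqi (rs O g') -> rot_eq O f g f' g' ->
  sg ^+ 2 = 1 -> 0 < dot (b - a) (b - a) ->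
  (forall t s, `|t| <= d -> 4^-1 <= s <= 3 / 4 -> O (aff a (perp sg (b - a)) (b - a) (t, s))) ->
  half_data O K1 a b sg d f g G11 G12 t11 t12 -> half_data O K2 a b (- sg) d f g G21 G22 t21 t22 ->
  forall i, `|Int (up (fun s => ((b - a).1 * t11 s + (b - a).2 * t12 s) * chi i s)) -
      Int (up (fun s => ((b - a).1 * t21 s + (b - a).2 * t22 s) * chi i s))| <=
   C * (nE K1 f' g' + nE K2 f' g' + enorm (b - a) * (n2 (rs K1 (fun x => G12 ord0 x - G11 ord_max x)) +
       n2 (rs K2 (fun x => G22 ord0 x - G21 ord_max x))))].
Proof.
move=> S1; have [chi [sch zch dual]] := dual_ex R n.+1.
have [M0 M00 bdM] := bd1_family sch zch.
have S0 : 0 < S by exact: (lt_le_trans ltr01).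
have d0 : 0 < (16 * S)^-1 by rewrite invr_gt0 mulr_gt0.
have d1 : (16 * S)^-1 <= 1 by rewrite invf_le1 ?mulr_gt0//; move: S1; clear; lra.
have [M1 M10 bcut] := bd1_cut d0 d1.
pose M := M0 + M1.
have Mp : 0 < M by rewrite addr_gt0.
have bM i : bd1 (chi i) M by apply: (bd1_le _ (bdM i)); rewrite lerDl ltW.
have bc : bd1 (cut (16 * S)^-1) M by apply: (bd1_le _ bcut); rewrite lerDr ltW.
have M2 : 0 < M ^+ 2 by rewrite exprn_gt0.
exists (4 * M ^+ 2 + M); first by rewrite addr_gt0// mulr_gt0.
exists chi; split => //.
  by move=> i s; have [_ H _ _] := bM i; apply: (le_trans (H s)); rewrite lerDr mulr_ge0// ltW.
move=> O K1 K2 a b sg f g f' g' G11 G12 G21 G22 t11 t12 t21 t22 d oO sf sgg sf' sg' HW sg1 vp HO D1 D2 i.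
set v := b - a in vp HO *; have v0 : dot v v != 0 by rewrite gt_eqF.
pose psi := fr (cut d) (chi i) a sg v.
have zc t : ~ (- d <= t <= d) -> cut d t = 0.
  by move=> H; have [] := @cut_out R d t d0; rewrite // ler_norml.
have tp : test_fun O psi.
  have HO' t s : - d <= t <= d -> 4^-1 <= s <= 3 / 4 -> O (aff a (perp sg v) v (t, s)).
    by move=> td ss; apply: HO => //; rewrite ler_norml.
  exact: (@fr_test R (cut d) (chi i) a sg v O (- d) d 4^-1 (3 / 4) sg1 v0 (@smooth1_cut R d) (sch i) zc (zch i) HO').
have [[sp np] Hpd] := fr_bounds a sg1 v0 bc (bM i).
have comm : pd ord0 (pd ord_max psi) = pd ord_max (pd ord0 psi) := fr_comm a sg v ord0 ord_max (@smooth1_cut R d) (sch i).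
have smp : smooth psi := fr_smooth a sg v (@smooth1_cut R d) (sch i).
have zero k t s : ~ (`|t| <= d /\ 4^-1 <= s <= 3 / 4) -> psi (aff a (perp sg v) v (t, s)) = 0 /\ pd k psi (aff a (perp sg v) v (t, s)) = 0.
  move=> H; rewrite /psi (fr_aff _ _ _ _ _ sg1 v0) (fr_pd _ _ _ _ _ (@smooth1_cut R d) (sch i)) (fr_aff _ _ _ _ _ sg1 v0) (fr_aff _ _ _ _ _ sg1 v0).
  have [td|td] := pselect (`|t| <= d); last exact: (zero_alg1 _ _ _ _ _ (cut_out d0 td)).
  have ss : ~ (4^-1 <= s <= 3 / 4) by move=> ss; apply: H; split.
  exact: (zero_alg2 _ _ _ _ _ (conj (zch i s ss) (derive1_out (sch i) (zch i) ss))).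
have zero' k t s : ~ (`|t| <= d /\ 4^-1 <= s <= 3 / 4) -> psi (aff a (perp (- sg) v) v (t, s)) = 0 /\ pd k psi (aff a (perp (- sg) v) v (t, s)) = 0.
  by rewrite aff_perpN => H; apply: zero; rewrite normrN.
have sgN : (- sg) ^+ 2 = 1 by rewrite sqrrN.
have psiE s : psi (a + s *: v) = chi i s.
  have -> : a + s *: v = aff a (perp sg v) v (0, s) by apply: pair_eqP; rewrite /aff /= /GRing.scale /=; ring.
  by rewrite /psi (fr_aff _ _ _ _ _ sg1 v0) cut0 mul1r.
have cchi : continuous (chi i) := smooth1_cont (sch i).
have [oK1 bK1 sK1 rK1 nK1 h11 h12 o11 o12 c11 c12] := D1.
have [oK2 bK2 sK2 rK2 nK2 h21 h22 o21 o22 c21 c22] := D2.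
have g1 := green_half oK1 bK1 smp d0 sg1 vp rK1 nK1 zero h11 h12 o11 o12 c11 c12 psiE cchi.
have g2 := green_half oK2 bK2 smp d0 sgN vp rK2 nK2 zero' h21 h22 o21 o22 c21 c22 psiE cchi.
have mK1 := open_measurable_plane oK1; have mK2 := open_measurable_plane oK2.
have cl A f0 g0 (x : sqi (rs A f0)) (y : sqi (rs A g0)) := cir_le x y (fun k => (Hpd k).1) (fun k => (Hpd k).2).
have s1f := sqi_rs_sub mK1 sK1 sf; have s1g := sqi_rs_sub mK1 sK1 sgg.
have s2f := sqi_rs_sub mK2 sK2 sf; have s2g := sqi_rs_sub mK2 sK2 sgg.
have s1f' := sqi_rs_sub mK1 sK1 sf'; have s1g' := sqi_rs_sub mK1 sK1 sg'.
have s2f' := sqi_rs_sub mK2 sK2 sf'; have s2g' := sqi_rs_sub mK2 sK2 sg'.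
have zpd k t s : ~ (`|t| <= d /\ 4^-1 <= s <= 3 / 4) -> pd k psi (aff a (perp sg v) v (t, s)) = 0.
  by move=> H; have [] := zero k t s H.
have [iO _] := cl _ _ _ sf sgg; have [i1 _] := cl _ _ _ s1f s1g; have [i2 _] := cl _ _ _ s2f s2g.
have [iO' _] := cl _ _ _ sf' sg'; have [i1' b1'] := cl _ _ _ s1f' s1g'; have [i2' b2'] := cl _ _ _ s2f' s2g'.
have sp1 := cir_split sg1 v0 d0 rK1 nK1 rK2 nK2 sK1 sK2 zpd iO i1 i2.
have sp2 := cir_split sg1 v0 d0 rK1 nK1 rK2 nK2 sK1 sK2 zpd iO' i1' i2'.
have W := HW _ tp comm; rewrite sp1 sp2 g1 g2 in W.
have [_ HG12] := h12; have [_ HG11] := h11; have [_ HG22] := h22; have [_ HG21] := h21.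
have sqC (K : set (R * R)) (mK : measurable K) f0 g0 : Lsp 2 K f0 -> Lsp 2 K g0 -> sqi (rs K (fun x => f0 x - g0 x)).
  by move=> l1 l2; have /(Lsp2P _ mK)[] := LspB mK l1 l2.
have sc1 := sqC _ mK1 _ _ (HG12 ord0).2 (HG11 ord_max).2.
have sc2 := sqC _ mK2 _ _ (HG22 ord0).2 (HG21 ord_max).2.
have k1 := Int_rs_le sc1 sp np; have k2 := Int_rs_le sc2 sp np.
have nsg : `|sg| = 1 by move/eqP: sg1; rewrite sqrf_eq1 => /orP[]/eqP ->; rewrite ?normrN1 ?normr1.
set X1 := Int (up _) in W *; set X2 := Int (up _) in W *.
set Y1 := Int (rs K1 _) in W k1; set Y2 := Int (rs K2 _) in W k2.
set Z1 := cir K1 f' g' _ in W b1'; set Z2 := cir K2 f' g' _ in W b2'.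
have -> : `|X1 - X2| = `|Y1 + Y2 - Z1 - Z2|.
  have -> : Y1 + Y2 - Z1 - Z2 = sg * (X1 - X2).
    have -> : Y1 + Y2 - Z1 - Z2 = Y1 + Y2 - (Z1 + Z2) by ring.
    by rewrite -W; ring.
  by rewrite normrM nsg mul1r.
have T := norm4_le Y1 Y2 Z1 Z2.
apply: (le_trans T); clear -k1 k2 b1' b2' M2 Mp.
set u1 := n2 _ in k1 *; set u2 := n2 _ in k2 *.
set e1 := nE _ _ _ in b1' *; set e2 := nE _ _ _ in b2' *.
have u10 : 0 <= u1 by exact: n2_ge0.
have u20 : 0 <= u2 by exact: n2_ge0.
have e10 : 0 <= e1 by rewrite addr_ge0// n2_ge0.
have e20 : 0 <= e2 by rewrite addr_ge0// n2_ge0.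
have L0 : 0 <= enorm v by exact: enorm_ge0.
have := lerD (lerD (lerD k1 k2) b1') b2'; move/le_trans; apply.
rewrite -subr_ge0.
have -> : (4 * M ^+ 2 + M) * (e1 + e2 + enorm v * (u1 + u2)) - (u1 * (2 * M ^+ 2 * enorm v) + u2 * (2 * M ^+ 2 * enorm v) + e1 * (4 * M ^+ 2) + e2 * (4 * M ^+ 2)) =
  M * (e1 + e2) + (2 * M ^+ 2 + M) * (enorm v * (u1 + u2)) by ring.
have k1' : 0 <= M * (e1 + e2) by apply: mulr_ge0; [exact: ltW|exact: addr_ge0].
have k2' : 0 <= 2 * M ^+ 2 + M by apply: addr_ge0; [apply: mulr_ge0 => //; exact: ltW|exact: ltW].
by apply: addr_ge0 => //; apply: mulr_ge0 => //; apply: mulr_ge0 => //; exact: addr_ge0.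
Qed.

(** The moment of the jump against [chi i] is that of [Jo] plus the coefficient [e i]. This bounds
    each coefficient, and on [0, 1] a polynomial is bounded by the sum of the moduli of its
    coefficients. *)
Lemma side_est (n : nat) (S : R) : 1 <= S -> exists2 C, 0 < C &
  forall O K1 K2 a b sg f g f' g' G11 G12 G21 G22 t11 t12 t21 t22 (Jo : R -> R) (e : nat -> R),
  let d := (16 * S)^-1 in let J := fun s => (b - a).1 * (t11 s - t21 s) + (b - a).2 * (t12 s - t22 s) in
  open O -> sqi (rs O f) -> sqi (rs O g) -> sqi (rs O f') -> sqi (rs O g') -> rot_eq O f g f' g' ->
  sg ^+ 2 = 1 -> 0 < dot (b - a) (b - a) ->
  (forall t s, `|t| <= d -> 4^-1 <= s <= 3 / 4 -> O (aff a (perp sg (b - a)) (b - a) (t, s))) ->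
  half_data O K1 a b sg d f g G11 G12 t11 t12 -> half_data O K2 a b (- sg) d f g G21 G22 t21 t22 ->
  (forall s, J s = Jo s + \sum_(j < n.+1) e j * s ^+ j) ->
  n2 (up J) <= C * (nE K1 f' g' + nE K2 f' g' + enorm (b - a) * (n2 (rs K1 (fun x => G12 ord0 x - G11 ord_max x)) +
       n2 (rs K2 (fun x => G22 ord0 x - G21 ord_max x))) + n2 (up Jo)).
Proof.
move=> S1; have [C C0 [chi [sch bch dual Hco]]] := side_coef n S1.
exists (1 + n.+1%:R * (2 * C)); first by rewrite ltr_pwDl// mulr_ge0// mulr_ge0// ltW.
move=> O K1 K2 a b sg f g f' g' G11 G12 G21 G22 t11 t12 t21 t22 Jo e d J oO sf sgg sf' sg' HW sg1 vp HO D1 D2 JE.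
have Hc := Hco _ _ _ _ _ _ _ _ _ _ _ _ _ _ _ _ _ _ oO sf sgg sf' sg' HW sg1 vp HO D1 D2.
set X := nE K1 f' g' + _ + _ in Hc *.
have X0 : 0 <= X.
  by rewrite /X !addr_ge0// ?n2_ge0// mulr_ge0 ?enorm_ge0// addr_ge0// n2_ge0.
have [_ _ _ _ _ _ _ [_ st11 _] [_ st12 _] _ _] := D1.
have [_ _ _ _ _ _ _ [_ st21 _] [_ st22 _] _ _] := D2.
clear -C0 sch bch dual Hc X0 st11 st12 st21 st22 JE.
pose P s := \sum_(j < n.+1) e j * s ^+ j.
have cpow (j : nat) : continuous (fun s : R => s ^+ j).
  by apply: smooth1_cont; exact: (@smooth1X _ (fun s => s) j (@smooth1_id R)).
have cP : continuous P by apply: cont_sum => j s; apply: cvgM; [exact: cvg_cst|exact: cpow].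
have sJ : sqi (up J).
  have := sqiD (sqiZ (b - a).1 (sqiB st11 st21)) (sqiZ (b - a).2 (sqiB st12 st22)); congr sqi.
  by apply/funext => x; rewrite /up /J; ring.
have [sP _] := sqi_up_cont cP.
have sJo : sqi (up Jo).
  have := sqiB sJ sP; congr sqi; apply/funext => x; rewrite /up JE -/(P x.2); ring.
have ej (i : 'I_n.+1) : `|e i| <= C * X + C * n2 (up Jo).
  have cchi := smooth1_cont (sch i).
  have j11 := up_ing_mul st11 cchi; have j12 := up_ing_mul st12 cchi.
  have j21 := up_ing_mul st21 cchi; have j22 := up_ing_mul st22 cchi.
  have jo := up_ing_mul sJo cchi.
  have [schi ichi] := sqi_up_cont cchi.
  have iA := ingD (ingZ (b - a).1 j11) (ingZ (b - a).2 j12).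
  have iB := ingD (ingZ (b - a).1 j21) (ingZ (b - a).2 j22).
  have EA : Int (up (fun s => ((b - a).1 * t11 s + (b - a).2 * t12 s) * chi i s)) - Int (up (fun s => ((b - a).1 * t21 s + (b - a).2 * t22 s) * chi i s)) =
     Int (up (fun s => J s * chi i s)).
    transitivity (Int (fun x => (b - a).1 * up (fun s => t11 s * chi i s) x + (b - a).2 * up (fun s => t12 s * chi i s) x) -
       Int (fun x => (b - a).1 * up (fun s => t21 s * chi i s) x + (b - a).2 * up (fun s => t22 s * chi i s) x)).
      by congr (_ - _); apply: eq_Int => x; rewrite /up; ring.
    by rewrite -(IntB iA iB); apply: eq_Int => x; rewrite /up /J; ring.
  have cPc : continuous (fun s => P s * chi i s) by move=> s; apply: cvgM; [exact: cP|exact: cchi].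
  have EJ : Int (up (fun s => J s * chi i s)) = Int (up (fun s => Jo s * chi i s)) + I1 (fun s => P s * chi i s).
    rewrite -(IntD jo (I1_ing cPc)); apply: eq_Int => x; rewrite /up JE -/(P x.2); ring.
  have EP : I1 (fun s => P s * chi i s) = e i.
    transitivity (I1 (fun s => \sum_(j < n.+1) e j * (chi i s * s ^+ j))).
      by apply: eq_I1 => s _; rewrite /P mulr_suml; apply: eq_bigr => j _; ring.
    have cj (j : 'I_n.+1) : continuous (fun s => chi i s * s ^+ j) by move=> s; apply: cvgM; [exact: cchi|exact: cpow].
    rewrite I1_sum; last by move=> j s; apply: cvgM; [exact: cvg_cst|exact: cj].
    rewrite (bigD1 i)//= big1 ?addr0; first by rewrite I1Z// dual eqxx mulr1.
    by move=> j ji; rewrite I1Z// dual eq_sym (negbTE ji) mulr0.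
  have b1 := Hc i; rewrite EA EJ EP in b1.
  have -> : e i = (Int (up (fun s => Jo s * chi i s)) + e i) - Int (up (fun s => Jo s * chi i s)) by ring.
  apply: (le_trans (ler_normB _ _)); apply: lerD => //.
  have -> : Int (up (fun s => Jo s * chi i s)) = Int (fun x => up Jo x * up (chi i) x).
    by apply: eq_Int => x; rewrite /up indicE; case: (_ \in _); rewrite ?mul1r ?mul0r.
  apply: (le_trans (Int_abs_cs sJo schi)); rewrite mulrC; apply: ler_wpM2r; first exact: n2_ge0.
  by apply: (n2_up_le cchi (ltW C0)) => s _; exact: bch.
have nP : n2 (up P) <= n.+1%:R * (C * X + C * n2 (up Jo)).
  have T0 : 0 <= C * X + C * n2 (up Jo) by exact: (le_trans (normr_ge0 _) (ej ord0)).
  apply: n2_up_le => //; first by rewrite mulr_ge0.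
  move=> s /andP[s0 s1]; apply: (le_trans (ler_norm_sum _ _ _)).
  have -> : n.+1%:R * (C * X + C * n2 (up Jo)) = \sum_(j < n.+1) (C * X + C * n2 (up Jo)) by rewrite sumr_const card_ord mulr_natl.
  apply: ler_sum => j _.
  rewrite normrM -[leRHS]mulr1; apply: ler_pM => //.
  by rewrite normrX exprn_ile1// ?ger0_norm.
have nJ : n2 (up J) <= n2 (up Jo) + n2 (up P).
  have -> : up J = (fun x => up Jo x + up P x) by apply/funext => x; rewrite /up JE -/(P x.2) mulrDr.
  exact: n2D.
apply: (le_trans nJ); apply: (le_trans (lerD (lexx _) nP)).
have := n2_ge0 (up Jo); move: (n2 (up Jo)) => y y0.
rewrite -subr_ge0.
have -> : (1 + n.+1%:R * (2 * C)) * (X + y) - (y + n.+1%:R * (C * X + C * y)) = X + n.+1%:R * (C * (X + y)) by ring.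
by apply: addr_ge0 => //; apply: mulr_ge0 => //; apply: mulr_ge0; [exact: ltW|exact: addr_ge0].
Qed.

End SideEstimate.

(** * Hoelder's inequality in L^2 and positivity of the dual norm of a point evaluation *)

Section Norms.
Variable R : realType.
Local Notation mu := (@area R).
Implicit Types (f g h k F phi psi : R * R -> R) (A B O K : set (R * R)) (u v w : R * R -> R * R).

Lemma Lnorm_sq (P : R) h : P != 0 ->
  ('N[mu]_P%:E[(fun x => (h x ^+ 2)%:E)] = 'N[mu]_(2 * P)%:E[(fun x => (h x)%:E)] `^ 2)%E.
Proof.
move=> P0; rewrite unlock /=.
rewrite -poweRrM; have -> : ((2 * P)^-1 * 2 = P^-1 :> R)%R by field.
apply: (congr1 (fun a => poweR a P^-1)).
by apply: eq_integral => x _; rewrite /= normrX powRrM powR_mulrn.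
Qed.

(** Hoelder's inequality for the squares of the functions, with exponents [r / 2] and [q / 2]. *)
Lemma hoelder2r h k (r q : R) : mble h -> mble k -> 0 < r -> 0 < q -> 2 / r + 2 / q = 1 ->
  ('N[mu]_2%:E[(fun x => (h x * k x)%:E)] <= 'N[mu]_r%:E[(fun x => (h x)%:E)] * 'N[mu]_q%:E[(fun x => (k x)%:E)])%E.
Proof.
move=> mh mk r0 q0 rq.
have r20 : 0 < r / 2 by rewrite divr_gt0.
have q20 : 0 < q / 2 by rewrite divr_gt0.
have rq' : (r / 2)^-1 + (q / 2)^-1 = 1 by rewrite !invfM !invrK mulrC [X in _ + X]mulrC.
have := @hoelder _ _ _ mu _ _ _ _ (mbleX 2 mh) (mbleX 2 mk) r20 q20 rq'.
set X := (X in (X <= _)%E); have -> : X = ('N[mu]_2%:E[(fun x => (h x * k x)%:E)] `^ 2)%E.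
  transitivity ('N[mu]_1%:E[(fun x => ((h x * k x) ^+ 2)%:E)])%E; last by rewrite Lnorm_sq ?oner_eq0// mulr1.
  by rewrite /X; apply: eq_Lnorm => x /=; rewrite exprMn.
rewrite (Lnorm_sq h) ?gt_eqF// (Lnorm_sq k) ?gt_eqF//.
have -> : 2 * (r / 2) = r by field.
have -> : 2 * (q / 2) = q by field.
rewrite -poweRM ?Lnorm_ge0// => H.
have E (x : \bar R) : (0 <= x -> (x `^ 2) `^ 2^-1 = x)%E by move=> x0; rewrite -poweRrM mulfV ?poweRe1.
rewrite -(E 'N[mu]_2%:E[_]%E) ?Lnorm_ge0// -[leRHS]E ?mule_ge0 ?Lnorm_ge0//.
by apply: gt0_ler_poweR => //; rewrite ?invr_ge0// ?nnegrE ?in_itv/= ?poweR_ge0 ?leey.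
Qed.

Lemma Lnm_ae (q : R) A f g : measurable A -> measurable_fun A f -> measurable_fun A g ->
  {ae mu, forall x, A x -> f x = g x} -> Lnm q A f = Lnm q A g.
Proof.
move=> mA mf mg fg; rewrite /Lnm unlock /=; apply: (congr1 (fun a => poweR a q^-1)).
have mm h : measurable_fun A h -> measurable_fun [set: R * R] (fun x => (`|\1_A x * h x| `^ q)%:E).
  move=> mh; apply/measurable_EFinP; apply: (measurableT_comp (@measurable_powR R q)).
  by apply: mble_abs; exact: mble_rs.
apply: ae_eq_integral => //=; [exact: mm|exact: mm|].
by apply: aeS (rs_ae fg) => x; rewrite /rs => -> _.
Qed.

Lemma Lnm_mono (q : R) A B f : 0 < q -> measurable A -> measurable B -> measurable_fun B f -> A `<=` B -> (Lnm q A f <= Lnm q B f)%E.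
Proof.
move=> q0 mA mB mf AB; rewrite /Lnm unlock /=.
have mfA := measurable_funS mB AB mf.
have mm C h : measurable C -> measurable_fun C h -> measurable_fun [set: R * R] (fun x => (`|\1_C x * h x| `^ q)%:E).
  move=> mC mh; apply/measurable_EFinP; apply: (measurableT_comp (@measurable_powR R q)).
  by apply: mble_abs; exact: mble_rs.
apply: (@gt0_ler_poweR _ q^-1); [by rewrite invr_ge0 ltW| | |].
- by rewrite in_itv /= leey andbT integral_ge0// => x _; rewrite lee_fin powR_ge0.
- by rewrite in_itv /= leey andbT integral_ge0// => x _; rewrite lee_fin powR_ge0.
apply: ge0_le_integral => //=.
- exact: mm.
- exact: mm.
- move=> x _; rewrite lee_fin; apply: ge0_ler_powR; rewrite ?nnegrE ?(ltW q0)//.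
  rewrite !indicE; case: (boolP (x \in A)) => [|_]; last by rewrite mul0r normr0.
  by rewrite inE => /AB /mem_set ->.
Qed.

Lemma Lnm_bounded (q : R) A f (M : R) : 0 < q -> measurable A -> measurable_fun A f -> A `<=` sq (0, 0) M -> 0 < M ->
  (forall x, `|f x| <= M) -> (Lnm q A f < +oo)%E.
Proof.
move=> q0 mA mf AM M0 fM; rewrite /Lnm unlock /=; apply: poweR_lty.
have iI : ing (\1_(sq (0, 0) M) : R * R -> R) := @ing_indic _ _ (0, 0) M (measurable_sq _ _) (fun x H => H).
apply: (@le_lt_trans _ _ (\int[mu]_x (M `^ q * \1_(sq (0, 0) M) x)%:E)%E); last first.
  by rewrite Int_EFin ?ltry//; exact: ingZ.
apply: ge0_le_integral => //=.
- apply/measurable_EFinP; apply: (measurableT_comp (@measurable_powR R q)).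
  by apply: mble_abs; exact: mble_rs.
- by apply/measurable_EFinP; exact: ing_mble (ingZ _ iI).
- move=> x _; rewrite lee_fin !indicE; case: (boolP (x \in A)) => [|_]; last first.
    by rewrite mul0r normr0 powR0 ?gt_eqF// mulr_ge0 ?powR_ge0.
  rewrite inE => /AM /mem_set ->; rewrite mul1r mulr1.
  by apply: ge0_ler_powR; rewrite ?nnegrE ?(ltW q0) ?(ltW M0).
Qed.

Lemma measurable_grad O S : open O -> (forall i, measurable_fun O (wD O i S)) -> measurable_fun O (fun x => enorm (grad O S x)).
Proof.
move=> oO H; have mO := open_measurable_plane oO; apply: (measurable_enorm mO).
exact: (measurable_pair mO (H ord0) (H ord_max)).
Qed.

Lemma test_W10 (q : R) O S M : 0 < q -> open O -> 0 < M -> O `<=` sq (0, 0) M -> test_fun O S -> W10 q O S.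
Proof.
move=> q0 oO M0 OM tS; have sS := test_smooth tS; have mO := open_measurable_plane oO.
have Lt phi : test_fun O phi -> Lsp q O phi.
  move=> tp; have [B B0 HB] := test_bounded tp.
  have mp : measurable_fun O phi by apply: mble_on; exact: (smooth_mble (test_smooth tp)).
  split => //; apply: (@Lnm_bounded q O phi (M + B)) => //.
  - by move=> x /OM[h1 h2]; split; [apply: (le_trans h1)|apply: (le_trans h2)]; rewrite lerDl.
  - by rewrite ltr_pwDl.
  - by move=> x; apply: (le_trans (HB x)); rewrite lerDr ltW.
have wd i := @is_wD_smooth _ O i S oO sS.
have W i : is_wD O i S (wD O i S) := wD_is (wd i).
have mW i : measurable_fun O (wD O i S) by have [_ [m _] _] := W i.
have mpd i : measurable_fun O (pd i S) by apply: mble_on; exact: (smooth_mble (@smooth_pd _ i _ sS)).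
have LW i : Lsp q O (wD O i S).
  split; first exact: mW.
  rewrite (Lnm_ae q mO (mW i) (mpd i) (wD_ae oO (wd i))).
  by have [] := Lt _ (test_pd i tS).
have L0 : Lnm q O (fun=> 0) = 0%E.
  transitivity ('N[mu]_q%:E[cst 0%E])%E; last by rewrite Lnorm0// gt_eqF.
  by apply: eq_Lnorm => x /=; rewrite mulr0.
split; first by split; [exact: Lt|move=> i; split; [exact: W|exact: LW]].
exists (fun=> S) => //; split.
  have -> : (fun n : nat => Lnm q O (fun x => S x - S x)) = (fun=> 0%E).
    by apply/funext => n; rewrite -[RHS]L0; congr Lnm; apply/funext => x; rewrite subrr.
  exact: cvg_cst.
move=> i; have -> : (fun n : nat => Lnm q O (fun x => pd i S x - wD O i S x)) = (fun=> 0%E).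
  apply/funext => n; rewrite -[RHS]L0; apply: (Lnm_ae q mO).
  - by apply: measurable_funB; [exact: mpd|exact: mW].
  - exact: measurable_cst.
  - by apply: aeS (wD_ae oO (wd i)) => x Hx Ox; rewrite (Hx Ox) subrr.
exact: cvg_cst.
Qed.

Lemma cont_ae_eq O f z : open O -> O z -> {within O, continuous f} -> {ae mu, forall x, O x -> f x = 0} -> f z = 0.
Proof.
move=> oO Oz cf ae0; apply/eqP/negPn/negP => fz.
have cz : {for z, continuous f}.
  by move: cf; rewrite continuous_open_subspace// => H; apply: H; rewrite inE.
have : nbhs z (f @^-1` [set r | r != 0]).
  by apply: cz; apply: open_nbhs_nbhs; split => //; exact: open_neq.
rewrite nbhsE => -[U [oU Uz] HU].
have oUO : open (U `&` O) by exact: openI.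
have [x [Ux Ox] Hx] := ae_ex oUO (conj Uz Oz) ae0.
by have := HU _ Ux; rewrite /= (Hx Ox) eqxx.
Qed.

(** Two continuous representatives agree everywhere in [O], so the value chosen by [delta] is
    forced. *)
Lemma delta_cont O z S : open O -> O z -> continuous S -> delta O z S = S z.
Proof.
move=> oO Oz cS; rewrite /delta; apply: xget_unique.
  by exists S; split => //; [exact: continuous_subspaceT|exact: ae_all].
move=> s [S' [cS' aeS' ->]].
have c : {within O, continuous (fun x => S' x - S x)}.
  by move=> x; apply: cvgB; [exact: cS'|exact: (continuous_subspaceT cS)].
have := cont_ae_eq oO Oz c; move=> H; apply/eqP; rewrite -subr_eq0; apply/eqP; apply: H.
by apply: aeS aeS' => x Hx Ox; rewrite Hx ?subrr.
Qed.

(** A bump at [z] has a positive value there and a gradient of finite norm; its quotient bounds the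
    supremum from below. *)
Lemma delta_norm_gt0 (q : R) O z : 0 < q -> open O -> bounded_set O -> O z ->
  exists2 D0 : R, 0 < D0 & (D0%:E <= dual_norm q O (W10 q O) (delta O z))%E.
Proof.
move=> q0 oO bO Oz; have mO := open_measurable_plane oO.
have [M M0 OM] : exists2 M, 0 < M & O `<=` @sq R (0, 0) M.
  have [M0 [_ HM]] := bO; exists (`|M0| + 1); first by rewrite ltr_pwDr.
  move=> x Ox; have := HM (`|M0| + 1) _ x Ox; rewrite (le_lt_trans (ler_norm _)) ?ltrDl//= => /(_ isT).
  by rewrite prod_normE /= ge_max => /andP[h1 h2]; split; rewrite /= subr0.
have [r r0 Hr] := open_sq oO Oz.
pose S := bumpat z r.
have tS : test_fun O S := bumpat_test r0 Hr.
have sS := test_smooth tS.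
have Sz : 0 < S z := bumpat_gt0 z r0.
have WS := test_W10 q0 oO M0 OM tS.
have wd i := @is_wD_smooth _ O i S oO sS.
have mW i : measurable_fun O (wD O i S) by have [_ [m _] _] := wD_is (wd i).
have mpd i : measurable_fun O (pd i S) by apply: mble_on; exact: (smooth_mble (@smooth_pd _ i _ sS)).
have mg := measurable_grad oO mW.
have mg' : measurable_fun O (fun x => enorm (pd ord0 S x, pd ord_max S x)).
  by apply: (measurable_enorm mO); exact: (measurable_pair mO (mpd ord0) (mpd ord_max)).
have Eg : Lnmv q O (grad O S) = Lnm q O (fun x => enorm (pd ord0 S x, pd ord_max S x)).
  apply: (Lnm_ae q mO mg mg'); apply: aeS (ae_and (wD_ae oO (wd ord0)) (wD_ae oO (wd ord_max))) => x [h0 h1] Ox.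
  by rewrite /grad (h0 Ox) (h1 Ox).
have [B0 B00 HB0] := test_bounded (test_pd ord0 tS).
have [B1 B10 HB1] := test_bounded (test_pd ord_max tS).
have fin : (Lnmv q O (grad O S) < +oo)%E.
  rewrite Eg; apply: (@Lnm_bounded q O _ (M + B0 + B1)) => //.
  - by move=> x /OM[h1 h2]; split; [apply: (le_trans h1)|apply: (le_trans h2)]; rewrite -addrA lerDl addr_ge0.
  - by rewrite -addrA ltr_pwDl// addr_ge0.
  - move=> x; rewrite ger0_norm ?enorm_ge0//; apply: (le_trans (enorm_le1 _)) => /=.
    by rewrite -addrA; apply: (le_trans (lerD (HB0 x) (HB1 x))); rewrite lerDr ltW.
(* A zero norm in the denominator would make the quotient 0. It is excluded, for the bump would be
   constant along the horizontal line through [z], which leaves its support. *)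
have nz : Lnmv q O (grad O S) <> 0%E.
  rewrite Eg => E0.
  have me : measurable_fun [set: R * R] (fun x => (\1_O x * enorm (pd ord0 S x, pd ord_max S x))%:E).
    by apply/measurable_EFinP; exact: mble_rs.
  have q0' : (0 < q%:E :> \bar R)%E by rewrite lte_fin.
  have ae0 := @Lnorm_eq0_eq0 _ _ _ mu _ q%:E me q0' E0.
  have ae1 : {ae mu, forall x, O x -> pd ord0 S x = 0}.
    apply: aeS ae0 => x Hx Ox; have := Hx Logic.I; rewrite /= indicE mem_set// mul1r => -[E].
    have [h _] := enorm_coord (pd ord0 S x, pd ord_max S x); rewrite E /= in h.
    by apply/eqP; rewrite -normr_le0.
  have z0 x : pd ord0 S x = 0.
    have [Ox|nOx] := pselect (O x); last exact: (test_out (test_pd ord0 tS) nOx).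
    apply: (cont_ae_eq oO Ox _ ae1); apply: continuous_subspaceT.
    by apply: smooth_cont; exact: smooth_pd.
  have [c [_ Hc]] := MVT_abs (fun x => is_derive_coord1 z.2 x sS) z.1 (z.1 + (r + 1)).
  move: Hc; rewrite z0 mul0r => /eqP; rewrite subr_eq0 => /eqP Hc.
  have : S (z.1 + (r + 1), z.2) = 0.
    apply: bumpat_out => // -[/=]; rewrite addrC addKr gtr0_norm; last by move: r0; clear; lra.
    by move: r0; clear; lra.
  by rewrite Hc -surjective_pairing => E; move: Sz; rewrite E ltxx.
have g0 : (0 <= Lnmv q O (grad O S))%E by exact: Lnorm_ge0.
have gfin : Lnmv q O (grad O S) \is a fin_num by rewrite ge0_fin_numE.
have fg : 0 < fine (Lnmv q O (grad O S)).
  by rewrite fine_gt0// fin andbT lt_neqAle g0 andbT eq_sym; apply/eqP.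
exists (S z / fine (Lnmv q O (grad O S))); first by rewrite divr_gt0.
apply: ereal_sup_ubound; right; exists S.
  split => //; move=> H; have := cont_ae_eq oO Oz (continuous_subspaceT (smooth_cont sS)) H.
  by move=> E; move: Sz; rewrite E ltxx.
by rewrite (delta_cont oO Oz (smooth_cont sS)).
Qed.

End Norms.

(** * The difference of the fluxes, and the circulation identity *)

Section FluxDifference.
Variable R : realType.
Local Notation mu := (@area R).
Implicit Types (f g h k F T phi psi : R * R -> R) (A B O K P : set (R * R)) (u v w : R * R -> R * R) (a b c : R * R) (tau : R -> R) (G : 'I_2 -> R * R -> R) (nu : R -> R).

Lemma lip_ge0 nu (CL : R) : (forall s t, `|nu s - nu t| <= CL * `|s - t|) -> 0 <= CL.
Proof. by move=> /(_ 1 0) H; apply: (le_trans (normr_ge0 _)); move: H; rewrite subr0 normr1 mulr1; exact. Qed.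

Lemma lip_cont nu (CL : R) : (forall s t, `|nu s - nu t| <= CL * `|s - t|) -> continuous nu.
Proof.
move=> H x; have C0 := lip_ge0 H; have C1 : 0 < CL + 1 by rewrite ltr_pwDr.
apply/cvgrPdist_le => e e0; have e1 : 0 < e / (CL + 1) by rewrite divr_gt0.
near=> y; apply: (le_trans (H _ _)).
apply: (@le_trans _ _ ((CL + 1) * `|x - y|)); first by rewrite ler_wpM2r// lerDl.
rewrite mulrC -ler_pdivlMr//; near: y.
Unshelve. all: by end_near.
Qed.

Lemma lip_measurable nu (CL : R) A T : (forall s t, `|nu s - nu t| <= CL * `|s - t|) -> measurable_fun A T ->
  measurable_fun A (fun x => nu (T x)).
Proof.
move=> H mT; apply: (@measurableT_comp _ _ _ _ _ _ nu) => //.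
by apply: continuous_measurable_fun; exact: lip_cont H.
Qed.

Lemma sqi_nuM nu (num nup : R) A T f : 0 < num -> (forall s, num <= nu s <= nup) -> measurable A ->
  measurable_fun A (fun x => nu (T x)) -> sqi (rs A f) -> sqi (rs A (fun x => nu (T x) * f x)).
Proof.
move=> n0 nb mA mT sf.
have -> : rs A (fun x => nu (T x) * f x) = (fun x => rs A (fun x => nu (T x)) x * rs A f x).
  by apply/funext => x; rewrite rsMM.
apply: (sqi_bounded (M := nup)) => //; first exact: mble_rs.
move=> x; have /andP[h1 h2] := nb (T x).
rewrite /rs indicE; case: (x \in A); rewrite ?mul1r ?mul0r ?normr0; last by exact: (le_trans (ltW n0) (le_trans h1 h2)).
by rewrite ger0_norm// (le_trans (ltW n0)).
Qed.

(** Each component splits into [nu (Th x)] times the velocity error and [nu (T x) - nu (Th x)] times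
    [u]; Hoelder's inequality with exponents [r] and [p'] bounds the second part. The factor 2 adds
    the two components. *)
Lemma e_bound nu (CL num nup p' r B t : R) O P u (uh : R * R -> R * R) T (Th : R * R -> R) :
  (forall s t, `|nu s - nu t| <= CL * `|s - t|) -> 0 < num -> (forall s, num <= nu s <= nup) ->
  0 < r -> 0 < p' -> 2 / r + 2 / p' = 1 ->
  measurable O -> measurable P -> P `<=` O -> measurable_fun O T -> measurable_fun O Th ->
  measurable_fun O u -> measurable_fun O uh -> sqv O u -> sqv O uh -> 0 <= B ->
  (CL%:E * Lnmv p' O u <= B%:E)%E -> Lnm r P (fun x => (T x - Th x)%R) = t%:E ->
  nE P (fun x => nu (T x) * (u x).1 - nu (Th x) * (uh x).1) (fun x => nu (T x) * (u x).2 - nu (Th x) * (uh x).2) <=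
  2 * (nup * n2v P (fun x => u x - uh x) + B * t).
Proof.
move=> lip n0 nb r0 p0 rp mO mP PO mT mTh mu' muh su suh B0 HB Ht.
have CL0 := lip_ge0 lip.
have np0 : 0 <= nup by have /andP[h1 h2] := nb 0; exact: (le_trans (ltW n0) (le_trans h1 h2)).
have mTP := measurable_funS mO PO mT; have mThP := measurable_funS mO PO mTh.
have muP := measurable_funS mO PO mu'; have muhP := measurable_funS mO PO muh.
have suP := sqv_sub mP PO su; have suhP := sqv_sub mP PO suh.
have m1 v : measurable_fun P v -> measurable_fun P (fun x => (v x).1) by move=> mv; apply: (measurableT_comp _ mv).
have m2 v : measurable_fun P v -> measurable_fun P (fun x => (v x).2) by move=> mv; apply: (measurableT_comp _ mv).
pose eu x := u x - uh x.
have meu : measurable_fun P eu.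
  have -> : eu = (fun x => ((u x).1 - (uh x).1, (u x).2 - (uh x).2)) by [].
  by apply: (measurable_pair mP); apply: measurable_funB; (try exact: m1); exact: m2.
have seu : sqv P eu.
  have [a1 a2] := suP; have [b1 b2] := suhP; split.
    by have := sqiB a1 b1; congr sqi; apply/funext => x; rewrite -rsB.
  by have := sqiB a2 b2; congr sqi; apply/funext => x; rewrite -rsB.
have se := sqi_enorm mP meu seu.
have mnT := lip_measurable lip mTP; have mnTh := lip_measurable lip mThP.
have key (pr1 : R * R -> R) : (forall x y, pr1 (x - y) = pr1 x - pr1 y) -> (forall x, `|pr1 x| <= enorm x) ->
    measurable_fun P (fun x => pr1 (u x)) -> measurable_fun P (fun x => pr1 (uh x)) ->
    n2 (rs P (fun x => nu (T x) * pr1 (u x) - nu (Th x) * pr1 (uh x))) <= nup * n2v P eu + B * t.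
  move=> prB prle mpu mpuh.
  have mE : mble (rs P (fun x => nu (T x) * pr1 (u x) - nu (Th x) * pr1 (uh x))).
    by apply: (mble_rs mP); apply: measurable_funB; apply: measurable_funM.
  have pw x : `|nu (T x) * pr1 (u x) - nu (Th x) * pr1 (uh x)| <= nup * enorm (eu x) + CL * (`|T x - Th x| * enorm (u x)).
    have -> : nu (T x) * pr1 (u x) - nu (Th x) * pr1 (uh x) = nu (Th x) * pr1 (eu x) + (nu (T x) - nu (Th x)) * pr1 (u x).
      by rewrite /eu prB; ring.
    apply: (le_trans (ler_normD _ _)); rewrite !normrM; apply: lerD.
      apply: ler_pM; [exact: normr_ge0|exact: normr_ge0| |exact: prle].
      by have /andP[h1 h2] := nb (Th x); rewrite ger0_norm// (le_trans (ltW n0)).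
    by rewrite mulrA; apply: ler_pM; [exact: normr_ge0|exact: normr_ge0|exact: lip|exact: prle].
  have t0 : 0 <= t by rewrite -lee_fin -Ht Lnorm_ge0.
  (* For [CL = 0] the hypothesis [HB] reads [0 <= B], even if the norm of [u] is infinite, so
     Hoelder's inequality is avoided; the second part is then 0. *)
  have [CLz|CLp] := eqVneq CL 0.
    have sN := sqiZ nup se.
    have le x : `|rs P (fun x => nu (T x) * pr1 (u x) - nu (Th x) * pr1 (uh x)) x| <= `|nup * rs P (fun x => enorm (eu x)) x|.
      have [Px|Px] := pselect (P x); last by rewrite (rs_out _ Px) normr0.
      rewrite !(rs_in _ Px) [leRHS]ger0_norm ?mulr_ge0 ?enorm_ge0//.
      by have := pw x; rewrite CLz mul0r addr0.
    apply: (le_trans (n2_le (sqi_le mE sN le) sN le)); rewrite n2Z// ger0_norm//.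
    by rewrite lerDl mulr_ge0.
  have CLp' : 0 < CL by rewrite lt_neqAle eq_sym CLp.
  have Ufin : (Lnmv p' O u < +oo)%E.
    rewrite ltNge; apply/negP; rewrite leye_eq => /eqP E; move: HB; rewrite E gt0_muley ?lte_fin//.
  have men : measurable_fun O (fun x => enorm (u x)) by exact: measurable_enorm.
  have UP : (Lnmv p' P u <= Lnmv p' O u)%E by exact: Lnm_mono.
  have [U HU] : exists U : R, Lnmv p' O u = U%:E.
    by exists (fine (Lnmv p' O u)); rewrite fineK// ge0_fin_numE// Lnorm_ge0.
  have mh : mble (rs P (fun x => T x - Th x)) by apply: (mble_rs mP); exact: measurable_funB.
  have mk : mble (rs P (fun x => enorm (u x))) by apply: (mble_rs mP); exact: measurable_enorm.
  have H2 := hoelder2r mh mk r0 p0 rp.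
  have H3 : ('N[mu]_2%:E[(fun x => (rs P (fun x => (T x - Th x)%R) x * rs P (fun x => enorm (u x)) x)%R%:E)] <= (t * U)%:E)%E.
    apply: (le_trans H2); rewrite EFinM -HU; apply: lee_pmul; rewrite ?Lnorm_ge0//.
    by rewrite -Ht.
  have mhk := mbleM mh mk.
  have shk : sqi (fun x => rs P (fun x => T x - Th x) x * rs P (fun x => enorm (u x)) x).
    by apply: (Lnorm_sqi mhk); apply: (le_lt_trans H3); rewrite ltry.
  rewrite (LnormE shk) lee_fin in H3.
  have s1 := sqiZ nup se; have s2 := sqiZ CL (sqi_abs shk); have s12 := sqiD s1 s2.
  have le x : `|rs P (fun x => nu (T x) * pr1 (u x) - nu (Th x) * pr1 (uh x)) x| <=
     `|nup * rs P (fun x => enorm (eu x)) x + CL * `|rs P (fun x => T x - Th x) x * rs P (fun x => enorm (u x)) x| |.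
    have [Px|Px] := pselect (P x); last by rewrite (rs_out _ Px) normr0.
    rewrite !(rs_in _ Px) normrM (ger0_norm (enorm_ge0 (u x))).
    rewrite [leRHS]ger0_norm; first exact: pw.
    by rewrite addr_ge0// mulr_ge0// ?enorm_ge0// mulr_ge0// enorm_ge0.
  apply: (le_trans (n2_le (sqi_le mE s12 le) s12 le)); apply: (le_trans (n2D s1 s2)).
  rewrite n2Z// n2Z; last exact: sqi_abs.
  rewrite !ger0_norm//; apply: lerD => //.
  have -> : n2 (fun x => `|rs P (fun x => T x - Th x) x * rs P (fun x => enorm (u x)) x|) = n2 (fun x => rs P (fun x => T x - Th x) x * rs P (fun x => enorm (u x)) x).
    by rewrite /n2; congr Num.sqrt; apply: eq_Int => x; rewrite real_normK ?num_real.
  apply: (@le_trans _ _ (CL * (t * U))); first by rewrite ler_wpM2l.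
  by rewrite mulrCA mulrC ler_wpM2r// -lee_fin EFinM -HU.
have k1 := key fst (fun x y => erefl) (fun x => (enorm_coord x).1) (m1 _ muP) (m1 _ muhP).
have k2 := key snd (fun x y => erefl) (fun x => (enorm_coord x).2) (m2 _ muP) (m2 _ muhP).
by rewrite mulr_natl mulr2n; exact: (lerD k1 k2).
Qed.

Lemma cirB O f g f' g' psi : sqi (rs O f) -> sqi (rs O g) -> sqi (rs O f') -> sqi (rs O g') ->
  (forall i, sqi (pd i psi)) ->
  cir O (fun x => f x - f' x) (fun x => g x - g' x) psi = cir O f g psi - cir O f' g' psi.
Proof.
move=> sf sg sf' sg' sp.
have [M bM] : exists M, forall i, n2 (pd i psi) <= M.
  exists (n2 (pd ord0 psi) + n2 (pd ord_max psi)) => i.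
  by case: (ei_cases R i) => -[_ ->]; [rewrite lerDl; exact: n2_ge0|rewrite lerDr; exact: n2_ge0].
have [i1 _] := cir_le sf sg sp bM; have [i2 _] := cir_le sf' sg' sp bM.
by rewrite /cir -(IntB i1 i2); apply: eq_Int => x; rewrite -rsB; congr (_ * _); move: (pd _ _ x) (pd _ _ x); clear=> *; ring.
Qed.

Lemma coupled_rot_eq nu (CL num nup : R) O (f u uh : R * R -> R * R) (pr T Th : R * R -> R) :
  (forall s t, `|nu s - nu t| <= CL * `|s - t|) -> 0 < num -> (forall s, num <= nu s <= nup) ->
  open O -> measurable_fun O T -> measurable_fun O Th -> measurable_fun O pr ->
  measurable_fun O f -> measurable_fun O u -> sqv O f -> sqv O u -> sqv O uh ->
  (forall v, H0div O v -> integ O (fun x => nu (T x) * dot (u x) (v x) - pr x * wdiv O v x) = integ O (fun x => dot (f x) (v x))) ->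
  rot_eq O (fun x => (f x).1 - nu (Th x) * (uh x).1) (fun x => (f x).2 - nu (Th x) * (uh x).2)
    (fun x => nu (T x) * (u x).1 - nu (Th x) * (uh x).1) (fun x => nu (T x) * (u x).2 - nu (Th x) * (uh x).2).
Proof.
move=> lip n0 nb oO mT mTh mpr mf mu' [sf1 sf2] [su1 su2] [suh1 suh2] Heq psi tp comm.
have mO := open_measurable_plane oO.
have mnT := lip_measurable lip mT; have mnTh := lip_measurable lip mTh.
have sT f0 : sqi (rs O f0) -> sqi (rs O (fun x => nu (T x) * f0 x)) by exact: sqi_nuM n0 nb mO mnT.
have sTh f0 : sqi (rs O f0) -> sqi (rs O (fun x => nu (Th x) * f0 x)) by exact: sqi_nuM n0 nb mO mnTh.
have sp i : sqi (pd i psi).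
  have sE : sqi (rs O (pd i psi)) := test_sqi mO (test_pd i tp).
  have E : rs O (pd i psi) = pd i psi.
    apply/funext => x; have [Ox|Ox] := pselect (O x); first by rewrite (rs_in _ Ox).
    by rewrite (rs_out _ Ox) (test_out (test_pd i tp) Ox).
  by rewrite -E.
rewrite (cirB sf1 sf2 (sTh _ suh1) (sTh _ suh2) sp) (cirB (sT _ su1) (sT _ su2) (sTh _ suh1) (sTh _ suh2) sp).
congr (_ - _).
have [Hr w0] := rot_H0div oO tp comm.
have := Heq _ Hr; rewrite integE integE => E.
have [[mr _] [mw _] _ _] := Hr.
have mu1 : measurable_fun O (fun x => (u x).1) by apply: (measurableT_comp _ mu').
have mu2 : measurable_fun O (fun x => (u x).2) by apply: (measurableT_comp _ mu').
have mr1 : measurable_fun O (fun x => (rot psi x).1) by apply: (measurableT_comp _ mr).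
have mr2 : measurable_fun O (fun x => (rot psi x).2) by apply: (measurableT_comp _ mr).
transitivity (Int (rs O (fun x => dot (f x) (rot psi x)))).
  by apply: eq_Int => x; congr (_ * _); rewrite /dot /rot /=; move: (pd _ _ x) (pd _ _ x); clear=> *; ring.
rewrite -E; apply: Int_ae.
- apply: (mble_rs mO); apply: measurable_funB; last exact: (measurable_funM mpr mw).
  exact: (measurable_funM mnT (measurable_funD (measurable_funM mu1 mr1) (measurable_funM mu2 mr2))).
- apply: (mble_rs mO); apply: measurable_funB; apply: measurable_funM.
  + exact: (measurable_funM mnT mu1).
  + exact: mr1.
  + exact: (measurable_funM mnT mu2).
  + apply: mble_on; exact: (smooth_mble (test_smooth (test_pd ord0 tp))).
- apply: aeS w0 => x Hx; have [Ox|Ox] := pselect (O x); last by rewrite !(rs_out _ Ox).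
  by rewrite !(rs_in _ Ox) (Hx Ox) mulr0 subr0 /dot /rot /=; move: (pd _ _ x) (pd _ _ x); clear=> *; ring.
Qed.

Lemma pol_line n F a (v0 : R * R) : pol n F -> exists e : nat -> R, forall s, F (a + s *: v0) = \sum_(j < n.+1) e j * s ^+ j.
Proof.
move=> pF; have [c Hc] := pol_mono (pol_aff a v0 0 pF).
(* The line is a degenerate frame with second vector and second coordinate 0; as [0 ^+ 0 = 1], the
   terms with [j = 0] remain. *)
exists (fun i => \sum_(j < n.+1) c i j * 0 ^+ j) => s.
have -> : a + s *: v0 = aff a v0 0 (s, 0) by apply: pair_eqP; rewrite /aff /= /GRing.scale /=; ring.
rewrite Hc; apply: eq_bigr => i _; rewrite mulr_suml; apply: eq_bigr => j _ /=; ring.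
Qed.

Lemma is_op_ae K a b F F' G G' tau : measurable K -> measurable_fun K F -> measurable_fun K F' ->
  (forall i, measurable_fun K (G i)) -> (forall i, measurable_fun K (G' i)) ->
  {ae mu, forall x, K x -> F x = F' x} -> (forall i, {ae mu, forall x, K x -> G i x = G' i x}) ->
  is_op K a b F G tau -> is_op K a b F' G' tau.
Proof.
move=> mK mF mF' mG mG' FF GG [mt st [C C0 H]]; split; [exact: mt|exact: st|].
exists C => // f sf; have [s1 e1] := H _ sf; split; first exact: s1.
suff -> : n3 K f F' G' = n3 K f F G by exact: e1.
have E f0 f1 f2 : smooth f0 -> measurable_fun K f1 -> measurable_fun K f2 -> {ae mu, forall x, K x -> f1 x = f2 x} ->
    n2 (rs K (fun x => f0 x - f2 x)) = n2 (rs K (fun x => f0 x - f1 x)).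
  move=> s0 m1 m2 E12; have m0 : measurable_fun K f0 by apply: mble_on; exact: (smooth_mble s0).
  apply: n2_ae; [by apply: (mble_rs mK); exact: measurable_funB|by apply: (mble_rs mK); exact: measurable_funB|].
  by apply: rs_ae; apply: aeS E12 => x Hx Kx; rewrite (Hx Kx).
rewrite /n3 (E _ _ _ sf mF mF' FF).
rewrite (E _ _ _ (@smooth_pd _ ord0 _ sf) (mG ord0) (mG' ord0) (GG ord0)).
by rewrite (E _ _ _ (@smooth_pd _ ord_max _ sf) (mG ord_max) (mG' ord_max) (GG ord_max)).
Qed.

Lemma fat_le K (s S : R) : s <= S -> fat K s -> fat K S.
Proof. by move=> sS [q [r [r0 Hq H]]]; exists q, r; split => //; apply: (le_trans H); rewrite ler_wpM2r// ltW. Qed.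

(** The open square of half-side [3 / 5 * r] lies in the disc, since 2 * 9 / 25 is less than 1; it
    puts the closed square of half-side [r / 2] in the interior. *)
Lemma fat_sq a b c K (s : R) : is_tri a b c K -> fat K s -> exists q l,
  [/\ 0 < l, sq q l `<=` K°, K° `<=` sq q (diam K) & diam K <= 2 * s * l].
Proof.
move=> tK [q [r [r0 Hq H]]]; exists q, (r / 2); split.
- by rewrite divr_gt0.
- have Kq : (fun x : R * R => (x.1 - q.1, x.2 - q.2)) @^-1` (@Qo R (3 / 5 * r)) `<=` K°.
    rewrite -open_subsetE.
      move=> x [/= h1 h2]; apply: Hq.
      have := @le_of_sq _ (enorm (x - q)) r (ltW r0); rewrite (ger0_norm (enorm_ge0 _)); apply.
      rewrite enorm_sq /dot -!expr2 /=.
      have B (y : R) : `|y| < 3 / 5 * r -> y ^+ 2 <= 9 / 25 * r ^+ 2.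
        move=> hy; rewrite -real_normK ?num_real//.
        have -> : 9 / 25 * r ^+ 2 = (3 / 5 * r) ^+ 2 by field.
        by apply: lerXn2r; rewrite ?nnegrE ?(ltW hy)// mulr_ge0// ltW.
      have := lerD (B _ h1) (B _ h2); have := sqr_ge0 r; move: (r ^+ 2) => *; lra.
    apply: open_comp; last exact: open_Qo.
    move=> x _.
    have c1 : (fun y : R * R => y.1 - q.1) y @[y --> x] --> x.1 - q.1 by apply: cvgB; [exact: cvg_fst|exact: cvg_cst].
    have c2 : (fun y : R * R => y.2 - q.2) y @[y --> x] --> x.2 - q.2 by apply: cvgB; [exact: cvg_snd|exact: cvg_cst].
    exact: (cvg_pair c1 c2).
  move=> x [h1 h2]; apply: Kq; split => /=; [move: h1|move: h2]; move: r0; clear; move: `|_| => z; lra.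
- move=> x /interior_subset Kx; have Kq : K q by apply: Hq; rewrite subrr /enorm /dot /= !mulr0 addr0 sqrtr0 ltW.
  have dx := diam_ge tK Kx Kq; have [h1 h2] := enorm_coord (x - q).
  by split; [exact: (le_trans h1)|exact: (le_trans h2)].
- by apply: (le_trans H); rewrite le_eqVlt; apply/orP; left; apply/eqP; field.
Qed.

End FluxDifference.

(** * Application of the two estimates to the elements and sides of a mesh *)

Section ElementsAndSides.
Variable R : realType.
Local Notation mu := (@area R).
Implicit Types (F phi psi e : R * R -> R) (A B O K g : set (R * R)) (f w : R * R -> R * R) (a b c : R * R) (tau : R -> R) (G : 'I_2 -> R * R -> R) (T : mesh R) (om : set (R * R) -> R * R -> R * R).

Definition c1 w : R * R -> R := fun x => (w x).1.
Definition c2 w : R * R -> R := fun x => (w x).2.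

Lemma tri_density a b c K F G : is_tri a b c K -> H1p K° F G ->
  exists phi : nat -> R * R -> R, (forall n, smooth (phi n)) /\ H1cvg K° phi F G.
Proof.
move=> [d0 ->] HF; have [q [r [M [r0 KM Hs]]]] := tri_star d0.
exact: H1_density (@open_interior _ (tri a b c)) KM r0 Hs HF.
Qed.

Lemma tri_bd a b c K : is_tri a b c K -> exists M, K° `<=` @sq R (0, 0) M.
Proof. by move=> [_ ->]; exact: tri_mble_sq. Qed.

Lemma H1p_mble A F G : H1p A F G -> measurable_fun A F /\ forall i, measurable_fun A (G i).
Proof. by move=> [[mF _] H]; split => // i; have [_ [mG _]] := H i. Qed.

(** What the estimates use of the coupled problem: on each element [w] is [f] minus a polynomial
    field, and [w] has the same circulation as [(e1, e2)]. *)
Record mdata O T (S : R) (N : nat) f w e1 e2 : Prop := MData {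
  md_open : open O;
  md_mesh : conforming_mesh O T;
  md_fat : forall K, T K -> fat K S;
  md_S : 1 <= S;
  md_int : forall U, open U -> U `<=` closure O -> U `<=` O;
  md_f1 : W1 2 O (c1 f);
  md_f2 : W1 2 O (c2 f);
  md_mw1 : measurable_fun O (c1 w);
  md_mw2 : measurable_fun O (c2 w);
  md_w1 : sqi (rs O (c1 w));
  md_w2 : sqi (rs O (c2 w));
  md_e1 : sqi (rs O e1);
  md_e2 : sqi (rs O e2);
  md_rot : rot_eq O (c1 w) (c2 w) e1 e2;
  md_pol : forall K, T K -> exists q1 q2, [/\ pol N q1, pol N q2,
     {ae mu, forall x, K° x -> c1 f x - q1 x = c1 w x} & {ae mu, forall x, K° x -> c2 f x - q2 x = c2 w x}] }.

(** The curl of [f] is taken once, on [O]. On an element it is also the curl of [f] minus any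
    constant, see [curl_osc], so the oscillation terms in the elements do not depend on the
    constant. *)
Definition Cf O f : R * R -> R := fun x => wD O ord0 (c2 f) x - wD O ord_max (c1 f) x.

Section Data.
Variables (O : set (R * R)) (T : mesh R) (S : R) (N : nat) (f w : R * R -> R * R) (e1 e2 : R * R -> R).
Hypothesis D : mdata O T S N f w e1 e2.

Lemma elem_sub K : T K -> K° `<=` O.
Proof.
move=> TK; apply: (md_int D); first exact: open_interior.
have [_ _ -> _] := md_mesh D.
by move=> x /interior_subset Kx; exists K.
Qed.

Lemma elem_tri K : T K -> exists a b c, is_tri a b c K.
Proof. by have [_ H _ _] := md_mesh D; exact: H. Qed.

Lemma elem_H1p K : T K -> H1p K° (c1 f) (fun i => wD O i (c1 f)) /\ H1p K° (c2 f) (fun i => wD O i (c2 f)).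
Proof.
move=> TK; have oK : open K° by exact: open_interior.
have KO := elem_sub TK; split; apply: (H1p_sub oK (md_open D) KO); apply: W1_H1p; [exact: md_f1 D|exact: md_f2 D].
Qed.

Lemma elem_w K : T K -> exists q1 q2, [/\ pol N q1, pol N q2,
  {ae mu, forall x, K° x -> c1 f x - q1 x = c1 w x} /\ {ae mu, forall x, K° x -> c2 f x - q2 x = c2 w x},
  H1p K° (c1 w) (fun i x => wD O i (c1 f) x - pd i q1 x) &
  H1p K° (c2 w) (fun i x => wD O i (c2 f) x - pd i q2 x)].
Proof.
move=> TK; have [q1 [q2 [p1 p2 a1 a2]]] := md_pol D TK; exists q1, q2; split => //.
have oK : open K° by exact: open_interior.
  have mK := open_measurable_plane oK; have mO := open_measurable_plane (md_open D).
  have [a [b [c tK]]] := elem_tri TK; have [M KM] := tri_bd tK.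
  have [h1 h2] := elem_H1p TK.
  have hq := H1pB oK h1 (H1p_smooth oK KM (pol_smooth p1)).
  have [_ mg] := H1p_mble hq.
  have mw := measurable_funS mO (elem_sub TK) (md_mw1 D).
  by apply: (H1p_ae oK mw mg a1 _ hq) => i; exact: ae_all.
have oK : open K° by exact: open_interior.
have mK := open_measurable_plane oK; have mO := open_measurable_plane (md_open D).
have [a [b [c tK]]] := elem_tri TK; have [M KM] := tri_bd tK.
have [h1 h2] := elem_H1p TK.
have hq := H1pB oK h2 (H1p_smooth oK KM (pol_smooth p2)).
have [_ mg] := H1p_mble hq.
have mw := measurable_funS mO (elem_sub TK) (md_mw2 D).
by apply: (H1p_ae oK mw mg a2 _ hq) => i; exact: ae_all.
Qed.

Lemma curl_H1p K (om : R * R -> R * R) G1 G2 : open K -> H1p K (c1 om) G1 -> H1p K (c2 om) G2 ->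
  Lnm 2 K (curl K om) = (n2 (rs K (fun x => G2 ord0 x - G1 ord_max x)))%:E.
Proof.
move=> oK H1 H2; have mK := open_measurable_plane oK.
have [_ g1] := H1; have [_ g2] := H2.
have [w1 l1] := g1 ord_max; have [w2 l2] := g2 ord0.
have W1' := wD_is w1; have W2' := wD_is w2.
have mW1 : measurable_fun K (wD K ord_max (c1 om)) by have [_ [m _] _] := W1'.
have mW2 : measurable_fun K (wD K ord0 (c2 om)) by have [_ [m _] _] := W2'.
have [mg1 _] := l1; have [mg2 _] := l2.
rewrite (@Lnm_ae _ _ _ _ (fun x => G2 ord0 x - G1 ord_max x) mK).
- rewrite Lnm2E//; have := LspB mK l2 l1 => /(Lsp2P _ mK)[_]; exact.
- exact: (measurable_funB mW2 mW1).
- exact: (measurable_funB mg2 mg1).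
- apply: aeS (ae_and (wD_ae oK w2) (wD_ae oK w1)) => x [h2 h1] Kx.
  by rewrite /curl -/(c1 om) -/(c2 om) (h1 Kx) (h2 Kx).
Qed.

Lemma elem_osc K (cc : R * R) : T K ->
  H1p K° (c1 (fun x => f x - cc)) (fun i => wD O i (c1 f)) /\ H1p K° (c2 (fun x => f x - cc)) (fun i => wD O i (c2 f)).
Proof.
move=> TK; have oK : open K° by exact: open_interior.
have [a [b [c tK]]] := elem_tri TK; have [M KM] := tri_bd tK.
have [h1 h2] := elem_H1p TK.
have E F (k : R) : (fun i x => wD O i F x - pd i (fun=> k) x) = (fun i => wD O i F).
  by apply/funext => i; apply/funext => x; rewrite pd_cst subr0.
have g1 := H1pB oK h1 (H1p_smooth oK KM (smooth_cst cc.1)); rewrite E in g1.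
have g2 := H1pB oK h2 (H1p_smooth oK KM (smooth_cst cc.2)); rewrite E in g2.
by split; [exact: g1|exact: g2].
Qed.

Lemma curl_osc K (cc : R * R) : T K -> Lnm 2 K° (curl K° (fun x => f x - cc)) = (n2 (rs K° (Cf O f)))%:E.
Proof.
by move=> TK; have [h1 h2] := elem_osc cc TK; rewrite (curl_H1p (@open_interior _ K) h1 h2).
Qed.

End Data.

Lemma sub_swap (x y z t : R) : (x - y) - (z - t) = (x - z) - (y - t).
Proof. by ring. Qed.

Lemma elem_est (N : nat) (S : R) : 1 <= S -> exists2 C, 0 < C &
  forall O T f w e1 e2, mdata O T S N f w e1 e2 -> forall K, T K -> exists k : R,
    [/\ 0 <= k, Lnm 2 K° (curl K° w) = k%:E &
     diam K * k <= C * (diam K * n2 (rs K° (Cf O f)) + nE K° e1 e2)].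
Proof.
move=> S1; have S2 : 0 < 2 * S by rewrite mulr_gt0// (lt_le_trans ltr01).
have [C C0 HC] := interior_est N S2; exists C => // O T f w e1 e2 D K TK.
have oK : open K° by exact: open_interior.
have mK := open_measurable_plane oK.
have [a [b [c tK]]] := elem_tri D TK.
have [q1 [q2 [p1 p2 [a1 a2] h1 h2]]] := elem_w D TK.
exists (n2 (rs K° (fun x => (wD O ord0 (c2 f) x - pd ord0 q2 x) - (wD O ord_max (c1 f) x - pd ord_max q1 x)))).
split; [exact: n2_ge0|exact: (curl_H1p oK h1 h2)|].
have [q [l [l0 lK Kh hS]]] := fat_sq tK (md_fat D TK).
have [f1 f2] := elem_H1p D TK.
have [_ mf1] := H1p_mble f1; have [_ mf2] := H1p_mble f2.
have [_ g1] := f1; have [_ g2] := f2.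
have scf : sqi (rs K° (Cf O f)).
  by have /(Lsp2P _ mK)[] := LspB mK (g2 ord0).2 (g1 ord_max).2.
have pq : pol N (fun x => pd ord0 q2 x - pd ord_max q1 x) := polB (pol_pd ord0 p2) (pol_pd ord_max p1).
apply: (HC O K° (c1 w) (c2 w) e1 e2 _ _ (Cf O f) _ q l (diam K) (md_open D) oK (elem_sub D TK) (md_w1 D) (md_w2 D)
  (md_e1 D) (md_e2 D) (md_rot D) Kh lK l0 hS h1 h2 pq (measurable_funB (mf2 ord0) (mf1 ord_max)) scf).
by apply: ae_all => x _; exact: sub_swap.
Qed.

Lemma up_lin (x y : R) (t t' u u' : R -> R) (z : R * R) :
  x * up t z + y * up t' z - (x * up u z + y * up u' z) = up (fun s => x * t s + y * t' s - (x * u s + y * u' s)) z.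
Proof. by rewrite /up; ring. Qed.

(** The square root of the length comes from arc length, the inverse of the length from the
    normalization of [tangent]. The chosen traces are replaced by given trace functions through
    [trace_uniq]. *)
Lemma side_jump T g om c c' G11 G12 G21 G22 (t11 t12 t21 t22 : R -> R) :
  let K1 := (adj T g).1 in let K2 := (adj T g).2 in let a := (ends g).1 in let b := (ends g).2 in
  is_tri a b c K1 -> is_tri a b c' K2 -> a <> b ->
  H1p K1° (c1 (om K1)) G11 -> H1p K1° (c2 (om K1)) G12 -> H1p K2° (c1 (om K2)) G21 -> H1p K2° (c2 (om K2)) G22 ->
  is_op K1° a b (c1 (om K1)) G11 t11 -> is_op K1° a b (c2 (om K1)) G12 t12 ->
  is_op K2° a b (c1 (om K2)) G21 t21 -> is_op K2° a b (c2 (om K2)) G22 t22 ->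
  side_L2 g (jump T g om) = (Num.sqrt (enorm (b - a)) * ((enorm (b - a))^-1 *
    n2 (up (fun s => (b - a).1 * (t11 s - t21 s) + (b - a).2 * (t12 s - t22 s)))))%:E.
Proof.
move=> K1 K2 a b tK1 tK2 ab h11 h12 h21 h22 o11 o12 o21 o22.
have i11 := trace_is tK1 ab h11; have i12 := trace_is tK1 ab h12.
have i21 := trace_is tK2 ab h21; have i22 := trace_is tK2 ab h22.
have u11 := trace_uniq tK1 ab h11 o11 i11; have u12 := trace_uniq tK1 ab h12 o12 i12.
have u21 := trace_uniq tK2 ab h21 o21 i21; have u22 := trace_uniq tK2 ab h22 o22 i22.
have [_ m11 _] := i11; have [_ m12 _] := i12; have [_ m21 _] := i21; have [_ m22 _] := i22.
have [_ s11 _] := o11; have [_ s12 _] := o12; have [_ s21 _] := o21; have [_ s22 _] := o22.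
clear i11 i12 i21 i22 o11 o12 o21 o22 h11 h12 h21 h22.
set L := enorm (b - a).
have L0 : 0 < L by exact: side_length_gt0.
set J := fun s => _.
have sJ : sqi (up J).
  have := sqiD (sqiZ (b - a).1 (sqiB s11 s21)) (sqiZ (b - a).2 (sqiB s12 s22)); congr sqi.
  by apply/funext => x; rewrite /up /J; ring.
have mj : measurable_fun (`[0, 1] : set R) (jump T g om \o along g).
  have mt (x y : R * R -> R) : measurable_fun (`[0, 1] : set R) (x \o along g) -> measurable_fun (`[0, 1] : set R) (y \o along g) ->
     measurable_fun (`[0, 1] : set R) (fun s => (tangent g).1 * (x \o along g) s + (tangent g).2 * (y \o along g) s).
    by move=> mx my; apply: measurable_funD; apply: measurable_funM.
  exact: (measurable_funB (mt _ _ m11 m12) (mt _ _ m21 m22)).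
have sLJ := sqiZ L^-1 sJ.
have E : {ae mu, forall x, L^-1 * up J x = up (jump T g om \o along g) x}.
  apply: aeS (ae_and (ae_and u11 u12) (ae_and u21 u22)) => x [[v11 v12] [v21 v22]].
  have -> : L^-1 * up J x = (tangent g).1 * up t11 x + (tangent g).2 * up t12 x - ((tangent g).1 * up t21 x + (tangent g).2 * up t22 x).
    have -> : (tangent g).1 = L^-1 * (b - a).1 by [].
    have -> : (tangent g).2 = L^-1 * (b - a).2 by [].
    by rewrite /up /J; ring.
  by rewrite -v11 -v12 -v21 -v22; exact: up_lin.
have mu' := mble_up mj.
have sU := sqi_ae mu' E sLJ.
rewrite (side_L2E mj sU); congr EFin; congr (_ * _).
by rewrite -(n2_ae (sLJ.1) mu' E) n2Z// gtr0_norm// invr_gt0.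
Qed.

(** Since [h <= S * L], the factor [sqrt h * sqrt L / L] is at most [sqrt S], hence at most [S],
    because [1 <= S]. *)
Lemma side_arith (h L S Cs Z Y X n nJ : R) : 0 < L -> 1 <= S -> 0 <= h -> h <= S * L -> 0 < Cs -> 0 <= Z ->
  0 <= n -> nJ <= Cs * (Z + n) -> X = Num.sqrt L * (L^-1 * nJ) -> Y = Num.sqrt L * (L^-1 * n) ->
  Num.sqrt h * X <= Cs * (S * Z) + Cs * (Num.sqrt h * Y).
Proof.
move=> L0 S1 h0 hS C0 Z0 n0 HJ -> ->.
set sh := Num.sqrt h; set sL := Num.sqrt L.
have S0 : 0 <= S by exact: le_trans S1.
have sL0 : 0 < sL by rewrite sqrtr_gt0.
have sLL : sL * sL = L by rewrite -expr2 sqr_sqrtr// ltW.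
have shS : sh <= S * sL.
  have H : h <= S ^+ 2 * L.
    apply: (le_trans hS); rewrite ler_wpM2r ?(ltW L0)//.
    by rewrite expr2 -[X in X <= _]mulr1 ler_wpM2l.
  have := ler_wsqrtr H; rewrite sqrtrM ?exprn_ge0// sqrtr_sqr ger0_norm//.
have q : sh * (sL * L^-1) <= S.
  have -> : sL * L^-1 = sL^-1 by rewrite -[L]sLL invfM mulrA mulfV ?gt_eqF// mul1r.
  by rewrite ler_pdivrMr.
have q0 : 0 <= sh * (sL * L^-1) by rewrite mulr_ge0 ?sqrtr_ge0// mulr_ge0 ?invr_ge0 ?ltW.
have -> : sh * (sL * (L^-1 * nJ)) = sh * (sL * L^-1) * nJ by ring.
apply: (le_trans (ler_wpM2l q0 HJ)).
have -> : sh * (sL * L^-1) * (Cs * (Z + n)) = Cs * (sh * (sL * L^-1) * Z) + Cs * (sh * (sL * (L^-1 * n))) by ring.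
by rewrite lerD2r ler_wpM2l ?(ltW C0)// ler_wpM2r.
Qed.

(** An open rectangle around the middle of the side is covered by the two elements, so it lies in
    the closure of [O], and in [O] by [md_int]. This is what makes the function built on the side a
    test function of [O]. *)
Lemma side_patch O T S N f w e1 e2 K1 K2 a b c c' : mdata O T S N f w e1 e2 -> T K1 -> T K2 ->
  is_tri a b c K1 -> is_tri a b c' K2 -> sgd a b c' = - sgd a b c ->
  forall t s, `|t| <= (16 * S)^-1 -> 4^-1 <= s <= 3 / 4 -> O (aff a (perp (sgd a b c) (b - a)) (b - a) (t, s)).
Proof.
move=> D T1 T2 tK1 tK2 sgE.
have [S0 g1] := fat_geom tK1 (md_fat D T1); have [_ g2] := fat_geom tK2 (md_fat D T2).
have [d0 KE] := tK1.
have sg1 := sgd_sq d0.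
have v0 : dot (b - a) (b - a) != 0.
  rewrite -enorm_sq expf_neq0// gt_eqF// enorm_gt0// => /eqP; rewrite subr_eq0 => /eqP /esym; exact: (tri_neq12 d0).
set sg := sgd a b c in sgE sg1 g1 *; set v := b - a in v0 *.
set d := (16 * S)^-1.
have dp : 0 < d by rewrite invr_gt0 mulr_gt0.
pose U : set (R * R) := ([set x | 0 < 2 * d - tc a sg v x] `&` [set x | 0 < 2 * d + tc a sg v x]) `&` ([set x | 0 < sc a v x - 8^-1] `&` [set x | 0 < 7 / 8 - sc a v x]).
have oU : open U.
  have ol (F : R * R -> R) : continuous F -> open [set x | 0 < F x].
    move=> cF; have -> : [set x | 0 < F x] = F @^-1` [set y : R | 0 < y] by [].
    by apply: open_comp; [move=> x _; exact: cF|exact: open_gt].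
  have ct : continuous (tc a sg v) by exact: lin_cont.
  have cs : continuous (sc a v) by exact: lin_cont.
  apply: openI; apply: openI; apply: ol => x.
  - by apply: cvgB; [exact: cvg_cst|exact: ct].
  - by apply: cvgD; [exact: cvg_cst|exact: ct].
  - by apply: cvgB; [exact: cs|exact: cvg_cst].
  - by apply: cvgB; [exact: cvg_cst|exact: cs].
have UO : U `<=` closure O.
  have [_ _ clE _] := md_mesh D; rewrite clE => x [[/= x1 x2] [/= x3 x4]].
  rewrite -(aff_coord a x sg1 v0).
  have hs : 8^-1 < sc a v x < 7 / 8 by apply/andP; split; move: x3 x4; clear; lra.
  have [tp|tn|t0] := ltrgtP 0 (tc a sg v x).
  - exists K1 => //; apply: interior_subset; apply: (tg_rect g1) => //.
    by rewrite tp /=; move: x1; rewrite subr_gt0.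
  - exists K2 => //; apply: interior_subset.
    rewrite -[tc a sg v x]opprK -aff_perpN -sgE; apply: (tg_rect g2) => //.
    by rewrite oppr_gt0 tn /=; move: x2; rewrite -/d; clear; lra.
  - exists K1 => //; rewrite -t0 KE; exists (sc a v x), 0; split.
    + by move: hs => /andP[h _]; apply: ltW; apply: lt_trans h.
    + by [].
    + by move: hs => /andP[_ h]; rewrite addr0; apply: ltW; apply: (lt_trans h); lra.
    + by apply: pair_eqP; rewrite /aff /v /= /GRing.scale /=; ring.
have UO' := md_int D oU UO.
move=> t s td /andP[s1 s2]; apply: UO'; rewrite /U /= (tc_aff _ _ _ sg1 v0) (sc_aff _ _ _ _ v0).
move: td; rewrite ler_norml => /andP[t1 t2].
by split; split; move: t1 t2 s1 s2 dp; clear; rewrite -/d; lra.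
Qed.

Lemma side_arith1 (A L k1 k2 h1 h2 n : R) : L <= h1 -> L <= h2 -> 0 <= k1 -> 0 <= k2 ->
  A + L * (k1 + k2) + n <= A + (h1 * k1 + h2 * k2) + n.
Proof.
by move=> L1 L2 p1 p2; rewrite lerD2r lerD2l mulrDr; apply: lerD; apply: ler_wpM2r.
Qed.

Lemma side_arith2 (X A S Z y : R) : X <= A * (S * Z) + A * y -> 0 < A -> 1 <= S -> 0 <= y ->
  X <= A * S * Z + A * S * y.
Proof.
move=> XE A0 S1 y0; apply: (le_trans XE); rewrite mulrA lerD2l -mulrA.
by rewrite ler_wpM2l ?(ltW A0)// -[leLHS]mul1r ler_wpM2r.
Qed.

(** On each element [w] and [f - cc] differ by a polynomial, so their unnormalized tangential jumps
    differ by the restriction of the polynomial [gq] to the side; [side_est] applies with [Jo] the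
    jump of [f - cc]. *)
Lemma side_term (N : nat) (S : R) : 1 <= S -> exists2 C, 0 < C &
  forall O T f w e1 e2 (cc : set (R * R) -> R * R), mdata O T S N f w e1 e2 ->
  forall K g, T K -> isides T K g -> exists (X Y : R) (K1 K2 : set (R * R)) (k1 k2 : R),
   [/\ 0 <= X, 0 <= Y, nbrs T K K1 /\ nbrs T K K2 &
    [/\ side_L2 g (jump T g (fun=> w)) = X%:E, side_L2 g (jump T g (fun K x => f x - cc K)) = Y%:E,
      Lnm 2 K1° (curl K1° w) = k1%:E, Lnm 2 K2° (curl K2° w) = k2%:E &
      Num.sqrt (diam K) * X <= C * (nE K1° e1 e2 + nE K2° e1 e2 + (diam K1 * k1 + diam K2 * k2)) + C * (Num.sqrt (diam K) * Y)]].
Proof.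
move=> S1; have [C C0 HC] := side_est N S1.
exists (C * S); first by rewrite mulr_gt0// (lt_le_trans ltr01).
move=> O T f w e1 e2 cc D K g TK gK.
have [c [c' [tK1 tK2 n1 n2' [sgE ab Kor]]]] := adj_cases (md_mesh D) (md_fat D) TK gK.
set K1 := (adj T g).1 in tK1 n1 Kor *; set K2 := (adj T g).2 in tK2 n2' Kor *.
have T1 : T K1 by case: n1. have T2 : T K2 by case: n2'.
set a := (ends g).1 in tK1 tK2 sgE ab *; set b := (ends g).2 in tK1 tK2 sgE ab *.
have oK1 : open K1° by exact: open_interior. have oK2 : open K2° by exact: open_interior.
have mK1 := open_measurable_plane oK1; have mK2 := open_measurable_plane oK2.
have [q11 [q12 [p11 p12 [a11 a12] h11 h12]]] := elem_w D T1.
have [q21 [q22 [p21 p22 [a21 a22] h21 h22]]] := elem_w D T2.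
have [f11 f12] := elem_H1p D T1; have [f21 f22] := elem_H1p D T2.
have [z11 z12] := elem_osc D (cc K1) T1; have [z21 z22] := elem_osc D (cc K2) T2.
have ex11 := trace_ex tK1 ab f11; have ex12 := trace_ex tK1 ab f12.
have ex21 := trace_ex tK2 ab f21; have ex22 := trace_ex tK2 ab f22.
case: ex11 => tau11 [r11 _]; case: ex12 => tau12 [r12 _].
case: ex21 => tau21 [r21 _]; case: ex22 => tau22 [r22 _].
have opw K' F F' G q tau : measurable K' -> H1p K' F G -> (exists M, K' `<=` @sq R (0, 0) M) -> open K' -> pol N q -> measurable_fun K' F' ->
    {ae mu, forall x, K' x -> F x - q x = F' x} -> is_op K' a b F G tau ->
    is_op K' a b F' (fun i x => G i x - pd i q x) (fun s => tau s - q (a + s *: (b - a))).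
  move=> mK' hF [M KM] oK' pq mF' E op; have op2 := is_op_sub op (pol_smooth pq).
  have [mFq mGq] := H1p_mble (H1pB oK' hF (H1p_smooth oK' KM (pol_smooth pq))).
  by apply: (is_op_ae mK' mFq mF' mGq mGq E _ op2) => i; exact: ae_all.
have [mw11 _] := H1p_mble h11; have [mw12 _] := H1p_mble h12.
have [mw21 _] := H1p_mble h21; have [mw22 _] := H1p_mble h22.
have bK1 := tri_bd tK1; have bK2 := tri_bd tK2.
have ow11 := opw _ _ _ _ _ _ mK1 f11 bK1 oK1 p11 mw11 a11 r11.
have ow12 := opw _ _ _ _ _ _ mK1 f12 bK1 oK1 p12 mw12 a12 r12.
have ow21 := opw _ _ _ _ _ _ mK2 f21 bK2 oK2 p21 mw21 a21 r21.
have ow22 := opw _ _ _ _ _ _ mK2 f22 bK2 oK2 p22 mw22 a22 r22.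
have opc K' F G tau (k : R) : is_op K' a b F G tau -> is_op K' a b (fun x => F x - k) G (fun s => tau s - k).
  move=> op; have := is_op_sub op (smooth_cst k); congr is_op.
  by apply/funext => i; apply/funext => x; rewrite pd_cst subr0.
have oz11 := opc _ _ _ _ (cc K1).1 r11; have oz12 := opc _ _ _ _ (cc K1).2 r12.
have oz21 := opc _ _ _ _ (cc K2).1 r21; have oz22 := opc _ _ _ _ (cc K2).2 r22.
have EX := side_jump (om := fun=> w) tK1 tK2 ab h11 h12 h21 h22 ow11 ow12 ow21 ow22.
have EY := side_jump (om := fun K x => f x - cc K) tK1 tK2 ab z11 z12 z21 z22 oz11 oz12 oz21 oz22.
rewrite -/a -/b in EX EY.
set L := enorm (b - a) in EX EY.
have L0 : 0 < L by exact: side_length_gt0.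
set J := (fun s => _ + _) in EX; set Jo := (fun s => _ + _) in EY.
have [S0 g1] := fat_geom tK1 (md_fat D T1); have [_ g2] := fat_geom tK2 (md_fat D T2).
have [d0 KE] := tK1; have sg1 := sgd_sq d0.
have vp : 0 < dot (b - a) (b - a) by rewrite -enorm_sq exprn_gt0.
pose gq x := (b - a).1 * (((cc K1).1 - q11 x) - ((cc K2).1 - q21 x)) + (b - a).2 * (((cc K1).2 - q12 x) - ((cc K2).2 - q22 x)).
have pg : pol N gq.
  have pc (k : R) q : pol N q -> pol N (fun x => k - q x) by move=> pq; exact: (polB (pol_cst N k) pq).
  exact: (polD (polZ _ (polB (pc _ _ p11) (pc _ _ p21))) (polZ _ (polB (pc _ _ p12) (pc _ _ p22)))).
have [e He] := pol_line a (b - a) pg.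
have JE s : J s = Jo s + \sum_(j < N.+1) e j * s ^+ j by rewrite -He /J /Jo /gq; ring.
have hd1 : half_data O K1° a b (sgd a b c) (16 * S)^-1 (c1 w) (c2 w) _ _ _ _ :=
  HalfData oK1 bK1 (elem_sub D T1) (tg_rect g1) (tg_neg g1) h11 h12 ow11 ow12 (tri_density tK1 h11) (tri_density tK1 h12).
have hd2 : half_data O K2° a b (sgd a b c') (16 * S)^-1 (c1 w) (c2 w) _ _ _ _ :=
  HalfData oK2 bK2 (elem_sub D T2) (tg_rect g2) (tg_neg g2) h21 h22 ow21 ow22 (tri_density tK2 h21) (tri_density tK2 h22).
rewrite sgE in hd2.
have HO := side_patch D T1 T2 tK1 tK2 sgE.
have main := HC O K1° K2° a b (sgd a b c) (c1 w) (c2 w) e1 e2 _ _ _ _ _ _ _ _ Jo e (md_open D) (md_w1 D) (md_w2 D) (md_e1 D) (md_e2 D) (md_rot D)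
  sg1 vp HO hd1 hd2 JE.
rewrite -/J -/L in main.
have k1E := curl_H1p oK1 h11 h12; have k2E := curl_H1p oK2 h21 h22.
set k1 := n2 (rs K1° _) in main k1E; set k2 := n2 (rs K2° _) in main k2E.
exists (Num.sqrt L * (L^-1 * n2 (up J))), (Num.sqrt L * (L^-1 * n2 (up Jo))), K1, K2, k1, k2.
have pos (y : R -> R) : 0 <= Num.sqrt L * (L^-1 * n2 (up y)).
  by apply: mulr_ge0; [exact: sqrtr_ge0|apply: mulr_ge0; [rewrite invr_ge0 ltW|exact: n2_ge0]].
split; [exact: pos|exact: pos|by split|split; [exact: EX|exact: EY|exact: k1E|exact: k2E|]].
have Lh1 := tg_len2 g1; have Lh2 := tg_len2 g2; rewrite -/L in Lh1 Lh2.
have hL : diam K <= S * L by case: Kor => ->; [exact: tg_len g1|exact: tg_len g2].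
have hK0 : 0 <= diam K by case: Kor => ->; [exact: ltW (diam_gt0 tK1)|exact: ltW (diam_gt0 tK2)].
have k10 : 0 <= k1 by exact: n2_ge0. have k20 : 0 <= k2 by exact: n2_ge0.
have nE0 (K' : set (R * R)) : 0 <= nE K' e1 e2 by apply: addr_ge0; exact: n2_ge0.
pose Z := nE K1° e1 e2 + nE K2° e1 e2 + (diam K1 * k1 + diam K2 * k2).
have Z0 : 0 <= Z.
  have d1 := ltW (diam_gt0 tK1); have d2 := ltW (diam_gt0 tK2).
  exact: (addr_ge0 (addr_ge0 (nE0 K1°) (nE0 K2°)) (addr_ge0 (mulr_ge0 d1 k10) (mulr_ge0 d2 k20))).
have mJ : n2 (up J) <= C * (Z + n2 (up Jo)).
  apply: (le_trans main); apply: ler_wpM2l; first exact: ltW.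
  exact: (side_arith1 _ _ Lh1 Lh2 k10 k20).
have fin := side_arith L0 S1 hK0 hL C0 Z0 (n2_ge0 _) mJ erefl erefl.
exact: (side_arith2 fin C0 S1 (mulr_ge0 (sqrtr_ge0 _) (pos Jo))).
Qed.

End ElementsAndSides.

(** * From the coupled problem to the indicator of an element *)

Section Indicator.
Variable R : realType.
Local Notation mu := (@area R).
Local Notation elems A := (finmap.enum_fset (fset_set A)).
Implicit Types (F : R * R -> R) (A O P K g : set (R * R)) (f u uh w : R * R -> R * R) (M : mesh R).

Lemma sqrt_sum_le (I : Type) (s : seq I) (h k : R) (X : I -> R) : 0 <= h -> 0 <= k -> (forall i, 0 <= X i) ->
  Num.sqrt (h ^+ 2 * k ^+ 2 + h * \sum_(i <- s) X i ^+ 2) <= h * k + \sum_(i <- s) Num.sqrt h * X i.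
Proof.
move=> h0 k0 X0; have hk := mulr_ge0 h0 k0.
have S0 (t : seq I) : 0 <= \sum_(i <- t) Num.sqrt h * X i.
  by apply: sumr_ge0 => i _; apply: mulr_ge0; [exact: sqrtr_ge0|exact: X0].
have sq_sum (t : seq I) : h * \sum_(i <- t) X i ^+ 2 <= (\sum_(i <- t) Num.sqrt h * X i) ^+ 2.
  elim: t => [|i t IH]; first by rewrite !big_nil mulr0 expr0n.
  have a0 : 0 <= Num.sqrt h * X i by apply: mulr_ge0; [exact: sqrtr_ge0|exact: X0].
  have E : h * X i ^+ 2 = (Num.sqrt h * X i) ^+ 2 by rewrite exprMn sqr_sqrtr.
  rewrite !big_cons mulrDr E sqrrD; have := mulr_ge0 a0 (S0 t); move: IH.
  clear; set b := \sum_(_ <- _) _ * _; set c := h * _; set a := _ * _; lra.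
rewrite -[leRHS]ger0_norm ?addr_ge0// -sqrtr_sqr; apply: ler_wsqrtr.
rewrite sqrrD -exprMn; have := sq_sum s; have := mulr_ge0 hk (S0 s).
by clear; set b := \sum_(_ <- _) _ * _; set c := h * \sum_(_ <- _) _; set a := h * k; lra.
Qed.

Lemma nbrs_self M K : M K -> nbrs M K K. Proof. by move=> MK; split => //; left. Qed.

Lemma isides_finite M K a b c : is_tri a b c K ->
  finite_set (isides M K) /\ (size (elems (isides M K)) <= 9)%N.
Proof.
move=> tK; have sub : isides M K `<=` [set` tsides a b c].
  by move=> g [sg _]; exact: side_tsides tK sg.
have fin : finite_set (isides M K) by apply: sub_finite_set sub _; exact: finite_seq.
split => //; apply: (@uniq_leq_size _ _ (tsides a b c)); first exact: finmap.fset_uniq.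
by move=> g; rewrite in_fset_set// => /set_mem/sub.
Qed.

Lemma patch_open M K : open (elem_patch M K).
Proof. by apply: bigcup_open => K' _; exact: open_interior. Qed.

Lemma Vh_measurable O M F : open O -> Vh O M F -> measurable_fun O F.
Proof.
move=> oO [cF _ _]; apply: open_continuous_measurable => //.
by apply: continuous_subspaceW cF; exact: subset_closure.
Qed.

(** Each component of a field of [Xh] is an affine function of one coordinate on an element, so its
    product with the discrete viscosity has degree one more. *)
Lemma poly_affine_mul d K (g v : R * R -> R) (a b0 : R) (c : R * R -> R) :
  (c = fun x => x.1) \/ (c = fun x => x.2) -> poly_on d K g ->
  {ae mu, forall x, K x -> v x = a * c x + b0} ->
  exists2 q, pol d.+1 q & {ae mu, forall x, K° x -> g x * v x = q x}.
Proof.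
move=> cE /poly_on_pol[q pq qE] vE.
have [q' pq' q'E] : exists2 q', pol d.+1 q' & forall x, q' x = (a * c x + b0) * q x.
  case: cE => ->.
  - by exists (fun x => (b0 + a * x.1 + 0 * x.2) * q x); [exact: pol_mullin|move=> x; ring].
  - by exists (fun x => (b0 + 0 * x.1 + a * x.2) * q x); [exact: pol_mullin|move=> x; ring].
exists q' => //; apply: aeS vE => x vE /interior_subset Kx.
by rewrite q'E (vE Kx) (qE _ Kx) mulrC.
Qed.

Section Solution.
Variables (O : set (R * R)) (M : mesh R) (z : R * R) (nu : R -> R) (CL num nup kappa p p' S : R) (d : nat).
Variables (f u uh : R * R -> R * R) (pr T ph Th : R * R -> R).
Hypothesis lip : forall s t, `|nu s - nu t| <= CL * `|s - t|.
Hypotheses (num0 : 0 < num) (nub : forall s, num <= nu s <= nup) (oO : open O) (lO : lipschitz_boundary O).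
Hypotheses (cM : conforming_mesh O M) (S1 : 1 <= S) (fatM : forall K, M K -> fat K S) (Hf : H1v O f).
Hypotheses (sol : continuous_sol O z nu kappa f p p' u pr T) (dsol : discrete_sol O z nu kappa f M uh ph Th).
Hypothesis Hpol : forall K, M K -> poly_on d K (fun x => nu (Th x)).

Lemma sol_basic : [/\ measurable_fun O T, measurable_fun O Th,
  measurable_fun O u /\ measurable_fun O uh & sqv O u /\ sqv O uh].
Proof.
have mO := open_measurable_plane oO.
have [[[/(Lspv2P _ mO)[mu' su] _ _ _] [_ [[[mT _] _] _]]] _ _ _] := sol.
have [[[[/(Lspv2P _ mO)[muh suh] _ _ _] _] [_ Vth]] _ _ _] := dsol.
by split => //; exact: Vh_measurable oO Vth.
Qed.

Lemma sol_mdata : mdata O M S d.+1 f (fun x => f x - nu (Th x) *: uh x)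
  (fun x => nu (T x) * (u x).1 - nu (Th x) * (uh x).1) (fun x => nu (T x) * (u x).2 - nu (Th x) * (uh x).2).
Proof.
have mO := open_measurable_plane oO.
have [mT mTh [mu' muh] [su suh]] := sol_basic.
have [f1 f2] := Hf.
have [[mf1 lf1] _] := f1; have [[mf2 lf2] _] := f2.
have [_ sf1] := (Lsp2P _ mO).1 (conj mf1 lf1); have [_ sf2] := (Lsp2P _ mO).1 (conj mf2 lf2).
have mf : measurable_fun O f.
  have := measurable_pair mO mf1 mf2; congr measurable_fun.
  by apply/funext => x; case: (f x).
have [[_ [[[mpr _] _] _]] Heq _ _] := sol.
have mnT := lip_measurable lip mT; have mnTh := lip_measurable lip mTh.
have sE (h : R * R -> R) T0 (v : R * R -> R) : measurable_fun O (fun x => nu (T0 x)) -> sqi (rs O h) -> sqi (rs O v) ->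
    sqi (rs O (fun x => h x - nu (T0 x) * v x)).
  move=> mT0 sh sv; have := sqiB sh (sqi_nuM num0 nub mO mT0 sv).
  by congr sqi; apply/funext => x; rewrite /rs mulrBr.
have m1 (v : R * R -> R * R) : measurable_fun O v -> measurable_fun O (fun x => (v x).1) by move=> mv; apply: (measurableT_comp _ mv).
have m2 (v : R * R -> R * R) : measurable_fun O v -> measurable_fun O (fun x => (v x).2) by move=> mv; apply: (measurableT_comp _ mv).
have [su1 su2] := su; have [suh1 suh2] := suh.
apply: MData.
- exact: oO.
- exact: cM.
- exact: fatM.
- exact: S1.
- by move=> U; exact: lipschitz_open.
- exact: f1.
- exact: f2.
- by apply: (measurable_funB mf1); apply: (measurable_funM mnTh); exact: m1.
- by apply: (measurable_funB mf2); apply: (measurable_funM mnTh); exact: m2.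
- exact: (sE _ _ _ mnTh sf1 suh1).
- exact: (sE _ _ _ mnTh sf2 suh2).
- exact: (sE _ _ _ mnTh (sqi_nuM num0 nub mO mnT su1) suh1).
- exact: (sE _ _ _ mnTh (sqi_nuM num0 nub mO mnT su2) suh2).
- exact: (coupled_rot_eq lip num0 nub oO mT mTh mpr mf mu' (conj sf1 sf2) su suh Heq).
- move=> K MK; have [[[_ Xu] _] _ _ _] := dsol; have [a [b abE]] := Xu _ MK.
  have a1 : {ae mu, forall x, K x -> (uh x).1 = a * x.1 + b.1} by apply: aeS abE => x H /H ->.
  have a2 : {ae mu, forall x, K x -> (uh x).2 = a * x.2 + b.2} by apply: aeS abE => x H /H ->.
  have [q1 pq1 E1] := poly_affine_mul (or_introl erefl) (Hpol MK) a1.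
  have [q2 pq2 E2] := poly_affine_mul (or_intror erefl) (Hpol MK) a2.
  exists q1, q2; split => //.
  + by apply: aeS E1 => x E /E <-.
  + by apply: aeS E2 => x E /E <-.
Qed.

End Solution.

(** The constant 18 is twice the bound 9 on the number of internal sides of an element, each of
    which has two adjacent elements. *)
Lemma final_arith (E os eu t Ys B nup CI C : R) (hk X : R) : 0 <= E -> 0 <= os -> 0 <= eu -> 0 <= t -> 0 <= Ys -> 0 <= B ->
  0 <= nup -> 0 < CI -> 0 < C -> E <= 2 * (nup * eu + B * t) ->
  hk <= CI * (os + E) -> X <= 9 * (C * (2 * E + 2 * (CI * (os + E)))) + C * Ys ->
  hk + X <= ((CI + 18 * C + 18 * (C * CI)) * (1 + 2 * nup + 2 * B) + C) * (eu + os + t + Ys).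
Proof.
move=> E0 o0 e0 t0 Y0 B0 n0 CI0 C0 HE Hk HX.
set D := CI + 18 * C + 18 * (C * CI).
have D0 : 0 <= D.
  by rewrite /D; have := mulr_ge0 (ltW C0) (ltW CI0); move: CI0 C0; clear; lra.
have H1 : hk + X <= D * (os + E) + C * Ys.
  have := mulr_ge0 (ltW C0) o0; move: Hk HX; rewrite /D; clear; set a := C * os => hk1 hk2 a0.
  have -> : (CI + 18 * C + 18 * (C * CI)) * (os + E) + C * Ys =
     CI * (os + E) + 9 * (C * (2 * E + 2 * (CI * (os + E)))) + C * Ys + 18 * a by rewrite /a; ring.
  lra.
apply: (le_trans H1); rewrite [leRHS]mulrDl; apply: lerD.
  rewrite -mulrA; apply: ler_wpM2l => //.
  have := mulr_ge0 n0 o0; have := mulr_ge0 n0 t0; have := mulr_ge0 n0 Y0; have := mulr_ge0 B0 e0; have := mulr_ge0 B0 o0.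
  have := mulr_ge0 B0 Y0; move: HE E0 o0 e0 t0 Y0; clear => HE.
  have -> : (1 + 2 * nup + 2 * B) * (eu + os + t + Ys) = eu + os + t + Ys + 2 * (nup * eu) + 2 * (nup * os) + 2 * (nup * t) + 2 * (nup * Ys)
    + 2 * (B * eu) + 2 * (B * os) + 2 * (B * t) + 2 * (B * Ys) by ring.
  move: HE; lra.
by apply: ler_wpM2l; [exact: ltW|move: o0 e0 t0; clear; lra].
Qed.

(** Stated with real witnesses: the finiteness of the extended norms and sums is part of the result,
    and what follows is real arithmetic. The constants depend on the degree [N] and the shape
    constant [S] only. *)
Lemma indicator_bound (N : nat) (S : R) : 1 <= S -> exists CI C : R, [/\ 0 < CI, 0 < C &
  forall O M f w e1 e2 (cc : set (R * R) -> R * R), mdata O M S N f w e1 e2 -> forall K, M K ->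
  exists os Ys E hk X : R, [/\ 0 <= os, 0 <= Ys, E = nE (elem_patch M K) e1 e2,
    (\sum_(K' \in nbrs M K) (diam K')%:E * Lnm 2 K'° (curl K'° (fun x => (f x - cc K')%R)) = os%:E)%E /\
    (\sum_(g \in isides M K) (Num.sqrt (diam K))%:E * side_L2 g (jump M g (fun K' x => (f x - cc K')%R)) = Ys%:E)%E &
    [/\ (error_indicator M w K <= (hk + X)%:E)%E,
     hk <= CI * (os + E) & X <= 9 * (C * (2 * E + 2 * (CI * (os + E)))) + C * Ys]]].
Proof.
move=> S1; have [CI CI0 HCI] := elem_est N S1; have [C C0 HC] := side_term N S1.
exists CI, C; split => // O M f w e1 e2 cc D K MK.
have [a [b [c tK]]] := elem_tri D MK.
have [finI szI] := isides_finite M tK.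
have [finM _ _ _] := md_mesh D.
have finN : finite_set (nbrs M K) by apply: sub_finite_set finM => K' [].
have mP := open_measurable_plane (@patch_open M K).
have PO : elem_patch M K `<=` O.
  by move=> x [K' [MK' _] K'x]; exact: elem_sub D _ MK' _ K'x.
pose E := nE (elem_patch M K) e1 e2.
have EK K' : nbrs M K K' -> nE K'° e1 e2 <= E.
  move=> nK; have oK' := @open_interior _ K'; have mK' := open_measurable_plane oK'.
  have KP : K'° `<=` elem_patch M K by move=> x xK; exists K'.
  have s1 := sqi_rs_sub mP PO (md_e1 D); have s2 := sqi_rs_sub mP PO (md_e2 D).
  by apply: lerD; [exact: n2_rs_sub mK' KP s1|exact: n2_rs_sub mK' KP s2].
pose o K' := diam K' * n2 (rs K'° (Cf O f)).
have dia0 K' : M K' -> 0 <= diam K'.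
  by move=> MK'; have [? [? [? tK']]] := elem_tri D MK'; exact: ltW (diam_gt0 tK').
pose os := \sum_(K' <- elems (nbrs M K)) o K'.
have o0 K' : nbrs M K K' -> 0 <= o K' by move=> [MK' _]; apply: mulr_ge0; [exact: dia0|exact: n2_ge0].
have o_os K' : nbrs M K K' -> o K' <= os.
  move=> nK'; rewrite /os (big_rem K') /=; last by rewrite in_fset_set//; exact: mem_set.
  rewrite lerDl big_seq; apply: sumr_ge0 => K2 /mem_rem; rewrite in_fset_set// => /set_mem; exact: o0.
have os0 : 0 <= os by apply: (le_trans (o0 _ (nbrs_self MK)) (o_os _ (nbrs_self MK))).
have hkE K' k : nbrs M K K' -> Lnm 2 K'° (curl K'° w) = k%:E -> diam K' * k <= CI * (os + E).
  move=> nK' kE; have [MK' _] := nK'; have [k' [_ k'E H]] := HCI _ _ _ _ _ _ D K' MK'.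
  have kk' : k = k' by apply: EFin_inj; rewrite -kE -k'E.
  rewrite kk'; apply: (le_trans H); apply: ler_wpM2l; first exact: ltW.
  by apply: lerD; [exact: o_os|exact: EK].
pose X g := fine (side_L2 g (jump M g (fun=> w))).
pose Y g := fine (side_L2 g (jump M g (fun K' x => (f x - cc K')%R))).
have sides g : isides M K g -> [/\ 0 <= X g, 0 <= Y g, side_L2 g (jump M g (fun=> w)) = (X g)%:E,
    side_L2 g (jump M g (fun K' x => (f x - cc K')%R)) = (Y g)%:E &
    Num.sqrt (diam K) * X g <= C * (2 * E + 2 * (CI * (os + E))) + C * (Num.sqrt (diam K) * Y g)].
  move=> sg; have [x [y [K1 [K2 [k1 [k2 [x0 y0 [n1 n2'] [xE yE k1E k2E H]]]]]]]] := HC _ _ _ _ _ _ cc D K g MK sg.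
  have -> : X g = x by rewrite /X xE. have -> : Y g = y by rewrite /Y yE.
  split => //; apply: (le_trans H); rewrite lerD2r; apply: ler_wpM2l; first exact: ltW.
  have h1 := hkE _ _ n1 k1E; have h2 := hkE _ _ n2' k2E; have h3 := EK _ n1; have h4 := EK _ n2'.
  by move: h1 h2 h3 h4; clear; set q := CI * _; lra.
have [k [k0 kE _]] := HCI _ _ _ _ _ _ D K MK.
exists os, (\sum_(g <- elems (isides M K)) Num.sqrt (diam K) * Y g), E, (diam K * k), (\sum_(g <- elems (isides M K)) Num.sqrt (diam K) * X g).
have inI g : g \in elems (isides M K) -> isides M K g by rewrite in_fset_set// => /set_mem.
split => //.
- rewrite big_seq; apply: sumr_ge0 => g /inI/sides[_ y0 _ _ _]; apply: mulr_ge0 => //; exact: sqrtr_ge0.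
- split.
  + rewrite fsbig_finite//= /os -sumEFin; apply: eq_big_seq => K'; rewrite in_fset_set// => /set_mem[MK' _].
    by rewrite (curl_osc D _ MK') EFinM.
  + rewrite fsbig_finite//= -sumEFin; apply: eq_big_seq => g /inI/sides[_ _ _ yE _].
    by rewrite yE EFinM.
split.
- rewrite /error_indicator kE fsbig_finite//=.
  have -> : (\sum_(g <- elems (isides M K)) side_L2 g (jump M g (fun=> w)) ^+ 2 =
     (\sum_(g <- elems (isides M K)) `|X g| ^+ 2)%:E)%E.
    rewrite -sumEFin; apply: eq_big_seq => g /inI/sides[x0 _ xE _ _].
    by rewrite xE ger0_norm// expr2 EFinM.
  rewrite -!EFinM -EFinD -expr2 poweR_EFin lee_fin powR12_sqrt; last first.
    apply: addr_ge0; apply: mulr_ge0; [exact: sqr_ge0|exact: sqr_ge0|exact: dia0|].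
    by apply: sumr_ge0 => g _; exact: sqr_ge0.
  apply: (le_trans (@sqrt_sum_le _ _ _ _ (fun g => `|X g|) (dia0 _ MK) k0 (fun g => normr_ge0 _))).
  rewrite lerD2l big_seq [leRHS]big_seq; apply: ler_sum => g /inI/sides[x0 _ _ _ _].
  by rewrite ger0_norm.
- exact: hkE (nbrs_self MK) kE.
- set Q := C * (2 * E + 2 * (CI * (os + E))).
  have E0 : 0 <= E by apply: addr_ge0; exact: n2_ge0.
  have Q0 : 0 <= Q.
    apply: mulr_ge0; first exact: ltW.
    by apply: addr_ge0; apply: mulr_ge0 => //; apply: mulr_ge0; [exact: ltW|exact: addr_ge0].
  apply: (@le_trans _ _ (\sum_(g <- elems (isides M K)) (Q + C * (Num.sqrt (diam K) * Y g)))).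
    rewrite big_seq [leRHS]big_seq; apply: ler_sum => g /inI/sides[_ _ _ _ H]; exact: H.
  rewrite big_split /= mulr_sumr lerD2r big_const_seq iter_addr_0 count_predT.
  rewrite -[leLHS]mulr_natl; apply: (ler_wpM2r Q0).
  by rewrite ler_nat; exact: szI.
Qed.

End Indicator.

Theorem theorem5p7 (R : realType)
  (Omega : set (R * R)) (hOmega : polygonal_domain Omega)
  (z : R * R) (hz : Omega z)
  (nu : R -> R) (CL num nup : R)
  (hLip : forall s t, `|nu s - nu t| <= CL * `|s - t|)
  (hnum : 0 < num) (hnu : forall s, num <= nu s <= nup)
  (kappa : R) (hkappa : 0 < kappa)
  (Th : nat -> mesh R) (hTh : mesh_family Omega Th)
  (eps hstar : R) (heps : 0 < eps) (hhstar : 0 < hstar)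
  (p p' : R) (hp1 : 1 < p) (hp : 2 - eps <= p < 2) (hpp' : p^-1 + p'^-1 = 1)
  (f : R * R -> R * R) (hf : H1v Omega f)
  (hdisc : forall k, (0 < k)%N -> k%:R^-1 <= hstar ->
     exists uh ph T_h, discrete_sol Omega z nu kappa f (Th k) uh ph T_h)
  (Ce Ckappa Ckappat : R)
  (hCe : embedding_const Omega p Ce)
  (hCe_best : forall Ce' : R, embedding_const Omega p Ce' -> Ce <= Ce')
  (hCkappa0 : 0 < Ckappa)
  (hCkappa : forall S, W10 p Omega S ->
     (Lnmv p Omega (grad Omega S) <=
        Ckappa%:E * dual_norm p' Omega (W10 p' Omega) (kform Omega kappa S))%E)
  (hCkappat0 : 0 < Ckappat)
  (hCkappat : forall k, (0 < k)%N -> k%:R^-1 <= hstar ->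
     forall S, Vh Omega (Th k) S ->
     (Lnmv p Omega (grad Omega S) <=
        Ckappat%:E * dual_norm p' Omega (Vh Omega (Th k)) (kform Omega kappa S))%E)
  (C0 C0t : R) (hC0 : C0 = (2 * Ce * Ckappa)^-1)
  (hC0t : C0t = (2 * Ce * Ckappat)^-1)
  (hfsmall : (Lnmv 2 Omega f <= (num * Num.min C0 C0t)%:E)%E)
  (rho vrho : R) (hrho : 0 < rho < 1) (hvrho : 0 < vrho < 1)
  (d : nat) :
  exists2 C : R, 0 < C &
  forall (k : nat) (u : R * R -> R * R) (pr T : R * R -> R)
         (uh : R * R -> R * R) (ph T_h : R * R -> R),
    (0 < k)%N -> k%:R^-1 <= hstar ->
    continuous_sol Omega z nu kappa f p p' u pr T ->
    discrete_sol Omega z nu kappa f (Th k) uh ph T_h ->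
    let eT := fun x : R * R => T x - T_h x in
    let eu := fun x : R * R => (u x - uh x : R * R) in
    let w := fun x : R * R => (f x - nu (T_h x) *: uh x : R * R) in
    let osc := fun (K : set (R * R)) (x : R * R) => (f x - P0proj f K : R * R) in
    ((C0^-1)%:E * Lnmv 2 Omega eu <= rho%:E)%E ->
    (CL%:E * dual_norm p' Omega (W10 p' Omega) (delta Omega z)
       * Lnmv p' Omega u <= (vrho * (1 - rho) * num * C0 ^+ 2)%:E)%E ->
    (forall K, Th k K -> poly_on d K (fun x => nu (T_h x))) ->
    forall K, Th k K ->
    (error_indicator (Th k) w K <=
     C%:E * (Lnmv 2 (elem_patch (Th k) K) eu
       + (\sum_(K' \in nbrs (Th k) K)
            (diam K')%:E * Lnm 2 K'° (curl K'° (osc K')))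
       + Lnm (2 * p / (2 - p)) (elem_patch (Th k) K) eT
       + (\sum_(g \in isides (Th k) K)
            (Num.sqrt (diam K))%:E
              * side_L2 g (jump (Th k) g osc))))%E.
Proof.
have [oO _ bO lO _] := hOmega; have [cT _ [sigma Hs]] := hTh.
have mO := open_measurable_plane oO.
move: hp => /andP[_ p2]; have p0 : 0 < p := lt_trans ltr01 hp1.
have p'0 : 0 < p'.
  have : 0 < p'^-1 by rewrite -(ltrD2l p^-1) hpp' addr0 invf_lt1.
  by rewrite invr_gt0.
have p20 : 0 < 2 - p by rewrite subr_gt0.
have r0 : 0 < 2 * p / (2 - p) by rewrite divr_gt0// mulr_gt0.
(* The exponent of the temperature error is the one that pairs with [p'] to give an L^2 bound in
   Hoelder's inequality. *)
have rp : 2 / (2 * p / (2 - p)) + 2 / p' = 1.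
  have -> : 2 / (2 * p / (2 - p)) = 2 / p - 1 by field; rewrite !gt_eqF.
  by rewrite addrAC -mulrDr hpp' mulr1 -addrA addrN addr0.
have CL0 := lip_ge0 hLip.
have nup0 : 0 <= nup by have /andP[h1 h2] := hnu 0; exact: (le_trans (ltW hnum) (le_trans h1 h2)).
(* [D0] is fixed before the solutions are introduced. Dividing the smallness hypothesis by it bounds
   [CL] times the norm of [u] by the constant [B], whatever the solution. *)
have [D0 D00 HD0] := delta_norm_gt0 p'0 oO bO hz.
pose S := Num.max 1 (4 * sigma).
have S1 : 1 <= S by rewrite le_max lexx.
have fatT k K : Th k K -> fat K S.
  move=> TK; have [_ H _ _] := cT k; have [a [b [c tK]]] := H _ TK.
  by apply: fat_le (fat_indiam tK (Hs _ _ TK)); rewrite le_max lexx orbT.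
(* These constants are obtained before the mesh index and the solutions are introduced. The degree
   is [d + 1] because the discrete viscosity, of degree [d], multiplies an affine field. *)
have [CI [CJ [CI0 CJ0 HC]]] := indicator_bound d.+1 S1.
pose B := `|vrho * (1 - rho) * num * C0 ^+ 2| / D0.
have B0 : 0 <= B by rewrite divr_ge0// ltW.
pose C := (CI + 18 * CJ + 18 * (CJ * CI)) * (1 + 2 * nup + 2 * B) + CJ.
have C0' : 0 < C.
  rewrite ltr_wpDl//; apply: mulr_ge0.
    by have := mulr_gt0 CJ0 CI0; move: CI0 CJ0; clear; lra.
  by move: nup0 B0; clear; lra.
exists C => // k u pr T uh ph T_h _ _ sol dsol eT eu w osc _ hsmall hpol K TK.
have D := sol_mdata hLip hnum hnu oO lO (cT k) S1 (fatT k) hf sol dsol hpol.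
have [mT mTh [mu' muh] [su suh]] := sol_basic oO sol dsol.
have mP := open_measurable_plane (@patch_open _ (Th k) K).
have PO : elem_patch (Th k) K `<=` Omega.
  by move=> x [K' [MK' _] K'x]; exact: elem_sub D _ MK' _ K'x.
have Bu : (CL%:E * Lnmv p' Omega u <= B%:E)%E.
  have N0 : (0 <= CL%:E * Lnmv p' Omega u)%E by rewrite mule_ge0// ?lee_fin//; exact: Lnorm_ge0.
  have H : (D0%:E * (CL%:E * Lnmv p' Omega u) <= (vrho * (1 - rho) * num * C0 ^+ 2)%:E)%E.
    apply: le_trans hsmall; rewrite [(CL%:E * dual_norm _ _ _ _)%E]muleC -muleA.
    by apply: lee_wpmul2r.
  rewrite -(@lee_pmul2l _ D0%:E)// ?lte_fin//; apply: (le_trans H).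
  by rewrite -EFinM lee_fin [leRHS]mulrC /B divfK ?gt_eqF// ler_norm.
have suE : sqv (elem_patch (Th k) K) eu.
  have [a1 a2] := sqv_sub mP PO su; have [b1 b2] := sqv_sub mP PO suh.
  by split; [have := sqiB a1 b1|have := sqiB a2 b2]; congr sqi; apply/funext => x; rewrite /rs -mulrBr.
have muE : measurable_fun (elem_patch (Th k) K) eu.
  have m1 (v : R * R -> R * R) : measurable_fun Omega v -> measurable_fun (elem_patch (Th k) K) (fun x => (v x).1) by move=> mv; apply: (measurableT_comp _ (measurable_funS mO PO mv)).
  have m2 (v : R * R -> R * R) : measurable_fun Omega v -> measurable_fun (elem_patch (Th k) K) (fun x => (v x).2) by move=> mv; apply: (measurableT_comp _ (measurable_funS mO PO mv)).
  exact: (measurable_pair mP (measurable_funB (m1 _ mu') (m1 _ muh)) (measurable_funB (m2 _ mu') (m2 _ muh))).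
have [os [Ys [E [hk [X [os0 Ys0 EE [osE YsE] [ind hkE XE]]]]]]] := HC _ _ _ _ _ _ (P0proj f) D K TK.
apply: (le_trans ind); rewrite (Lnmv2E mP muE suE).
have osE' : (\sum_(K' \in nbrs (Th k) K) (diam K')%:E * Lnm 2 K'° (curl K'° (osc K')) = os%:E)%E by exact: osE.
have YsE' : (\sum_(g \in isides (Th k) K) (Num.sqrt (diam K))%:E * side_L2 g (jump (Th k) g osc) = Ys%:E)%E by exact: YsE.
rewrite osE' YsE'.
have n0 : 0 <= n2v (elem_patch (Th k) K) eu by exact: n2_ge0.
have E0 : 0 <= E by rewrite EE; apply: addr_ge0; exact: n2_ge0.
have t0 : (0 <= Lnm (2 * p / (2 - p)) (elem_patch (Th k) K) eT)%E by exact: Lnorm_ge0.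
(* If the temperature error has infinite norm on the patch, the right-hand side is infinite. *)
case tE : (Lnm (2 * p / (2 - p)) (elem_patch (Th k) K) eT) t0 => [t| |] // t0; last first.
  by rewrite addey// addye// gt0_muley ?leey// lte_fin.
have HE : E <= 2 * (nup * n2v (elem_patch (Th k) K) eu + B * t).
  by rewrite EE; exact: (e_bound hLip hnum hnu r0 p'0 rp mO mP PO mT mTh mu' muh su suh B0 Bu tE).
rewrite -!EFinD -EFinM lee_fin.
by apply: final_arith HE hkE XE.
Qed.
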